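(* Let $(M,J)$ be a smooth almost complex manifold and let $W\subseteq M$ be a smoothly embedded totally real submanifold which is a closed subset of $M$. Let $f:\check{D}^{+}\to M$ be a smooth $J$-holomorphic map such that $f(\partial\check{D}^{+})\subseteq W$. Suppose that the image of $f$ is relatively compact in $M$ and that the area of the image of $f$ is finite for some Riemannian metric on $M$. Then $f$ has a smooth extension over $0\in D^{+}$, i.e. there is a smooth map $D^{+}\to M$ whose restriction to $\check{D}^{+}$ is $f$.
   Context: All manifolds are without boundary unless stated otherwise. $D^{+}=\{z\in\mathbb{C}: |z|<1,\ \mathrm{Im}\,z\ge 0\}$, $\check{D}^{+}=D^{+}\setminus\{0\}$ (a Riemann surface with boundary), $\partial\check{D}^{+}=\{z\in\mathbb{R}:0<|z|<1\}$. Smoothness on $D^{+}$ and $\check{D}^+$ is smoothness on a manifold with boundary (local existence of smooth extensions to open subsets of $\mathbb{C}$). A submanifold $W$ of $(M,J)$ is totally real if $\dim W=\frac12\dim M$ and $J(T_pW)\cap T_pW=\{0\}$ for all $p\in W$. A $C^1$ map $h$ from a Riemann surface with complex structure $i$ to $(M,J)$ is $J$-holomorphic if $J\circ dh=dh\circ i$. The area of the image of a $C^1$ map $h:S\to M$ from a surface $S$ is the area of $S$ with respect to the (possibly degenerate) pull-back of the Riemannian metric of $M$ by $h$ (so it counts multiplicity). A subset is relatively compact if its closure is compact. *)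

(* Defs.v *)
From HB Require Import structures.
From mathcomp Require Import all_boot all_order all_algebra.
From mathcomp Require Import all_classical all_reals all_analysis.
Set Implicit Arguments.
Unset Strict Implicit.
Unset Printing Implicit Defensive.
Import Order.TTheory GRing.Theory Num.Theory.
Import numFieldNormedType.Exports.
Local Open Scope classical_set_scope.
Local Open Scope ring_scope.

(* Intended for A open and V finite-dimensional, where it is the usual C^n. *)
Fixpoint Cn_on (R : realType) (V W : normedModType R) (n : nat)
    (A : set V) (f : V -> W) : Prop :=
  match n with
  | 0 => forall x, A x -> {for x, continuous f}
  | n'.+1 => (forall x, A x -> differentiable f x) /\
             (forall v, Cn_on n' A (fun x => 'D_v f x))
  end.

Definition smooth_on (R : realType) (V W : normedModType R)
    (A : set V) (f : V -> W) : Prop := forall n, Cn_on n A f.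

(* A homeomorphism from dom onto an open subset of R^m; the values of coord
   outside dom and of param outside coord @` dom are irrelevant. *)
Record chart (R : realType) (M : topologicalType) (m : nat) := Chart {
  dom : set M;
  coord :> M -> 'rV[R]_m;
  param : 'rV[R]_m -> M;
  dom_open : open dom;
  image_open : open (coord @` dom);
  coordK : forall p, dom p -> param (coord p) = p;
  coord_continuous : forall p, dom p -> {for p, continuous coord};
  param_continuous : forall x, (coord @` dom) x -> {for x, continuous param} }.

Definition transition (R : realType) (M : topologicalType) (m : nat)
    (c d : chart R M m) : 'rV[R]_m -> 'rV[R]_m := d \o param c.

Definition compatible (R : realType) (M : topologicalType) (m : nat)
    (c d : chart R M m) : Prop :=
  smooth_on (c @` (dom c `&` dom d)) (transition c d) /\
  smooth_on (d @` (dom c `&` dom d)) (transition d c).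

(* The smooth structure is a maximal atlas. *)
Record smooth_manifold (R : realType) (M : topologicalType) (m : nat) :=
  SmoothManifold {
  manifold_hausdorff : hausdorff_space M;
  manifold_second_countable : @second_countable M;
  charts : set (chart R M m);
  charts_cover : forall p, exists2 c, charts c & dom c p;
  charts_compatible : forall c d, charts c -> charts d -> compatible c d;
  charts_maximal :
    forall c, (forall d, charts d -> compatible c d) -> charts c }.

(* A tangent vector at p is given by a row vector for each chart c around p,
   its components in c; components in c and d are related by the differential
   of the transition map at c p.  A tensor field is given accordingly by its
   components in every chart.  Endomorphisms act on components from the
   right. *)
Definition tangent_change (R : realType) (M : topologicalType) (m : nat)
    (c d : chart R M m) (p : M) (v : 'rV[R]_m) : 'rV[R]_m :=
  'd (transition c d) (c p) v.

Record almost_complex (R : realType) (M : topologicalType) (m : nat)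
    (S : smooth_manifold R M m) := AlmostComplex {
  acs :> chart R M m -> 'rV[R]_m -> 'M[R]_m;
  acs_smooth : forall c, charts S c -> smooth_on (c @` dom c) (acs c);
  acs_natural : forall c d p v, charts S c -> charts S d -> dom c p -> dom d p ->
    tangent_change c d p (v *m acs c (c p)) =
    tangent_change c d p v *m acs d (d p);
  acs_square : forall c p, charts S c -> dom c p ->
    acs c (c p) *m acs c (c p) = - 1%:M }.

Definition bilin (R : realType) (m : nat) (G : 'M[R]_m) (v w : 'rV[R]_m) : R :=
  (v *m G *m w^T) 0 0.

Record riemannian_metric (R : realType) (M : topologicalType) (m : nat)
    (S : smooth_manifold R M m) := RiemannianMetric {
  metric :> chart R M m -> 'rV[R]_m -> 'M[R]_m;
  metric_smooth : forall c, charts S c -> smooth_on (c @` dom c) (metric c);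
  metric_natural : forall c d p v w,
    charts S c -> charts S d -> dom c p -> dom d p ->
    bilin (metric d (d p)) (tangent_change c d p v) (tangent_change c d p w) =
    bilin (metric c (c p)) v w;
  metric_sym : forall c p, charts S c -> dom c p ->
    (metric c (c p))^T = metric c (c p);
  metric_pos : forall c p v, charts S c -> dom c p -> v != 0 ->
    0 < bilin (metric c (c p)) v v }.

(* R^k x {0} in R^m *)
Definition flat (R : realType) (m k : nat) : set 'rV[R]_m :=
  [set x | forall i : 'I_m, (k <= i)%N -> x 0 i = 0].

Definition slice_chart (R : realType) (M : topologicalType) (m : nat)
    (S : smooth_manifold R M m) (k : nat) (W : set M) (c : chart R M m) : Prop :=
  charts S c /\ c @` (dom c `&` W) = (c @` dom c) `&` @flat R m k.

(* k is the dimension of W. *)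
Definition embedded_submanifold (R : realType) (M : topologicalType) (m : nat)
    (S : smooth_manifold R M m) (k : nat) (W : set M) : Prop :=
  (k <= m)%N /\ forall p, W p -> exists2 c, slice_chart S k W c & dom c p.

(* T_pW in the components of the chart c. *)
Definition tangent_sub (R : realType) (M : topologicalType) (m : nat)
    (S : smooth_manifold R M m) (k : nat) (W : set M) (c : chart R M m) (p : M) :
    set 'rV[R]_m :=
  [set v | exists s, [/\ slice_chart S k W s, dom s p &
                         @flat R m k (tangent_change c s p v)]].

Definition totally_real (R : realType) (M : topologicalType) (m : nat)
    (S : smooth_manifold R M m) (J : almost_complex S) (k : nat) (W : set M) :
    Prop :=
  m = k.*2 /\
  forall p c, W p -> charts S c -> dom c p ->
    [set v *m J c (c p) | v in tangent_sub S k W c p] `&`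
      tangent_sub S k W c p = [set 0].

(* Intended for A open. *)
Definition smooth_map (R : realType) (V : normedModType R)
    (M : topologicalType) (m : nat) (S : smooth_manifold R M m)
    (A : set V) (h : V -> M) : Prop :=
  (forall z, A z -> {for z, continuous h}) /\
  (forall c, charts S c -> smooth_on (A `&` h @^-1` dom c) (c \o h)).

(* C is identified with R * R, z = x + i y being (x, y); maps on a subset D
   of C are total functions whose values outside D are irrelevant. *)
Definition local_extension (R : realType) (M : topologicalType) (m : nat)
    (S : smooth_manifold R M m) (D : set (R * R)) (h : R * R -> M) (z : R * R)
    (g : R * R -> M) : Prop :=
  exists U : set (R * R), [/\ open U, U z, smooth_map S U g &
    forall w, U w -> D w -> g w = h w].

Definition smooth_in (R : realType) (M : topologicalType) (m : nat)
    (S : smooth_manifold R M m) (D : set (R * R)) (h : R * R -> M) : Prop :=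
  forall z, D z -> exists g, local_extension S D h z g.

(* dh_z(v) in the components of the chart c.  At boundary points of D it is
   computed on a local smooth extension of h; the choice is immaterial when D
   is contained in the closure of its interior. *)
Definition tangent_map (R : realType) (M : topologicalType) (m : nat)
    (S : smooth_manifold R M m) (D : set (R * R)) (h : R * R -> M)
    (c : chart R M m) (z v : R * R) : 'rV[R]_m :=
  'd (c \o (xget h [set g | local_extension S D h z g])) z v.

Definition mul_i (R : realType) (v : R * R) : R * R := (- v.2, v.1).

Definition J_holomorphic (R : realType) (M : topologicalType) (m : nat)
    (S : smooth_manifold R M m) (J : almost_complex S)
    (D : set (R * R)) (h : R * R -> M) : Prop :=
  forall z c v, D z -> charts S c -> dom c (h z) ->
    tangent_map S D h c z v *m J c (c (h z)) = tangent_map S D h c z (mul_i v).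

Definition chart_at (R : realType) (M : topologicalType) (m : nat)
    (S : smooth_manifold R M m) (p : M) : chart R M m :=
  s2val (cid2 (charts_cover S p)).

(* Square root of the Gram determinant of the pull-back metric in the
   coordinates x, y; it does not depend on the chart around h z. *)
Definition area_density (R : realType) (M : topologicalType) (m : nat)
    (S : smooth_manifold R M m) (g : riemannian_metric S)
    (D : set (R * R)) (h : R * R -> M) (z : R * R) : R :=
  let c := chart_at S (h z) in
  let G := g c (c (h z)) in
  let hx := tangent_map S D h c z (1, 0) in
  let hy := tangent_map S D h c z (0, 1) in
  Num.sqrt (bilin G hx hx * bilin G hy hy - bilin G hx hy ^+ 2).

Definition area (R : realType) (M : topologicalType) (m : nat)
    (S : smooth_manifold R M m) (g : riemannian_metric S)
    (D : set (R * R)) (h : R * R -> M) : \bar R :=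
  (\int[lebesgue_measure \x lebesgue_measure]_(z in D)
     (area_density g D h z)%:E)%E.

Definition relatively_compact (M : topologicalType) (A : set M) : Prop :=
  compact (closure A).

Definition half_disc (R : realType) : set (R * R) :=
  [set z | z.1 ^+ 2 + z.2 ^+ 2 < 1 /\ 0 <= z.2].

Definition punctured_half_disc (R : realType) : set (R * R) :=
  @half_disc R `\ (0, 0).

Definition punctured_half_disc_boundary (R : realType) : set (R * R) :=
  [set z | z.2 = 0 /\ 0 < `|z.1| < 1].

(* Main.v *)
Require Import Defs.
From HB Require Import structures.
From mathcomp Require Import all_boot all_order all_algebra.
From mathcomp Require Import all_classical all_reals all_analysis.
From mathcomp Require Import zify ring lra.
Set Implicit Arguments.
Unset Strict Implicit.
Unset Printing Implicit Defensive.
Import Order.TTheory GRing.Theory Num.Theory.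
Import numFieldNormedType.Exports.
Local Open Scope classical_set_scope.
Local Open Scope ring_scope.

(* Everything is done pointwise, by maximum principles.  Near a point of W a
   chart is straightened so that W is flat and J preserves the splitting along
   W; f then satisfies a quasilinear elliptic system in which one block of
   components (the "imaginary part") vanishes on the real axis and the other
   has vanishing normal derivative there, and gradients are bounded interiorly
   by barriers.  Finite area excludes bubbling: by point picking, a sequence
   with |z||df(z)| bounded below would give disjoint squares each carrying a
   fixed amount of area, so |z||df(z)| -> 0.  On half-annuli the imaginary part
   decays towards both ends, hence f varies little along rays whatever the
   modulus, and f is trapped in arbitrarily small balls around a limit point.
   Barriers then give bounds for df up to the puncture, and differentiating the
   system (passing to tangent prolongations) bounds all derivatives.  A
   Seeley reflection turns bounded derivatives into a smooth extension across
   the puncture. *)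

(** * Maps of class C^n *)

(** Finite area enters only through a count of disjoint squares, so |z||df(z)| -> 0 comes without a
    rate, and integrated along a ray this still diverges logarithmically. The rate is recovered from
    the boundary condition. The imaginary part b vanishes on the axis and its size controls the
    gradient linearly: |df| <= C sup|b| / |z|. As lapl b is quadratic in df, |lapl b| <= eta sup|b|
    / |z|^2 with eta small, and the superharmonic functions y^k and y^k |z|^(-2k), 0 < k < 1, beat
    such a right-hand side. The exponent k = 3/4 serves the last step: then |df|^2 = O(|z|^(-1/2)),
    which the concave barrier y - y^(3/2) absorbs, giving b = O(y) and a bounded df. The constant
    3/256 is k(1 - k)/16. Higher derivatives follow because the class of systems is closed under
    adjoining dw as an unknown; a free scale keeps the adjoined part small. The radii of validity
    and the constants of the interior estimates depend on the system and on a base point only, never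
    on the solution or its domain, so one estimate serves every scale near the puncture. *)

Section Smooth.
Variable R : realType.
Implicit Types V W : normedModType R.

Lemma Cn_on_sub V W n (A B : set V) (f : V -> W) :
  A `<=` B -> Cn_on n B f -> Cn_on n A f.
Proof.
elim: n f => [|n IH] f AB /=; first by move=> h x /AB; apply: h.
by move=> [h1 h2]; split => [x /AB /h1//|v]; apply: IH.
Qed.

Lemma Cn_onW V W n (A : set V) (f : V -> W) : Cn_on n.+1 A f -> Cn_on n A f.
Proof.
elim: n f => [|n IH] f /=.
  by move=> [h _] x /h /differentiable_continuous.
by move=> [h1 h2]; split => // v; apply: IH.
Qed.

Lemma near_eq_differentiable V W (f g : V -> W) (x : V) :
  (\near x, f x = g x) -> differentiable f x -> differentiable g x.
Proof.
move=> fg df; have [d e] := (diff_locallyP _ _).1 df.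
have fgx : f x = g x := nbhs_singleton fg.
have D : g \o shift x = cst (g x) + 'd f x +o_ 0 id.
  apply/eqaddoP => _/posnumP[eps].
  have /eqaddoP /(_ eps%:num) /(_ [gt0 of eps%:num]) := e.
  move: fg; rewrite (near_shift 0 x) subr0 => fg.
  apply: filterS2 fg => y /=; rewrite !fctE /= fgx.
  by move=> ->.
have G : 'd g x = 'd f x :> (V -> W) by apply: diff_unique.
by apply/diff_locallyP; rewrite G.
Qed.

Lemma Cn_on_eq V W n (A : set V) (f g : V -> W) : open A ->
  (forall x, A x -> f x = g x) -> Cn_on n A f -> Cn_on n A g.
Proof.
move=> oA; elim: n f g => [|n IH] f g fg /=.
  move=> h x Ax; have := h x Ax.
  rewrite /prop_for /continuous_at -(fg x Ax); apply: cvg_trans.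
  apply: near_eq_cvg; near=> y; apply: fg; near: y.
  exact: open_nbhs_nbhs.
have E x : A x -> \near x, f x = g x.
  by move=> Ax; near=> y; apply: fg; near: y; exact: open_nbhs_nbhs.
move=> [h1 h2]; split => [x Ax|v].
  exact: near_eq_differentiable (E x Ax) (h1 x Ax).
move: (h2 v); apply: IH => x Ax; exact: near_eq_derive (E x Ax).
Unshelve. all: by end_near. Qed.

Lemma smooth_on_sub V W (A B : set V) (f : V -> W) :
  A `<=` B -> smooth_on B f -> smooth_on A f.
Proof. by move=> AB h n; apply: Cn_on_sub (h n). Qed.

Lemma smooth_on_differentiable V W (A : set V) (f : V -> W) x :
  smooth_on A f -> A x -> differentiable f x.
Proof. by move=> /(_ 1%N) [h _]; apply: h. Qed.

Lemma smooth_on_derive V W (A : set V) (f : V -> W) v :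
  smooth_on A f -> smooth_on A (fun x => 'D_v f x).
Proof. by move=> h n; have [_] := h n.+1; apply. Qed.

Lemma Cn_on_cst V W n (A : set V) (c : W) : Cn_on n A (fun=> c).
Proof.
elim: n c => [|n IH] c /=; first by move=> x _; exact: cst_continuous.
split => [x _|v]; first exact: differentiable_cst.
have -> : (fun x => 'D_v (fun=> c) x) = fun=> 0 :> W.
  by rewrite funeqE => x; rewrite derive_cst.
exact: IH.
Qed.

Lemma Cn_onD V W n (A : set V) (f g : V -> W) : open A ->
  Cn_on n A f -> Cn_on n A g -> Cn_on n A (fun x => f x + g x).
Proof.
move=> oA; elim: n f g => [|n IH] f g /=.
  by move=> hf hg x Ax; apply: continuousD; [exact: hf|exact: hg].
move=> [f1 f2] [g1 g2]; split => [x Ax|v].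
  by apply: differentiableD; [exact: f1|exact: g1].
apply: (Cn_on_eq oA) (IH _ _ (f2 v) (g2 v)) => x Ax.
by rewrite deriveD //; apply: diff_derivable; [exact: f1|exact: g1].
Qed.

Lemma Cn_onM V n (A : set V) (f g : V -> R) : open A ->
  Cn_on n A f -> Cn_on n A g -> Cn_on n A (fun x => f x * g x).
Proof.
move=> oA; elim: n f g => [|n IH] f g.
  by move=> hf hg x Ax; apply: continuousM; [exact: hf|exact: hg].
move=> hf hg; have [f1 f2] := hf; have [g1 g2] := hg; split => [x Ax|v].
  by apply: differentiableM; [exact: f1|exact: g1].
have := Cn_onD oA (IH _ _ (Cn_onW hf) (g2 v)) (IH _ _ (Cn_onW hg) (f2 v)).
apply: (Cn_on_eq oA) => x Ax.
by rewrite deriveM //; apply: diff_derivable; [exact: f1|exact: g1].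
Qed.

Lemma Cn_on_sum V W n (A : set V) (I : Type) (r : seq I) (P : pred I)
  (f : I -> V -> W) : open A ->
  (forall i, P i -> Cn_on n A (f i)) ->
  Cn_on n A (fun x => \sum_(i <- r | P i) f i x).
Proof.
move=> oA h; elim: r => [|i r IH].
  by apply: (Cn_on_eq oA) (Cn_on_cst n A 0) => x _; rewrite big_nil.
case Pi: (P i).
  apply: (Cn_on_eq oA) (Cn_onD oA (h i Pi) IH) => x _.
  by rewrite big_cons Pi.
by apply: (Cn_on_eq oA) IH => x _; rewrite big_cons Pi.
Qed.

Lemma Cn_on_prod V n (A : set V) (I : Type) (r : seq I) (P : pred I)
  (f : I -> V -> R) : open A ->
  (forall i, P i -> Cn_on n A (f i)) ->
  Cn_on n A (fun x => \prod_(i <- r | P i) f i x).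
Proof.
move=> oA h; elim: r => [|i r IH].
  by apply: (Cn_on_eq oA) (Cn_on_cst n A (1 : R)) => x _; rewrite big_nil.
case Pi: (P i).
  apply: (Cn_on_eq oA) (Cn_onM oA (h i Pi) IH) => x _.
  by rewrite big_cons Pi.
by apply: (Cn_on_eq oA) IH => x _; rewrite big_cons Pi.
Qed.

Lemma Cn_onV V n (A : set V) (f : V -> R) : open A ->
  (forall x, A x -> f x != 0) ->
  Cn_on n A f -> Cn_on n A (fun x => (f x)^-1).
Proof.
move=> oA f0; elim: n => [|n IH].
  by move=> hf x Ax; apply: continuousV; [exact: f0|exact: hf].
move=> hf; have [f1 f2] := hf; split => [x Ax|v].
  by apply: differentiableV; [exact: f1|exact: f0].
have IHf := IH (Cn_onW hf).
have := Cn_onM oA (Cn_on_cst n A (-1 : R)) (Cn_onM oA (Cn_onM oA IHf IHf) (f2 v)).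
apply: (Cn_on_eq oA) => x Ax.
rewrite deriveV; [|exact: f0|by apply: diff_derivable; exact: f1].
by rewrite mulN1r expr2 invfM scaleNr.
Qed.

Lemma Cn_on_mx V m p n (A : set V) (f : V -> 'M[R]_(m, p)) : open A ->
  (forall i j, Cn_on n A (fun x => f x i j)) -> Cn_on n A f.
Proof.
move=> oA; elim: n f => [|n IH] f.
  move=> h x Ax; apply/cvgrPdist_lt => e e0.
  near=> y; rewrite /Num.Def.normr/= mx_normrE (bigmax_lt _ e0)//= => i _.
  rewrite !mxE/=; move: i; near: y; apply: filter_forall => /= i.
  by have /cvgrPdist_lt/(_ _ e0) := h i.1 i.2 x Ax.
move=> h.
have D x : A x -> differentiable f x.
  move=> Ax; have -> : f = fun y => \sum_i \sum_j f y i j *: delta_mx i j.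
    by rewrite funeqE => y; rewrite -matrix_sum_delta.
  pose g i y := \sum_j f y i j *: (delta_mx i j : 'M[R]_(m, p)).
  have -> : (fun y => \sum_i \sum_j f y i j *: delta_mx i j) = \sum_i g i.
    by rewrite funeqE => y; rewrite fct_sumE.
  apply: differentiable_sum => i.
  have -> : g i = \sum_j (fun y => f y i j *: (delta_mx i j : 'M[R]_(m, p))).
    by rewrite funeqE => y; rewrite fct_sumE.
  apply: differentiable_sum => j; apply: differentiableZl.
  by have [h1 _] := h i j; apply: h1.
split=> // v; apply: IH => i j; have [_ /(_ v)] := h i j.
apply: (Cn_on_eq oA) => x Ax.
by rewrite derive_mx ?mxE//; apply: diff_derivable; apply: D.
Unshelve. all: by end_near. Qed.

Lemma Cn_on_coord V m p n (A : set V) (f : V -> 'M[R]_(m, p)) i j : open A ->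
  Cn_on n A f -> Cn_on n A (fun x => f x i j).
Proof.
move=> oA; elim: n f => [|n IH] f.
  move=> h x Ax; exact: (continuous_comp (h x Ax) (@coord_continuous _ _ _ i j _)).
move=> [h1 h2]; split => [x Ax|v].
  exact: (differentiable_comp (h1 x Ax) (differentiable_coord _ _ _)).
apply: (Cn_on_eq oA) (IH _ (h2 v)) => x Ax.
by rewrite derive_mx ?mxE//; apply: diff_derivable; apply: h1.
Qed.

Lemma derive_comp_rV V m (f : 'rV[R]_m -> R) (g : V -> 'rV[R]_m) x v :
  differentiable g x -> differentiable f (g x) ->
  'D_v (fun y => f (g y)) x =
  \sum_l 'D_(delta_mx 0 l) f (g x) * 'D_v (fun y => g y 0 l) x.
Proof.
move=> dg df; rewrite deriveE; last exact: (differentiable_comp dg df).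
rewrite (_ : 'd _ x = 'd (f \o g) x) // diff_comp //=.
rewrite -(deriveE v dg) derive_mx; last exact: diff_derivable.
rewrite [X in 'd f _ X]matrix_sum_delta big_ord1 linear_sum /=.
by apply: eq_bigr => l _; rewrite linearZ /= mxE (deriveE _ df); apply: mulrC.
Qed.

Lemma Cn_on_comp V m n (A : set V) (B : set 'rV[R]_m) (f : 'rV[R]_m -> R)
  (g : V -> 'rV[R]_m) : open A -> (forall x, A x -> B (g x)) ->
  Cn_on n B f -> Cn_on n A g -> Cn_on n A (fun x => f (g x)).
Proof.
move=> oA AB; elim: n f => [|n IH] f.
  by move=> hf hg x Ax; apply: (continuous_comp (hg x Ax) (hf _ (AB x Ax))).
move=> [f1 f2] hg; have [g1 g2] := hg; split => [x Ax|v].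
  exact: (differentiable_comp (g1 x Ax) (f1 _ (AB x Ax))).
have H l : Cn_on n A (fun x => 'D_(delta_mx 0 l) f (g x) * 'D_v (fun y => g y 0 l) x).
  apply: (Cn_onM oA); first exact: (IH _ (f2 _) (Cn_onW hg)).
  have := Cn_on_coord 0 l oA (g2 v); apply: (Cn_on_eq oA) => x Ax.
  by rewrite derive_mx ?mxE//; apply: diff_derivable; apply: g1.
have := Cn_on_sum (index_enum _) oA (fun l (_ : xpredT l) => H l).
apply: (Cn_on_eq oA) => x Ax.
by rewrite derive_comp_rV //; [exact: g1|exact/f1/AB].
Qed.

Lemma Cn_on_lin V W n (A : set V) (f : {linear V -> W}) : open A ->
  continuous f -> Cn_on n A f.
Proof.
move=> oA cf; case: n => [|n]; first by move=> x _; apply: cf.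
have df x : differentiable f x by apply: linear_differentiable.
split=> [//|v]; apply: (Cn_on_eq oA) (Cn_on_cst n A (f v)) => x _.
by rewrite deriveE // diff_lin.
Qed.

End Smooth.

Section Line.
Variable R : realType.
Implicit Types V W : normedModType R.

Lemma is_derive_line V W (f : V -> W) (z v : V) (s : R) :
  differentiable f (s *: v + z) ->
  is_derive s (1 : R) (fun t : R => f (t *: v + z)) ('D_v f (s *: v + z)).
Proof.
move=> df; pose g (t : R) := t *: v + z.
have dl : is_diff s ( *:%R ^~ v) ( *:%R ^~ v) := is_diff_scalel s v.
have dc : differentiable (cst z : R -> V) s := differentiable_cst z s.
have Eg : g = ( *:%R ^~ v) + cst z by rewrite funeqE.
have dg : differentiable g s by rewrite Eg; apply: differentiableD => //; exact: (@ex_diff _ _ _ _ _ _ _ dl).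
have dgE : 'd g s = *:%R ^~ v :> (R -> V).
  rewrite Eg diffD //.
  by rewrite diff_cst (@diff_val _ _ _ _ _ _ _ dl) funeqE => t; apply: addr0.
have dfg : differentiable (f \o g) s by apply: differentiable_comp.
split; first exact: (@diff_derivable _ _ _ (f \o g) s 1 dfg).
by rewrite -[fun t => _]/(f \o g) (deriveE _ dfg) diff_comp //= dgE scale1r deriveE.
Qed.

Lemma MVT_le (f df : R -> R) (a b : R) : a <= b ->
  (forall s, a <= s <= b -> is_derive s (1 : R) f (df s)) ->
  exists2 c, a <= c <= b & f b - f a = df c * (b - a).
Proof.
move=> ab h.
have [] := @MVT_segment R f df a b ab.
- by move=> x /[!in_itv]/= /andP[ax xb]; apply: h; rewrite !ltW.
- apply: derivable_within_continuous => x /[!in_itv]/= xab.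
  by case: (h x xab).
by move=> c /[!in_itv]/= cab e; exists c.
Qed.

(** The second difference over the parallelogram spanned by [t u] and [t v] is symmetric in [u] and
    [v]; two mean value steps turn it into [t ^+ 2] times either mixed derivative at a point near
    [z]. Continuity of both at [z] lets [t] tend to 0. *)
Lemma derive_swap V (f : V -> R) (U : set V) (z u v : V) : open U -> U z ->
  smooth_on U f -> 'D_u (fun x => 'D_v f x) z = 'D_v (fun x => 'D_u f x) z.
Proof.
move=> oU Uz sf.
have key u' v' : forall e, 0 < e -> \forall t \near (0 : R)^'+,
    exists x, `| 'D_u' (fun x => 'D_v' f x) z - 'D_u' (fun x => 'D_v' f x) x| < e
    /\ f (t *: u' + (t *: v' + z)) - f (t *: u' + z) - f (t *: v' + z) + f z
       = 'D_u' (fun x => 'D_v' f x) x * t ^+ 2.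
  move=> e e0.
  have sDf := smooth_on_derive v' sf; have sDDf := smooth_on_derive u' sDf.
  have cD : {for z, continuous (fun x => 'D_u' (fun x => 'D_v' f x) x)}.
    exact/differentiable_continuous/(smooth_on_differentiable sDDf Uz).
  have N : \forall x \near z, U x /\
    `| 'D_u' (fun x => 'D_v' f x) z - 'D_u' (fun x => 'D_v' f x) x| < e.
    near=> x; split; near: x; first exact: open_nbhs_nbhs.
    by move/cvgrPdist_lt : cD; apply.
  have /nbhs_ballP[r r0 Hr] := N.
  have r0' : 0 < r := r0.
  have M0 : 0 < `|u'| + `|v'| + 1 by rewrite ltr_wpDl // addr_ge0.
  have B s t t0 : 0 <= s <= t0 -> 0 <= t <= t0 -> t0 < r / (`|u'| + `|v'| + 1) ->
    ball z r (s *: u' + (t *: v' + z)).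
    move=> /andP[s0 st] /andP[t00 tt] tr.
    rewrite -ball_normE /= addrA opprD addrCA subrr addr0 normrN.
    apply: (le_lt_trans (ler_normD _ _)); rewrite !normrZ !ger0_norm //.
    rewrite ltr_pdivlMr // in tr; apply: le_lt_trans tr.
    have t0' := le_trans s0 st.
    by rewrite !mulrDr mulr1 ler_wpDr // lerD // ler_wpM2r.
  near=> t.
  have t0 : 0 < t by near: t; exact: nbhs_right_gt.
  have tr : t < r / (`|u'| + `|v'| + 1).
    by near: t; apply: nbhs_right_lt; rewrite divr_gt0.
  have l0 : 0 <= (0 : R) <= t by rewrite lexx ltW.
  have lt : 0 <= t <= t by rewrite lexx ltW.
  pose p (s : R) := f (s *: v' + (t *: u' + z)) - f (s *: v' + z).
  pose dp (s : R) := 'D_v' f (s *: v' + (t *: u' + z)) - 'D_v' f (s *: v' + z).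
  have [s st es] : exists2 s, 0 <= s <= t & p t - p 0 = dp s * (t - 0).
    apply: MVT_le; first exact: ltW.
    move=> s st; apply: is_deriveB; apply: is_derive_line.
      apply: (smooth_on_differentiable sf); rewrite addrCA.
      by have [] := Hr _ (B _ _ _ lt st tr).
    apply: (smooth_on_differentiable sf).
    by have := B _ _ _ l0 st tr; rewrite scale0r add0r => /Hr[].
  pose q (r : R) := 'D_v' f (r *: u' + (s *: v' + z)).
  have [x xt ex] : exists2 x, 0 <= x <= t & q t - q 0 =
      'D_u' (fun x => 'D_v' f x) (x *: u' + (s *: v' + z)) * (t - 0).
    apply: (@MVT_le q (fun x => 'D_u' (fun x => 'D_v' f x) (x *: u' + (s *: v' + z)))).
      exact: ltW.
    move=> x xt; apply: is_derive_line; apply: (smooth_on_differentiable sDf).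
    by have [] := Hr _ (B _ _ _ xt st tr).
  exists (x *: u' + (s *: v' + z)); split.
    by have [] := Hr _ (B _ _ _ xt st tr).
  move: es ex; rewrite /p /dp /q !scale0r !add0r !subr0.
  rewrite !(addrCA (t *: u')) => es ex.
  rewrite ex in es; rewrite expr2 mulrA -es opprB addrA.
  by rewrite (addrC _ (f z)) (addrAC _ (- f (t *: u' + z))) addrCA addrA; ring.
apply/eqP; rewrite -subr_eq0 -normr_le0; apply/ler_addgt0Pl => e e0.
rewrite addr0.
have e20 : 0 < e / 2 by rewrite divr_gt0.
have F1 := key u v _ e20; have F2 := key v u _ e20.
have [t [[x [x1 x2]] [[y [y1 y2]] t0]]] :=
  filter_ex (filterI F1 (filterI F2 (nbhs_right_gt (0 : R)))).
have xy : 'D_u (fun x => 'D_v f x) x = 'D_v (fun x => 'D_u f x) y.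
  have t2 : t ^+ 2 != 0 by rewrite expf_neq0 // gt_eqF.
  by apply: (mulIf t2); rewrite -x2 -y2 (addrCA (t *: u)); ring.
rewrite xy in x1.
rewrite (splitr e); apply: le_trans (lerD (ltW x1) (ltW y1)).
rewrite -[X in _ <= _ + X]normrN; apply: le_trans (ler_normD _ _).
by rewrite opprB addrA subrK.
Unshelve. all: by end_near. Qed.

End Line.

(** * Calculus on relatively open subsets of the upper half plane *)

(** Relative openness in the closed upper half plane. Interior domains qualify as well as those
    touching the axis, so one calculus serves interior and boundary points. *)
Definition hopen (R : realType) (D : set (R * R)) : Prop :=
  forall z, D z -> 0 <= z.2 /\ \forall w \near z, 0 <= w.2 -> D w.

Definition ext_at (R : realType) (W : normedModType R) (D : set (R * R))
    (h : R * R -> W) (z : R * R) (g : R * R -> W) : Prop :=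
  exists U : set (R * R), [/\ open U, U z, smooth_on U g &
    forall w, U w -> D w -> g w = h w].

Definition smD (R : realType) (W : normedModType R) (D : set (R * R))
    (h : R * R -> W) : Prop :=
  forall z, D z -> exists g, ext_at D h z g.

HB.lock Definition dx (R : realType) (W : normedModType R) (h : R * R -> W)
    (z : R * R) : W := 'D_((1, 0) : R * R) h z.

(** One-sided, hence determined by values on the half plane even at points of the axis; [dx] can be
    two-sided there because horizontal lines stay inside a relatively open set. For functions with
    smooth local extensions both agree with the derivatives of any extension. *)
HB.lock Definition dy (R : realType) (W : normedModType R) (h : R * R -> W)
    (z : R * R) : W :=
  lim ((fun t : R => t^-1 *: (h (z.1, z.2 + t) - h z)) @ 0^'+).

Lemma open_comp_in (T U : topologicalType) (f : T -> U) (A : set T) (B : set U) :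
  open A -> {in A, continuous f} -> open B -> open (A `&` f @^-1` B).
Proof.
rewrite !openE => oA cf oB x [Ax Bfx]; apply: filterI; first exact: oA.
by apply: (cf x (mem_set Ax)); apply: oB.
Qed.

Section DCalculus.
Variable R : realType.
Implicit Types (W : normedModType R) (D : set (R * R)) (z w : R * R).

Lemma near_xline (P : set (R * R)) z : (\near z, P z) ->
  \forall t \near (0 : R), P (t *: ((1, 0) : R * R) + z).
Proof.
move=> Pz; have : \forall v \near (0 : R * R), P (v + z).
  by move: Pz; rewrite (near_shift 0 z) subr0.
exact: near0Z.
Qed.

Lemma near_yline (P : set (R * R)) z : (\near z, P z) ->
  \forall t \near (0 : R), P (t *: ((0, 1) : R * R) + z).
Proof.
move=> Pz; have : \forall v \near (0 : R * R), P (v + z).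
  by move: Pz; rewrite (near_shift 0 z) subr0.
exact: near0Z.
Qed.

Lemma xlineE (t : R) z : t *: ((1, 0) : R * R) + z = (t + z.1, z.2).
Proof.
by case: z => a b; congr pair; rewrite /= ?[t *: _]mulr1 // [t *: _]mulr0 add0r.
Qed.

Lemma ylineE (t : R) z : t *: ((0, 1) : R * R) + z = (z.1, t + z.2).
Proof.
by case: z => a b; congr pair; rewrite /= ?[t *: _]mulr1 // [t *: _]mulr0 add0r.
Qed.

Lemma dx_congr W D (h g : R * R -> W) z : hopen D -> D z ->
  (\forall w \near z, D w -> g w = h w) -> dx h z = 'D_((1, 0) : R * R) g z.
Proof.
move=> oD Dz gh; have [z2 nD] := oD z Dz.
rewrite dx.unlock /derive; congr (lim _).
have E : \forall t \near (0 : R), h (t *: ((1, 0) : R * R) + z) = g (t *: ((1, 0) : R * R) + z).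
  apply: filterS (filterI (near_xline gh) (near_xline nD)) => t [H1 H2].
  by rewrite H1 //; apply: H2; rewrite xlineE.
have E0 : h z = g z by have := nbhs_singleton E; rewrite scale0r add0r.
rewrite eqEsubset; split; apply/near_eq_cvg/cvg_within;
  by apply: filterS E => t Et; rewrite /= Et E0.
Qed.

Lemma dy_is W D (h g : R * R -> W) z (l : W) : hopen D -> D z ->
  (\forall w \near z, D w -> g w = h w) -> is_derive z ((0, 1) : R * R) g l ->
  dy h z = l.
Proof.
move=> oD Dz gh [dg gl]; have [z2 nD] := oD z Dz.
rewrite dy.unlock; apply: cvg_lim => //.
have E : \forall t \near (0 : R)^'+, t^-1 *: (g (t *: ((0, 1) : R * R) + z) - g z) =
    t^-1 *: (h (z.1, z.2 + t) - h z).
  have F : \forall t \near (0 : R)^'+,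
      (D (t *: ((0, 1) : R * R) + z) ->
       g (t *: ((0, 1) : R * R) + z) = h (t *: ((0, 1) : R * R) + z)) /\
      (0 <= (t *: ((0, 1) : R * R) + z).2 -> D (t *: ((0, 1) : R * R) + z)).
    by apply: cvg_within; exact: filterI (near_yline gh) (near_yline nD).
  apply: filterS (filterI F (nbhs_right_gt 0)) => t [[H1 H2] t0].
  have -> : (z.1, z.2 + t) = t *: ((0, 1) : R * R) + z by rewrite ylineE addrC.
  by rewrite H1 ?(nbhs_singleton gh) //; apply: H2; rewrite ylineE /= addr_ge0 // ltW.
apply: cvg_trans (near_eq_cvg E) _.
by rewrite -gl; apply: cvg_dnbhs_at_right; exact: dg.
Qed.

Lemma ext_near W D (h g : R * R -> W) z : ext_at D h z g ->
  \forall w \near z, D w -> g w = h w.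
Proof.
move=> [U [oU Uz _ gh]].
by apply: filterS (open_nbhs_nbhs (conj oU Uz)) => w; apply: gh.
Qed.

Lemma ext_differentiable W D (h g : R * R -> W) z : ext_at D h z g ->
  differentiable g z.
Proof. by move=> [U [oU Uz sg _]]; apply: smooth_on_differentiable sg Uz. Qed.

Lemma dx_ext W D (h g : R * R -> W) z : hopen D -> D z -> ext_at D h z g ->
  dx h z = 'D_((1, 0) : R * R) g z.
Proof. by move=> oD Dz /ext_near; apply: dx_congr. Qed.

Lemma dy_ext W D (h g : R * R -> W) z : hopen D -> D z -> ext_at D h z g ->
  dy h z = 'D_((0, 1) : R * R) g z.
Proof.
move=> oD Dz e; apply: (dy_is oD Dz (ext_near e)).
by apply: derivableP; apply: diff_derivable; apply: ext_differentiable e.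
Qed.

Lemma ext_dx W D (h g : R * R -> W) z : hopen D -> ext_at D h z g ->
  ext_at D (dx h) z (fun w => 'D_((1, 0) : R * R) g w).
Proof.
move=> oD [U [oU Uz sg gh]]; exists U; split => //.
  exact: smooth_on_derive.
by move=> w Uw Dw; rewrite -(dx_ext (h := h) oD Dw (g := g)) //; exists U.
Qed.

Lemma ext_dy W D (h g : R * R -> W) z : hopen D -> ext_at D h z g ->
  ext_at D (dy h) z (fun w => 'D_((0, 1) : R * R) g w).
Proof.
move=> oD [U [oU Uz sg gh]]; exists U; split => //.
  exact: smooth_on_derive.
by move=> w Uw Dw; rewrite -(dy_ext (h := h) oD Dw (g := g)) //; exists U.
Qed.

Lemma smD_dx W D (h : R * R -> W) : hopen D -> smD D h -> smD D (dx h).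
Proof.
by move=> oD sh z Dz; have [g e] := sh z Dz; eexists; exact: ext_dx oD e.
Qed.

Lemma smD_dy W D (h : R * R -> W) : hopen D -> smD D h -> smD D (dy h).
Proof.
by move=> oD sh z Dz; have [g e] := sh z Dz; eexists; exact: ext_dy oD e.
Qed.

Lemma ext_congr W D (h h' g : R * R -> W) z : (forall w, D w -> h w = h' w) ->
  ext_at D h z g -> ext_at D h' z g.
Proof.
move=> hh' [U [oU Uz sg gh]]; exists U; split => // w Uw Dw.
by rewrite gh // hh'.
Qed.

Lemma smD_congr W D (h h' : R * R -> W) : (forall w, D w -> h w = h' w) ->
  smD D h -> smD D h'.
Proof.
by move=> hh' sh z Dz; have [g e] := sh z Dz; exists g; exact: ext_congr e.
Qed.

Lemma smD_sub W D D' (h : R * R -> W) : D `<=` D' -> smD D' h -> smD D h.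
Proof.
move=> DD' sh z Dz; have [g [U [oU Uz sg gh]]] := sh z (DD' z Dz).
by exists g, U; split => // w Uw Dw; apply: gh => //; apply: DD'.
Qed.

Lemma dx_eqD W D (h h' : R * R -> W) z : hopen D -> smD D h -> D z ->
  (forall w, D w -> h w = h' w) -> dx h z = dx h' z.
Proof.
move=> oD sh Dz hh'; have [g e] := sh z Dz.
by rewrite (dx_ext oD Dz e) (dx_ext oD Dz (ext_congr hh' e)).
Qed.

Lemma dy_eqD W D (h h' : R * R -> W) z : hopen D -> smD D h -> D z ->
  (forall w, D w -> h w = h' w) -> dy h z = dy h' z.
Proof.
move=> oD sh Dz hh'; have [g e] := sh z Dz.
by rewrite (dy_ext oD Dz e) (dy_ext oD Dz (ext_congr hh' e)).
Qed.

Lemma smD_smooth W D (g : R * R -> W) (U : set (R * R)) :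
  open U -> D `<=` U -> smooth_on U g -> smD D g.
Proof. by move=> oU DU sg z Dz; exists g, U; split => //; apply: DU. Qed.

Lemma smD_cst W D (c : W) : smD D (fun=> c).
Proof.
by apply: (@smD_smooth _ _ _ setT) openT _ _ => // n; apply: Cn_on_cst.
Qed.

Lemma ext_bin W1 W2 W3 D (F : W1 -> W2 -> W3) (h1 g1 : R * R -> W1)
  (h2 g2 : R * R -> W2) z :
  (forall (U : set (R * R)), open U -> smooth_on U g1 -> smooth_on U g2 ->
    smooth_on U (fun z => F (g1 z) (g2 z))) ->
  ext_at D h1 z g1 -> ext_at D h2 z g2 ->
  ext_at D (fun z => F (h1 z) (h2 z)) z (fun z => F (g1 z) (g2 z)).
Proof.
move=> HF [U [oU Uz sg gh]] [U' [oU' Uz' sg' gh']]; exists (U `&` U'); split.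
- exact: openI.
- by [].
- by apply: HF; [exact: openI|exact: smooth_on_sub sg => ? []|
                 exact: smooth_on_sub sg' => ? []].
- by move=> w [Uw Uw'] Dw; rewrite gh // gh'.
Qed.

Lemma extD W D (h1 g1 h2 g2 : R * R -> W) z :
  ext_at D h1 z g1 -> ext_at D h2 z g2 ->
  ext_at D (fun z => h1 z + h2 z) z (fun z => g1 z + g2 z).
Proof.
by apply: ext_bin => U oU s1 s2 n; apply: Cn_onD.
Qed.

Lemma extM D (h1 g1 h2 g2 : R * R -> R) z :
  ext_at D h1 z g1 -> ext_at D h2 z g2 ->
  ext_at D (fun z => h1 z * h2 z) z (fun z => g1 z * g2 z).
Proof.
by apply: ext_bin => U oU s1 s2 n; apply: Cn_onM.
Qed.

Lemma smDD W D (h1 h2 : R * R -> W) : smD D h1 -> smD D h2 ->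
  smD D (fun z => h1 z + h2 z).
Proof.
move=> s1 s2 z Dz; have [g1 e1] := s1 z Dz; have [g2 e2] := s2 z Dz.
by eexists; exact: extD e1 e2.
Qed.

Lemma smDM D (h1 h2 : R * R -> R) : smD D h1 -> smD D h2 ->
  smD D (fun z => h1 z * h2 z).
Proof.
move=> s1 s2 z Dz; have [g1 e1] := s1 z Dz; have [g2 e2] := s2 z Dz.
by eexists; exact: extM e1 e2.
Qed.

Lemma smD_sum W D (I : Type) (r : seq I) (P : pred I) (h : I -> R * R -> W) :
  (forall i, P i -> smD D (h i)) -> smD D (fun z => \sum_(i <- r | P i) h i z).
Proof.
move=> sh; elim: r => [|i r IH].
  by apply: smD_congr (smD_cst (0 : W)) => w _; rewrite big_nil.
case Pi: (P i).
  by apply: smD_congr (smDD (sh i Pi) IH) => w _; rewrite big_cons Pi.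
by apply: smD_congr IH => w _; rewrite big_cons Pi.
Qed.

Lemma dxD W D (h1 h2 : R * R -> W) z : hopen D -> smD D h1 -> smD D h2 -> D z ->
  dx (fun z => h1 z + h2 z) z = dx h1 z + dx h2 z.
Proof.
move=> oD s1 s2 Dz; have [g1 e1] := s1 z Dz; have [g2 e2] := s2 z Dz.
rewrite (dx_ext oD Dz (extD e1 e2)) (dx_ext oD Dz e1) (dx_ext oD Dz e2) deriveD //;
by apply: diff_derivable; apply: ext_differentiable; eassumption.
Qed.

Lemma dyD W D (h1 h2 : R * R -> W) z : hopen D -> smD D h1 -> smD D h2 -> D z ->
  dy (fun z => h1 z + h2 z) z = dy h1 z + dy h2 z.
Proof.
move=> oD s1 s2 Dz; have [g1 e1] := s1 z Dz; have [g2 e2] := s2 z Dz.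
rewrite (dy_ext oD Dz (extD e1 e2)) (dy_ext oD Dz e1) (dy_ext oD Dz e2) deriveD //;
by apply: diff_derivable; apply: ext_differentiable; eassumption.
Qed.

Lemma dxM D (h1 h2 : R * R -> R) z : hopen D -> smD D h1 -> smD D h2 -> D z ->
  dx (fun z => h1 z * h2 z) z = dx h1 z * h2 z + h1 z * dx h2 z.
Proof.
move=> oD s1 s2 Dz; have [g1 e1] := s1 z Dz; have [g2 e2] := s2 z Dz.
rewrite (dx_ext oD Dz (extM e1 e2)) (dx_ext oD Dz e1) (dx_ext oD Dz e2) deriveM;
  try by apply: diff_derivable; apply: ext_differentiable; eassumption.
rewrite -(nbhs_singleton (ext_near e1) Dz) -(nbhs_singleton (ext_near e2) Dz).
by rewrite addrC; congr (_ + _); apply: mulrC.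
Qed.

Lemma dyM D (h1 h2 : R * R -> R) z : hopen D -> smD D h1 -> smD D h2 -> D z ->
  dy (fun z => h1 z * h2 z) z = dy h1 z * h2 z + h1 z * dy h2 z.
Proof.
move=> oD s1 s2 Dz; have [g1 e1] := s1 z Dz; have [g2 e2] := s2 z Dz.
rewrite (dy_ext oD Dz (extM e1 e2)) (dy_ext oD Dz e1) (dy_ext oD Dz e2) deriveM;
  try by apply: diff_derivable; apply: ext_differentiable; eassumption.
rewrite -(nbhs_singleton (ext_near e1) Dz) -(nbhs_singleton (ext_near e2) Dz).
by rewrite addrC; congr (_ + _); apply: mulrC.
Qed.

Lemma dx_cst W (c : W) z : dx (fun=> c) z = 0.
Proof. by rewrite dx.unlock derive_cst. Qed.

Lemma dy_cst W D (c : W) z : hopen D -> D z -> dy (fun=> c) z = 0.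
Proof.
move=> oD Dz; apply: (dy_is (g := fun=> c) oD Dz); exact: filterE.
Qed.

Lemma dx_sum W D (I : Type) (r : seq I) (P : pred I) (h : I -> R * R -> W) z :
  hopen D -> (forall i, P i -> smD D (h i)) -> D z ->
  dx (fun z => \sum_(i <- r | P i) h i z) z = \sum_(i <- r | P i) dx (h i) z.
Proof.
move=> oD sh Dz; elim: r => [|i r IH].
  rewrite big_nil -[RHS](dx_cst (0 : W) z); congr (dx _ z).
  by rewrite funeqE => w; rewrite big_nil.
have E w : \sum_(i <- i :: r | P i) h i w =
    (if P i then h i w + \sum_(i <- r | P i) h i w else \sum_(i <- r | P i) h i w).
  by rewrite big_cons.
rewrite (_ : (fun z => _) = (fun w => if P i then h i w + \sum_(i <- r | P i) h i w
  else \sum_(i <- r | P i) h i w)); last by rewrite funeqE => w; exact: E.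
rewrite big_cons; case Pi: (P i) => //.
by rewrite (dxD oD (sh i Pi) (smD_sum r sh) Dz) IH.
Qed.

Lemma dy_sum W D (I : Type) (r : seq I) (P : pred I) (h : I -> R * R -> W) z :
  hopen D -> (forall i, P i -> smD D (h i)) -> D z ->
  dy (fun z => \sum_(i <- r | P i) h i z) z = \sum_(i <- r | P i) dy (h i) z.
Proof.
move=> oD sh Dz; elim: r => [|i r IH].
  rewrite big_nil -[RHS](dy_cst (0 : W) oD Dz); congr (dy _ z).
  by rewrite funeqE => w; rewrite big_nil.
have E w : \sum_(i <- i :: r | P i) h i w =
    (if P i then h i w + \sum_(i <- r | P i) h i w else \sum_(i <- r | P i) h i w).
  by rewrite big_cons.
rewrite (_ : (fun z => _) = (fun w => if P i then h i w + \sum_(i <- r | P i) h i w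
  else \sum_(i <- r | P i) h i w)); last by rewrite funeqE => w; exact: E.
rewrite big_cons; case Pi: (P i) => //.
by rewrite (dyD oD (sh i Pi) (smD_sum r sh) Dz) IH.
Qed.

Lemma ext_coord D m p (h g : R * R -> 'M[R]_(m, p)) z i j : ext_at D h z g ->
  ext_at D (fun z => h z i j) z (fun z => g z i j).
Proof.
move=> [U [oU Uz sg gh]]; exists U; split => //.
  by move=> n; apply: Cn_on_coord.
by move=> w Uw Dw; rewrite gh.
Qed.

Lemma smD_coord D m p (h : R * R -> 'M[R]_(m, p)) i j : smD D h ->
  smD D (fun z => h z i j).
Proof.
by move=> sh z Dz; have [g e] := sh z Dz; eexists; exact: ext_coord e.
Qed.

Lemma dx_coord D m p (h : R * R -> 'M[R]_(m, p)) i j z : hopen D -> smD D h ->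
  D z -> dx (fun z => h z i j) z = dx h z i j.
Proof.
move=> oD sh Dz; have [g e] := sh z Dz.
rewrite (dx_ext oD Dz (ext_coord i j e)) (dx_ext oD Dz e) derive_mx ?mxE //.
by apply: diff_derivable; apply: ext_differentiable e.
Qed.

Lemma dy_coord D m p (h : R * R -> 'M[R]_(m, p)) i j z : hopen D -> smD D h ->
  D z -> dy (fun z => h z i j) z = dy h z i j.
Proof.
move=> oD sh Dz; have [g e] := sh z Dz.
rewrite (dy_ext oD Dz (ext_coord i j e)) (dy_ext oD Dz e) derive_mx ?mxE //.
by apply: diff_derivable; apply: ext_differentiable e.
Qed.

Lemma smD_mx D m p (h : R * R -> 'M[R]_(m, p)) :
  (forall i j, smD D (fun z => h z i j)) -> smD D h.
Proof.
move=> sh z Dz.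
have H (ij : 'I_m * 'I_p) : exists g, ext_at D (fun z => h z ij.1 ij.2) z g.
  exact: sh.
have [G HG] := choice H.
have [V HV] := choice HG.
exists (fun w => \matrix_(i, j) G (i, j) w).
have : \near z, forall ij, V ij z.
  apply: (filter_forall (f := V) (nbhs_filter z)) => ij; have [oV Vz _ _] := HV ij.
  exact: open_nbhs_nbhs.
move=> N; exists (interior [set w | forall ij, V ij w]); split.
- exact: open_interior.
- exact: N.
- move=> n; apply: Cn_on_mx; first exact: open_interior.
  move=> i j; have [_ _ s _] := HV (i, j).
  apply: (@Cn_on_eq _ _ _ _ _ (G (i, j))).
  + exact: open_interior.
  + by move=> x _; rewrite mxE.
  + by apply: Cn_on_sub (s n) => x /interior_subset; apply.
- move=> w /interior_subset Vw Dw; apply/matrixP => i j; rewrite mxE.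
  by have [_ _ _ ->] := HV (i, j).
Qed.

Lemma smD_mulmx D m p q (h1 : R * R -> 'M[R]_(m, p)) (h2 : R * R -> 'M[R]_(p, q)) :
  smD D h1 -> smD D h2 -> smD D (fun z => h1 z *m h2 z).
Proof.
move=> s1 s2; apply: smD_mx => i j.
apply: (@smD_congr _ _ (fun z => \sum_k h1 z i k * h2 z k j)).
  by move=> w _; rewrite mxE.
by apply: smD_sum => k _; apply: smDM; apply: smD_coord.
Qed.

Lemma dx_mulmx D m p q (h1 : R * R -> 'M[R]_(m, p)) (h2 : R * R -> 'M[R]_(p, q)) z :
  hopen D -> smD D h1 -> smD D h2 -> D z ->
  dx (fun z => h1 z *m h2 z) z = dx h1 z *m h2 z + h1 z *m dx h2 z.
Proof.
move=> oD s1 s2 Dz; apply/matrixP => i j.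
rewrite -(dx_coord i j oD (smD_mulmx s1 s2) Dz) !mxE -big_split /=.
have E w : (h1 w *m h2 w) i j = \sum_k h1 w i k * h2 w k j by rewrite mxE.
rewrite (_ : (fun z => _) = fun w => \sum_k h1 w i k * h2 w k j); last first.
  by rewrite funeqE.
rewrite (dx_sum _ oD) //; last first.
  by move=> k _; apply: smDM; apply: smD_coord.
apply: eq_bigr => k _.
by rewrite (dxM oD (smD_coord i k s1) (smD_coord k j s2) Dz) !(dx_coord _ _ oD).
Qed.

Lemma dy_mulmx D m p q (h1 : R * R -> 'M[R]_(m, p)) (h2 : R * R -> 'M[R]_(p, q)) z :
  hopen D -> smD D h1 -> smD D h2 -> D z ->
  dy (fun z => h1 z *m h2 z) z = dy h1 z *m h2 z + h1 z *m dy h2 z.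
Proof.
move=> oD s1 s2 Dz; apply/matrixP => i j.
rewrite -(dy_coord i j oD (smD_mulmx s1 s2) Dz) !mxE -big_split /=.
have E w : (h1 w *m h2 w) i j = \sum_k h1 w i k * h2 w k j by rewrite mxE.
rewrite (_ : (fun z => _) = fun w => \sum_k h1 w i k * h2 w k j); last first.
  by rewrite funeqE.
rewrite (dy_sum _ oD) //; last first.
  by move=> k _; apply: smDM; apply: smD_coord.
apply: eq_bigr => k _.
by rewrite (dyM oD (smD_coord i k s1) (smD_coord k j s2) Dz) !(dy_coord _ _ oD).
Qed.

Lemma dxdy D (h : R * R -> R) z : hopen D -> smD D h -> D z ->
  dx (dy h) z = dy (dx h) z.
Proof.
move=> oD sh Dz; have [g e] := sh z Dz.
rewrite (dx_ext oD Dz (ext_dy oD e)) (dy_ext oD Dz (ext_dx oD e)).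
by have [U [oU Uz sg _]] := e; exact: derive_swap sg.
Qed.

Lemma dxdy_mx D m p (h : R * R -> 'M[R]_(m, p)) z : hopen D -> smD D h -> D z ->
  dx (dy h) z = dy (dx h) z.
Proof.
move=> oD sh Dz; apply/matrixP => i j.
have sy := smD_dy oD sh; have sx := smD_dx oD sh; have sij := smD_coord i j sh.
have E1 : dx (dy h) z i j = dx (fun z => dy h z i j) z.
  by rewrite (dx_coord i j oD sy Dz).
have E2 : dy (dx h) z i j = dy (fun z => dx h z i j) z.
  by rewrite (dy_coord i j oD sx Dz).
have E3 : dx (dy (fun z => h z i j)) z = dx (fun z => dy h z i j) z.
  apply: (dx_eqD oD (smD_dy oD sij) Dz) => w Dw; exact: (dy_coord i j oD sh Dw).
have E4 : dy (dx (fun z => h z i j)) z = dy (fun z => dx h z i j) z.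
  apply: (dy_eqD oD (smD_dx oD sij) Dz) => w Dw; exact: (dx_coord i j oD sh Dw).
exact: etrans E1 (etrans (esym E3) (etrans (dxdy oD sij Dz) (etrans E4 (esym E2)))).
Qed.

Lemma smD_comp D m (u : R * R -> 'rV[R]_m) (Om : set 'rV[R]_m) (c : 'rV[R]_m -> R) :
  open Om -> (forall z, D z -> Om (u z)) -> smooth_on Om c -> smD D u ->
  smD D (fun z => c (u z)).
Proof.
move=> oO DO sc su z Dz; have [g [U [oU Uz sg gh]]] := su z Dz.
have cg : {in U, continuous g}.
  by move=> w /set_mem Uw; apply: differentiable_continuous; exact: smooth_on_differentiable sg Uw.
exists (fun z => c (g z)), (U `&` g @^-1` Om); split.
- exact: open_comp_in.
- by split => //=; rewrite gh //; apply: DO.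
- move=> n; apply: (@Cn_on_comp _ _ _ _ _ Om).
  + exact: open_comp_in.
  + by move=> x [].
  + exact: sc.
  + by apply: Cn_on_sub (sg n) => x [].
- by move=> w [Uw _] Dw; rewrite gh.
Qed.

Lemma smD_compmx D m p q (u : R * R -> 'rV[R]_m) (Om : set 'rV[R]_m)
    (A : 'rV[R]_m -> 'M[R]_(p, q)) :
  open Om -> (forall z, D z -> Om (u z)) -> smooth_on Om A -> smD D u ->
  smD D (fun z => A (u z)).
Proof.
move=> oO DO sA su; apply: smD_mx => i j.
by apply: (smD_comp oO DO (c := fun p => A p i j)) => // n; apply: Cn_on_coord.
Qed.

Lemma dx_comp D m (u : R * R -> 'rV[R]_m) (Om : set 'rV[R]_m) (c : 'rV[R]_m -> R) z :
  hopen D -> open Om -> (forall z, D z -> Om (u z)) -> smooth_on Om c -> smD D u ->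
  D z ->
  dx (fun z => c (u z)) z = \sum_l 'D_(delta_mx 0 l) c (u z) * dx u z 0 l.
Proof.
move=> oD oO DO sc su Dz; have [g e] := su z Dz.
have gz := nbhs_singleton (ext_near e) Dz.
rewrite (dx_congr (g := fun z => c (g z)) oD Dz); last first.
  by apply: filterS (ext_near e) => w H Dw; rewrite H.
rewrite derive_comp_rV; last 2 first.
- exact: ext_differentiable e.
- by apply: (smooth_on_differentiable sc); rewrite gz; apply: DO.
rewrite gz; apply: eq_bigr => l _; congr (_ * _).
by rewrite -(dx_coord 0 l oD su Dz) (dx_ext oD Dz (ext_coord 0 l e)).
Qed.

Lemma dy_comp D m (u : R * R -> 'rV[R]_m) (Om : set 'rV[R]_m) (c : 'rV[R]_m -> R) z :
  hopen D -> open Om -> (forall z, D z -> Om (u z)) -> smooth_on Om c -> smD D u ->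
  D z ->
  dy (fun z => c (u z)) z = \sum_l 'D_(delta_mx 0 l) c (u z) * dy u z 0 l.
Proof.
move=> oD oO DO sc su Dz; have [g e] := su z Dz.
have gz := nbhs_singleton (ext_near e) Dz.
have dc : differentiable c (g z).
  by apply: (smooth_on_differentiable sc); rewrite gz; apply: DO.
have -> : dy (fun z => c (u z)) z = 'D_((0, 1) : R * R) (fun z => c (g z)) z.
  apply: (dy_is (g := fun z => c (g z)) oD Dz).
    by apply: filterS (ext_near e) => w H Dw; rewrite H.
  apply: derivableP; apply: diff_derivable.
  exact: (differentiable_comp (ext_differentiable e) dc).
rewrite derive_comp_rV //; last exact: ext_differentiable e.
rewrite gz; apply: eq_bigr => l _; congr (_ * _).
by rewrite -(dy_coord 0 l oD su Dz) (dy_ext oD Dz (ext_coord 0 l e)).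
Qed.
End DCalculus.

Arguments dx {R W}.
Arguments dy {R W}.

(** * Maximum principle *)

Section MaxPrinciple.
Variable R : realType.
Implicit Types (D : set (R * R)) (z w : R * R).

Lemma near_norm_ex (V : normedModType R) (x : V) (P : set V) :
  nbhs x P -> exists2 e : R, 0 < e & forall y, `|y - x| < e -> P y.
Proof.
move=> /nbhs_normP[e e0 H].
by exists e => // y yx; apply: H; rewrite /ball_ /= distrC.
Qed.

Lemma near_norm (V : normedModType R) (x : V) (P : set V) (e : R) : 0 < e ->
  (forall y, `|y - x| < e -> P y) -> nbhs x P.
Proof.
move=> e0 H; apply/nbhs_normP.
by exists e => // y /=; rewrite distrC; apply: H.
Qed.

Lemma mx_norm_le m p (M : 'M[R]_(m, p)) (c : R) : 0 <= c ->
  (forall i j, `|M i j| <= c) -> `|M| <= c.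
Proof.
by move=> c0 H; rewrite /Num.Def.normr/= mx_normrE bigmax_le // => i _; apply: H.
Qed.

Lemma mx_norm_coord m p (M : 'M[R]_(m, p)) i j : `|M i j| <= `|M|.
Proof.
by rewrite [leRHS]/Num.Def.normr/= mx_normrE; exact: (le_bigmax _ (fun ij => `|M ij.1 ij.2|) (i, j)).
Qed.

Lemma pair_norm_lt z (e : R) : (`|z| < e) = (`|z.1| < e) && (`|z.2| < e).
Proof. by rewrite prod_normE gt_max. Qed.

Lemma pair_norm_le z (e : R) : (`|z| <= e) = (`|z.1| <= e) && (`|z.2| <= e).
Proof. by rewrite prod_normE ge_max. Qed.

(** A second-order test that sees the maximum only from the right: if [a > 0], the derivative [G] is
    positive just after 0 and the mean value theorem makes [F] exceed [F 0]. The last alternative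
    supplies [G 0 = 0], either as a Neumann condition or through Fermat's rule. *)
Lemma max1 (F G : R -> R) (a : R) :
  (\forall t \near (0 : R), is_derive t (1 : R) F (G t)) ->
  is_derive (0 : R) (1 : R) G a ->
  (\forall t \near (0 : R)^'+, F t <= F 0) ->
  (G 0 = 0 \/ \forall t \near (0 : R), F t <= F 0) -> a <= 0.
Proof.
move=> dF dG mF G0.
have {}G0 : G 0 = 0.
  case: G0 => // m2.
  have [e e0 He] := near_norm_ex (filterI dF m2).
  have E : is_derive (0 : R) 1 F 0.
    have in0 (t : R) : t \in `](- e), e[%R -> `|t - 0| < e.
      by rewrite in_itv /= subr0 ltr_norml.
    apply: (@derive1_at_max R F (- e) e 0).
    - by rewrite ge0_cp // ltW.
    - by move=> t /in0 /He[[]].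
    - by rewrite in_itv /= oppr_lt0 e0.
    - by move=> t /in0 /He[].
  have [[_ d0] _] := He 0 (ltac:(by rewrite subr0 normr0)).
  by rewrite -d0; case: E.
rewrite leNgt; apply/negP => a0.
have [cG eG] := dG.
have C : (fun t : R => t^-1 *: (G (t *: 1 + 0) - G 0)) @ 0^'+ --> a.
  by rewrite -eG; apply: cvg_dnbhs_at_right; exact: cG.
have P : \forall t \near (0 : R)^'+, 0 < G t.
  have H : \forall t \near (0 : R)^'+, 0 < t^-1 *: (G (t *: 1 + 0) - G 0) by apply: (cvgr_gt a C).
  near=> t.
  have t0 : 0 < t by near: t; exact: nbhs_right_gt.
  have : 0 < t^-1 *: (G (t *: 1 + 0) - G 0) by near: t; exact: H.
  by rewrite G0 subr0 addr0 [t *: 1]mulr1 pmulr_rgt0 // invr_gt0.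
have [e1 e10 H1] := near_norm_ex (dF).
have [e2 /= e20 H2] := P.
have [e3 /= e30 H3] := mF.
pose t := Num.min e1 (Num.min e2 e3) / 2.
have t0 : 0 < t by rewrite divr_gt0 // !lt_min e10 e20.
have [t1 t2 t3] : [/\ t < e1, t < e2 & t < e3].
  have tm : t < Num.min e1 (Num.min e2 e3).
    by rewrite ltr_pdivrMr // ltr_pMr ?ltr1n // !lt_min e10 e20.
  by move: tm; rewrite !lt_min => /andP[-> /andP[-> ->]].
have [] := @MVT R F G 0 t t0.
- move=> x /[!in_itv]/= /andP[x0 xt]; apply: H1.
  by rewrite subr0 gtr0_norm // (lt_trans xt).
- apply: derivable_within_continuous => x /[!in_itv]/= /andP[x0 xt].
  have [] // : is_derive x 1 F (G x).
  by apply: H1; rewrite subr0 ger0_norm // (le_lt_trans xt).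
move=> c /[!in_itv]/= /andP[c0 ct] e.
have Gc : 0 < G c.
  by apply: H2 => //=; rewrite sub0r normrN gtr0_norm // (lt_trans ct).
have : F t <= F 0.
  by apply: H3 => //=; rewrite sub0r normrN gtr0_norm.
by rewrite -subr_le0 e subr0 leNgt mulr_gt0.
Unshelve. all: by end_near. Qed.

(** On the axis only half of the vertical line is available; the vanishing normal derivative makes
    up for the missing half. *)
Lemma max_lapl D (P : R * R -> R) z : hopen D -> smD D P -> D z ->
  (\forall w \near z, D w -> P w <= P z) -> (z.2 = 0 -> dy P z = 0) ->
  dx (dx P) z + dy (dy P) z <= 0.
Proof.
move=> oD sP Dz mP bP; have [g e] := sP z Dz.
have [U [oU Uz sg gP]] := e.
have [z2 nD] := oD z Dz.
have gz : g z = P z by apply: gP.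
have dg w : U w -> differentiable g w by apply: smooth_on_differentiable.
have ddg v w : U w -> differentiable (fun x => 'D_v g x) w.
  by apply: smooth_on_differentiable; apply: smooth_on_derive.
have NU := open_nbhs_nbhs (conj oU Uz).
rewrite (dx_ext oD Dz (ext_dx oD e)) (dy_ext oD Dz (ext_dy oD e)) -[X in _ <= X]addr0.
apply: lerD.
  apply: (@max1 (fun t => g (t *: ((1, 0) : R * R) + z)) (fun t => 'D_((1, 0) : R * R) g (t *: ((1, 0) : R * R) + z))).
  - by apply: filterS (near_xline NU) => t Ut; apply: is_derive_line; apply: dg.
  - have := @is_derive_line R _ _ (fun x => 'D_((1, 0) : R * R) g x) z (1, 0) 0.
    by rewrite scale0r add0r; apply; apply: ddg.
  - apply: cvg_within.
    apply: filterS (filterI (near_xline NU) (filterI (near_xline nD) (near_xline mP))) => t [Ut [Dt Pt]].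
    have D' : D (t *: (1, 0) + z) by apply: Dt; rewrite xlineE.
    by rewrite scale0r add0r gz gP //; apply: Pt.
  - right.
    apply: filterS (filterI (near_xline NU) (filterI (near_xline nD) (near_xline mP))) => t [Ut [Dt Pt]].
    have D' : D (t *: (1, 0) + z) by apply: Dt; rewrite xlineE.
    by rewrite scale0r add0r gz gP //; apply: Pt.
apply: (@max1 (fun t => g (t *: ((0, 1) : R * R) + z)) (fun t => 'D_((0, 1) : R * R) g (t *: ((0, 1) : R * R) + z))).
- by apply: filterS (near_yline NU) => t Ut; apply: is_derive_line; apply: dg.
- have := @is_derive_line R _ _ (fun x => 'D_((0, 1) : R * R) g x) z (0, 1) 0.
  by rewrite scale0r add0r; apply; apply: ddg.
- have N : \forall t \near (0 : R)^'+, U (t *: ((0, 1) : R * R) + z) /\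
     (0 <= (t *: ((0, 1) : R * R) + z).2 -> D (t *: ((0, 1) : R * R) + z)) /\
     (D (t *: ((0, 1) : R * R) + z) -> P (t *: ((0, 1) : R * R) + z) <= P z).
    by apply: cvg_within; exact: filterI (near_yline NU) (filterI (near_yline nD) (near_yline mP)).
  apply: filterS (filterI N (nbhs_right_ge 0)) => t [[Ut [Dt Pt]] t0].
  have D' : D (t *: (0, 1) + z) by apply: Dt; rewrite ylineE /= addr_ge0.
  by rewrite scale0r add0r gz gP //; apply: Pt.
- have [z20|z20] := eqVneq z.2 0.
    by left; rewrite scale0r add0r -(dy_ext oD Dz e); apply: bP.
  right; have z2p : 0 < z.2 by rewrite lt_neqAle eq_sym z20.
  have L : \forall t \near (0 : R), - z.2 < t by apply: lt_nbhsr; rewrite oppr_lt0.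
  apply: filterS (filterI L (filterI (near_yline NU) (filterI (near_yline nD) (near_yline mP)))) => t [Lt [Ut [Dt Pt]]].
  have D' : D (t *: (0, 1) + z).
    by apply: Dt; rewrite ylineE /= -lerBlDr sub0r ltW.
  by rewrite scale0r add0r gz gP //; apply: Pt.
Qed.

Lemma is_derive_x D (h : R * R -> R) (s y : R) : hopen D -> smD D h -> D (s, y) ->
  is_derive s (1 : R) (fun t => h (t, y)) (dx h (s, y)).
Proof.
move=> oD sh Ds; have [g e] := sh _ Ds.
rewrite (dx_ext oD Ds e).
have E (t : R) : (t, y) = t *: ((1, 0) : R * R) + (0, y).
  by rewrite xlineE /= addr0.
have dg : differentiable g (s *: ((1, 0) : R * R) + (0, y)).
  by rewrite -E; exact: ext_differentiable e.
have := is_derive_line dg; rewrite -E; apply: near_eq_is_derive.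
have [_ nD] := oD _ Ds.
have [r r0 H] := near_norm_ex (filterI nD (ext_near e)).
apply: (near_norm r0) => t ts.
have [] := H (t, y).
  by rewrite pair_norm_lt /= ts subrr normr0.
move=> H1 H2; rewrite -E H2 //; apply: H1; by have [] := oD _ Ds.
Qed.

Lemma is_derive_y D (h : R * R -> R) (x s : R) : hopen D -> smD D h -> D (x, s) ->
  0 < s -> is_derive s (1 : R) (fun t => h (x, t)) (dy h (x, s)).
Proof.
move=> oD sh Ds s0; have [g e] := sh _ Ds.
rewrite (dy_ext oD Ds e).
have E (t : R) : (x, t) = t *: ((0, 1) : R * R) + (x, 0).
  by rewrite ylineE /= addr0.
have dg : differentiable g (s *: ((0, 1) : R * R) + (x, 0)).
  by rewrite -E; exact: ext_differentiable e.
have := is_derive_line dg; rewrite -E; apply: near_eq_is_derive.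
have [_ nD] := oD _ Ds.
have [r r0 H] := near_norm_ex (filterI nD (ext_near e)).
have N : nbhs s (fun t => `|t - s| < r) by apply: (near_norm r0).
apply: filterS (filterI (lt_nbhsr s0) N) => t [t0 ts]; have [] := H (x, t).
  by rewrite pair_norm_lt /= ts subrr normr0 r0.
by move=> H1 H2; rewrite -E H2 //; apply: H1; rewrite /= ltW.
Qed.

Lemma smD_cvg D (W : normedModType R) (h : R * R -> W) z : hopen D -> smD D h ->
  D z -> forall e, 0 < e -> exists2 r, 0 < r &
  forall w, D w -> `|w - z| < r -> `|h w - h z| < e.
Proof.
move=> oD sh Dz e e0; have [g eg] := sh z Dz.
have cg := differentiable_continuous (ext_differentiable eg).
have /cvgrPdist_lt/(_ _ e0) N := cg.
have [r r0 H] := near_norm_ex (filterI N (ext_near eg)).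
exists r => // w Dw wz; have [H1 H2] := H w wz.
by rewrite -(H2 Dw) -(nbhs_singleton (ext_near eg) Dz) distrC.
Qed.

Lemma path_le (f g f' g' : R -> R) (a b : R) : a <= b ->
  (forall s, a < s < b -> [/\ is_derive s (1 : R) f (f' s),
     is_derive s (1 : R) g (g' s) & `|f' s| <= g' s]) ->
  {within `[a, b], continuous f} -> {within `[a, b], continuous g} ->
  `|f b - f a| <= g b - g a.
Proof.
rewrite le_eqVlt => /predU1P[->|ab H cf cg]; first by rewrite !subrr normr0.
have K (k : R) : `|k| = 1 -> k * (f b - f a) <= g b - g a.
  move=> k1.
  have [] := @MVT R (fun s => g s - k * f s) (fun s => g' s - k * f' s) a b ab.
  - move=> x /[!in_itv]/= xab; have [d1 d2 _] := H x xab.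
    by apply: is_deriveB; apply: is_deriveZ.
  - by move=> x; apply: cvgB; [exact: cg|apply: cvgM; [exact: cvg_cst|exact: cf]].
  move=> c /[!in_itv]/= cab e; have [_ _ fg] := H c cab.
  rewrite -subr_ge0.
  have -> : g b - g a - k * (f b - f a) = g b - k * f b - (g a - k * f a) by ring.
  rewrite e mulr_ge0 // ?subr_ge0 ?(ltW ab) //.
  apply: le_trans fg; rewrite (le_trans (ler_norm _)) // normrM k1 mul1r lexx //.
rewrite ler_norml; apply/andP; split.
  by have := K (-1) (normrN1 _); rewrite mulN1r lerNl.
by have := K 1 (normr1 _); rewrite mul1r.
Qed.

Lemma cont_within_y D (h : R * R -> R) (a b x : R) : hopen D -> smD D h ->
  (forall s, a <= s <= b -> D (x, s)) ->
  {within `[a, b], continuous (fun s => h (x, s))}.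
Proof.
move=> oD sh H; apply/subspace_continuousP => y; rewrite /= in_itv /= => yab.
apply/cvgrPdist_lt => e e0; have [r r0 Hr] := smD_cvg oD sh (H y yab) e0.
apply: (near_norm r0) => t ty tab; rewrite distrC; apply: Hr.
  by apply: H; move: tab; rewrite /= in_itv.
by rewrite pair_norm_lt /= subrr normr0 r0.
Qed.

Lemma cont_within_x D (h : R * R -> R) (a b y : R) : hopen D -> smD D h ->
  (forall s, a <= s <= b -> D (s, y)) ->
  {within `[a, b], continuous (fun s => h (s, y))}.
Proof.
move=> oD sh H; apply: derivable_within_continuous => x /[!in_itv]/= xab.
by have [] := is_derive_x oD sh (H x xab).
Qed.

Lemma cont_lin (C a b : R) : {within `[a, b], continuous (fun s => C * s)}.
Proof.
apply: continuous_subspaceT => x; apply: cvgM; [exact: cvg_cst|exact: cvg_id].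
Qed.

Lemma is_derive_lin (C x : R) : is_derive x (1 : R) (fun s => C * s) C.
Proof.
have := is_deriveZ C (is_derive_id x (1 : R)).
by rewrite [C *: 1]mulr1.
Qed.

Lemma dx_lip D m p (h : R * R -> 'M[R]_(m, p)) (a b y C : R) : hopen D -> smD D h ->
  a <= b -> (forall s, a <= s <= b -> D (s, y) /\ `|dx h (s, y)| <= C) ->
  `|h (b, y) - h (a, y)| <= C * (b - a).
Proof.
move=> oD sh ab H.
have C0 : 0 <= C.
  by have [] := H a (ltac:(by rewrite lexx ab)) => _; apply: le_trans; exact: normr_ge0.
apply: mx_norm_le => [|i j]; first by rewrite mulr_ge0 // subr_ge0.
rewrite !mxE mulrBr.
have HD s : a <= s <= b -> D (s, y) by move=> /H[].
apply: (@path_le (fun s => h (s, y) i j) (fun s => C * s) (fun s => dx (fun z => h z i j) (s, y)) (fun=> C)) => //.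
- move=> s /andP[sa sb]; have [Ds dhC] := H s (ltac:(by rewrite !ltW)).
  split; first exact: (is_derive_x oD (smD_coord i j sh) Ds).
    exact: is_derive_lin.
  rewrite (dx_coord _ _ oD sh Ds); exact: le_trans (mx_norm_coord _ _ _) dhC.
- exact: cont_within_x oD (smD_coord i j sh) HD.
- exact: cont_lin.
Qed.

Lemma dy_lip D m p (h : R * R -> 'M[R]_(m, p)) (a b x C : R) : hopen D -> smD D h ->
  a <= b -> (forall s, a <= s <= b -> D (x, s) /\ `|dy h (x, s)| <= C) ->
  `|h (x, b) - h (x, a)| <= C * (b - a).
Proof.
move=> oD sh ab H.
have C0 : 0 <= C.
  by have [] := H a (ltac:(by rewrite lexx ab)) => _; apply: le_trans; exact: normr_ge0.
have [a0 _] := oD _ (H a (ltac:(by rewrite lexx ab))).1.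
apply: mx_norm_le => [|i j]; first by rewrite mulr_ge0 // subr_ge0.
rewrite !mxE mulrBr.
have HD s : a <= s <= b -> D (x, s) by move=> /H[].
apply: (@path_le (fun s => h (x, s) i j) (fun s => C * s) (fun s => dy (fun z => h z i j) (x, s)) (fun=> C)) => //.
- move=> s /andP[sa sb]; have [Ds dhC] := H s (ltac:(by rewrite !ltW)).
  split; first exact: (is_derive_y oD (smD_coord i j sh) Ds (le_lt_trans a0 sa)).
    exact: is_derive_lin.
  rewrite (dy_coord _ _ oD sh Ds); exact: le_trans (mx_norm_coord _ _ _) dhC.
- exact: cont_within_y oD (smD_coord i j sh) HD.
- exact: cont_lin.
Qed.

End MaxPrinciple.

(** * Laplacian and sums of squares *)

Definition lapl (R : realType) (W : normedModType R) (h : R * R -> W) (z : R * R) : W :=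
  dx (dx h) z + dy (dy h) z.

Definition sqn (R : realType) (N : nat) (v : 'rV[R]_N) : R := \sum_i v 0 i ^+ 2.

Section Bernstein.
Variable R : realType.
Implicit Types (D : set (R * R)) (z w : R * R).

Lemma smD_lapl D (W : normedModType R) (h : R * R -> W) : hopen D -> smD D h ->
  smD D (lapl h).
Proof.
move=> oD sh; exact: smDD (smD_dx oD (smD_dx oD sh)) (smD_dy oD (smD_dy oD sh)).
Qed.

Lemma laplD D (W : normedModType R) (f g : R * R -> W) z : hopen D -> smD D f ->
  smD D g -> D z -> lapl (fun z => f z + g z) z = lapl f z + lapl g z.
Proof.
move=> oD sf sg Dz; have sfg := smDD sf sg.
have [fx fy gx gy] : [/\ smD D (dx f), smD D (dy f), smD D (dx g) & smD D (dy g)].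
  by split; [exact: smD_dx|exact: smD_dy|exact: smD_dx|exact: smD_dy].
rewrite /lapl.
rewrite (dx_eqD oD (smD_dx oD sfg) Dz (h' := fun z => dx f z + dx g z)); last first.
  by move=> w Dw; apply: (dxD oD).
rewrite (dy_eqD oD (smD_dy oD sfg) Dz (h' := fun z => dy f z + dy g z)); last first.
  by move=> w Dw; apply: (dyD oD).
by rewrite (dxD oD fx gx Dz) (dyD oD fy gy Dz) addrACA.
Qed.

Lemma laplM D (f g : R * R -> R) z : hopen D -> smD D f -> smD D g -> D z ->
  lapl (fun z => f z * g z) z = lapl f z * g z +
    2 * (dx f z * dx g z + dy f z * dy g z) + f z * lapl g z.
Proof.
move=> oD sf sg Dz; have sfg := smDM sf sg.
have [fx fy gx gy] : [/\ smD D (dx f), smD D (dy f), smD D (dx g) & smD D (dy g)].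
  by split; [exact: smD_dx|exact: smD_dy|exact: smD_dx|exact: smD_dy].
rewrite /lapl.
rewrite (dx_eqD oD (smD_dx oD sfg) Dz (h' := fun z => dx f z * g z + f z * dx g z)); last first.
  by move=> w Dw; apply: (dxM oD).
rewrite (dy_eqD oD (smD_dy oD sfg) Dz (h' := fun z => dy f z * g z + f z * dy g z)); last first.
  by move=> w Dw; apply: (dyM oD).
rewrite (dxD oD (smDM fx sg) (smDM sf gx) Dz) (dyD oD (smDM fy sg) (smDM sf gy) Dz).
rewrite (dxM oD fx sg Dz) (dxM oD sf gx Dz) (dyM oD fy sg Dz) (dyM oD sf gy Dz).
move: (dx (dx f) z) (dy (dy f) z) (dx (dx g) z) (dy (dy g) z) (dx f z) (dy f z)
  (dx g z) (dy g z) (f z) (g z) => a1 a2 a3 a4 a5 a6 a7 a8 a9 a10.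
ring.
Qed.

Lemma lapl_sum D (W : normedModType R) (I : Type) (r : seq I) (P : pred I)
    (h : I -> R * R -> W) z :
  hopen D -> (forall i, P i -> smD D (h i)) -> D z ->
  lapl (fun z => \sum_(i <- r | P i) h i z) z = \sum_(i <- r | P i) lapl (h i) z.
Proof.
move=> oD sh Dz; have ss := smD_sum r sh.
rewrite /lapl big_split /=; congr (_ + _).
  rewrite (dx_eqD oD (smD_dx oD ss) Dz (h' := fun z => \sum_(i <- r | P i) dx (h i) z)).
    by apply: (dx_sum _ oD) Dz => i /sh; exact: smD_dx.
  by move=> w Dw; apply: (dx_sum _ oD).
rewrite (dy_eqD oD (smD_dy oD ss) Dz (h' := fun z => \sum_(i <- r | P i) dy (h i) z)).
  by apply: (dy_sum _ oD) Dz => i /sh; exact: smD_dy.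
by move=> w Dw; apply: (dy_sum _ oD).
Qed.

Lemma lapl_coord D m p (h : R * R -> 'M[R]_(m, p)) i j z : hopen D -> smD D h ->
  D z -> lapl (fun z => h z i j) z = lapl h z i j.
Proof.
move=> oD sh Dz; have sij := smD_coord i j sh; rewrite /lapl [RHS]mxE; congr (_ + _).
  rewrite -(dx_coord i j oD (smD_dx oD sh) Dz).
  by apply: (dx_eqD oD (smD_dx oD sij) Dz) => w Dw; apply: (dx_coord i j oD).
rewrite -(dy_coord i j oD (smD_dy oD sh) Dz).
by apply: (dy_eqD oD (smD_dy oD sij) Dz) => w Dw; apply: (dy_coord i j oD).
Qed.

Lemma lapl_dx D m p (h : R * R -> 'M[R]_(m, p)) z : hopen D -> smD D h ->
  D z -> lapl (dx h) z = dx (lapl h) z.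
Proof.
move=> oD sh Dz; have [sx sy] := (smD_dx oD sh, smD_dy oD sh).
have -> : dx (lapl h) z = dx (dx (dx h)) z + dx (dy (dy h)) z.
  exact: dxD oD (smD_dx oD sx) (smD_dy oD sy) Dz.
have E : dy (dy (dx h)) z = dy (dx (dy h)) z.
  by apply: (dy_eqD oD (smD_dy oD sx) Dz) => w Dw; apply/esym; exact: dxdy_mx oD sh Dw.
have E' : dx (dy (dy h)) z = dy (dx (dy h)) z by exact: dxdy_mx oD sy Dz.
by rewrite /lapl E E'.
Qed.

Lemma sqn_ge0 N (v : 'rV[R]_N) : 0 <= sqn v.
Proof. by apply: sumr_ge0 => i _; apply: sqr_ge0. Qed.

Lemma norm_sqn N (v : 'rV[R]_N) : `|v| ^+ 2 <= sqn v.
Proof.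
suff: `|v| <= Num.sqrt (sqn v).
  by move=> h; rewrite -(sqr_sqrtr (sqn_ge0 v)) ler_pXn2r // nnegrE ?sqrtr_ge0.
apply: mx_norm_le => [|i j]; first exact: sqrtr_ge0.
rewrite ord1 -sqrtr_sqr ler_wsqrtr // /sqn (bigD1 j) //= lerDl.
by apply: sumr_ge0 => k _; apply: sqr_ge0.
Qed.

Lemma sqn_norm N (v : 'rV[R]_N) : sqn v <= N%:R * `|v| ^+ 2.
Proof.
have -> : N%:R * `|v| ^+ 2 = \sum_(i < N) `|v| ^+ 2.
  by rewrite sumr_const card_ord mulr_natl.
apply: ler_sum => i _; rewrite -real_normK ?num_real // ler_pXn2r ?nnegrE //.
exact: mx_norm_coord.
Qed.

Lemma smD_sqn D N (h : R * R -> 'rV[R]_N) : smD D h -> smD D (fun z => sqn (h z)).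
Proof.
move=> sh; apply: smD_sum => i _.
by apply: smDM; apply: smD_coord.
Qed.

Lemma dx_sqn D N (h : R * R -> 'rV[R]_N) z : hopen D -> smD D h -> D z ->
  dx (fun z => sqn (h z)) z = \sum_i 2 * (h z 0 i * dx h z 0 i).
Proof.
move=> oD sh Dz; rewrite /sqn (dx_sum _ oD) //; last first.
  by move=> i _; apply: smDM; apply: smD_coord.
apply: eq_bigr => i _; have si := smD_coord 0 i sh.
have -> : dx (fun z => h z 0 i ^+ 2) z = dx (fun z => h z 0 i * h z 0 i) z by [].
by rewrite (dxM oD si si Dz) !(dx_coord 0 i oD sh Dz) mulr2n mulrDl mul1r; congr (_ + _); apply: mulrC.
Qed.

Lemma dy_sqn D N (h : R * R -> 'rV[R]_N) z : hopen D -> smD D h -> D z ->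
  dy (fun z => sqn (h z)) z = \sum_i 2 * (h z 0 i * dy h z 0 i).
Proof.
move=> oD sh Dz; rewrite /sqn (dy_sum _ oD) //; last first.
  by move=> i _; apply: smDM; apply: smD_coord.
apply: eq_bigr => i _; have si := smD_coord 0 i sh.
have -> : dy (fun z => h z 0 i ^+ 2) z = dy (fun z => h z 0 i * h z 0 i) z by [].
by rewrite (dyM oD si si Dz) !(dy_coord 0 i oD sh Dz) mulr2n mulrDl mul1r; congr (_ + _); apply: mulrC.
Qed.

(** Bochner's identity: the squared first derivatives come with a good sign and later absorb the
    error terms. *)
Lemma lapl_sqn D N (h : R * R -> 'rV[R]_N) z : hopen D -> smD D h -> D z ->
  lapl (fun z => sqn (h z)) z = 2 * (sqn (dx h z) + sqn (dy h z)) +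
    \sum_i 2 * (h z 0 i * lapl h z 0 i).
Proof.
move=> oD sh Dz; rewrite /sqn (lapl_sum _ oD) //; last first.
  by move=> i _; apply: smDM; apply: smD_coord.
rewrite -big_split mulr_sumr -big_split /=.
apply: eq_bigr => i _; have si := smD_coord 0 i sh.
have -> : lapl (fun z => h z 0 i ^+ 2) z = lapl (fun z => h z 0 i * h z 0 i) z by [].
rewrite (laplM oD si si Dz) !(dx_coord 0 i oD sh Dz) !(dy_coord 0 i oD sh Dz).
rewrite (lapl_coord 0 i oD sh Dz).
by move: (lapl h z 0 i) (h z 0 i) (dx h z 0 i) (dy h z 0 i) => a b c d; ring.
Qed.

Lemma dot_bound N (v w : 'rV[R]_N) : `|\sum_i v 0 i * w 0 i| <= N%:R * (`|v| * `|w|).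
Proof.
apply: le_trans (ler_norm_sum _ _ _) _.
have -> : N%:R * (`|v| * `|w|) = \sum_(i < N) `|v| * `|w|.
  by rewrite sumr_const card_ord mulr_natl.
by apply: ler_sum => i _; rewrite normrM ler_pM // mx_norm_coord.
Qed.

Lemma mulmx_norm m p q (A : 'M[R]_(m, p)) (B : 'M[R]_(p, q)) :
  `|A *m B| <= p%:R * (`|A| * `|B|).
Proof.
apply: mx_norm_le => [|i j]; first by rewrite !mulr_ge0.
rewrite mxE; apply: le_trans (ler_norm_sum _ _ _) _.
have -> : p%:R * (`|A| * `|B|) = \sum_(i < p) `|A| * `|B|.
  by rewrite sumr_const card_ord mulr_natl.
by apply: ler_sum => k _; rewrite normrM ler_pM // mx_norm_coord.
Qed.

End Bernstein.

(** * Polynomial cutoff functions *)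

Section Cutoff.
Variable R : realType.
Implicit Types (D : set (R * R)) (z w : R * R).

Lemma smooth_on_fst (U : set (R * R)) : open U -> smooth_on U (fun z : R * R => z.1).
Proof.
move=> oU n; have := @Cn_on_lin R _ _ n U (fst : {linear (R * R)%type -> R}) oU.
by apply => x; exact: cvg_fst.
Qed.

Lemma smooth_on_snd (U : set (R * R)) : open U -> smooth_on U (fun z : R * R => z.2).
Proof.
move=> oU n; have := @Cn_on_lin R _ _ n U (snd : {linear (R * R)%type -> R}) oU.
by apply => x; exact: cvg_snd.
Qed.

Lemma dx_smooth D (U : set (R * R)) (h : R * R -> R) z l : hopen D -> D z ->
  open U -> U z -> smooth_on U h ->
  is_derive z.1 (1 : R) (fun t => h (t, z.2)) l -> dx h z = l.
Proof.
case: z => x y; move=> oD Dz oU Uz sh [_ <-].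
have e : ext_at D h (x, y) h by exists U.
have E (t : R) : (t, y) = t *: ((1, 0) : R * R) + (0, y).
  by rewrite xlineE /= addr0.
rewrite (dx_ext oD Dz e).
have dg : differentiable h (x *: ((1, 0) : R * R) + (0, y)).
  by rewrite -E; exact: ext_differentiable e.
have [_] := is_derive_line dg; rewrite -E => <-.
have -> // : (fun t : R => h (t *: ((1, 0) : R * R) + (0, y))) = fun t => h (t, y).
by rewrite funeqE => t; rewrite E.
Qed.

Lemma dy_smooth D (U : set (R * R)) (h : R * R -> R) z l : hopen D -> D z ->
  open U -> U z -> smooth_on U h ->
  is_derive z.2 (1 : R) (fun t => h (z.1, t)) l -> dy h z = l.
Proof.
case: z => x y; move=> oD Dz oU Uz sh [_ <-].
have e : ext_at D h (x, y) h by exists U.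
have E (t : R) : (x, t) = t *: ((0, 1) : R * R) + (x, 0).
  by rewrite ylineE /= addr0.
rewrite (dy_ext oD Dz e).
have dg : differentiable h (y *: ((0, 1) : R * R) + (x, 0)).
  by rewrite -E; exact: ext_differentiable e.
have [_] := is_derive_line dg; rewrite -E => <-.
have -> // : (fun t : R => h (t *: ((0, 1) : R * R) + (x, 0))) = fun t => h (x, t).
by rewrite funeqE => t; rewrite E.
Qed.

(** The outer square makes the squared derivative at most a multiple of [cut1] itself, as the
    maximum principle argument needs. It serves as a cutoff where [|x - x0| <= r], with zeros at the
    two ends. *)
Definition cut1 (x0 r x : R) : R := (1 - ((x - x0) / r) ^+ 2) ^+ 2.
Definition dcut1 (x0 r x : R) : R :=
  - 4 / r * ((x - x0) / r) * (1 - ((x - x0) / r) ^+ 2).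
Definition ddcut1 (x0 r x : R) : R := (12 * ((x - x0) / r) ^+ 2 - 4) / r ^+ 2.

Lemma is_derive_cut1 (x0 r x : R) : 0 < r ->
  is_derive x (1 : R) (cut1 x0 r) (dcut1 x0 r x).
Proof.
move=> r0; pose s (x : R) := (x - x0) / r.
have ds y : is_derive y (1 : R) s r^-1.
  have d := is_deriveB (is_derive_id y (1 : R)) (is_derive_cst x0 y (1 : R)).
  have d2 := is_deriveM d (is_derive_cst r^-1 y (1 : R)).
  apply: (is_derive_eq d2).
  by rewrite /= scaler0 add0r subr0 [_ *: 1]mulr1.
have -> : cut1 x0 r = (cst 1 - s ^+ 2) ^+ 2.
  by rewrite funeqE => y; rewrite /cut1 !fctE.
have d := is_deriveX 2 (is_deriveB (is_derive_cst (1 : R) x 1) (is_deriveX 2 (ds x))).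
apply: (is_derive_eq d); rewrite /dcut1 -/(s x) !fctE.
rewrite /GRing.scale /=. move: (r^-1) (s x) => a b; ring.
Qed.

Lemma is_derive_dcut1 (x0 r x : R) : 0 < r ->
  is_derive x (1 : R) (dcut1 x0 r) (ddcut1 x0 r x).
Proof.
move=> r0; pose s (x : R) := (x - x0) / r.
have ds y : is_derive y (1 : R) s r^-1.
  have d := is_deriveB (is_derive_id y (1 : R)) (is_derive_cst x0 y (1 : R)).
  have d2 := is_deriveM d (is_derive_cst r^-1 y (1 : R)).
  apply: (is_derive_eq d2).
  by rewrite /= scaler0 add0r subr0 [_ *: 1]mulr1.
have -> : dcut1 x0 r = (cst (- 4 / r) * s) * (cst 1 - s ^+ 2).
  by rewrite funeqE => y; rewrite /dcut1 !fctE.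
have d := is_deriveM (is_deriveM (is_derive_cst (- 4 / r) x 1) (ds x))
  (is_deriveB (is_derive_cst (1 : R) x 1) (is_deriveX 2 (ds x))).
apply: (is_derive_eq d); rewrite /ddcut1 -/(s x) !fctE.
rewrite /GRing.scale /= !expr1 -exprVn; move: r^-1 (s x) => a b; ring.
Qed.

Lemma cut1_bounds (x0 r x : R) : 0 < r -> `|x - x0| <= r ->
  [/\ 0 <= cut1 x0 r x <= 1, dcut1 x0 r x ^+ 2 <= 16 / r ^+ 2 * cut1 x0 r x &
      `|ddcut1 x0 r x| <= 8 / r ^+ 2].
Proof.
move=> r0 xr; rewrite /cut1 /dcut1 /ddcut1 -!exprVn.
have : `|(x - x0) / r| <= 1.
  by rewrite normrM normfV (gtr0_norm r0) ler_pdivrMr // mul1r.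
have ir : 0 < r^-1 by rewrite invr_gt0.
move: r^-1 ((x - x0) / r) ir => a s a0; rewrite ler_norml => /andP[s1 s2].
have s21 : s ^+ 2 <= 1 by nra.
have s20 : 0 <= s ^+ 2 by apply: sqr_ge0.
have [S ES] : exists S, s ^+ 2 = S by exists (s ^+ 2).
rewrite ES in s21 s20 *.
have [S1 S0] := (s21, s20).
split.
- by apply/andP; split; nra.
- have -> : (- 4 * a * s * (1 - S)) ^+ 2 = 16 * a ^+ 2 * (1 - S) ^+ 2 * s ^+ 2 by ring.
  by rewrite ES ler_piMr // mulr_ge0 ?sqr_ge0 // mulr_ge0 // sqr_ge0.
- rewrite normrM (ger0_norm (sqr_ge0 a)) ler_wpM2r ?sqr_ge0 // ler_norml.
  by apply/andP; split; lra.
Qed.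

Lemma is_derive_mulr (f : R -> R) (x l c : R) : is_derive x (1 : R) f l ->
  is_derive x (1 : R) (fun t => f t * c) (l * c).
Proof.
move=> df; have d := is_deriveM df (is_derive_cst c x (1 : R)).
by apply: (is_derive_eq d); rewrite scaler0 add0r mulrC.
Qed.

Lemma is_derive_mull (f : R -> R) (x l c : R) : is_derive x (1 : R) f l ->
  is_derive x (1 : R) (fun t => c * f t) (c * l).
Proof.
move=> df; have d := is_deriveM (is_derive_cst c x (1 : R)) df.
by apply: (is_derive_eq d); rewrite scaler0 addr0.
Qed.

Definition cut (z0 : R * R) (r : R) (z : R * R) : R :=
  cut1 z0.1 r z.1 * cut1 z0.2 r z.2.

Lemma smooth_on_cut1 (x0 r : R) (V : normedModType R) (U : set V) (h : V -> R) :
  open U -> smooth_on U h -> smooth_on U (fun p => cut1 x0 r (h p)).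
Proof.
move=> oU sh n.
have s1 : Cn_on n U (fun p => (h p + - x0) * r^-1).
  by apply: (Cn_onM oU) (Cn_on_cst _ _ _); apply: (Cn_onD oU) (Cn_on_cst _ _ _).
have s2 : Cn_on n U (fun p => 1 + -1 * ((h p + - x0) * r^-1 * ((h p + - x0) * r^-1))).
  apply: (Cn_onD oU (Cn_on_cst _ _ _)); apply: (Cn_onM oU (Cn_on_cst _ _ _)).
  exact: (Cn_onM oU s1 s1).
by apply: (Cn_on_eq oU) (Cn_onM oU s2 s2) => p _; rewrite mulN1r.
Qed.

Lemma smooth_on_dcut1 (x0 r : R) (V : normedModType R) (U : set V) (h : V -> R) :
  open U -> smooth_on U h -> smooth_on U (fun p => dcut1 x0 r (h p)).
Proof.
move=> oU sh n.
have s1 : Cn_on n U (fun p => (h p + - x0) * r^-1).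
  by apply: (Cn_onM oU) (Cn_on_cst _ _ _); apply: (Cn_onD oU) (Cn_on_cst _ _ _).
have s2 : Cn_on n U (fun p => 1 + -1 * ((h p + - x0) * r^-1 * ((h p + - x0) * r^-1))).
  apply: (Cn_onD oU (Cn_on_cst _ _ _)); apply: (Cn_onM oU (Cn_on_cst _ _ _)).
  exact: (Cn_onM oU s1 s1).
have s3 := Cn_onM oU (Cn_onM oU (Cn_on_cst n U (- 4 / r)) s1) s2.
by apply: (Cn_on_eq oU) s3 => p _; rewrite mulN1r.
Qed.

Lemma smooth_on_cut z0 r : smooth_on [set: R * R] (cut z0 r).
Proof.
move=> n; apply: (Cn_onM openT).
  exact: (smooth_on_cut1 _ _ openT (smooth_on_fst openT)).
exact: (smooth_on_cut1 _ _ openT (smooth_on_snd openT)).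
Qed.

Lemma smD_cut D z0 r : smD D (cut z0 r).
Proof. by apply: (smD_smooth openT) => //; exact: smooth_on_cut. Qed.

Lemma dx_cut D z0 r z : hopen D -> D z -> 0 < r ->
  dx (cut z0 r) z = dcut1 z0.1 r z.1 * cut1 z0.2 r z.2.
Proof.
move=> oD Dz r0; apply: (dx_smooth oD Dz openT I (smooth_on_cut z0 r)).
exact: (is_derive_mulr (cut1 z0.2 r z.2) (is_derive_cut1 z0.1 z.1 r0)).
Qed.

Lemma dy_cut D z0 r z : hopen D -> D z -> 0 < r ->
  dy (cut z0 r) z = cut1 z0.1 r z.1 * dcut1 z0.2 r z.2.
Proof.
move=> oD Dz r0; apply: (dy_smooth oD Dz openT I (smooth_on_cut z0 r)).
exact: (is_derive_mull (cut1 z0.1 r z.1) (is_derive_cut1 z0.2 z.2 r0)).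
Qed.

Lemma lapl_cut D z0 r z : hopen D -> D z -> 0 < r ->
  lapl (cut z0 r) z = ddcut1 z0.1 r z.1 * cut1 z0.2 r z.2 +
                      cut1 z0.1 r z.1 * ddcut1 z0.2 r z.2.
Proof.
move=> oD Dz r0; rewrite /lapl; have sc := @smD_cut D z0 r; congr (_ + _).
  rewrite (dx_eqD oD (smD_dx oD sc) Dz (h' := fun z => dcut1 z0.1 r z.1 * cut1 z0.2 r z.2)).
    have s : smooth_on setT (fun z : R * R => dcut1 z0.1 r z.1 * cut1 z0.2 r z.2).
      move=> n; apply: (Cn_onM openT).
        exact: (smooth_on_dcut1 _ _ openT (smooth_on_fst openT)).
      exact: (smooth_on_cut1 _ _ openT (smooth_on_snd openT)).
    apply: (dx_smooth oD Dz openT I s).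
    exact: (is_derive_mulr (cut1 z0.2 r z.2) (is_derive_dcut1 z0.1 z.1 r0)).
  by move=> w Dw; apply: dx_cut oD Dw r0.
rewrite (dy_eqD oD (smD_dy oD sc) Dz (h' := fun z => cut1 z0.1 r z.1 * dcut1 z0.2 r z.2)).
  have s : smooth_on setT (fun z : R * R => cut1 z0.1 r z.1 * dcut1 z0.2 r z.2).
    move=> n; apply: (Cn_onM openT).
      exact: (smooth_on_cut1 _ _ openT (smooth_on_fst openT)).
    exact: (smooth_on_dcut1 _ _ openT (smooth_on_snd openT)).
  apply: (dy_smooth oD Dz openT I s).
  exact: (is_derive_mull (cut1 z0.1 r z.1) (is_derive_dcut1 z0.2 z.2 r0)).
by move=> w Dw; apply: dy_cut oD Dw r0.
Qed.

(** The norm of [R * R] is the maximum norm, so this is a closed square cut by the half plane; [cut]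
    vanishes on all its sides except one that lies on the axis. *)
Definition box (z0 : R * R) (r : R) : set (R * R) :=
  [set z | `|z - z0| <= r /\ 0 <= z.2].

Lemma cut_bounds D z0 r z : hopen D -> D z -> 0 < r -> box z0 r z ->
  [/\ 0 <= cut z0 r z <= 1,
      dx (cut z0 r) z ^+ 2 <= 16 / r ^+ 2 * cut z0 r z,
      dy (cut z0 r) z ^+ 2 <= 16 / r ^+ 2 * cut z0 r z &
      `|lapl (cut z0 r) z| <= 16 / r ^+ 2].
Proof.
move=> oD Dz r0 [zr _]; move: zr; rewrite pair_norm_le /= => /andP[h1 h2].
have [/andP[a0 a1] a2 a3] := cut1_bounds r0 h1.
have [/andP[b0 b1] b2 b3] := cut1_bounds r0 h2.
rewrite (dx_cut _ oD Dz r0) (dy_cut _ oD Dz r0) (lapl_cut _ oD Dz r0) /cut.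
have c0 : 0 <= 16 / r ^+ 2 by rewrite divr_ge0 // sqr_ge0.
have aux (C A B d : R) : 0 <= C -> 0 <= A -> 0 <= B -> B <= 1 -> d ^+ 2 <= C * A ->
    (d * B) ^+ 2 <= C * (A * B).
  move=> C0 A0 B0 B1 h; rewrite exprMn.
  apply: (@le_trans _ _ (C * A * B ^+ 2)); first by rewrite ler_wpM2r ?sqr_ge0.
  by rewrite -mulrA !ler_wpM2l // expr2 ler_piMr.
split.
- by rewrite mulr_ge0 //= mulr_ile1.
- exact: aux.
- by rewrite (mulrC (cut1 _ _ _)) (mulrC (cut1 z0.1 _ _)); exact: aux.
- apply: (le_trans (ler_normD _ _)); rewrite (normrM (ddcut1 _ _ _)) (normrM (cut1 _ _ _)) (ger0_norm a0) (ger0_norm b0).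
  have -> : 16 / r ^+ 2 = 8 / r ^+ 2 + 8 / r ^+ 2 by rewrite -mulrDl -natrD.
  apply: lerD; first by rewrite -[leRHS]mulr1 ler_pM.
  by rewrite -[leRHS]mul1r ler_pM.
Qed.

End Cutoff.

(** * Interior gradient estimates *)

Section Gradient.
Variable R : realType.
Implicit Types (D : set (R * R)) (z w : R * R).

Lemma box_compact z0 (r : R) : compact (box z0 r).
Proof.
have -> : box z0 r = `[z0.1 - r, z0.1 + r] `*` `[Num.max 0 (z0.2 - r), z0.2 + r].
  rewrite predeqE => -[x y]; rewrite /box /= pair_norm_le /= !in_itv /= !ler_distl ge_max.
  split=> [[/andP[-> /andP[-> ->]] ->]|[-> /andP[/andP[-> ->] ->]]] //.
by apply: compact_setX; apply: segment_compact.
Qed.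

Lemma within_continuousD D (h : R * R -> R) (A : set (R * R)) : hopen D -> smD D h ->
  A `<=` D -> {within A, continuous h}.
Proof.
move=> oD sh AD; apply/subspace_continuousP => y Ay.
apply/cvgrPdist_lt => e e0; have [r r0 Hr] := smD_cvg oD sh (AD y Ay) e0.
apply: (near_norm r0) => t ty At; rewrite distrC; apply: Hr => //; exact: AD.
Qed.

(** Young's inequality with weight [chi]. Where [chi] vanishes so does [a]; elsewhere multiplication
    by [chi] completes the square of [chi X + 4 a V]. *)
Lemma grad_aux (chi a X V q : R) : 0 <= chi -> a ^+ 2 <= 16 * q * chi -> 0 <= q ->
  - (2^-1 * chi * X ^+ 2 + 128 * q * V ^+ 2) <= 4 * (a * (V * X)).
Proof.
move=> c0 aq q0; have [c1|c1] := eqVneq chi 0.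
  have a0 : a = 0.
    by apply/eqP; rewrite -sqrf_eq0 eq_le sqr_ge0 andbT (le_trans aq) // c1 mulr0.
  by rewrite a0 c1 mulr0 !mul0r mulr0 add0r oppr_le0 mulr_ge0 ?sqr_ge0 // mulr_ge0.
have cp : 0 < chi by rewrite lt_neqAle eq_sym c1.
rewrite -subr_ge0 opprK -(pmulr_rge0 _ cp).
have -> : chi * (4 * (a * (V * X)) + (2^-1 * chi * X ^+ 2 + 128 * q * V ^+ 2)) =
  2^-1 * (chi * X + 4 * a * V) ^+ 2 + 8 * V ^+ 2 * (16 * q * chi - a ^+ 2).
  by field.
by rewrite addr_ge0 // mulr_ge0 ?sqr_ge0 ?subr_ge0 // mulr_ge0 // sqr_ge0.
Qed.

(** The bookkeeping of [273 = 16 + 128 + 128 + 1]: the Laplacian of the cutoff, its two cross terms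
    with the gradient, and one unit kept for strict positivity. Of the good terms [2 X] and [2 Y]
    the errors consume one [X] and half a [Y]. *)
Lemma bernstein_arith (a1 a2 a3 ch ee X Y S1 S2 S3 q L k m : R) :
  (273 * q + k * m) * ee <= L -> k * (ch * ee ^+ 2) <= k * m * ee ->
  - (16 * q * ee) <= a1 * ee ->
  - (ch * (2^-1 * X + k * ee ^+ 2)) <= ch * S1 ->
  - (2^-1 * ch * X + 128 * q * ee) <= 2 * (a2 * S2) ->
  - (2^-1 * ch * Y + 128 * q * ee) <= 2 * (a3 * S3) ->
  0 <= ch * X -> 0 <= ch * Y -> 0 < q * ee ->
  0 < a1 * ee + 2 * (a2 * S2 + a3 * S3) + ch * (2 * (X + Y) + S1) + L.
Proof.
move=> Hp hM hL hV gx gy sx0 sy0 ep.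
have -> : a1 * ee + 2 * (a2 * S2 + a3 * S3) + ch * (2 * (X + Y) + S1) + L =
  a1 * ee + 2 * (a2 * S2) + 2 * (a3 * S3) + 2 * (ch * X) + 2 * (ch * Y) + ch * S1 + L by ring.
have e0 : (273 * q + k * m) * ee = 273 * (q * ee) + k * m * ee by ring.
have e1 : ch * (2^-1 * X + k * ee ^+ 2) = 2^-1 * (ch * X) + k * (ch * ee ^+ 2) by ring.
have e2 : 16 * q * ee = 16 * (q * ee) by ring.
have e3 : 2^-1 * ch * X + 128 * q * ee = 2^-1 * (ch * X) + 128 * (q * ee) by ring.
have e4 : 2^-1 * ch * Y + 128 * q * ee = 2^-1 * (ch * Y) + 128 * (q * ee) by ring.
rewrite e0 in Hp; rewrite e1 in hV; rewrite e2 in hL; rewrite e3 in gx; rewrite e4 in gy.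
lra.
Qed.

(** Bernstein's method. [chi |v|^2 + lam psi] cannot have its maximum where [chi |v|^2 > 0], because
    its Laplacian is positive there: the subharmonicity of [psi] pays for the errors. So the maximum
    is at most [lam s0]. As [lam] contains the maximum [M] of [chi |v|^2], this reads
    [M <= 273 s0 / (c r^2) + M / 2] once [s0] is small, and [546 = 2 * 273]. *)
Lemma bernstein D N (v : R * R -> 'rV[R]_N) (psi : R * R -> R) z0 (r K c s0 : R) :
  hopen D -> smD D v -> smD D psi -> 0 < r -> 0 < c -> 0 <= K ->
  (z0.2 = 0 \/ r <= z0.2) -> box z0 r `<=` D ->
  (forall z, box z0 r z -> 0 <= psi z <= s0) ->
  (forall z, box z0 r z -> `|lapl v z| <= K * (`|v z| * (`|v z| ^+ 2 + `|dx v z|))) ->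
  (forall z, box z0 r z -> c * sqn (v z) <= lapl psi z) ->
  (forall z, box z0 r z -> z.2 = 0 -> z0.2 = 0 ->
    dy psi z = 0 /\ \sum_i v z 0 i * dy v z 0 i = 0) ->
  s0 * (2 * N%:R * K + 2 * N%:R ^+ 2 * K ^+ 2) <= c / 2 ->
  forall z, box z0 r z -> cut z0 r z * sqn (v z) <= 546 * s0 / (c * r ^+ 2).
Proof.
move=> oD sv sp r0 c0 K0 z0r BD Hpsi HD Hc HN Hs z1 Bz1.
set K' := 2 * N%:R * K + 2 * N%:R ^+ 2 * K ^+ 2 in Hs.
have K'0 : 0 <= K' by rewrite /K' addr_ge0 // !mulr_ge0 // ?sqr_ge0.
pose e z := sqn (v z); pose chi := cut z0 r.
have se : smD D e by exact: smD_sqn.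
have sc : smD D chi by exact: smD_cut.
have B0 : box z0 r !=set0 by exists z1.
have [zM BzM maxM] := compact_EVT_max B0 (@box_compact z0 r)
  (within_continuousD oD (smDM sc se) BD).
set M := chi zM * e zM in maxM.
have {}maxM z : box z0 r z -> chi z * e z <= M by move=> Bz; apply: maxM; rewrite inE.
rewrite inE in BzM.
have chi0 z : box z0 r z -> 0 <= chi z.
  by move=> Bz; have [/andP[]] := cut_bounds oD (BD z Bz) r0 Bz.
have M0 : 0 <= M by rewrite /M mulr_ge0 ?chi0 ?sqn_ge0.
have ir : 0 < (r ^+ 2)^-1 by rewrite invr_gt0 exprn_gt0.
have s00 : 0 <= s0 by have /andP[] := Hpsi z1 Bz1; exact: le_trans.
(* [M] enters because one error is of order [chi |v|^4], which is at most [M |v|^2]. *)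
pose lam := (273 / r ^+ 2 + K' * M) / c.
have lam0 : 0 <= lam.
  apply: divr_ge0; last exact: ltW.
  by apply: addr_ge0; [exact: mulr_ge0 (ler0n _ _) (ltW ir)|exact: mulr_ge0].
pose F z := chi z * e z + lam * psi z.
have sce := smDM sc se.
have slp := smDM (@smD_cst _ _ D lam) sp.
have sF : smD D F := smDD sce slp.
have key z : box z0 r z -> e z != 0 -> 0 < lapl F z.
  move=> Bz ez; have Dz := BD z Bz.
  have [/andP[h0 h1] hx hy hl] := cut_bounds oD Dz r0 Bz.
  have -> : lapl F z = lapl (fun z => chi z * e z) z + lapl (fun z => lam * psi z) z.
    exact: (laplD oD sce slp Dz).
  have -> : lapl (fun z => lam * psi z) z = lam * lapl psi z.
    rewrite (laplM oD (@smD_cst _ _ D lam) sp Dz) /lapl dx_cst.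
    rewrite (dx_eqD oD (smD_dx oD (@smD_cst _ _ D lam)) Dz (h' := fun=> 0)); last first.
      by move=> w _; rewrite dx_cst.
    rewrite (dy_eqD oD (smD_dy oD (@smD_cst _ _ D lam)) Dz (h' := fun=> 0)); last first.
      by move=> w Dw; rewrite (dy_cst _ oD Dw).
    by rewrite dx_cst !(dy_cst _ oD Dz) !(mul0r, mulr0, addr0, add0r).
  rewrite (laplM oD sc se Dz) (lapl_sqn oD sv Dz) (dx_sqn oD sv Dz) (dy_sqn oD sv Dz).
  have e0 : 0 < e z by rewrite lt_neqAle eq_sym ez sqn_ge0.
  have nv : `|v z| ^+ 2 <= e z := norm_sqn (v z).
  have nx : `|dx v z| ^+ 2 <= sqn (dx v z) := norm_sqn _.
  have vD : `|\sum_i 2 * (v z 0 i * lapl v z 0 i)| <=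
      2^-1 * sqn (dx v z) + K' * e z ^+ 2.
    rewrite -mulr_sumr normrM ger0_norm //.
    apply: (le_trans (ler_wpM2l _ (dot_bound _ _))) => //.
    apply: (@le_trans _ _ (2 * (N%:R * (`|v z| * (K * (`|v z| * (`|v z| ^+ 2 + `|dx v z|))))))).
      by rewrite !ler_wpM2l // HD.
    have -> : 2 * (N%:R * (`|v z| * (K * (`|v z| * (`|v z| ^+ 2 + `|dx v z|))))) =
       2 * N%:R * K * ((`|v z| ^+ 2) ^+ 2) + 2 * N%:R * K * (`|v z| ^+ 2 * `|dx v z|) by ring.
    apply: (@le_trans _ _ (2 * N%:R * K * (e z ^+ 2) + 2 * N%:R * K * (e z * `|dx v z|))).
      apply: lerD; rewrite ler_wpM2l ?mulr_ge0 //.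
        by rewrite ler_pXn2r // nnegrE ?sqr_ge0 ?sqn_ge0.
      by rewrite ler_wpM2r.
    rewrite /K' [X in _ <= _ + X]mulrDl addrCA; apply: lerD => //.
    apply: (@le_trans _ _ (2^-1 * `|dx v z| ^+ 2 + 2 * N%:R ^+ 2 * K ^+ 2 * e z ^+ 2)); last first.
      by rewrite lerD2r ler_wpM2l.
    rewrite -subr_ge0.
    have -> : 2^-1 * `|dx v z| ^+ 2 + 2 * N%:R ^+ 2 * K ^+ 2 * e z ^+ 2 -
      2 * N%:R * K * (e z * `|dx v z|) = 2^-1 * (`|dx v z| - 2 * N%:R * K * e z) ^+ 2.
      by move: (`|dx v z|) (e z) (N%:R) => a b n; field.
    by rewrite mulr_ge0 ?sqr_ge0.
  have gx : - (2^-1 * chi z * sqn (dx v z) + 128 * (r ^+ 2)^-1 * e z) <=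
     2 * (dx chi z * \sum_i 2 * (v z 0 i * dx v z 0 i)).
    rewrite !mulr_sumr -big_split /= -sumrN; apply: ler_sum => i _.
    have -> : 2 * (dx chi z * (2 * (v z 0 i * dx v z 0 i))) =
      4 * (dx chi z * (v z 0 i * dx v z 0 i)).
      by move: (dx chi z) (v z 0 i) (dx v z 0 i) => a b d; ring.
    by apply: grad_aux => //; exact: ltW.
  have gy : - (2^-1 * chi z * sqn (dy v z) + 128 * (r ^+ 2)^-1 * e z) <=
     2 * (dy chi z * \sum_i 2 * (v z 0 i * dy v z 0 i)).
    rewrite !mulr_sumr -big_split /= -sumrN; apply: ler_sum => i _.
    have -> : 2 * (dy chi z * (2 * (v z 0 i * dy v z 0 i))) =
      4 * (dy chi z * (v z 0 i * dy v z 0 i)).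
      by move: (dy chi z) (v z 0 i) (dy v z 0 i) => a b d; ring.
    by apply: grad_aux => //; exact: ltW.
  have Hp : lam * (c * e z) <= lam * lapl psi z by rewrite ler_wpM2l // Hc.
  have lE : lam * (c * e z) = (273 / r ^+ 2 + K' * M) * e z.
    by rewrite mulrA /lam divfK // gt_eqF.
  rewrite lE in Hp.
  have hM : K' * (chi z * e z ^+ 2) <= K' * M * e z.
    by rewrite -mulrA ler_wpM2l // expr2 mulrA ler_wpM2r ?(ltW e0) ?maxM.
  have hL : - (16 / r ^+ 2 * e z) <= lapl chi z * e z.
    by rewrite -mulNr ler_wpM2r ?(ltW e0) //; move: hl; rewrite ler_norml => /andP[].
  have hV : - (chi z * (2^-1 * sqn (dx v z) + K' * e z ^+ 2)) <=
      chi z * \sum_i 2 * (v z 0 i * lapl v z 0 i).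
    by rewrite -mulrN ler_wpM2l //; move: vD; rewrite ler_norml => /andP[].
  have sx0 := mulr_ge0 h0 (sqn_ge0 (dx v z)).
  have sy0 := mulr_ge0 h0 (sqn_ge0 (dy v z)).
  have ep : 0 < (r ^+ 2)^-1 * e z by rewrite mulr_gt0.
  exact: bernstein_arith Hp hM hL hV gx gy sx0 sy0 ep.
have [zF BzF maxF] := compact_EVT_max B0 (@box_compact z0 r)
  (within_continuousD oD sF BD).
rewrite inE in BzF.
have {}maxF z : box z0 r z -> F z <= F zF by move=> Bz; apply: maxF; rewrite inE.
have FF : F zF <= lam * s0.
  have /andP[p0 p1] := Hpsi zF BzF.
  have [x0|xn0] := eqVneq (chi zF * e zF) 0.
    by rewrite /F x0 add0r ler_wpM2l.
  exfalso; move: xn0; rewrite mulf_eq0 negb_or => /andP[chn en].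
  have := key zF BzF en; apply/negP; rewrite -leNgt.
  have [zr z20] := BzF.
  (* The cutoff vanishes on the sides of the square, so this maximum is interior or on the axis,
     where the Neumann condition applies. *)
  have zrs : `|zF.1 - z0.1| < r /\ `|zF.2 - z0.2| < r.
    move: zr; rewrite pair_norm_le /= => /andP[a b].
    rewrite !lt_neqAle a b !andbT; split; apply: contra chn => /eqP E.
      rewrite /chi /cut /cut1.
      suff -> : ((zF.1 - z0.1) / r) ^+ 2 = 1 by rewrite subrr expr0n mul0r.
      by rewrite -(real_normK (num_real _)) normrM normfV E (gtr0_norm r0) divff ?gt_eqF // expr1n.
    rewrite /chi /cut /cut1.
    suff -> : ((zF.2 - z0.2) / r) ^+ 2 = 1 by rewrite subrr expr0n mulr0.
    by rewrite -(real_normK (num_real _)) normrM normfV E (gtr0_norm r0) divff ?gt_eqF // expr1n.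
  apply: (max_lapl oD sF (BD _ BzF)).
    have m0 : 0 < Num.min (r - `|zF.1 - z0.1|) (r - `|zF.2 - z0.2|).
      by rewrite lt_min !subr_gt0 zrs.1 zrs.2.
    apply: (near_norm m0) => w wz Dw; apply: maxF.
    have [w20 _] := oD w Dw; split=> //.
    move: wz; rewrite lt_min => /andP[w1 w2].
    rewrite pair_norm_le /=; apply/andP; split.
      have -> : w.1 - z0.1 = (w.1 - zF.1) + (zF.1 - z0.1) by rewrite addrA subrK.
      apply: (le_trans (ler_normD _ _)); rewrite -lerBrDr ltW //.
      by move: w1; rewrite pair_norm_lt /= => /andP[].
    have -> : w.2 - z0.2 = (w.2 - zF.2) + (zF.2 - z0.2) by rewrite addrA subrK.
    apply: (le_trans (ler_normD _ _)); rewrite -lerBrDr ltW //.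
    by move: w2; rewrite pair_norm_lt /= => /andP[].
  move=> zF20.
  have z020 : z0.2 = 0.
    case: z0r => // rz; move: zrs.2.
    rewrite zF20 sub0r normrN ltr_norml => /andP[_]; rewrite ltNge rz //.
  have [N1 N2] := HN zF BzF zF20 z020.
  have DzF := BD _ BzF.
  rewrite (dyD oD sce slp DzF) (dyM oD sc se DzF) (dyM oD (@smD_cst _ _ D lam) sp DzF).
  rewrite (dy_cst _ oD DzF) N1 (dy_sqn oD sv DzF) -mulr_sumr N2 (dy_cut _ oD DzF r0).
  by rewrite /dcut1 zF20 z020 subrr !mul0r mulr0 !mul0r mulr0 !mul0r !mulr0 !addr0.
have ML : M <= lam * s0.
  apply: le_trans FF; apply: le_trans (maxF zM BzM).
  have /andP[p0 _] := Hpsi zM BzM.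
  by rewrite /F lerDl mulr_ge0.
apply: le_trans (maxM z1 Bz1) _.
have : M <= 273 * s0 / (c * r ^+ 2) + M / 2.
  apply: le_trans ML _; rewrite /lam.
  have -> : (273 / r ^+ 2 + K' * M) / c * s0 = 273 * s0 / (c * r ^+ 2) + (s0 * K') / c * M.
    by field; rewrite !gt_eqF.
  by rewrite lerD2l mulrC ler_wpM2l // ler_pdivrMr // (mulrC 2^-1).
move=> H; have : M / 2 <= 273 * s0 / (c * r ^+ 2) by lra.
rewrite ler_pdivrMr // => /le_trans; apply.
rewrite [leLHS]mulrC mulrA mulrA; lra.
Qed.

End Gradient.

(** [u] is the map in a chart and [w] the unknown in straightened coordinates, with [du = dw E(u)];
    the Cauchy-Riemann equation is written for [w], but its coefficients are functions of [u]. Hence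
    [w] need not determine [u], and the straightening map is never inverted. [I] marks the imaginary
    components: they vanish on the axis, where [A] maps the real ones into them. *)
Record sys (R : realType) (m N : nat) (I : pred 'I_N) (Om : set 'rV[R]_m)
    (E : 'rV[R]_m -> 'M[R]_(N, m)) (A : 'rV[R]_m -> 'M[R]_N)
    (D : set (R * R)) (u : R * R -> 'rV[R]_m) (w : R * R -> 'rV[R]_N) : Prop := Sys {
  sys_hopen : hopen D;
  sys_open : open Om;
  sys_E : smooth_on Om E;
  sys_A : smooth_on Om A;
  sys_u : smD D u;
  sys_w : smD D w;
  sys_Om : forall z, D z -> Om (u z);
  sys_ux : forall z, D z -> dx u z = dx w z *m E (u z);
  sys_uy : forall z, D z -> dy u z = dy w z *m E (u z);
  sys_eq : forall z, D z -> dy w z = dx w z *m A (u z);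
  sys_sq : forall z, D z -> A (u z) *m A (u z) = - 1%:M;
  sys_bd : forall z, D z -> z.2 = 0 -> forall i, I i -> w z 0 i = 0;
  sys_swap : forall z, D z -> z.2 = 0 -> forall j i, ~~ I j -> ~~ I i -> A (u z) j i = 0 }.

(** * Pointwise estimates for first-order systems *)

Section Sys.
Variables (R : realType) (m N : nat) (I : pred 'I_N) (Om : set 'rV[R]_m).
Variables (E : 'rV[R]_m -> 'M[R]_(N, m)) (A : 'rV[R]_m -> 'M[R]_N).
Implicit Types (D : set (R * R)) (z : R * R) (u : R * R -> 'rV[R]_m) (w : R * R -> 'rV[R]_N).

Local Notation SYS := (sys I Om E A).

Lemma bd_dx D (h : R * R -> R) : hopen D -> smD D h ->
  (forall z, D z -> z.2 = 0 -> h z = 0) -> forall z, D z -> z.2 = 0 -> dx h z = 0.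
Proof.
move=> oD sh H [x y] Dz /= y0; have [_ eD] := is_derive_x oD sh Dz.
rewrite -eD y0; have [_ nD] := oD _ Dz.
have Z : \forall t \near x, h (t, 0) = 0.
  have [e e0 He] := near_norm_ex nD.
  apply: (near_norm e0) => t tx; apply: H => //; apply: He => //.
  by rewrite pair_norm_lt /= tx y0 subrr normr0.
by rewrite (near_eq_derive _ Z) derive_cst.
Qed.

(** Cross-differentiation of the first-order equation: by [A^2 = -1] the second derivatives cancel,
    and what remains is quadratic in first derivatives. *)
Lemma sys_lapl D u w z : SYS D u w -> D z ->
  lapl w z = dx w z *m (dx (fun z => A (u z)) z *m A (u z) + dy (fun z => A (u z)) z).
Proof.
move=> S Dz; have [oD oO sE sA su sw HO _ _ Heq Hsq _ _] := S.
have sAu := smD_compmx oO HO sA su.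
have sx := smD_dx oD sw.
have E1 : dy (dy w) z = dy (dx w) z *m A (u z) + dx w z *m dy (fun z => A (u z)) z.
  rewrite -(dy_mulmx oD sx sAu Dz).
  by apply: (dy_eqD oD (smD_dy oD sw) Dz).
have E2 : dy (dx w) z = dx (dx w) z *m A (u z) + dx w z *m dx (fun z => A (u z)) z.
  rewrite -(dxdy_mx oD sw Dz) -(dx_mulmx oD sx sAu Dz).
  by apply: (dx_eqD oD (smD_dy oD sw) Dz).
rewrite /lapl E1 E2 mulmxDl -(mulmxA (dx (dx w) z)) Hsq // mulmxN mulmx1.
by rewrite mulmxDr !addrA subrr add0r mulmxA.
Qed.

Lemma sys_bd_dx D u w z : SYS D u w -> D z -> z.2 = 0 -> forall i, I i -> dx w z 0 i = 0.
Proof.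
move=> S Dz z0 i Ii; rewrite -(dx_coord 0 i (sys_hopen S) (sys_w S) Dz).
apply: (bd_dx (sys_hopen S) _ _ Dz z0); first exact: smD_coord (sys_w S).
by move=> t Dt t0; apply: (sys_bd S).
Qed.

(** The Neumann half of the boundary condition: on the axis [dx w] has only real components, and [A]
    sends these to imaginary ones. *)
Lemma sys_bd_dy D u w z : SYS D u w -> D z -> z.2 = 0 -> forall i, ~~ I i -> dy w z 0 i = 0.
Proof.
move=> S Dz z0 i Ii; rewrite (sys_eq S Dz) mxE big1 // => j _.
have [Ij|Ij] := boolP (I j); first by rewrite (sys_bd_dx S Dz z0 Ij) mul0r.
by rewrite (sys_swap S Dz z0 Ij Ii) mulr0.
Qed.

Lemma sys_bd_dxy D u w z : SYS D u w -> D z -> z.2 = 0 -> forall i, ~~ I i -> dy (dx w) z 0 i = 0.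
Proof.
move=> S Dz z0 i Ii; have oD := sys_hopen S; have sy := smD_dy oD (sys_w S).
rewrite -(dxdy_mx oD (sys_w S) Dz) -(dx_coord 0 i oD sy Dz).
apply: (bd_dx oD _ _ Dz z0); first exact: smD_coord sy.
by move=> t Dt t0; apply: sys_bd_dy S Dt t0 _ Ii.
Qed.

Variable q : 'rV[R]_m.
Hypothesis Omq : Om q.

Definition sfun : Type := (R * R -> 'rV[R]_m) -> (R * R -> 'rV[R]_N) -> R * R -> R.

(** An estimate [L = O(X)] near [q] whose radius and constant precede the domain and the solution;
    this uniformity lets one estimate serve all squares that shrink towards the puncture. *)
Definition evle (L X : sfun) : Prop := exists d C : R, [/\ 0 < d, 0 <= C &
  forall D u w, SYS D u w -> forall z, D z -> `|u z - q| < d -> L u w z <= C * X u w z].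

Lemma evle_mono (L L' X X' : sfun) :
  (forall D u w, SYS D u w -> forall z, D z -> L u w z <= L' u w z) ->
  (forall u w z, X' u w z <= X u w z) -> evle L' X' -> evle L X.
Proof.
move=> H HX [d [C [d0 C0 h]]]; exists d, C; split => // D u w S z Dz uq.
apply: le_trans (H D u w S z Dz) _; apply: le_trans (h D u w S z Dz uq) _.
by rewrite ler_wpM2l.
Qed.

Lemma evleD (L1 L2 X : sfun) : (forall u w z, 0 <= X u w z) -> evle L1 X -> evle L2 X ->
  evle (fun u w z => L1 u w z + L2 u w z) X.
Proof.
move=> X0 [d [C [d0 C0 h]]] [d' [C' [d'0 C'0 h']]].
exists (Num.min d d'), (C + C'); split; [by rewrite lt_min d0|exact: addr_ge0|].
move=> D u w S z Dz; rewrite lt_min => /andP[h1 h2].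
by rewrite mulrDl lerD // (h D u w, h' D u w).
Qed.

Lemma evleM (L1 L2 X1 X2 : sfun) :
  (forall u w z, 0 <= L1 u w z) -> (forall u w z, 0 <= L2 u w z) ->
  evle L1 X1 -> evle L2 X2 ->
  evle (fun u w z => L1 u w z * L2 u w z) (fun u w z => X1 u w z * X2 u w z).
Proof.
move=> p1 p2 [d [C [d0 C0 h]]] [d' [C' [d'0 C'0 h']]].
exists (Num.min d d'), (C * C'); split; [by rewrite lt_min d0|exact: mulr_ge0|].
move=> D u w S z Dz; rewrite lt_min => /andP[h1 h2].
by rewrite mulrACA ler_pM // (h D u w, h' D u w).
Qed.

Lemma evle_sum (T : finType) (L : T -> sfun) (X : sfun) : (forall u w z, 0 <= X u w z) ->
  (forall i, evle (L i) X) -> evle (fun u w z => \sum_i L i u w z) X.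
Proof.
move=> X0 H; have : evle (fun u w z => \sum_(i <- enum T) L i u w z) X.
  elim: (enum T) => [|i r IH].
    exists 1, 0; split => // D u w _ z _ _.
    by rewrite big_nil mul0r.
  have [d [C [d0 C0 h]]] := evleD X0 (H i) IH.
  exists d, C; split => // D u w S z Dz uq; rewrite big_cons.
  exact: (h D u w S z Dz uq).
move=> [d [C [d0 C0 h]]]; exists d, C; split => // D u w S z Dz uq.
by have := h D u w S z Dz uq; rewrite big_enum.
Qed.

Lemma evle_smooth p p' (F : 'rV[R]_m -> 'M[R]_(p, p')) : open Om -> smooth_on Om F ->
  evle (fun u w z => `|F (u z)|) (fun u w z => 1).
Proof.
move=> oO sF.
have cF := differentiable_continuous (smooth_on_differentiable sF Omq).
have H : \forall p \near q, `|F q - F p| < 1 by move/cvgrPdist_lt : cF; apply.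
have [d d0 Hd] := near_norm_ex H.
exists d, (`|F q| + 1); split => //.
move=> D u w _ z _ uq; rewrite mulr1.
have -> : F (u z) = F q - (F q - F (u z)) by rewrite opprB addrC subrK.
by apply: (le_trans (ler_normB _ _)); rewrite lerD2l ltW // Hd.
Qed.

(** [V] and [V2] have weights one and two under dilations of the domain; first and second
    derivatives of composites with [u] are bounded by them, which makes the resulting estimates
    scale invariant. *)
Local Notation V := (fun (u : R * R -> 'rV[R]_m) (w : R * R -> 'rV[R]_N) (z : R * R) => `|dx w z|).
Local Notation V2 := (fun (u : R * R -> 'rV[R]_m) (w : R * R -> 'rV[R]_N) (z : R * R) =>
  `|dx w z| ^+ 2 + `|dx (dx w) z|).
Hypothesis oO : open Om.
Hypothesis sE : smooth_on Om E.
Hypothesis sA : smooth_on Om A.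

Lemma V2_ge0 u w z : 0 <= `|dx w z| ^+ 2 + `|dx (dx w) z|.
Proof. by rewrite addr_ge0 // sqr_ge0. Qed.

Lemma evle_mulmx p p' p'' (F : (R * R -> 'rV[R]_m) -> (R * R -> 'rV[R]_N) -> R * R -> 'M[R]_(p, p'))
  (G : (R * R -> 'rV[R]_m) -> (R * R -> 'rV[R]_N) -> R * R -> 'M[R]_(p', p'')) X1 X2 :
  evle (fun u w z => `|F u w z|) X1 -> evle (fun u w z => `|G u w z|) X2 ->
  evle (fun u w z => `|F u w z *m G u w z|) (fun u w z => X1 u w z * X2 u w z).
Proof.
move=> h1 h2; have [||d [C [d0 C0 h]]] := evleM _ _ h1 h2; try by move=> *; exact: normr_ge0.
exists d, (p'%:R * C); split => //; first by rewrite mulr_ge0.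
move=> D u w S z Dz uq; apply: le_trans (mulmx_norm _ _) _.
by rewrite -mulrA ler_wpM2l // (h D u w S z Dz uq).
Qed.

Lemma evle_refl (X : sfun) : evle X X.
Proof. by exists 1, 1; split => // D u w _ z _ _; rewrite mul1r. Qed.

Lemma evle_dyw : evle (fun u w z => `|dy w z|) V.
Proof.
apply: (evle_mono (L' := fun u w z => `|dx w z *m A (u z)|)
  (X' := fun u w z => `|dx w z| * 1)).
- by move=> D u w S z Dz; rewrite (sys_eq S Dz).
- by move=> u w z; rewrite mulr1.
- by apply: evle_mulmx; [exact: evle_refl|exact: evle_smooth].
Qed.

Lemma evle_ux : evle (fun u w z => `|dx u z|) V.
Proof.
apply: (evle_mono (L' := fun u w z => `|dx w z *m E (u z)|)
  (X' := fun u w z => `|dx w z| * 1)).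
- by move=> D u w S z Dz; rewrite (sys_ux S Dz).
- by move=> u w z; rewrite mulr1.
- by apply: evle_mulmx; [exact: evle_refl|exact: evle_smooth].
Qed.

Lemma evle_uy : evle (fun u w z => `|dy u z|) V.
Proof.
apply: (evle_mono (L' := fun u w z => `|dy w z *m E (u z)|)
  (X' := fun u w z => `|dx w z| * 1)).
- by move=> D u w S z Dz; rewrite (sys_uy S Dz).
- by move=> u w z; rewrite mulr1.
- by apply: evle_mulmx; [exact: evle_dyw|exact: evle_smooth].
Qed.

Lemma evle_mx p p' (F : (R * R -> 'rV[R]_m) -> (R * R -> 'rV[R]_N) -> R * R -> 'M[R]_(p, p')) X :
  (forall u w z, 0 <= X u w z) ->
  (forall i j, evle (fun u w z => `|F u w z i j|) X) -> evle (fun u w z => `|F u w z|) X.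
Proof.
move=> X0 H; apply: (evle_mono (L' := fun u w z => \sum_(ij : 'I_p * 'I_p') `|F u w z ij.1 ij.2|) (X' := X)) => //.
  move=> D u w S z Dz; apply: mx_norm_le => [|i j]; first by apply: sumr_ge0.
  rewrite (bigD1 (i, j)) //= lerDl; exact: sumr_ge0.
by apply: evle_sum.
Qed.

Lemma smooth_entry p p' (F : 'rV[R]_m -> 'M[R]_(p, p')) i j : smooth_on Om F ->
  smooth_on Om (fun x => F x i j).
Proof. by move=> sF n; apply: Cn_on_coord. Qed.

Lemma evle_scalar (c : 'rV[R]_m -> R) : smooth_on Om c ->
  evle (fun u w z => `|c (u z)|) (fun u w z => 1).
Proof.
move=> sc; apply: (evle_mono (L' := fun u w z => `|(const_mx (c (u z)) : 'M[R]_1)|) (X' := fun u w z => 1)).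
- by move=> D u w _ z _; have := mx_norm_coord (const_mx (c (u z)) : 'M[R]_1) 0 0; rewrite mxE.
- by [].
apply: (evle_smooth (F := fun x => const_mx (c x) : 'M[R]_1)) => // n.
by apply: Cn_on_mx => // i j; apply: (Cn_on_eq oO) (sc n) => x _; rewrite mxE.
Qed.

Lemma evle_dx (c : 'rV[R]_m -> R) : smooth_on Om c ->
  evle (fun u w z => `|dx (fun z => c (u z)) z|) V.
Proof.
move=> sc; apply: (evle_mono (X' := V)
   (L' := fun u w z => \sum_l `|'D_(delta_mx 0 l) c (u z)| * `|dx u z|)) => //.
  move=> D u w S z Dz.
  rewrite (dx_comp (sys_hopen S) oO (sys_Om S) sc (sys_u S) Dz).
  apply: le_trans (ler_norm_sum _ _ _) _; apply: ler_sum => l _.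
  by rewrite normrM ler_wpM2l // mx_norm_coord.
apply: evle_sum => // l.
have H := evleM _ _ (evle_scalar (smooth_on_derive (delta_mx 0 l) sc)) evle_ux.
by apply: evle_mono (H _ _) => // u w z; rewrite mul1r.
Qed.

Lemma evle_dy (c : 'rV[R]_m -> R) : smooth_on Om c ->
  evle (fun u w z => `|dy (fun z => c (u z)) z|) V.
Proof.
move=> sc; apply: (evle_mono (X' := V)
   (L' := fun u w z => \sum_l `|'D_(delta_mx 0 l) c (u z)| * `|dy u z|)) => //.
  move=> D u w S z Dz.
  rewrite (dy_comp (sys_hopen S) oO (sys_Om S) sc (sys_u S) Dz).
  apply: le_trans (ler_norm_sum _ _ _) _; apply: ler_sum => l _.
  by rewrite normrM ler_wpM2l // mx_norm_coord.
apply: evle_sum => // l.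
have H := evleM _ _ (evle_scalar (smooth_on_derive (delta_mx 0 l) sc)) evle_uy.
by apply: evle_mono (H _ _) => // u w z; rewrite mul1r.
Qed.

Lemma evle_dxmx p p' (F : 'rV[R]_m -> 'M[R]_(p, p')) : smooth_on Om F ->
  evle (fun u w z => `|dx (fun z => F (u z)) z|) V.
Proof.
move=> sF; apply: evle_mx => // i j.
apply: (evle_mono (X' := V)) (evle_dx (smooth_entry i j sF)) => // D u w S z Dz.
by rewrite -(dx_coord i j (sys_hopen S) (smD_compmx oO (sys_Om S) sF (sys_u S)) Dz).
Qed.

Lemma evle_dymx p p' (F : 'rV[R]_m -> 'M[R]_(p, p')) : smooth_on Om F ->
  evle (fun u w z => `|dy (fun z => F (u z)) z|) V.
Proof.
move=> sF; apply: evle_mx => // i j.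
apply: (evle_mono (X' := V)) (evle_dy (smooth_entry i j sF)) => // D u w S z Dz.
by rewrite -(dy_coord i j (sys_hopen S) (smD_compmx oO (sys_Om S) sF (sys_u S)) Dz).
Qed.

Lemma evle_prod2 p p' p'' (F G : (R * R -> 'rV[R]_m) -> (R * R -> 'rV[R]_N) -> R * R -> 'M[R]_(p, p'))
  (B B' : (R * R -> 'rV[R]_m) -> (R * R -> 'rV[R]_N) -> R * R -> 'M[R]_(p', p'')) :
  evle (fun u w z => `|F u w z|) V2 -> evle (fun u w z => `|B u w z|) (fun u w z => 1) ->
  evle (fun u w z => `|G u w z|) V -> evle (fun u w z => `|B' u w z|) V ->
  evle (fun u w z => `|F u w z *m B u w z + G u w z *m B' u w z|) V2.
Proof.
move=> h1 h2 h3 h4.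
apply: (evle_mono (X' := V2)
  (L' := fun u w z => `|F u w z *m B u w z| + `|G u w z *m B' u w z|)) => //.
  by move=> D u w _ z _; exact: ler_normD.
apply: evleD; first exact: V2_ge0.
  by apply: evle_mono (evle_mulmx h1 h2) => // u w z; rewrite mulr1.
by apply: evle_mono (evle_mulmx h3 h4) => // u w z; rewrite -expr2 lerDl.
Qed.

Lemma evle_VV2 : evle (fun u w z => `|dx (dx w) z|) V2.
Proof. by exists 1, 1; split => // D u w _ z _ _; rewrite mul1r lerDr sqr_ge0. Qed.

Lemma evle_dxdyw : evle (fun u w z => `|dx (dy w) z|) V2.
Proof.
apply: (evle_mono (X' := V2) (L' := fun u w z => `|dx (dx w) z *m A (u z) +
   dx w z *m dx (fun z => A (u z)) z|)) => //.
  move=> D u w S z Dz; have oD := sys_hopen S.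
  have sAu := smD_compmx oO (sys_Om S) sA (sys_u S).
  rewrite -(dx_mulmx oD (smD_dx oD (sys_w S)) sAu Dz).
  by rewrite (dx_eqD oD (smD_dy oD (sys_w S)) Dz (h' := fun z => dx w z *m A (u z))) //; move=> t Dt; exact: (sys_eq S Dt).
exact: (evle_prod2 evle_VV2 (evle_smooth oO sA) (evle_refl V) (evle_dxmx sA)).
Qed.

Lemma evle_uxx : evle (fun u w z => `|dx (dx u) z|) V2.
Proof.
apply: (evle_mono (X' := V2) (L' := fun u w z => `|dx (dx w) z *m E (u z) +
   dx w z *m dx (fun z => E (u z)) z|)) => //.
  move=> D u w S z Dz; have oD := sys_hopen S.
  have sAu := smD_compmx oO (sys_Om S) sE (sys_u S).
  rewrite -(dx_mulmx oD (smD_dx oD (sys_w S)) sAu Dz).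
  by rewrite (dx_eqD oD (smD_dx oD (sys_u S)) Dz (h' := fun z => dx w z *m E (u z))) //; move=> t Dt; exact: (sys_ux S Dt).
exact: (evle_prod2 evle_VV2 (evle_smooth oO sE) (evle_refl V) (evle_dxmx sE)).
Qed.

Lemma evle_uxy : evle (fun u w z => `|dx (dy u) z|) V2.
Proof.
apply: (evle_mono (X' := V2) (L' := fun u w z => `|dx (dy w) z *m E (u z) +
   dy w z *m dx (fun z => E (u z)) z|)) => //.
  move=> D u w S z Dz; have oD := sys_hopen S.
  have sAu := smD_compmx oO (sys_Om S) sE (sys_u S).
  rewrite -(dx_mulmx oD (smD_dy oD (sys_w S)) sAu Dz).
  by rewrite (dx_eqD oD (smD_dy oD (sys_u S)) Dz (h' := fun z => dy w z *m E (u z))) //; move=> t Dt; exact: (sys_uy S Dt).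
exact: (evle_prod2 evle_dxdyw (evle_smooth oO sE) evle_dyw (evle_dxmx sE)).
Qed.

Lemma evle_second (c : 'rV[R]_m -> R) (du : (R * R -> 'rV[R]_m) -> R * R -> 'rV[R]_m) :
  smooth_on Om c -> (forall D u w, SYS D u w -> smD D (du u)) ->
  evle (fun u w z => `|du u z|) V -> evle (fun u w z => `|dx (du u) z|) V2 ->
  evle (fun u w z => `|dx (fun z => \sum_l 'D_(delta_mx 0 l) c (u z) * du u z 0 l) z|) V2.
Proof.
move=> sc sdu h1 h2; apply: (evle_mono (X' := V2)
   (L' := fun u w z => \sum_l (`|dx (fun z => 'D_(delta_mx 0 l) c (u z)) z| * `|du u z| +
      `|'D_(delta_mx 0 l) c (u z)| * `|dx (du u) z|))) => //.
  move=> D u w S z Dz; have oD := sys_hopen S.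
  have sdc l := smD_comp oO (sys_Om S) (smooth_on_derive (delta_mx 0 l) sc) (sys_u S).
  have sd := sdu D u w S.
  rewrite (dx_sum _ oD); [|by move=> l _; apply: smDM => //; exact: smD_coord|exact: Dz].
  apply: le_trans (ler_norm_sum _ _ _) _; apply: ler_sum => l _.
  rewrite (dxM oD (sdc l) (smD_coord 0 l sd) Dz) (dx_coord 0 l oD sd Dz).
  apply: le_trans (ler_normD _ _) _; rewrite !normrM.
  by apply: lerD; rewrite ler_wpM2l // mx_norm_coord.
apply: evle_sum => [|l]; first exact: V2_ge0.
apply: evleD; first exact: V2_ge0.
  have H := evleM _ _ (evle_dx (smooth_on_derive (delta_mx 0 l) sc)) h1.
  by apply: evle_mono (H _ _) => // u w z; rewrite -expr2 lerDl.
have H := evleM _ _ (evle_scalar (smooth_on_derive (delta_mx 0 l) sc)) h2.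
by apply: evle_mono (H _ _) => // u w z; rewrite mul1r.
Qed.

Lemma evle_dxx (c : 'rV[R]_m -> R) : smooth_on Om c ->
  evle (fun u w z => `|dx (dx (fun z => c (u z))) z|) V2.
Proof.
move=> sc; have H := evle_second sc (fun D u w S => smD_dx (sys_hopen S) (sys_u S)) evle_ux evle_uxx.
apply: (evle_mono (X' := V2)) H => // D u w S z Dz; have oD := sys_hopen S.
have scu := smD_comp oO (sys_Om S) sc (sys_u S).
rewrite (dx_eqD oD (smD_dx oD scu) Dz (h' := fun z => \sum_l 'D_(delta_mx 0 l) c (u z) * dx u z 0 l)) //.
by move=> t Dt; exact: dx_comp oD oO (sys_Om S) sc (sys_u S) Dt.
Qed.

Lemma evle_dxy (c : 'rV[R]_m -> R) : smooth_on Om c ->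
  evle (fun u w z => `|dx (dy (fun z => c (u z))) z|) V2.
Proof.
move=> sc; have H := evle_second sc (fun D u w S => smD_dy (sys_hopen S) (sys_u S)) evle_uy evle_uxy.
apply: (evle_mono (X' := V2)) H => // D u w S z Dz; have oD := sys_hopen S.
have scu := smD_comp oO (sys_Om S) sc (sys_u S).
rewrite (dx_eqD oD (smD_dy oD scu) Dz (h' := fun z => \sum_l 'D_(delta_mx 0 l) c (u z) * dy u z 0 l)) //.
by move=> t Dt; exact: dy_comp oD oO (sys_Om S) sc (sys_u S) Dt.
Qed.

Lemma evle_dxxmx p p' (F : 'rV[R]_m -> 'M[R]_(p, p')) : smooth_on Om F ->
  evle (fun u w z => `|dx (dx (fun z => F (u z))) z|) V2.
Proof.
move=> sF; apply: evle_mx => [|i j]; first exact: V2_ge0.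
apply: (evle_mono (X' := V2)) (evle_dxx (smooth_entry i j sF)) => // D u w S z Dz.
have oD := sys_hopen S; have sFu := smD_compmx oO (sys_Om S) sF (sys_u S).
rewrite -(dx_coord i j oD (smD_dx oD sFu) Dz).
rewrite (dx_eqD oD (smD_coord i j (smD_dx oD sFu)) Dz (h' := dx (fun z => F (u z) i j))) //.
by move=> t Dt; rewrite (dx_coord i j oD sFu Dt).
Qed.

Lemma evle_dxymx p p' (F : 'rV[R]_m -> 'M[R]_(p, p')) : smooth_on Om F ->
  evle (fun u w z => `|dx (dy (fun z => F (u z))) z|) V2.
Proof.
move=> sF; apply: evle_mx => [|i j]; first exact: V2_ge0.
apply: (evle_mono (X' := V2)) (evle_dxy (smooth_entry i j sF)) => // D u w S z Dz.
have oD := sys_hopen S; have sFu := smD_compmx oO (sys_Om S) sF (sys_u S).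
rewrite -(dx_coord i j oD (smD_dy oD sFu) Dz).
rewrite (dx_eqD oD (smD_coord i j (smD_dy oD sFu)) Dz (h' := dy (fun z => F (u z) i j))) //.
by move=> t Dt; rewrite (dy_coord i j oD sFu Dt).
Qed.

Local Notation B := (fun (u : R * R -> 'rV[R]_m) (z : R * R) =>
  dx (fun z => A (u z)) z *m A (u z) + dy (fun z => A (u z)) z).

Lemma evle_B : evle (fun u w z => `|B u z|) V.
Proof.
apply: (evle_mono (X' := V) (L' := fun u w z => `|dx (fun z => A (u z)) z *m A (u z)| +
  `|dy (fun z => A (u z)) z|)) => //; first by move=> *; exact: ler_normD.
apply: evleD => //; last exact: evle_dymx.
by apply: evle_mono (evle_mulmx (evle_dxmx sA) (evle_smooth oO sA)) => // u w z; rewrite mulr1.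
Qed.

Lemma evle_lapl : evle (fun u w z => `|lapl w z|) (fun u w z => `|dx w z| ^+ 2).
Proof.
apply: (evle_mono (L' := fun u w z => `|dx w z *m B u z|) (X' := fun u w z => `|dx w z| * `|dx w z|)) => //.
  by move=> D u w S z Dz; rewrite (sys_lapl S Dz).
exact: evle_mulmx (evle_refl V) evle_B.
Qed.

Lemma evle_dxB : evle (fun u w z => `|dx (B u) z|) V2.
Proof.
apply: (evle_mono (X' := V2) (L' := fun u w z =>
  `|dx (dx (fun z => A (u z))) z *m A (u z) + dx (fun z => A (u z)) z *m dx (fun z => A (u z)) z|
  + `|dx (dy (fun z => A (u z))) z|)) => //.
  move=> D u w S z Dz; have oD := sys_hopen S.
  have sAu := smD_compmx oO (sys_Om S) sA (sys_u S).
  have sx := smD_dx oD sAu; have sy := smD_dy oD sAu.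
  rewrite (dxD oD (smD_mulmx sx sAu) sy Dz) (dx_mulmx oD sx sAu Dz).
  exact: ler_normD.
apply: evleD; [exact: V2_ge0| |exact: evle_dxymx].
exact: (evle_prod2 (evle_dxxmx sA) (evle_smooth oO sA) (evle_dxmx sA) (evle_dxmx sA)).
Qed.

(** The second-order equation differentiated along [x]: [dx w] itself then satisfies the
    differential inequality that [bernstein] asks of [v]. *)
Lemma evle_lapldx : evle (fun u w z => `|lapl (dx w) z|)
  (fun u w z => `|dx w z| * (`|dx w z| ^+ 2 + `|dx (dx w) z|)).
Proof.
apply: (evle_mono (X' := fun u w z => `|dx w z| * (`|dx w z| ^+ 2 + `|dx (dx w) z|))
  (L' := fun u w z => `|dx (dx w) z *m B u z| + `|dx w z *m dx (B u) z|)) => //.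
  move=> D u w S z Dz; have oD := sys_hopen S.
  have sAu := smD_compmx oO (sys_Om S) sA (sys_u S).
  have sx := smD_dx oD sAu; have sy := smD_dy oD sAu.
  have sB := smDD (smD_mulmx sx sAu) sy.
  rewrite (lapl_dx oD (sys_w S) Dz).
  rewrite (dx_eqD oD (smD_lapl oD (sys_w S)) Dz (h' := fun z => dx w z *m B u z)); last first.
    by move=> t Dt; exact: sys_lapl S Dt.
  rewrite (dx_mulmx oD (smD_dx oD (sys_w S)) sB Dz); exact: ler_normD.
apply: evleD; first by move=> u w z; rewrite mulr_ge0 // V2_ge0.
  apply: evle_mono (evle_mulmx (evle_refl (fun u w z => `|dx (dx w) z|)) evle_B) => // u w z.
  by rewrite mulrC ler_wpM2l // lerDr sqr_ge0.
exact: evle_mulmx (evle_refl V) evle_dxB.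
Qed.

End Sys.

(** * Gradient estimates for solutions of the systems *)

Definition projI (R : realType) (N : nat) (I : pred 'I_N) : 'M[R]_N :=
  \matrix_(i, j) ((i == j) && I i)%:R.

Section GradientEstimates.
Variables (R : realType) (m N : nat) (I : pred 'I_N) (Om : set 'rV[R]_m).
Variables (E : 'rV[R]_m -> 'M[R]_(N, m)) (A : 'rV[R]_m -> 'M[R]_N).
Implicit Types (D : set (R * R)) (z : R * R) (u : R * R -> 'rV[R]_m) (w : R * R -> 'rV[R]_N).
Local Notation SYS := (sys I Om E A).
Local Notation P := (projI R I).

Lemma projIE p (v : 'M[R]_(p, N)) i j : (v *m P) i j = if I j then v i j else 0.
Proof.
rewrite mxE (bigD1 j) //= !mxE eqxx /= big1 ?addr0; last first.
  by move=> k kj; rewrite mxE (negbTE kj) mulr0.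
by case: (I j); rewrite ?mulr1 ?mulr0.
Qed.

Lemma projI_le p (v : 'M[R]_(p, N)) : `|v *m P| <= `|v|.
Proof.
apply: mx_norm_le => // i j; rewrite projIE.
by case: ifP => _; [exact: mx_norm_coord|rewrite normr0].
Qed.

Lemma box_self z (r : R) : 0 <= r -> 0 <= z.2 -> box z r z.
Proof. by move=> r0 z0; split => //; rewrite subrr normr0. Qed.

(** [bernstein] wants a square that is centred on the axis or does not cross it. A point at height
    at least [rho / 2] is the centre of a square of half the size; a lower one lies in the square
    around its projection to the axis, where the cutoff is at least 1/4. Either way the constant
    grows by a factor 4, and [2184 = 4 * 546]. *)
Lemma grad_near D u w (psi : R * R -> R) z (rho K c s0 : R) :
  SYS D u w -> smD D psi -> 0 < rho -> 0 < c -> 0 <= K -> 0 <= z.2 ->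
  box z rho `<=` D ->
  (forall t, box z rho t -> 0 <= psi t <= s0) ->
  (forall t, box z rho t ->
     `|lapl (dx w) t| <= K * (`|dx w t| * (`|dx w t| ^+ 2 + `|dx (dx w) t|))) ->
  (forall t, box z rho t -> c * sqn (dx w t) <= lapl psi t) ->
  (forall t, box z rho t -> t.2 = 0 -> dy psi t = 0) ->
  s0 * (2 * N%:R * K + 2 * N%:R ^+ 2 * K ^+ 2) <= c / 2 ->
  sqn (dx w z) <= 2184 * s0 / (c * rho ^+ 2).
Proof.
move=> S sp r0 c0 K0 z0 BD Hpsi HK Hc HN Hs.
have oD := sys_hopen S; have sv := smD_dx oD (sys_w S).
have Nv t : box z rho t -> t.2 = 0 -> \sum_i dx w t 0 i * dy (dx w) t 0 i = 0.
  move=> Bt t0; apply: big1 => i _; have [Ii|Ii] := boolP (I i).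
    by rewrite (sys_bd_dx S (BD t Bt) t0 Ii) mul0r.
  by rewrite (sys_bd_dxy S (BD t Bt) t0 Ii) mulr0.
have s00 : 0 <= s0.
  have /andP[] := Hpsi z (box_self (ltW r0) z0); exact: le_trans.
have cr0 : 0 < c * rho ^+ 2 by rewrite mulr_gt0 // exprn_gt0.
have [zr|zr] := leP (rho / 2) z.2.
  have r20 : 0 < rho / 2 by rewrite divr_gt0.
  have sub t : box z (rho / 2) t -> box z rho t.
    move=> [h1 h2]; split => //; apply: le_trans h1 _.
    by rewrite ler_pdivrMr // ler_peMr ?ler1n // ltW.
  have := @bernstein R D N (dx w) psi z (rho / 2) K c s0 oD sv sp r20 c0 K0 (or_intror zr).
  move=> /(_ _ _ _ _ _ Hs z (box_self (ltW r20) z0)).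
  have -> : cut z (rho / 2) z = 1.
    by rewrite /cut /cut1 !subrr !mul0r expr0n /= subr0 expr1n mulr1.
  rewrite mul1r => h; apply: le_trans (h _ _ _ _ _) _.
  - by move=> t /sub; exact: BD.
  - by move=> t /sub; exact: Hpsi.
  - by move=> t /sub; exact: HK.
  - by move=> t /sub; exact: Hc.
  - by move=> t /sub Bt t0 _; split; [exact: HN|exact: Nv].
  have -> : 546 * s0 / (c * (rho / 2) ^+ 2) = 4 * 546 * s0 / (c * rho ^+ 2).
    by field; rewrite !gt_eqF.
  by rewrite -natrM.
pose zc : R * R := (z.1, 0).
have sub t : box zc rho t -> box z rho t.
  move=> []; rewrite pair_norm_le /= subr0 => /andP[h1 h2] t0; split => //.
  rewrite pair_norm_le /= h1 /=; move: h2; rewrite (ger0_norm t0) => h2.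
  rewrite ler_norml; apply/andP; split; last by lra.
  by lra.
have := @bernstein R D N (dx w) psi zc rho K c s0 oD sv sp r0 c0 K0 (or_introl erefl).
have Bz : box zc rho z.
  split => //; rewrite pair_norm_le /= subrr normr0 (ltW r0) subr0 ger0_norm //=.
  by lra.
move=> /(_ _ _ _ _ _ Hs z Bz) h.
have {}h : cut zc rho z * sqn (dx w z) <= 546 * s0 / (c * rho ^+ 2).
  apply: h.
  - by move=> t /sub; exact: BD.
  - by move=> t /sub; exact: Hpsi.
  - by move=> t /sub; exact: HK.
  - by move=> t /sub; exact: Hc.
  - by move=> t /sub Bt t0 _; split; [exact: HN|exact: Nv].
have cl : 1 / 4 <= cut zc rho z.
  rewrite /cut /cut1 /= subrr mul0r expr0n /= subr0 expr1n mul1r subr0.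
  have h0 : 0 <= z.2 / rho by rewrite divr_ge0 // ltW.
  have h1 : z.2 / rho <= 1 / 2 by rewrite ler_pdivrMr //; lra.
  move: (z.2 / rho) h0 h1 => s h0 h1.
  have h2 : s ^+ 2 <= 1 / 4 by nra.
  by nra.
have := sqn_ge0 (dx w z); move: (sqn (dx w z)) h => e h e0.
have h3 : 1 / 4 * e <= 546 * s0 / (c * rho ^+ 2).
  by apply: le_trans h; rewrite ler_wpM2r.
have -> : 2184 * s0 / (c * rho ^+ 2) = 4 * (546 * s0 / (c * rho ^+ 2)).
  by rewrite !mulrA -natrM.
by lra.
Qed.

Variable q : 'rV[R]_m.
Hypothesis Omq : Om q.
Hypothesis oO : open Om.
Hypothesis sE : smooth_on Om E.
Hypothesis sA : smooth_on Om A.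

Lemma dx_sub_cst (p : nat) D (w : R * R -> 'rV[R]_p) (c : 'rV[R]_p) z : hopen D -> smD D w -> D z ->
  dx (fun z => w z + c) z = dx w z.
Proof.
move=> oD sw Dz.
by rewrite (dxD oD sw (@smD_cst _ _ D c) Dz) dx_cst addr0.
Qed.

Lemma dy_sub_cst (p : nat) D (w : R * R -> 'rV[R]_p) (c : 'rV[R]_p) z : hopen D -> smD D w -> D z ->
  dy (fun z => w z + c) z = dy w z.
Proof.
move=> oD sw Dz.
by rewrite (dyD oD sw (@smD_cst _ _ D c) Dz) (dy_cst _ oD Dz) addr0.
Qed.

Lemma lapl_sub_cst (p : nat) D (w : R * R -> 'rV[R]_p) (c : 'rV[R]_p) z : hopen D -> smD D w -> D z ->
  lapl (fun z => w z + c) z = lapl w z.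
Proof.
move=> oD sw Dz; have s := smDD sw (@smD_cst _ _ D c); rewrite /lapl.
rewrite (dx_eqD oD (smD_dx oD s) Dz (h' := dx w)); last first.
  by move=> t Dt; exact: (dx_sub_cst _ oD sw Dt).
rewrite (dy_eqD oD (smD_dy oD s) Dz (h' := dy w)) //.
by move=> t Dt; exact: (dy_sub_cst _ oD sw Dt).
Qed.

Lemma dot_lapl_bound (n : nat) (v w : 'rV[R]_n) (a b : R) : `|v| <= a -> `|w| <= b ->
  - (2 * n%:R * (a * b)) <= \sum_i 2 * (v 0 i * w 0 i).
Proof.
move=> va wb; rewrite -mulr_sumr -mulrA -mulrN ler_wpM2l //.
have := dot_bound v w; rewrite ler_norml => /andP[h _]; apply: le_trans h.
by rewrite lerN2 ler_wpM2l // ler_pM.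
Qed.

(** The auxiliary function is [psi = |w - p|^2]: its Laplacian dominates [|dx w|^2] once the
    oscillation of [w] is small. The base value [p] must be real if the square meets the axis, so
    that [psi] has vanishing normal derivative there. *)
Lemma gradient_bound : exists d C : R, [/\ 0 < d, 0 <= C &
  forall D u w (p : 'rV[R]_N) z (rho : R), SYS D u w -> 0 < rho -> 0 <= z.2 ->
  box z rho `<=` D ->
  (forall t, box z rho t -> `|u t - q| < d /\ `|w t - p| <= d) ->
  (forall t, box z rho t -> t.2 = 0 -> forall i, I i -> p 0 i = 0) ->
  `|dx w z| <= C / rho].
Proof.
have [d1 [C1 [d10 C10 h1]]] := evle_lapl I Omq oO sE sA.
have [d2 [K [d20 K0 h2]]] := evle_lapldx I Omq oO sE sA.
pose K' := 2 * N%:R * K + 2 * N%:R ^+ 2 * K ^+ 2.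
have K'0 : 0 <= K' by rewrite /K' addr_ge0 // !mulr_ge0 // ?sqr_ge0.
(* [d3] lets the gradient terms in the Laplacian of [psi] absorb the quadratic error; [d4] below is
   the smallness of [psi] required by [bernstein]. *)
pose d3 := (2 * N%:R * C1 + 1)^-1.
have n0 : 0 <= 2 * N%:R * C1 by rewrite !mulr_ge0.
have d30 : 0 < d3 by rewrite invr_gt0 ltr_wpDl.
pose d4 := (2 * (N%:R * K') + 1)^-1.
have n1 : 0 <= 2 * (N%:R * K') by rewrite !mulr_ge0.
have d40 : 0 < d4 by rewrite invr_gt0 ltr_wpDl.
pose d := Num.min (Num.min d1 d2) (Num.min d3 (Num.min d4 1)).
have d0 : 0 < d by rewrite !lt_min d10 d20 d30 d40 ltr01.
have [dd1 dd2 [dd3 dd4 dd5]] : [/\ d <= d1, d <= d2 & [/\ d <= d3, d <= d4 & d <= 1]].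
  have : d <= d by [].
  by rewrite {2}/d !le_min => /andP[/andP[-> ->] /andP[-> /andP[-> ->]]].
exists d, (Num.sqrt (2184 * (N%:R * d ^+ 2))); split; [exact: d0|exact: sqrtr_ge0|].
move=> D u w p z rho S r0 z0 BD Hd Hp.
have oD := sys_hopen S; have sw := sys_w S.
pose wp t := w t + - p.
have swp : smD D wp by apply: smDD; [exact: sw|exact: smD_cst].
have := @grad_near D u w (fun t => sqn (wp t)) z rho K 1 (N%:R * d ^+ 2) S (smD_sqn swp) r0 ltr01 K0 z0 BD.
move=> H; have {}H : sqn (dx w z) <= 2184 * (N%:R * d ^+ 2) / (1 * rho ^+ 2).
  apply: H.
  - move=> t Bt; rewrite sqn_ge0 /=; apply: le_trans (sqn_norm _) _.
    rewrite ler_wpM2l // ler_pXn2r ?nnegrE ?(ltW d0) //.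
    by have [] := Hd t Bt.
  - move=> t Bt; have [h _] := Hd t Bt.
    exact: (h2 D u w S t (BD t Bt) (lt_le_trans h dd2)).
  - move=> t Bt; have Dt := BD t Bt; have [hu hw] := Hd t Bt.
    rewrite mul1r (lapl_sqn oD swp Dt) (dx_sub_cst _ oD sw Dt) (dy_sub_cst _ oD sw Dt).
    have hl := h1 D u w S t Dt (lt_le_trans hu dd1).
    have := dot_lapl_bound hw hl; rewrite -(lapl_sub_cst (- p) oD sw Dt) -/wp => hb.
    have n2 : 2 * N%:R * (d * (C1 * `|dx w t| ^+ 2)) <= `|dx w t| ^+ 2.
      have -> : 2 * N%:R * (d * (C1 * `|dx w t| ^+ 2)) = (d * (2 * N%:R * C1)) * `|dx w t| ^+ 2 by ring.
      rewrite ler_piMl ?sqr_ge0 //; apply: (@le_trans _ _ (d3 * (2 * N%:R * C1))).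
        by rewrite ler_wpM2r.
      by rewrite /d3 mulrC ler_pdivrMr ?ltr_wpDl // mul1r lerDl.
    have n3 := norm_sqn (dx w t); have n4 := sqn_ge0 (dy w t).
    move: (sqn (dx w t)) (sqn (dy w t)) (`|dx w t| ^+ 2) (\sum_i 2 * (wp t 0 i * lapl wp t 0 i)) n2 n3 n4 hb.
    by move=> a b c e n2 n3 n4 hb; lra.
  - move=> t Bt t0; have Dt := BD t Bt.
    rewrite (dy_sqn oD swp Dt) big1 // => i _; rewrite (dy_sub_cst _ oD sw Dt).
    have [Ii|Ii] := boolP (I i).
      by rewrite /wp !mxE (sys_bd S Dt t0 Ii) (Hp t Bt t0 i Ii) subrr mul0r mulr0.
    by rewrite (sys_bd_dy S Dt t0 Ii) !mulr0.
  - rewrite -/K'; apply: (@le_trans _ _ (d4 * (N%:R * K'))).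
      have -> : N%:R * d ^+ 2 * K' = d ^+ 2 * (N%:R * K') by ring.
      rewrite ler_wpM2r ?mulr_ge0 //; apply: le_trans dd4.
      by rewrite expr2 ler_piMr // ltW.
    by rewrite /d4 mulrC ler_pdivrMr ?ltr_wpDl //; lra.
have n5 := le_trans (norm_sqn (dx w z)) H.
rewrite mul1r in n5.
rewrite -(ler_pXn2r (ltn0Sn 1)) ?nnegrE ?divr_ge0 ?sqrtr_ge0 ?(ltW r0) //.
rewrite expr_div_n sqr_sqrtr; first exact: n5.
by apply: mulr_ge0; [exact: ler0n|apply: mulr_ge0; [exact: ler0n|exact: sqr_ge0]].
Qed.

Hypothesis Aq2 : A q *m A q = - 1%:M.
Hypothesis Aqs : forall j i, ~~ I j -> ~~ I i -> A q j i = 0.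

Lemma dx_proj D w z : hopen D -> smD D w -> D z -> dx (fun z => w z *m P) z = dx w z *m P.
Proof.
move=> oD sw Dz.
by rewrite (dx_mulmx oD sw (@smD_cst _ _ D P) Dz) dx_cst mulmx0 addr0.
Qed.

Lemma dy_proj D w z : hopen D -> smD D w -> D z -> dy (fun z => w z *m P) z = dy w z *m P.
Proof.
move=> oD sw Dz.
by rewrite (dy_mulmx oD sw (@smD_cst _ _ D P) Dz) (dy_cst _ oD Dz) mulmx0 addr0.
Qed.

Lemma smD_proj D w : smD D w -> smD D (fun z => w z *m P).
Proof. by move=> sw; apply: smD_mulmx sw _; exact: smD_cst. Qed.

Lemma lapl_proj D w z : hopen D -> smD D w -> D z -> lapl (fun z => w z *m P) z = lapl w z *m P.
Proof.
move=> oD sw Dz; have s := smD_proj sw; rewrite /lapl mulmxDl; congr (_ + _).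
  rewrite -(dx_proj oD (smD_dx oD sw) Dz); apply: (dx_eqD oD (smD_dx oD s) Dz) => t Dt.
  exact: (dx_proj oD sw Dt).
rewrite -(dy_proj oD (smD_dy oD sw) Dz); apply: (dy_eqD oD (smD_dy oD s) Dz) => t Dt.
exact: (dy_proj oD sw Dt).
Qed.

(** Let [a] be the real part of [dx w]. At [q] the matrix [A] turns [a] into a purely imaginary
    vector, and [a = - a A A]; so [a] is bounded by the imaginary part of [a A]. This is the
    imaginary part of [dy w], up to a term in the imaginary part of [dx w] and an error of size
    [|a|] times the oscillation of [A]. *)
Lemma real_part_bound : exists d C : R, [/\ 0 < d, 0 <= C &
  forall D u w z, SYS D u w -> D z -> `|u z - q| < d ->
  `|dx w z| <= C * (`|dx w z *m P| + `|dy w z *m P|)].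
Proof.
have [d1 [C1 [d10 C10 h1]]] := evle_smooth I E A Omq oO sA.
pose A0 := A q; pose n : R := N%:R.
have n0 : 0 <= n by [].
(* With this oscillation of [A] the error term is at most half of [|a|]. *)
pose eps := (2 * (n * (n * `|A0|)) + 1)^-1.
have M0 : 0 <= 2 * (n * (n * `|A0|)) by rewrite !mulr_ge0.
have eps0 : 0 < eps by rewrite invr_gt0 ltr_wpDl.
have cA := differentiable_continuous (smooth_on_differentiable sA Omq).
have H : \forall p \near q, `|A q - A p| < eps by move/cvgrPdist_lt : cA; apply.
have [d2 d20 h2] := near_norm_ex H.
pose C := 2 * (n * `|A0|) * (n * C1 + 1) + 1.
exists (Num.min d1 d2), C; split; first by rewrite lt_min d10.
  by rewrite addr_ge0 // mulr_ge0 ?mulr_ge0 // addr_ge0 // mulr_ge0.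
move=> D u w z S Dz; rewrite lt_min => /andP[u1 u2].
have hA : `|A (u z)| <= C1 by have := h1 D u w S z Dz u1; rewrite mulr1.
have hd : `|A (u z) - A0| <= eps by rewrite distrC ltW // h2.
set v := dx w z; set bx := v *m P; set by' := dy w z *m P.
pose a := v - bx.
have aI i : I i -> a 0 i = 0 by move=> Ii; rewrite /a mxE [X in _ + X]mxE /bx projIE Ii subrr.
have aA : a *m A0 = a *m A0 *m P.
  apply/rowP => i; rewrite projIE; case: ifPn => // Ii.
  rewrite mxE big1 // => j _; have [Ij|Ij] := boolP (I j); first by rewrite aI ?mul0r.
  by rewrite /A0 Aqs ?mulr0.
have ea : a = - (a *m A0 *m A0) by rewrite -mulmxA Aq2 mulmxN mulmx1 opprK.
have na : `|a| <= n * (`|a *m A0 *m P| * `|A0|).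
  by rewrite {1}ea normrN -aA; exact: mulmx_norm.
have e2 : a *m A0 *m P = by' - bx *m A (u z) *m P - a *m (A (u z) - A0) *m P.
  rewrite /by' (sys_eq S Dz) -/v -!mulmxBl; congr (_ *m P).
  by rewrite mulmxBr -/a opprB addrC subrK.
have nb : `|a *m A0 *m P| <= `|by'| + n * (`|bx| * C1) + n * (`|a| * eps).
  rewrite e2; apply: le_trans (ler_normB _ _) _; apply: lerD.
    apply: le_trans (ler_normB _ _) _; rewrite lerD2l.
    apply: le_trans (projI_le _) _; apply: le_trans (mulmx_norm _ _) _.
    by rewrite ler_wpM2l // ler_wpM2l.
  apply: le_trans (projI_le _) _; apply: le_trans (mulmx_norm _ _) _.
  by rewrite ler_wpM2l // ler_wpM2l.
have na2 : `|a| <= 2 * (n * `|A0|) * (`|by'| + n * (`|bx| * C1)).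
  have h3 : `|a| <= n * `|A0| * (`|by'| + n * (`|bx| * C1)) + n * (n * `|A0|) * eps * `|a|.
    apply: le_trans na _.
    have -> : n * (`|a *m A0 *m P| * `|A0|) = n * `|A0| * `|a *m A0 *m P| by ring.
    apply: (@le_trans _ _ (n * `|A0| * (`|by'| + n * (`|bx| * C1) + n * (`|a| * eps)))).
      by rewrite ler_wpM2l // mulr_ge0.
    by rewrite mulrDr lerD2l; have -> : n * `|A0| * (n * (`|a| * eps)) = n * (n * `|A0|) * eps * `|a| by ring.
  have h4 : n * (n * `|A0|) * eps * `|a| <= 2^-1 * `|a|.
    rewrite ler_wpM2r // /eps ler_pdivrMr ?ltr_wpDl //; lra.
  move: h3 h4; move: (`|a|) (n * (n * `|A0|) * eps * `|a|) => x y; rewrite -mulrA.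
  by move: (n * `|A0| * (`|by'| + n * (`|bx| * C1))) => t; lra.
have nv : `|v| <= `|a| + `|bx| by rewrite -{1}(subrK bx v) ler_normD.
apply: le_trans nv _; rewrite /C mulrDl mul1r; apply: lerD.
  apply: le_trans na2 _; rewrite -[leRHS]mulrA ler_wpM2l ?mulr_ge0 //.
  have [x0 y0] : 0 <= `|bx| /\ 0 <= `|by'| by [].
  move: (`|bx|) (`|by'|) x0 y0 => x y x0 y0.
  have nC : 0 <= n * C1 by rewrite mulr_ge0.
  have := mulr_ge0 nC y0.
  have -> : n * (x * C1) = n * C1 * x by ring.
  by rewrite mulrDl mul1r mulrDr; lra.
by rewrite lerDl.
Qed.

End GradientEstimates.

Section GradientIm.
Variables (R : realType) (m N : nat) (I : pred 'I_N) (Om : set 'rV[R]_m).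
Variables (E : 'rV[R]_m -> 'M[R]_(N, m)) (A : 'rV[R]_m -> 'M[R]_N).
Implicit Types (D : set (R * R)) (z : R * R) (u : R * R -> 'rV[R]_m) (w : R * R -> 'rV[R]_N).
Local Notation SYS := (sys I Om E A).
Local Notation P := (projI R I).
Variable q : 'rV[R]_m.
Hypothesis Omq : Om q.
Hypothesis oO : open Om.
Hypothesis sE : smooth_on Om E.
Hypothesis sA : smooth_on Om A.
Hypothesis Aq2 : A q *m A q = - 1%:M.
Hypothesis Aqs : forall j i, ~~ I j -> ~~ I i -> A q j i = 0.

Lemma mul_min_le (x y a : R) : 0 <= a -> 0 <= x -> 0 < y -> x <= y / (a + 1) -> a * x <= y.
Proof.
move=> a0 x0 y0; rewrite ler_pdivlMr ?ltr_wpDl // mulrDr mulr1 mulrC => h.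
by apply: le_trans h; rewrite lerDl.
Qed.

(** Here only the imaginary part of [w] is small, and its square serves as [psi]; its gradient
    controls the whole gradient by [real_part_bound]. The result is linear in the size [beta] of the
    imaginary part, the gain from which the decay at the puncture is derived. *)
Lemma gradient_bound_im : exists d C : R, [/\ 0 < d, 0 <= C &
  forall D u w z (rho beta : R), SYS D u w -> 0 < rho -> 0 <= z.2 ->
  box z rho `<=` D -> beta <= d ->
  (forall t, box z rho t -> `|u t - q| < d /\ `|w t *m P| <= beta) ->
  `|dx w z| <= C * beta / rho].
Proof.
have [d1 [C1 [d10 C10 h1]]] := evle_lapl I Omq oO sE sA.
have [d2 [K [d20 K0 h2]]] := evle_lapldx I Omq oO sE sA.
have [d3 [C3 [d30 C30 h3]]] := real_part_bound E Omq oO sA Aq2 Aqs.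
pose K' := 2 * N%:R * K + 2 * N%:R ^+ 2 * K ^+ 2.
have K'0 : 0 <= K' by rewrite /K' addr_ge0 // !mulr_ge0 // ?sqr_ge0.
have c30 : 0 < C3 + 1 by rewrite ltr_wpDl.
(* [kap |dx w|^2] is at most the squared gradient of the imaginary part; [c] below converts the
   maximum norm into [sqn]. *)
pose kap := (2 * (C3 + 1) ^+ 2)^-1.
have kap0 : 0 < kap by rewrite invr_gt0 mulr_gt0 // exprn_gt0.
have N10 : 0 < (N%:R : R) + 1 by rewrite ltr_wpDl.
pose c := kap / (N%:R + 1).
have c0 : 0 < c by rewrite divr_gt0.
have n0 : 0 <= 2 * N%:R * C1 by rewrite !mulr_ge0.
have n1 : 0 <= N%:R * K' by rewrite !mulr_ge0.
pose d := Num.min (Num.min d1 (Num.min d2 d3))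
  (Num.min (kap / (2 * N%:R * C1 + 1)) (Num.min ((c / 2) / (N%:R * K' + 1)) 1)).
have d0 : 0 < d.
  rewrite !lt_min d10 d20 d30 ltr01 !divr_gt0 // ltr_wpDl //.
have [[dd1 dd2 dd6] [dd3 dd4 dd5]] : [/\ d <= d1, d <= d2 & d <= d3] /\
   [/\ d <= kap / (2 * N%:R * C1 + 1), d <= (c / 2) / (N%:R * K' + 1) & d <= 1].
  have : d <= d by [].
  by rewrite {2}/d !le_min => /andP[/andP[-> /andP[-> ->]] /andP[-> /andP[-> ->]]].
have [k [k0 kE]] : exists k : R, 0 <= k /\ k = 2184.
  by exists 2184; split; [exact: ler0n|].
exists d, (Num.sqrt (k * N%:R / c)); split; [exact: d0|exact: sqrtr_ge0|].
move=> D u w z rho beta S r0 z0 BD bd Hd.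
have oD := sys_hopen S; have sw := sys_w S.
have b0 : 0 <= beta by have [_] := Hd z (box_self (ltW r0) z0); exact: le_trans.
pose b t := w t *m P.
have sb : smD D b by exact: smD_proj.
have := @grad_near R m N I Om E A D u w (fun t => sqn (b t)) z rho K c (N%:R * beta ^+ 2) S (smD_sqn sb) r0 c0 K0 z0 BD.
move=> H; have {}H : sqn (dx w z) <= 2184 * (N%:R * beta ^+ 2) / (c * rho ^+ 2).
  apply: H.
  - move=> t Bt; rewrite sqn_ge0 /=; apply: le_trans (sqn_norm _) _.
    rewrite ler_wpM2l // ler_pXn2r ?nnegrE //.
    by have [] := Hd t Bt.
  - move=> t Bt; have [h _] := Hd t Bt.
    exact: (h2 D u w S t (BD t Bt) (lt_le_trans h dd2)).
  - move=> t Bt; have Dt := BD t Bt; have [hu hw] := Hd t Bt.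
    rewrite (lapl_sqn oD sb Dt) (dx_proj _ oD sw Dt) (dy_proj _ oD sw Dt).
    have hl := h1 D u w S t Dt (lt_le_trans hu dd1).
    have hl' : `|lapl b t| <= C1 * `|dx w t| ^+ 2.
      by rewrite (lapl_proj _ oD sw Dt); apply: le_trans hl; exact: projI_le.
    have hb := dot_lapl_bound hw hl'; rewrite -/(b t) in hb.
    have n2 : 2 * N%:R * (beta * (C1 * `|dx w t| ^+ 2)) <= kap * `|dx w t| ^+ 2.
      have -> : 2 * N%:R * (beta * (C1 * `|dx w t| ^+ 2)) = ((2 * N%:R * C1) * beta) * `|dx w t| ^+ 2 by ring.
      rewrite ler_wpM2r ?sqr_ge0 //; apply: (mul_min_le n0 b0 kap0).
      exact: le_trans bd dd3.
    have n3 : 2 * (kap * `|dx w t| ^+ 2) <= 2 * (sqn (dx w t *m P) + sqn (dy w t *m P)).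
      rewrite ler_wpM2l //.
      have hv := h3 D u w t S Dt (lt_le_trans hu dd6).
      have m1 := norm_sqn (dx w t *m P); have m2 := norm_sqn (dy w t *m P).
      apply: (@le_trans _ _ (`|dx w t *m P| ^+ 2 + `|dy w t *m P| ^+ 2)); last exact: lerD.
      rewrite /kap mulrC ler_pdivrMr ?mulr_gt0 ?exprn_gt0 //.
      have hv2 : `|dx w t| <= (C3 + 1) * (`|dx w t *m P| + `|dy w t *m P|).
        by apply: le_trans hv _; rewrite ler_wpM2r ?addr_ge0 // lerDl.
      have : `|dx w t| ^+ 2 <= ((C3 + 1) * (`|dx w t *m P| + `|dy w t *m P|)) ^+ 2.
        by rewrite ler_pXn2r // nnegrE // mulr_ge0 ?addr_ge0 // ltW.
      move/le_trans; apply; rewrite exprMn.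
      have s0 : 0 <= (C3 + 1) ^+ 2 by rewrite sqr_ge0.
      move: ((C3 + 1) ^+ 2) s0 (`|dx w t *m P|) (`|dy w t *m P|) => cc s0 x y.
      have -> : (x ^+ 2 + y ^+ 2) * (2 * cc) = cc * (x + y) ^+ 2 + cc * (x - y) ^+ 2 by ring.
      by rewrite lerDl mulr_ge0 // sqr_ge0.
    have n4 : c * sqn (dx w t) <= kap * `|dx w t| ^+ 2.
      apply: (@le_trans _ _ (c * ((N%:R + 1) * `|dx w t| ^+ 2))).
        rewrite ler_wpM2l ?(ltW c0) //; apply: le_trans (sqn_norm _) _.
        by rewrite ler_wpM2r ?sqr_ge0 // lerDl.
      by rewrite mulrA /c divfK // gt_eqF.
    move: hb n2 n3 n4.
    move: (kap * `|dx w t| ^+ 2) (2 * N%:R * (beta * (C1 * `|dx w t| ^+ 2)))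
      (\sum_i 2 * (b t 0 i * lapl b t 0 i)) (2 * (sqn (dx w t *m P) + sqn (dy w t *m P))) (c * sqn (dx w t)).
    by move=> a1 a2 a3 a4 a5 hb n2 n3 n4; lra.
  - move=> t Bt t0; have Dt := BD t Bt.
    rewrite (dy_sqn oD sb Dt) big1 // => i _; rewrite (dy_proj _ oD sw Dt) /b !projIE.
    by case: ifPn => Ii; [rewrite (sys_bd S Dt t0 Ii) mul0r mulr0|rewrite mul0r mulr0].
  - rewrite -/K'; have -> : N%:R * beta ^+ 2 * K' = (N%:R * K') * beta ^+ 2 by ring.
    apply: (mul_min_le n1 (sqr_ge0 _)); first by rewrite divr_gt0.
    apply: le_trans dd4; apply: le_trans (_ : beta <= d) => //.
    by rewrite expr2 ler_piMr // (le_trans bd).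
rewrite -kE in H.
have n5 := le_trans (norm_sqn (dx w z)) H.
have q0 : 0 <= k * N%:R / c.
  by apply: divr_ge0; [apply: mulr_ge0|exact: ltW].
have rn : 0 <= Num.sqrt (k * N%:R / c) * beta / rho.
  by apply: divr_ge0; [apply: mulr_ge0 => //; exact: sqrtr_ge0|exact: ltW].
rewrite -(ler_pXn2r (ltn0Sn 1)) ?nnegrE //.
apply: le_trans n5 _; rewrite expr_div_n exprMn (sqr_sqrtr q0).
have -> // : k * (N%:R * beta ^+ 2) / (c * rho ^+ 2) = k * N%:R / c * beta ^+ 2 / rho ^+ 2.
by field; rewrite !gt_eqF.
Qed.

End GradientIm.

(** * Block matrices *)

Section BlockSmooth.
Variable R : realType.
Implicit Types V : normedModType R.

Lemma Cn_on_row_mx V n (U : set V) p a b (f : V -> 'M[R]_(p, a)) (g : V -> 'M[R]_(p, b)) :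
  open U -> Cn_on n U f -> Cn_on n U g -> Cn_on n U (fun x => row_mx (f x) (g x)).
Proof.
move=> oU sf sg; apply: Cn_on_mx => // i j; case e: (fintype.split j) => [k|k].
  by apply: (Cn_on_eq oU) (Cn_on_coord i k oU sf) => x _; rewrite mxE e.
by apply: (Cn_on_eq oU) (Cn_on_coord i k oU sg) => x _; rewrite mxE e.
Qed.

Lemma Cn_on_col_mx V n (U : set V) p a b (f : V -> 'M[R]_(a, p)) (g : V -> 'M[R]_(b, p)) :
  open U -> Cn_on n U f -> Cn_on n U g -> Cn_on n U (fun x => col_mx (f x) (g x)).
Proof.
move=> oU sf sg; apply: Cn_on_mx => // i j; case e: (fintype.split i) => [k|k].
  by apply: (Cn_on_eq oU) (Cn_on_coord k j oU sf) => x _; rewrite mxE e.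
by apply: (Cn_on_eq oU) (Cn_on_coord k j oU sg) => x _; rewrite mxE e.
Qed.

Lemma Cn_on_compmx V m p p' n (U : set V) (B : set 'rV[R]_m) (F : 'rV[R]_m -> 'M[R]_(p, p'))
  (g : V -> 'rV[R]_m) : open U -> open B -> (forall x, U x -> B (g x)) ->
  Cn_on n B F -> Cn_on n U g -> Cn_on n U (fun x => F (g x)).
Proof.
move=> oU oB UB sF sg; apply: Cn_on_mx => // i j.
exact: (Cn_on_comp oU UB (Cn_on_coord i j oB sF) sg).
Qed.

Lemma Cn_on_mulmx V n (U : set V) a b c (f : V -> 'M[R]_(a, b)) (g : V -> 'M[R]_(b, c)) :
  open U -> Cn_on n U f -> Cn_on n U g -> Cn_on n U (fun x => f x *m g x).
Proof.
move=> oU sf sg; apply: Cn_on_mx => // i j.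
have H k : Cn_on n U (fun x => f x i k * g x k j).
  by apply: (Cn_onM oU); exact: Cn_on_coord.
apply: (Cn_on_eq oU) (Cn_on_sum (index_enum _) oU (fun k (_ : true) => H k)) => x _.
by rewrite mxE.
Qed.

Lemma Cn_on_scale V n (U : set V) a b (c : V -> R) (f : V -> 'M[R]_(a, b)) :
  open U -> Cn_on n U c -> Cn_on n U f -> Cn_on n U (fun x => c x *: f x).
Proof.
move=> oU sc sf; apply: Cn_on_mx => // i j.
by apply: (Cn_on_eq oU) (Cn_onM oU sc (Cn_on_coord i j oU sf)) => x _; rewrite mxE.
Qed.

Lemma lsubmx_continuous a b : continuous (lsubmx : 'rV[R]_(a + b) -> 'rV[R]_a).
Proof. by move=> x; apply: differentiable_continuous; exact: differentiable_lsubmx. Qed.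

Lemma rsubmx_continuous a b : continuous (rsubmx : 'rV[R]_(a + b) -> 'rV[R]_b).
Proof. by move=> x; apply: differentiable_continuous; exact: differentiable_rsubmx. Qed.

Lemma Cn_on_lsubmx n a b (U : set 'rV[R]_(a + b)) : open U ->
  Cn_on n U (lsubmx : 'rV[R]_(a + b) -> 'rV[R]_a).
Proof. by move=> oU; apply: (Cn_on_lin n oU); exact: lsubmx_continuous. Qed.

Lemma Cn_on_rsubmx n a b (U : set 'rV[R]_(a + b)) : open U ->
  Cn_on n U (rsubmx : 'rV[R]_(a + b) -> 'rV[R]_b).
Proof. by move=> oU; apply: (Cn_on_lin n oU); exact: rsubmx_continuous. Qed.

Lemma smD_row_mx D p a b (f : R * R -> 'M[R]_(p, a)) (g : R * R -> 'M[R]_(p, b)) :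
  smD D f -> smD D g -> smD D (fun z => row_mx (f z) (g z)).
Proof.
move=> sf sg; apply: smD_mx => i j; case e: (fintype.split j) => [k|k].
  by apply: smD_congr (smD_coord i k sf) => z _; rewrite mxE e.
by apply: smD_congr (smD_coord i k sg) => z _; rewrite mxE e.
Qed.

Lemma dx_row_mx D p a b (f : R * R -> 'M[R]_(p, a)) (g : R * R -> 'M[R]_(p, b)) z :
  hopen D -> smD D f -> smD D g -> D z ->
  dx (fun z => row_mx (f z) (g z)) z = row_mx (dx f z) (dx g z).
Proof.
move=> oD sf sg Dz; have s := smD_row_mx sf sg; apply/matrixP => i j.
rewrite -(dx_coord i j oD s Dz) [RHS]mxE; case e: (fintype.split j) => [k|k].
  rewrite -(dx_coord i k oD sf Dz); apply: (dx_eqD oD (smD_coord i j s) Dz) => t _.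
  by rewrite mxE e.
rewrite -(dx_coord i k oD sg Dz); apply: (dx_eqD oD (smD_coord i j s) Dz) => t _.
by rewrite mxE e.
Qed.

Lemma dy_row_mx D p a b (f : R * R -> 'M[R]_(p, a)) (g : R * R -> 'M[R]_(p, b)) z :
  hopen D -> smD D f -> smD D g -> D z ->
  dy (fun z => row_mx (f z) (g z)) z = row_mx (dy f z) (dy g z).
Proof.
move=> oD sf sg Dz; have s := smD_row_mx sf sg; apply/matrixP => i j.
rewrite -(dy_coord i j oD s Dz) [RHS]mxE; case e: (fintype.split j) => [k|k].
  rewrite -(dy_coord i k oD sf Dz); apply: (dy_eqD oD (smD_coord i j s) Dz) => t _.
  by rewrite mxE e.
rewrite -(dy_coord i k oD sg Dz); apply: (dy_eqD oD (smD_coord i j s) Dz) => t _.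
by rewrite mxE e.
Qed.

Lemma scale_mulmx a b (t : R) (M : 'M[R]_(a, b)) : t *: M = M *m t%:M.
Proof. by rewrite mul_mx_scalar. Qed.

Lemma smDZ D a b (t : R) (f : R * R -> 'M[R]_(a, b)) : smD D f -> smD D (fun z => t *: f z).
Proof.
move=> sf; apply: smD_congr (smD_mulmx sf (@smD_cst _ _ D (t%:M : 'M[R]_b))) => z _.
by rewrite scale_mulmx.
Qed.

Lemma dxZ D a b (t : R) (f : R * R -> 'M[R]_(a, b)) z : hopen D -> smD D f -> D z ->
  dx (fun z => t *: f z) z = t *: dx f z.
Proof.
move=> oD sf Dz; rewrite (dx_eqD oD (smDZ t sf) Dz (h' := fun z => f z *m t%:M)).
  by rewrite (dx_mulmx oD sf (@smD_cst _ _ D _) Dz) dx_cst mulmx0 addr0 scale_mulmx.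
by move=> s _; rewrite scale_mulmx.
Qed.

Lemma dyZ D a b (t : R) (f : R * R -> 'M[R]_(a, b)) z : hopen D -> smD D f -> D z ->
  dy (fun z => t *: f z) z = t *: dy f z.
Proof.
move=> oD sf Dz; rewrite (dy_eqD oD (smDZ t sf) Dz (h' := fun z => f z *m t%:M)).
  by rewrite (dy_mulmx oD sf (@smD_cst _ _ D _) Dz) (dy_cst _ oD Dz) mulmx0 addr0 scale_mulmx.
by move=> s _; rewrite scale_mulmx.
Qed.

Lemma dx_compmx D m p q (u : R * R -> 'rV[R]_m) (Om : set 'rV[R]_m)
  (A : 'rV[R]_m -> 'M[R]_(p, q)) z :
  hopen D -> open Om -> (forall z, D z -> Om (u z)) -> smooth_on Om A -> smD D u -> D z ->
  dx (fun z => A (u z)) z = \sum_l dx u z 0 l *: 'D_(delta_mx 0 l) A (u z).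
Proof.
move=> oD oO DO sA su Dz; apply/matrixP => i j.
rewrite -(dx_coord i j oD (smD_compmx oO DO sA su) Dz).
rewrite (dx_comp oD oO DO (c := fun x => A x i j) _ su Dz); last first.
  by move=> n; apply: Cn_on_coord.
rewrite summxE; apply: eq_bigr => l _; rewrite mxE mulrC; congr (_ * _).
rewrite derive_mx ?mxE //; apply: diff_derivable.
by apply: (smooth_on_differentiable sA); apply: DO.
Qed.

End BlockSmooth.

(** * Prolongation: first derivatives as new unknowns *)

Section Prolongation.
Variables (R : realType) (m N : nat) (I : pred 'I_N) (Om : set 'rV[R]_m).
Variables (E : 'rV[R]_m -> 'M[R]_(N, m)) (A : 'rV[R]_m -> 'M[R]_N).

Definition prolI : pred 'I_(N + N) := fun i => match fintype.split i with inl j => I j | inr j => I j end.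
Definition prolOm : set 'rV[R]_(m + N) := [set p | Om (lsubmx p)].
Definition prolE (p : 'rV[R]_(m + N)) : 'M[R]_(N + N, m + N) :=
  block_mx (E (lsubmx p)) 0 0 1%:M.
(** The derivative of [A] in the direction [v E], where [v] is the adjoined coordinate: along a
    solution [v = tau dx w], and the chain rule makes this [tau dx (A u)]. *)
Definition prolDA (p : 'rV[R]_(m + N)) : 'M[R]_N :=
  \sum_l (rsubmx p *m E (lsubmx p)) 0 l *: 'D_(delta_mx 0 l) A (lsubmx p).
Definition prolA (p : 'rV[R]_(m + N)) : 'M[R]_(N + N) :=
  block_mx (A (lsubmx p)) (prolDA p) 0 (A (lsubmx p)).
(** The factor [tau] does not enter [prolE] and [prolA]; it can be chosen after the solution is
    known, to make the adjoined components as small as desired. *)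
Definition prolu (tau : R) (u : R * R -> 'rV[R]_m) (w : R * R -> 'rV[R]_N) (z : R * R) :
  'rV[R]_(m + N) := row_mx (u z) (tau *: dx w z).
Definition prolw (tau : R) (w : R * R -> 'rV[R]_N) (z : R * R) :
  'rV[R]_(N + N) := row_mx (w z) (tau *: dx w z).

Lemma open_prolOm : open Om -> open prolOm.
Proof. by move=> oO; apply: open_comp => // x _; exact: lsubmx_continuous. Qed.

Lemma smooth_prolDA : open Om -> smooth_on Om E -> smooth_on Om A -> smooth_on prolOm prolDA.
Proof.
move=> oO sE sA n; have oP := open_prolOm oO.
apply: Cn_on_sum => // l _; apply: Cn_on_scale => //.
  apply: Cn_on_coord => //; apply: Cn_on_mulmx => //; first exact: Cn_on_rsubmx.
  by apply: (Cn_on_compmx oP oO) (sE n) _ => //; exact: Cn_on_lsubmx.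
apply: (Cn_on_compmx (F := 'D_(delta_mx 0 l) A) oP oO) => //.
  exact: (smooth_on_derive _ sA).
exact: Cn_on_lsubmx.
Qed.

Lemma smooth_prolE : open Om -> smooth_on Om E -> smooth_on prolOm prolE.
Proof.
move=> oO sE n; have oP := open_prolOm oO.
apply: Cn_on_col_mx => //; apply: Cn_on_row_mx => //; try exact: Cn_on_cst.
by apply: (Cn_on_compmx oP oO) (sE n) _ => //; exact: Cn_on_lsubmx.
Qed.

Lemma smooth_prolA : open Om -> smooth_on Om E -> smooth_on Om A -> smooth_on prolOm prolA.
Proof.
move=> oO sE sA; have oP := open_prolOm oO.
have sAl n : Cn_on n prolOm (fun p => A (lsubmx p)).
  by apply: (Cn_on_compmx oP oO) (sA n) _ => //; exact: Cn_on_lsubmx.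
move=> n; apply: Cn_on_col_mx => //; apply: Cn_on_row_mx => //; try exact: Cn_on_cst.
exact: smooth_prolDA.
Qed.

(** The equation and its [x]-derivative together form a system with the block triangular matrix
    [prolA]. The square is [-1] because differentiating [A^2 = -1] gives [A dA + dA A = 0]; the
    boundary conditions are inherited because an identity along the axis can be differentiated in
    [x]. *)
Lemma prolongation tau D u w : sys I Om E A D u w ->
  sys prolI prolOm prolE prolA D (prolu tau u w) (prolw tau w).
Proof.
move=> S; have [oD oO sE sA su sw HO Hux Huy Heq Hsq Hbd Hsw] := S.
have oP := open_prolOm oO.
have sx := smD_dx oD sw; have stx := smDZ tau sx.
have sAu := smD_compmx oO HO sA su.
have DAE z : D z -> prolDA (prolu tau u w z) = tau *: dx (fun z => A (u z)) z.
  move=> Dz; rewrite (dx_compmx oD oO HO sA su Dz) scaler_sumr /prolDA /prolu.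
  apply: eq_bigr => l _; rewrite row_mxKl row_mxKr -scalemxAl -Hux // scalerA.
  by rewrite mxE.
have lE z : lsubmx (prolu tau u w z) = u z by rewrite row_mxKl.
split => //.
- exact: smooth_prolE.
- exact: smooth_prolA.
- exact: smD_row_mx.
- exact: smD_row_mx.
- by move=> z Dz; rewrite /prolOm /= lE; exact: HO.
- move=> z Dz; rewrite (dx_row_mx oD su stx Dz) (dx_row_mx oD sw stx Dz).
  by rewrite /prolE lE mul_row_block !mulmx0 addr0 add0r mulmx1 Hux.
- move=> z Dz; rewrite (dy_row_mx oD su stx Dz) (dy_row_mx oD sw stx Dz).
  by rewrite /prolE lE mul_row_block !mulmx0 addr0 add0r mulmx1 Huy.
- move=> z Dz; rewrite (dx_row_mx oD sw stx Dz) (dy_row_mx oD sw stx Dz).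
  rewrite /prolA lE mul_row_block mulmx0 addr0 DAE // Heq //; congr row_mx.
  rewrite (dxZ _ oD sx Dz) (dyZ _ oD sx Dz) -(dxdy_mx oD sw Dz).
  rewrite (dx_eqD oD (smD_dy oD sw) Dz Heq) (dx_mulmx oD sx sAu Dz).
  by rewrite scalerDr addrC -scalemxAr -scalemxAl.
- move=> z Dz; rewrite /prolA lE mulmx_block !mulmx0 !mul0mx !addr0 !add0r DAE //.
  have E0 : dx (fun z => A (u z)) z *m A (u z) + A (u z) *m dx (fun z => A (u z)) z = 0.
    rewrite -(dx_mulmx oD sAu sAu Dz).
    by rewrite (dx_eqD oD (smD_mulmx sAu sAu) Dz Hsq) dx_cst.
  rewrite Hsq // -scalemxAr -scalemxAl -scalerDr addrC E0 scaler0.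
  by rewrite scalar_mx_block opp_block_mx oppr0.
- move=> z Dz z0 i; rewrite /prolI /prolw mxE; case: (fintype.split i) => j Ij.
    exact: (Hbd z Dz z0 j Ij).
  by rewrite mxE (sys_bd_dx S Dz z0 Ij) mulr0.
- move=> z Dz z0 j i; rewrite /prolI /prolA lE mxE; case: (fintype.split j) => j' Ij; rewrite mxE; case: (fintype.split i) => i' Ii.
  + exact: (Hsw z Dz z0).
  + rewrite DAE // mxE -(dx_coord j' i' oD sAu Dz).
    rewrite (bd_dx oD (smD_coord j' i' sAu) _ Dz z0) ?mulr0 // => t Dt t0.
    exact: Hsw.
  + by rewrite mxE.
  + exact: (Hsw z Dz z0).
Qed.

Lemma prol_real (q : 'rV[R]_m) : A q *m A q = - 1%:M ->
  (forall j i, ~~ I j -> ~~ I i -> A q j i = 0) ->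
  prolA (row_mx q 0) *m prolA (row_mx q 0) = - 1%:M /\
  (forall j i, ~~ prolI j -> ~~ prolI i -> prolA (row_mx q 0) j i = 0).
Proof.
move=> h1 h2.
have D0 : prolDA (row_mx q 0) = 0.
  rewrite /prolDA big1 // => l _.
  by rewrite row_mxKr mul0mx mxE scale0r.
rewrite /prolA row_mxKl D0; split.
  by rewrite mulmx_block !mulmx0 !mul0mx !addr0 !add0r h1 scalar_mx_block opp_block_mx oppr0.
move=> j i; rewrite /prolI mxE; case: (fintype.split j) => j' Ij; rewrite mxE; case: (fintype.split i) => i' Ii.
- exact: h2.
- by rewrite mxE.
- by rewrite mxE.
- exact: h2.
Qed.

End Prolongation.

(** * Barriers and decay at the puncture *)

Section Barrier.
Variable R : realType.
Implicit Types (D : set (R * R)) (z w : R * R).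

Lemma Cn_on_powR (V : normedModType R) n (U : set V) (g : V -> R) (k : R) : open U ->
  (forall x, U x -> 0 < g x) -> Cn_on n U g -> Cn_on n U (fun x => g x `^ k).
Proof.
move=> oU g0.
have dp x : U x -> differentiable (fun y : R => y `^ k) (g x).
  by move=> Ux; apply/derivable1_diffP; have [] := is_derive1_powR k (g0 x Ux).
elim: n k dp => [|n IH] k dp.
  move=> h x Ux.
  exact: (continuous_comp (h x Ux) (differentiable_continuous (dp x Ux))).
move=> hg; have [g1 g2] := hg.
have dg x (Ux : U x) : differentiable (fun x => g x `^ k) x.
  exact: (differentiable_comp (g1 x Ux) (dp x Ux)).
split => // v.
have dp' x : U x -> differentiable (fun y : R => y `^ (k - 1)) (g x).
  by move=> Ux; apply/derivable1_diffP; have [] := is_derive1_powR (k - 1) (g0 x Ux).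
have := Cn_onM oU (Cn_onM oU (Cn_on_cst n U k) (IH _ dp' (Cn_onW hg))) (g2 v).
apply: (Cn_on_eq oU) => x Ux.
rewrite (deriveE _ (dg x Ux)).
have -> : 'd (fun x => g x `^ k) x = 'd (fun y : R => y `^ k) (g x) \o 'd g x :> (V -> R).
  exact: (diff_comp (g1 x Ux) (dp x Ux)).
rewrite /= -(deriveE v (g1 x Ux)).
have [_ e] := is_derive1_powR k (g0 x Ux).
rewrite (diff1E (dp x Ux)) derive1E e; exact: mulrC.
Qed.

Lemma dx_powR D (h : R * R -> R) (k : R) z : hopen D -> smD D h -> (forall z, D z -> 0 < h z) ->
  D z -> dx (fun z => h z `^ k) z = k * h z `^ (k - 1) * dx h z.
Proof.
case: z => x y; move=> oD sh h0 Dz; have [g e] := sh _ Dz.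
have [U [oU Uz sg gh]] := e.
have gz := nbhs_singleton (ext_near e) Dz.
have dg := ext_differentiable e.
have dp : differentiable (fun t : R => t `^ k) (g (x, y)).
  by apply/derivable1_diffP; rewrite gz; have [] := is_derive1_powR k (h0 _ Dz).
rewrite (dx_congr (g := fun z => g z `^ k) oD Dz); last first.
  by apply: filterS (ext_near e) => w H Dw; rewrite H.
rewrite deriveE; last exact: (differentiable_comp dg dp).
have -> : 'd (fun x => g x `^ k) (x, y) = 'd (fun t : R => t `^ k) (g (x, y)) \o 'd g (x, y) :> (R * R -> R).
  exact: (diff_comp dg dp).
rewrite /= -(deriveE _ dg) (dx_ext oD Dz e).
have [_ e'] := is_derive1_powR k (h0 _ Dz).
rewrite (diff1E dp) derive1E gz e'; exact: mulrC.
Qed.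

Lemma dy_powR D (h : R * R -> R) (k : R) z : hopen D -> smD D h -> (forall z, D z -> 0 < h z) ->
  D z -> dy (fun z => h z `^ k) z = k * h z `^ (k - 1) * dy h z.
Proof.
case: z => x y; move=> oD sh h0 Dz; have [g e] := sh _ Dz.
have [U [oU Uz sg gh]] := e.
have gz := nbhs_singleton (ext_near e) Dz.
have dg := ext_differentiable e.
have dp : differentiable (fun t : R => t `^ k) (g (x, y)).
  by apply/derivable1_diffP; rewrite gz; have [] := is_derive1_powR k (h0 _ Dz).
have -> : dy (fun z => h z `^ k) (x, y) = 'D_((0, 1) : R * R) (fun z => g z `^ k) (x, y).
  apply: (dy_is (g := fun z => g z `^ k) oD Dz).
    by apply: filterS (ext_near e) => w H Dw; rewrite H.
  apply: derivableP; apply: diff_derivable; exact: (differentiable_comp dg dp).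
rewrite deriveE; last exact: (differentiable_comp dg dp).
have -> : 'd (fun x => g x `^ k) (x, y) = 'd (fun t : R => t `^ k) (g (x, y)) \o 'd g (x, y) :> (R * R -> R).
  exact: (diff_comp dg dp).
rewrite /= -(deriveE _ dg) (dy_ext oD Dz e).
have [_ e'] := is_derive1_powR k (h0 _ Dz).
rewrite (diff1E dp) derive1E gz e'; exact: mulrC.
Qed.

Lemma smD_powR D (h : R * R -> R) (k : R) : smD D h -> (forall z, D z -> 0 < h z) ->
  smD D (fun z => h z `^ k).
Proof.
move=> sh h0 z Dz; have [g [U [oU Uz sg gh]]] := sh z Dz.
have cg : {in U, continuous g}.
  by move=> w /set_mem Uw; apply: differentiable_continuous; exact: smooth_on_differentiable sg Uw.
have oV : open (U `&` g @^-1` [set t : R | 0 < t]) by apply: open_comp_in => //; exact: open_gt.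
exists (fun z => g z `^ k), (U `&` g @^-1` [set t | 0 < t]); split => //.
- by split => //=; rewrite gh // h0.
- move=> n; apply: Cn_on_powR => //; first by move=> x [].
  by apply: Cn_on_sub (sg n) => x [].
- by move=> w [Uw _] Dw; rewrite gh.
Qed.

Lemma lapl_powR D (h : R * R -> R) (k : R) z : hopen D -> smD D h -> (forall z, D z -> 0 < h z) ->
  D z -> lapl (fun z => h z `^ k) z = k * (k - 1) * h z `^ (k - 2) * (dx h z ^+ 2 + dy h z ^+ 2) +
    k * h z `^ (k - 1) * lapl h z.
Proof.
move=> oD sh h0 Dz; have sp := smD_powR k sh h0; have sp1 := smD_powR (k - 1) sh h0.
have sx := smD_dx oD sh; have sy := smD_dy oD sh.
have sk := @smD_cst _ _ D k.
have skp := smDM sk sp1.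
rewrite /lapl (dx_eqD oD (smD_dx oD sp) Dz (h' := fun z => k * h z `^ (k - 1) * dx h z)); last first.
  by move=> t Dt; exact: dx_powR oD sh h0 Dt.
rewrite (dy_eqD oD (smD_dy oD sp) Dz (h' := fun z => k * h z `^ (k - 1) * dy h z)); last first.
  by move=> t Dt; exact: dy_powR oD sh h0 Dt.
rewrite (dxM oD skp sx Dz) (dyM oD skp sy Dz) (dxM oD sk sp1 Dz) (dyM oD sk sp1 Dz).
rewrite dx_cst (dy_cst _ oD Dz) (dx_powR _ oD sh h0 Dz) (dy_powR _ oD sh h0 Dz).
have -> : k - 1 - 1 = k - 2 by ring.
move: (h z `^ (k - 1)) (h z `^ (k - 2)) (dx h z) (dy h z) (dx (dx h) z) (dy (dy h) z) => a b c d e f.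
ring.
Qed.

Definition upper D : set (R * R) := [set z | D z /\ 0 < z.2].

Lemma hopen_upper D : hopen D -> hopen (upper D).
Proof.
move=> oD z [Dz z0]; have [z2 nD] := oD z Dz; split => //.
have [e e0 H] := near_norm_ex nD.
have m0 : 0 < Num.min e z.2 by rewrite lt_min e0.
apply: (near_norm m0) => w; rewrite lt_min => /andP[h1 h2] w0; split; first exact: H.
by move: h2; rewrite pair_norm_lt /= => /andP[_]; rewrite ltr_norml => /andP[h _]; lra.
Qed.

Lemma upper_sub D : upper D `<=` D. Proof. by move=> z []. Qed.

Lemma smD_snd D : smD D (fun z : R * R => z.2).
Proof. by apply: (smD_smooth openT) => //; exact: smooth_on_snd openT. Qed.

Lemma smD_fst D : smD D (fun z : R * R => z.1).
Proof. by apply: (smD_smooth openT) => //; exact: smooth_on_fst openT. Qed.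

Lemma dx_snd D z : hopen D -> D z -> dx (fun z : R * R => z.2) z = 0.
Proof.
move=> oD Dz.
exact: (dx_smooth oD Dz openT I (smooth_on_snd openT) (is_derive_cst z.2 z.1 (1 : R))).
Qed.

Lemma dy_snd D z : hopen D -> D z -> dy (fun z : R * R => z.2) z = 1.
Proof.
move=> oD Dz.
exact: (dy_smooth oD Dz openT I (smooth_on_snd openT) (is_derive_id z.2 (1 : R))).
Qed.

Lemma dx_fst D z : hopen D -> D z -> dx (fun z : R * R => z.1) z = 1.
Proof.
move=> oD Dz.
exact: (dx_smooth oD Dz openT I (smooth_on_fst openT) (is_derive_id z.1 (1 : R))).
Qed.

Lemma dy_fst D z : hopen D -> D z -> dy (fun z : R * R => z.1) z = 0.
Proof.
move=> oD Dz.
exact: (dy_smooth oD Dz openT I (smooth_on_fst openT) (is_derive_cst z.1 z.2 (1 : R))).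
Qed.

Lemma lapl_snd D z : hopen D -> D z -> lapl (fun z : R * R => z.2) z = 0.
Proof.
move=> oD Dz; rewrite /lapl.
rewrite (dx_eqD oD (smD_dx oD (@smD_snd D)) Dz (h' := fun=> (0 : R))); last by move=> t Dt; exact: (dx_snd oD Dt).
rewrite (dy_eqD oD (smD_dy oD (@smD_snd D)) Dz (h' := fun=> (1 : R))); last by move=> t Dt; exact: (dy_snd oD Dt).
by rewrite dx_cst (dy_cst _ oD Dz) addr0.
Qed.

Lemma lapl_fst D z : hopen D -> D z -> lapl (fun z : R * R => z.1) z = 0.
Proof.
move=> oD Dz; rewrite /lapl.
rewrite (dx_eqD oD (smD_dx oD (@smD_fst D)) Dz (h' := fun=> (1 : R))); last by move=> t Dt; exact: (dx_fst oD Dt).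
rewrite (dy_eqD oD (smD_dy oD (@smD_fst D)) Dz (h' := fun=> (0 : R))); last by move=> t Dt; exact: (dy_fst oD Dt).
by rewrite dx_cst (dy_cst _ oD Dz) addr0.
Qed.

(** The squared Euclidean length, whereas [|z|] is the maximum norm. *)
Definition sq2 (z : R * R) : R := z.1 * z.1 + z.2 * z.2.

Lemma smD_sq2 D : smD D sq2.
Proof. exact: smDD (smDM (@smD_fst D) (@smD_fst D)) (smDM (@smD_snd D) (@smD_snd D)). Qed.

Lemma sq2_facts D z : hopen D -> D z ->
  [/\ dx sq2 z = 2 * z.1, dy sq2 z = 2 * z.2 & lapl sq2 z = 4].
Proof.
move=> oD Dz; have [s1 s2] := (@smD_fst D, @smD_snd D).
have [s11 s22] := (smDM s1 s1, smDM s2 s2).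
rewrite /sq2; split.
- rewrite (dxD oD s11 s22 Dz) (dxM oD s1 s1 Dz) (dxM oD s2 s2 Dz).
  by rewrite (dx_fst oD Dz) (dx_snd oD Dz); ring.
- rewrite (dyD oD s11 s22 Dz) (dyM oD s1 s1 Dz) (dyM oD s2 s2 Dz).
  by rewrite (dy_fst oD Dz) (dy_snd oD Dz); ring.
- rewrite (laplD oD s11 s22 Dz) (laplM oD s1 s1 Dz) (laplM oD s2 s2 Dz).
  rewrite (lapl_fst oD Dz) (lapl_snd oD Dz) (dx_fst oD Dz) (dx_snd oD Dz) (dy_fst oD Dz) (dy_snd oD Dz).
  by ring.
Qed.

Lemma powR_shift (s k : R) : 0 < s -> s `^ (k - 1) * s = s `^ k.
Proof.
move=> s0; rewrite -{2}(powRr1 (ltW s0)) -powRD ?(gt_eqF s0) ?implybT //.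
by congr (_ `^ _); ring.
Qed.

Lemma lapl_ypow D (k : R) z : hopen D -> D z -> 0 < z.2 ->
  lapl (fun z : R * R => z.2 `^ k) z = k * (k - 1) * z.2 `^ (k - 2).
Proof.
move=> oD Dz z0; have oU := hopen_upper oD.
have Uz : upper D z by [].
have p (t : R * R) : upper D t -> 0 < t.2 by case.
rewrite (lapl_powR k oU (@smD_snd _) p Uz) (dx_snd oU Uz) (dy_snd oU Uz) (lapl_snd oU Uz).
by rewrite expr0n expr1n add0r mulr1 mulr0 addr0.
Qed.

(** A combination of [y^k] and its transform under inversion in the Euclidean unit circle,
    [(y / |z|^2)^k]. Inversion is conformal, so the second Laplacian is that of the first,
    [k (k - 1) y^(k - 2)], times [|z|^(-2k)]; both are negative for [0 < k < 1]. *)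
Definition barrier (a c k : R) (z : R * R) : R :=
  a * z.2 `^ k + c * (z.2 `^ k * sq2 z `^ (- k)).

Lemma sq2_gt0 z : 0 < z.2 -> 0 < sq2 z.
Proof. by move=> z0; rewrite /sq2 ltr_wpDl // -?expr2 ?sqr_ge0 // exprn_gt0. Qed.

Lemma smD_barrier D a c k : smD (upper D) (barrier a c k).
Proof.
have p (t : R * R) : upper D t -> 0 < t.2 by case.
have p2 (t : R * R) : upper D t -> 0 < sq2 t by move=> /p; exact: sq2_gt0.
have sy := smD_powR k (@smD_snd (upper D)) p.
have ss := smD_powR (- k) (@smD_sq2 (upper D)) p2.
exact: smDD (smDM (@smD_cst _ _ _ a) sy) (smDM (@smD_cst _ _ _ c) (smDM sy ss)).
Qed.

Lemma laplZ D (a : R) (h : R * R -> R) z : hopen D -> smD D h -> D z ->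
  lapl (fun z => a * h z) z = a * lapl h z.
Proof.
move=> oD sh Dz; have sa := @smD_cst _ _ D a.
rewrite (laplM oD sa sh Dz) /lapl dx_cst (dy_cst _ oD Dz).
rewrite (dx_eqD oD (smD_dx oD sa) Dz (h' := fun=> (0 : R))); last by move=> t _; exact: dx_cst.
rewrite (dy_eqD oD (smD_dy oD sa) Dz (h' := fun=> (0 : R))); last by move=> t Dt; exact: (dy_cst _ oD Dt).
by rewrite dx_cst (dy_cst _ oD Dz) !(mul0r, mulr0, addr0, add0r).
Qed.

Lemma lapl_barrier D a c k z : hopen D -> upper D z ->
  lapl (barrier a c k) z = k * (k - 1) * z.2 `^ (k - 2) * (a + c * sq2 z `^ (- k)).
Proof.
move=> oD Uz; have oU := hopen_upper oD.
have p (t : R * R) : upper D t -> 0 < t.2 by case.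
have p2 (t : R * R) : upper D t -> 0 < sq2 t by move=> /p; exact: sq2_gt0.
have sy := smD_powR k (@smD_snd (upper D)) p.
have ss := smD_powR (- k) (@smD_sq2 (upper D)) p2.
have [sa sc] := (@smD_cst _ _ (upper D) a, @smD_cst _ _ (upper D) c).
rewrite /barrier (laplD oU (smDM sa sy) (smDM sc (smDM sy ss)) Uz).
rewrite (laplZ a oU sy Uz) (laplZ c oU (smDM sy ss) Uz) (laplM oU sy ss Uz).
rewrite (lapl_powR k oU (@smD_snd _) p Uz) (lapl_powR (- k) oU (@smD_sq2 _) p2 Uz).
rewrite (dx_powR _ oU (@smD_snd _) p Uz) (dy_powR _ oU (@smD_snd _) p Uz).
rewrite (dx_powR _ oU (@smD_sq2 _) p2 Uz) (dy_powR _ oU (@smD_sq2 _) p2 Uz).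
have [-> -> ->] := sq2_facts oU Uz.
rewrite (dx_snd oU Uz) (dy_snd oU Uz) (lapl_snd oU Uz).
have s0 := p2 z Uz; have y0 := p z Uz.
have e1 : sq2 z `^ (- k - 1) = sq2 z `^ (- k - 2) * sq2 z.
  by rewrite -(powR_shift (- k - 1) s0); congr (_ `^ _ * _); ring.
have e2 : z.2 `^ k = z.2 `^ (k - 1) * z.2 by rewrite powR_shift.
rewrite e2 e1 /sq2.
move: (sq2 z `^ (- k)) (sq2 z `^ (- k - 2)) (z.2 `^ (k - 1)) (z.2 `^ (k - 2)) (z.1) (z.2) => S1 S2 Y1 Y2 x y.
ring.
Qed.

End Barrier.

Section PowR.
Variable R : realType.
Implicit Types (x y k : R).

Lemma powRVk x k : 0 < x -> x^-1 `^ k = x `^ (- k).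
Proof. by move=> x0; rewrite -(powR_inv1 (ltW x0)) -powRrM mulN1r. Qed.

Lemma powR_mono x y k : 0 <= k -> 0 <= x -> x <= y -> x `^ k <= y `^ k.
Proof. by move=> k0 x0 xy; apply: ge0_ler_powR => //; rewrite nnegrE // (le_trans x0). Qed.

Lemma powR2_le k : 0 <= k <= 1 -> (2 : R) `^ k <= 2.
Proof.
move=> /andP[k0 k1]; rewrite -{2}(powRr1 (ler0n R 2)).
by apply: ler_powR => //; rewrite ler1n.
Qed.

Lemma powR_dbl x y k : 0 <= k <= 1 -> 0 <= x -> x <= 2 * y -> 0 <= y -> x `^ k <= 2 * y `^ k.
Proof.
move=> /andP[k0 k1] x0 xy y0; apply: (le_trans (powR_mono k0 x0 xy)).
by rewrite powRM // ler_wpM2r ?powR_ge0 // powR2_le // k0.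
Qed.

End PowR.

(** * Decay on half-annuli *)

Section Decay.
Variable R : realType.
Implicit Types (D : set (R * R)) (z w : R * R).

Definition Ann (t r : R) : set (R * R) := [set z | t <= `|z| <= r /\ 0 <= z.2].

Lemma smD_norm_continuous D N (h : R * R -> 'rV[R]_N) (A : set (R * R)) : hopen D ->
  smD D h -> A `<=` D -> {within A, continuous (fun z => `|h z|)}.
Proof.
move=> oD sh AD; apply/subspace_continuousP => y Ay.
apply/cvgrPdist_lt => e e0; have [r r0 Hr] := smD_cvg oD sh (AD y Ay) e0.
apply: (near_norm r0) => t ty At; apply: le_lt_trans (ler_dist_dist _ _) _.
by rewrite distrC; apply: Hr => //; exact: AD.
Qed.

Lemma Ann_compact (t r e : R) : compact (Ann t r `&` [set z | e <= z.2]).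
Proof.
apply: (@subclosed_compact _ _ (box (0 : R * R) r)); last 2 first.
- exact: box_compact.
- by move=> z [[/andP[_ h1] h2] _]; split; rewrite ?subr0.
have -> : Ann t r `&` [set z | e <= z.2] = (fun z : R * R => `|z|) @^-1` [set x | t <= x] `&`
    (fun z : R * R => `|z|) @^-1` [set x | x <= r] `&`
    ((fun z : R * R => z.2) @^-1` [set x | 0 <= x] `&` (fun z : R * R => z.2) @^-1` [set x | e <= x]).
  rewrite predeqE => z; rewrite /Ann /=; split.
    by move=> [[/andP[-> ->] ->] ->].
  by move=> [[-> ->] [-> ->]].
have cn : continuous (fun z : R * R => `|z|) by move=> x; exact: norm_continuous.
have cs : continuous (fun z : R * R => z.2) by move=> x; exact: cvg_snd.
by apply: closedI; apply: closedI; apply: preimage_closed;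
  do [exact: closed_ge|exact: closed_le|move=> x _; exact: cn|move=> x _; exact: cs].
Qed.

Lemma mx_norm_attained N (v : 'rV[R]_N) : `|v| != 0 -> exists i, `|v 0 i| = `|v|.
Proof.
move=> v0; apply/not_existsP => H.
have lt i : `|v 0 i| < `|v| by rewrite lt_neqAle mx_norm_coord andbT; apply/eqP; exact: H.
have : `|v| < `|v|.
  rewrite {1}/Num.Def.normr/= mx_normrE bigmax_lt //.
    by rewrite lt_neqAle eq_sym v0 normr_ge0.
  by move=> [i j] _ /=; rewrite ord1.
by rewrite ltxx.
Qed.

Lemma sq2_norm z : `|z| ^+ 2 <= sq2 z <= 2 * `|z| ^+ 2.
Proof.
have a1 : `|z.1| ^+ 2 = z.1 * z.1 by rewrite real_normK ?num_real // expr2.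
have a2 : `|z.2| ^+ 2 = z.2 * z.2 by rewrite real_normK ?num_real // expr2.
have b1 : 0 <= `|z.1| by []. have b2 : 0 <= `|z.2| by [].
rewrite /sq2 -a1 -a2 prod_normE /=; move: (`|z.1|) (`|z.2|) b1 b2 => a b a0 b0.
by case: (leP a b) => h; apply/andP; split; nra.
Qed.

Lemma snd_le_norm z : `|z.2| <= `|z|.
Proof. by rewrite prod_normE le_max lexx orbT. Qed.

Section Annulus.
Variables (D : set (R * R)) (N : nat) (b : R * R -> 'rV[R]_N) (t r0 M X eta k : R).
Hypothesis oD : hopen D.
Hypothesis sb : smD D b.
Hypothesis t0 : 0 < t.
Hypothesis r00 : 0 < r0.
Hypothesis AD : Ann t r0 `<=` D.
Hypothesis M0 : 0 < M.
Hypothesis X0 : 0 <= X.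
Hypothesis k01 : 0 < k < 1.
Hypothesis hb : forall z, Ann t r0 z -> `|b z| <= M * (z.2 / `|z|).
Hypothesis eta0 : 0 <= eta.
Hypothesis eta1 : eta <= k * (1 - k) / 16.
Hypothesis hl : forall z, Ann t r0 z -> 2 * t <= `|z| -> `|z| <= r0 / 2 ->
  forall sigma, (forall s, box z (`|z| / 4) s -> `|b s| <= sigma) ->
  `|lapl b z| <= eta / `|z| ^+ 2 * (sigma + X * `|z| `^ k).

Let k0 : 0 < k. Proof. by case/andP: k01. Qed.
Let k1 : k < 1. Proof. by case/andP: k01. Qed.
Let kk : 0 <= k <= 1. Proof. by rewrite !ltW. Qed.
(** Normalised so that [B] is at least of order [(y / |z|)^k] both at [|z| = r0] and at [|z| = t],
    whatever the ratio [t / r0]; [g] majorises [B] by a function of [|z|] alone. *)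
Let B := barrier (r0 `^ (- k)) (t `^ k) k.
Let g (z : R * R) := (`|z| / r0) `^ k + (t / `|z|) `^ k.
Let K := 4 * M + X * r0 `^ k.

Let nz z : Ann t r0 z -> 0 < `|z|.
Proof. by move=> [/andP[h _] _]; exact: lt_le_trans h. Qed.

Let BE z : 0 < z.2 -> B z = (z.2 / r0) `^ k + (t * (z.2 / sq2 z)) `^ k.
Proof.
move=> z0; have s0 := sq2_gt0 z0; have y0 := ltW z0.
rewrite /B /barrier !powRM ?invr_ge0 ?divr_ge0 ?(ltW t0) ?(ltW s0) ?(ltW r00) //.
by rewrite !powRVk // (mulrC (z.2 `^ k) (r0 `^ _)).
Qed.

Let B_gt0 z : 0 < z.2 -> 0 < B z.
Proof.
move=> z0; rewrite BE //; apply: addr_gt0; apply: powR_gt0; first exact: divr_gt0.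
by rewrite mulr_gt0 // divr_gt0 // sq2_gt0.
Qed.

Let g_gt0 z : Ann t r0 z -> 0 < g z.
Proof. by move=> Az; apply: addr_gt0; apply: powR_gt0; rewrite divr_gt0 // nz. Qed.

Let B_le_g z : Ann t r0 z -> 0 < z.2 -> B z <= g z.
Proof.
move=> Az z0; rewrite BE //; have n0 := nz Az.
have yn : z.2 <= `|z| by apply: le_trans (snd_le_norm z); exact: ler_norm.
have s0 := sq2_gt0 z0.
apply: lerD; apply: powR_mono; try exact: ltW.
- by rewrite divr_ge0 // ltW.
- by rewrite ler_pM2r ?invr_gt0.
- by rewrite mulr_ge0 ?divr_ge0 // ltW.
rewrite ler_wpM2l ?(ltW t0) // ler_pdivrMr // mulrC ler_pdivlMr //.
have /andP[h _] := sq2_norm z; apply: le_trans h.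
by rewrite expr2 ler_wpM2r // ltW.
Qed.

(** A comparison of Harnack type: on the square of size [|z| / 4] the norm stays between 3/4 and 5/4
    of [|z|], which costs a factor at most 2 as [k <= 1]. *)
Let near_bound z s : Ann t r0 z -> 2 * t <= `|z| -> `|z| <= r0 / 2 -> box z (`|z| / 4) s ->
  Ann t r0 s /\ (0 < s.2 -> B s <= 2 * g z).
Proof.
move=> Az h1 h2 [bs s0]; have n0 := nz Az.
have l1 : `|s| <= 5 / 4 * `|z|.
  have -> : s = (s - z) + z by rewrite subrK.
  by apply: le_trans (ler_normD _ _) _; lra.
have l2 : 3 / 4 * `|z| <= `|s|.
  have : `|z| <= `|z - s| + `|s| by rewrite -{1}(subrK s z) ler_normD.
  by rewrite distrC; lra.
have As : Ann t r0 s.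
  by split => //; apply/andP; split; lra.
split => // sp; rewrite BE // /g mulrDr; have ns := nz As.
have ys : s.2 <= `|s| by apply: le_trans (snd_le_norm s); exact: ler_norm.
have q0 := sq2_gt0 sp.
apply: lerD; apply: (powR_dbl kk).
- by rewrite divr_ge0 // ltW.
- by rewrite mulrA ler_pM2r ?invr_gt0 //; lra.
- by rewrite divr_ge0 // ltW.
- by rewrite mulr_ge0 ?divr_ge0 // ltW.
- rewrite [leRHS]mulrCA ler_wpM2l ?(ltW t0) // ler_pdivrMr // mulrAC ler_pdivlMr //.
  have /andP[h _] := sq2_norm s.
  apply: (@le_trans _ _ (2 * `|s| ^+ 2)); last by rewrite ler_wpM2l.
  by rewrite expr2; nra.
- by rewrite divr_ge0 // ltW.
Qed.

Let lapl_bound z : Ann t r0 z -> 0 < z.2 ->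
  lapl B z <= - (k * (1 - k) / 2 / `|z| ^+ 2 * g z).
Proof.
move=> Az z0; have n0 := nz Az; have Uz : upper D z by split; [exact: AD|].
have yn : z.2 <= `|z| by apply: le_trans (snd_le_norm z); exact: ler_norm.
have s0 := sq2_gt0 z0.
rewrite /B (lapl_barrier _ _ _ oD Uz).
have -> : k * (k - 1) * z.2 `^ (k - 2) * (r0 `^ (- k) + t `^ k * sq2 z `^ (- k)) =
  - (k * (1 - k) * (z.2 `^ (k - 2) * (r0 `^ (- k) + t `^ k * sq2 z `^ (- k)))) by ring.
rewrite lerN2 -!mulrA ler_wpM2l ?(ltW k0) // ler_wpM2l ?subr_ge0 ?(ltW k1) //.
have e1 (x : R) : 0 < x -> x `^ (k - 2) = (x `^ (2 - k))^-1.
  by move=> x0; rewrite -powRN opprB.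
have P1 : `|z| `^ (k - 2) <= z.2 `^ (k - 2).
  rewrite !e1 // lef_pV2 ?posrE ?powR_gt0 //.
  by apply: powR_mono; rewrite ?subr_ge0 ?(ltW z0) // (le_trans (ltW k1)) // ler1n.
have P2 : `|z| `^ (k - 2) = (`|z| ^+ 2)^-1 * `|z| `^ k.
  rewrite powRD ?(gt_eqF n0) ?implybT // mulrC; congr (_ * _).
  by rewrite (powR_invn 2 (ltW n0)).
apply: (@le_trans _ _ (`|z| `^ (k - 2) * (r0 `^ (- k) + t `^ k * sq2 z `^ (- k)))); last first.
  by rewrite ler_wpM2r // addr_ge0 ?mulr_ge0 ?powR_ge0.
rewrite P2 mulrCA -mulrA ler_wpM2l ?invr_ge0 ?sqr_ge0 // /g mulrDr mulrDr.
have ge : (`|z| / r0) `^ k = `|z| `^ k * r0 `^ (- k).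
  by rewrite powRM ?invr_ge0 ?(ltW r00) // powRVk.
have gt : (t / `|z|) `^ k = t `^ k * `|z| `^ (- k).
  by rewrite powRM ?invr_ge0 ?(ltW t0) // powRVk.
apply: lerD.
  rewrite ge; have := mulr_ge0 (powR_ge0 `|z| k) (powR_ge0 r0 (- k)).
  by move: (`|z| `^ k * r0 `^ (- k)) => a a0; lra.
rewrite gt mulrCA [leRHS]mulrCA ler_wpM2l ?powR_ge0 //.
have h : sq2 z `^ k <= 2 * (`|z| ^+ 2) `^ k.
  apply: powR_dbl => //; first exact: ltW.
  by have /andP[_] := sq2_norm z.
have e2 : (`|z| ^+ 2) `^ k = `|z| `^ k * `|z| `^ k by rewrite expr2 powRM.
rewrite e2 in h; rewrite !powRN.
have [p1 p2] : 0 < sq2 z `^ k /\ 0 < `|z| `^ k by split; exact: powR_gt0.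
move: (sq2 z `^ k) (`|z| `^ k) h p1 p2 => a c h a0 c0.
rewrite ler_pdivlMr //; have -> : 2^-1 / c * a = a / (2 * c) by field; rewrite gt_eqF.
by rewrite ler_pdivrMr ?mulr_gt0 //; lra.
Qed.

(** In the two collars no differential inequality is available; there the given bound on [b] is
    already below the barrier, since [y / |z| <= (y / |z|)^k]. The inner collar produces the factor
    4. *)
Let edge z : Ann t r0 z -> 0 < z.2 -> `|z| <= 2 * t \/ r0 / 2 <= `|z| -> `|b z| <= 4 * M * B z.
Proof.
move=> Az z0 e; have n0 := nz Az.
have yn : z.2 <= `|z| by apply: le_trans (snd_le_norm z); exact: ler_norm.
apply: le_trans (hb Az) _; rewrite [4 * M]mulrC -mulrA ler_wpM2l ?(ltW M0) //.
have y1 : z.2 / `|z| <= (z.2 / `|z|) `^ k.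
  by apply: ger1_powR; rewrite ?(ltW k1) // divr_gt0 //= ler_pdivrMr // mul1r.
apply: le_trans y1 _; rewrite BE //.
have p1 := powR_ge0 (z.2 / r0) k; have p2 := powR_ge0 (t * (z.2 / sq2 z)) k.
case: e => e.
  have h : (z.2 / `|z|) `^ k <= 2 * (2 * (t * (z.2 / sq2 z)) `^ k); last first.
    by rewrite mulrA -natrM in h; lra.
  have S0 := sq2_gt0 z0.
  apply: (@le_trans _ _ (2 * (z.2 / (2 * `|z|)) `^ k)).
    apply: (powR_dbl kk); [by rewrite divr_ge0 // ltW| |by rewrite divr_ge0 ?mulr_ge0 // ltW].
    have -> // : 2 * (z.2 / (2 * `|z|)) = z.2 / `|z| by field; rewrite gt_eqF.
  rewrite ler_wpM2l //; apply: (powR_dbl kk).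
  - by rewrite divr_ge0 ?mulr_ge0 // ltW.
  - rewrite ler_pdivrMr ?mulr_gt0 //.
    have -> : 2 * (t * (z.2 / sq2 z)) * (2 * `|z|) = z.2 * (4 * t * `|z|) / sq2 z.
      by field; rewrite gt_eqF.
    rewrite ler_pdivlMr // ler_wpM2l ?(ltW z0) //.
    by have /andP[_ h] := sq2_norm z; apply: le_trans h _; rewrite expr2; nra.
  - by rewrite mulr_ge0 ?divr_ge0 // ltW.
have h : (z.2 / `|z|) `^ k <= 2 * (z.2 / r0) `^ k; last by lra.
apply: (powR_dbl kk); [by rewrite divr_ge0 // ltW| |by rewrite divr_ge0 // ltW].
rewrite ler_pdivrMr //; have -> : 2 * (z.2 / r0) * `|z| = z.2 * (2 * `|z|) / r0 by field; rewrite gt_eqF.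
by rewrite ler_pdivlMr // ler_wpM2l ?(ltW z0) //; lra.
Qed.

(** If the ratio [|b| / B] exceeded [K], its maximum [Ss] would be attained off the collars and off
    the axis. There [|lapl b|] is at most [3 eta Ss g / |z|^2], while [- Ss lapl B] is at least
    [k (1 - k) / 2] times [Ss g / |z|^2], which is larger by the bound on [eta]. The component of
    [b] that attains the norm then contradicts the maximum principle. *)
Let main z : Ann t r0 z -> 0 < z.2 -> `|b z| <= K * B z.
Proof.
move=> Az1 z10; rewrite leNgt; apply/negP => ab.
have p0 : 0 < r0 `^ k by rewrite powR_gt0.
have K0 : 0 < K by rewrite ltr_pwDl ?mulr_gt0 ?mulr_ge0 // ltW.
have K4 : 4 * M <= K by rewrite lerDl mulr_ge0 // ltW.
pose c0 := K * r0 `^ (- k) * t / M.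
have c00 : 0 < c0 by rewrite divr_gt0 ?mulr_gt0 // powR_gt0.
(* Below this height the bound [M y / t] on [b] is at most [K (y / r0)^k]. This keeps the axis,
   where [B] vanishes, away from the domain of the ratio. *)
pose e := c0 `^ ((1 - k)^-1).
have k10 : 0 < 1 - k by rewrite subr_gt0.
have low s : Ann t r0 s -> 0 < s.2 -> s.2 <= e -> `|b s| <= K * B s.
  move=> As s0 se; apply: le_trans (hb As) _; have ns := nz As.
  have /andP[ts _] := As.1.
  apply: (@le_trans _ _ (M * (s.2 / t))).
    by rewrite ler_wpM2l ?(ltW M0) // ler_wpM2l ?(ltW s0) // lef_pV2.
  apply: (@le_trans _ _ (K * (s.2 / r0) `^ k)); last first.
    by rewrite ler_wpM2l ?(ltW K0) // BE // lerDl powR_ge0.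
  have h : s.2 `^ (1 - k) <= c0.
    apply: (@le_trans _ _ (e `^ (1 - k))); first by apply: powR_mono; rewrite ?(ltW s0) ?(ltW k10).
    by rewrite /e -powRrM mulVf ?gt_eqF // powRr1 // ltW.
  have e1 : s.2 = s.2 `^ (1 - k) * s.2 `^ k.
    by rewrite -powRD ?(gt_eqF s0) ?implybT // subrK powRr1 // ltW.
  rewrite {1}e1 powRM ?invr_ge0 ?(ltW s0) ?(ltW r00) // powRVk //.
  have -> : M * (s.2 `^ (1 - k) * s.2 `^ k / t) = (M / t * s.2 `^ (1 - k)) * s.2 `^ k by ring.
  rewrite [s.2 `^ k * _]mulrC mulrA ler_wpM2r ?powR_ge0 //.
  apply: (@le_trans _ _ (M / t * c0)); first by rewrite ler_wpM2l // divr_ge0 ?(ltW M0) ?(ltW t0).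
  by rewrite /c0 le_eqVlt; apply/orP; left; apply/eqP; field; rewrite !gt_eqF.
have ez : e <= z.2.
  by rewrite leNgt; apply/negP => h; move: ab; rewrite ltNge low // ltW.
have e0 : 0 < e by rewrite powR_gt0.
pose T := Ann t r0 `&` [set s | e <= s.2].
have TU : T `<=` upper D by move=> s [As es]; split; [exact: AD|exact: lt_le_trans es].
pose rho s := b s *m ((B s)^-1)%:M.
have oU := hopen_upper oD.
have sB : smD (upper D) B by exact: smD_barrier.
have sbU := smD_sub (@upper_sub R D) sb.
have srho : smD (upper D) rho.
  apply: smD_mulmx sbU _; apply: smD_mx => i j.
  have sBi : smD (upper D) (fun s => B s `^ (-1)).
    by apply: smD_powR sB _ => s [_]; exact: B_gt0.
  apply: (smD_congr _ (smDM sBi (@smD_cst _ _ (upper D) ((i == j)%:R : R)))) => s [_ s0].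
  by rewrite mxE powR_inv1 ?(ltW (B_gt0 s0)) // mulr_natr.
have rn s : 0 < s.2 -> `|rho s| = `|b s| / B s.
  by move=> s0; rewrite /rho mul_mx_scalar normrZ gtr0_norm ?invr_gt0 ?B_gt0 // mulrC.
have T0 : T !=set0 by exists z.
have [zs Tzs maxz] := compact_EVT_max T0 (@Ann_compact t r0 e) (smD_norm_continuous oU srho TU).
rewrite inE in Tzs; have [As es] := Tzs.
have s0 : 0 < zs.2 := lt_le_trans e0 es.
pose Ss := `|b zs| / B zs.
have SK : K < Ss.
  apply: (@lt_le_trans _ _ (`|b z| / B z)); first by rewrite ltr_pdivlMr ?B_gt0.
  by rewrite /Ss -!rn //; apply: maxz; rewrite inE.
have Sp := lt_trans K0 SK.
have bzs : `|b zs| = Ss * B zs by rewrite /Ss divfK // gt_eqF // B_gt0.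
have bound s : Ann t r0 s -> 0 < s.2 -> `|b s| <= Ss * B s.
  move=> Asn sp; have [le|gt] := leP e s.2.
    have : `|rho s| <= `|rho zs| by apply: maxz; rewrite inE.
    by rewrite !rn // -/Ss ler_pdivrMr // B_gt0.
  apply: le_trans (low s Asn sp (ltW gt)) _.
  by rewrite ler_wpM2r ?(ltW SK) // ltW // B_gt0.
have inner : 2 * t < `|zs| < r0 / 2.
  apply/andP; rewrite !ltNge; split; apply/negP => h.
    have := edge As s0 (or_introl h); rewrite bzs ler_pM2r ?B_gt0 // => h2.
    by have := lt_le_trans SK (le_trans h2 K4); rewrite ltxx.
  have := edge As s0 (or_intror h); rewrite bzs ler_pM2r ?B_gt0 // => h2.
  by have := lt_le_trans SK (le_trans h2 K4); rewrite ltxx.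
case/andP: inner => in1 in2.
have n0 := nz As; have g0 := g_gt0 As.
(* The local supremum in the hypothesis on [lapl b] is estimated through the maximal ratio [Ss]
   itself. *)
have lb : `|lapl b zs| <= eta / `|zs| ^+ 2 * (2 * g zs * Ss + X * `|zs| `^ k).
  apply: (hl As (ltW in1) (ltW in2)) => s Bs.
  have [Asn Bg] := near_bound As (ltW in1) (ltW in2) Bs.
  have [sz|sz] := eqVneq s.2 0.
    apply: le_trans (hb Asn) _; rewrite sz mul0r mulr0.
    by apply: mulr_ge0 (ltW Sp); apply: mulr_ge0 (ltW g0); exact: ler0n.
  have sp : 0 < s.2 by rewrite lt_neqAle eq_sym sz; exact: Asn.2.
  apply: le_trans (bound s Asn sp) _; rewrite mulrC ler_wpM2r ?(ltW Sp) //.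
  exact: Bg.
have [i bi] : exists i, `|b zs 0 i| = `|b zs|.
  by apply: mx_norm_attained; rewrite bzs mulf_neq0 // gt_eqF // B_gt0.
pose sg := Num.sg (b zs 0 i).
have sgn : `|sg| <= 1 by rewrite normr_sg; case: (b zs 0 i != 0).
pose F s := sg * b s 0 i + (- Ss) * B s.
have sbi := smD_coord 0 i sbU.
have s1 := smDM (@smD_cst _ _ (upper D) sg) sbi.
have s2 := smDM (@smD_cst _ _ (upper D) (- Ss)) sB.
have Uz := TU zs Tzs.
have L : lapl F zs <= 0.
  apply: (max_lapl oU (smDD s1 s2) Uz); last by move=> zs20; move: s0; rewrite zs20 ltxx.
  have d0 : 0 < Num.min (`|zs| - 2 * t) (r0 / 2 - `|zs|) by rewrite lt_min !subr_gt0 in1.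
  apply: (near_norm d0) => s; rewrite lt_min => /andP[d1 d2] [_ sp].
  have F0 : F zs = 0.
    by rewrite /F mulNr -bzs -bi /sg -normrEsg subrr.
  have Asn : Ann t r0 s.
    have l1 : `|s| <= `|s - zs| + `|zs| by rewrite -{1}(subrK zs s) ler_normD.
    have l2 : `|zs| <= `|s - zs| + `|s| by rewrite distrC -{1}(subrK s zs) ler_normD.
    split; last exact: ltW.
    have ar (a1 a2 a3 : R) : a1 < a3 - 2 * t -> a1 < r0 / 2 - a3 -> a2 <= a1 + a3 -> a3 <= a1 + a2 ->
      t <= a2 <= r0.
      by move: t0 r00 => ? ? ? ? ? ?; apply/andP; split; lra.
    exact: ar d1 d2 l1 l2.
  change (F s <= F zs); rewrite F0 /F mulNr subr_le0; apply: le_trans (bound s Asn sp).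
  apply: le_trans (ler_norm _) _; rewrite normrM.
  by apply: le_trans (mx_norm_coord (b s) 0 i); rewrite ler_piMl.
have lF : lapl F zs = sg * lapl b zs 0 i - Ss * lapl B zs.
  rewrite /F (laplD oU s1 s2 Uz) (laplZ sg oU sbi Uz) (laplZ (- Ss) oU sB Uz) mulNr.
  by rewrite (lapl_coord 0 i oU sbU Uz).
rewrite lF subr_le0 in L.
have lBz := lapl_bound As s0.
have c1 : Ss * lapl B zs <= Ss * - (k * (1 - k) / 2 / `|zs| ^+ 2 * g zs) by rewrite ler_wpM2l // ltW.
have c2 : - `|lapl b zs| <= sg * lapl b zs 0 i.
  rewrite lerNl -mulrN; apply: le_trans (ler_norm _) _; rewrite normrM normrN.
  by apply: le_trans (mx_norm_coord (lapl b zs) 0 i); rewrite ler_piMl.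
have c3 : X * `|zs| `^ k <= Ss * g zs.
  have -> : X * `|zs| `^ k = X * r0 `^ k * (`|zs| / r0) `^ k.
    rewrite -mulrA -powRM ?divr_ge0 ?(ltW r00) //; congr (_ * _ `^ _).
    by field; rewrite gt_eqF.
  apply: ler_pM; rewrite ?mulr_ge0 ?powR_ge0 //.
    by apply: le_trans (ltW SK); rewrite /K lerDr mulr_ge0 // ltW.
  by rewrite /g lerDl powR_ge0.
have c4 : `|lapl b zs| <= eta / `|zs| ^+ 2 * (3 * (Ss * g zs)).
  apply: le_trans lb _; rewrite ler_wpM2l ?divr_ge0 ?sqr_ge0 //; lra.
have q0 : 0 < `|zs| ^- 2 * (Ss * g zs) by rewrite mulr_gt0 ?invr_gt0 ?exprn_gt0 // mulr_gt0.
have c5 : k * (1 - k) / 2 * (`|zs| ^- 2 * (Ss * g zs)) <= 3 * eta * (`|zs| ^- 2 * (Ss * g zs)).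
  have e1 : Ss * - (k * (1 - k) / 2 / `|zs| ^+ 2 * g zs) = - (k * (1 - k) / 2 * (`|zs| ^- 2 * (Ss * g zs))) by ring.
  have e2 : eta / `|zs| ^+ 2 * (3 * (Ss * g zs)) = 3 * eta * (`|zs| ^- 2 * (Ss * g zs)) by ring.
  rewrite e1 in c1; rewrite e2 in c4; lra.
rewrite ler_pM2r // in c5.
have kp : 0 < k * (1 - k) by rewrite mulr_gt0.
have ar (xx yy : R) : yy <= xx / 16 -> xx / 2 <= 3 * yy -> 0 < xx -> False by move=> ? ? ?; lra.
exact: ar eta1 c5 kp.
Qed.

Lemma decay_annulus z : Ann t r0 z ->
  `|b z| <= (4 * M + X * r0 `^ k) * ((`|z| / r0) `^ k + (t / `|z|) `^ k).
Proof.
move=> Az; have K0 : 0 <= K by rewrite addr_ge0 // mulr_ge0 ?powR_ge0 // ltW.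
have [z0|z0] := eqVneq z.2 0.
  apply: le_trans (hb Az) _; rewrite z0 mul0r mulr0 mulr_ge0 //.
  by rewrite addr_ge0 // powR_ge0.
have zp : 0 < z.2 by rewrite lt_neqAle eq_sym z0; exact: Az.2.
apply: le_trans (main Az zp) _; rewrite ler_wpM2l //; exact: B_le_g.
Qed.

End Annulus.

End Decay.

(** * Linear decay towards the axis *)

Section Boundary.
Variable R : realType.
Implicit Types (D : set (R * R)) (z : R * R).

Definition pbox (r : R) : set (R * R) := [set z | 0 < `|z| <= r /\ 0 <= z.2].

(** The barrier [h = K y - c y^(3/2)] has Laplacian [- (C + 1) y^(-1/2)], strictly beyond what [b]
    can match; the factor 4/3 in [c] undoes [3/2 * 1/2]. The domain is not compact at the puncture:
    a slack [ep] covers a neighbourhood of 0, where [|b| <= M |z|^k] is small, and is then sent to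
    0. *)
Lemma linear_barrier D N (b : R * R -> 'rV[R]_N) (r M C k : R) : hopen D -> smD D b ->
  0 < r -> 0 < M -> 0 <= C -> 0 < k -> pbox r `<=` D ->
  (forall z, pbox r z -> `|b z| <= M * (z.2 / `|z|)) ->
  (forall z, pbox r z -> `|b z| <= M * `|z| `^ k) ->
  (forall z, pbox r z -> 0 < z.2 -> `|lapl b z| <= C * z.2 `^ (3 / 2 - 2)) ->
  exists2 K : R, 0 <= K & forall z, pbox r z -> `|b z| <= K * z.2.
Proof.
move=> oD sb r0 M0 C0 k0 rD hM hk hl.
pose c := 4 / 3 * (C + 1); have c0 : 0 < c by rewrite /c; lra.
(* Makes [h] at least [M y / r], which dominates [b] on the outer edge [|z| = r]. *)
pose K := M / r + c * r `^ 2^-1.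
have [M0w c0w r0w] := And3 (ltW M0) (ltW c0) (ltW r0).
have K0 : 0 <= K by apply: addr_ge0; [exact: divr_ge0|apply: mulr_ge0 => //; exact: powR_ge0].
exists K => // z1 z1r.
have [z10|z1n] := eqVneq z1.2 0.
  by have := hM z1 z1r; rewrite z10 mul0r !mulr0.
have z1p : 0 < z1.2 by rewrite lt_neqAle eq_sym z1n; exact: z1r.2.
pose h z := K * z.2 + (- c) * z.2 `^ (3 / 2).
have split32 z : 0 < z.2 -> z.2 `^ (3 / 2) = z.2 * z.2 `^ 2^-1.
  move=> z0; rewrite (_ : 3 / 2 = 1 + 2^-1 :> R); last by lra.
  by rewrite powRD ?(gt_eqF z0) ?implybT // powRr1 // ltW.
have hle z : pbox r z -> 0 < z.2 -> M / r * z.2 <= h z.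
  move=> zr z0; rewrite /h /K split32 //.
  have : z.2 `^ 2^-1 <= r `^ 2^-1.
    apply: powR_mono; rewrite ?invr_ge0 ?(ltW z0) //.
    have /andP[_ le] := zr.1; apply: le_trans le.
    by apply: le_trans (snd_le_norm z); rewrite ler_norm.
  rewrite -subr_ge0 => d0.
  have : 0 <= c * z.2 * (r `^ 2^-1 - z.2 `^ 2^-1) by rewrite mulr_ge0 // mulr_ge0 // ltW.
  by move: (r `^ _) (z.2 `^ _) => a1 a2; lra.
suff main : forall z, pbox r z -> 0 < z.2 -> `|b z| <= h z.
  apply: le_trans (main z1 z1r z1p) _.
  by rewrite /h mulNr gerBl mulr_ge0 ?powR_ge0 // ltW.
move=> z zr zp; apply/ler_addgt0Pl => ep ep0; rewrite leNgt; apply/negP => ab.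
pose del := (ep / M) `^ k^-1.
have del0 : 0 < del by apply: powR_gt0; exact: divr_gt0.
have inner s : pbox r s -> `|s| <= del -> `|b s| <= ep.
  move=> sr sd; apply: le_trans (hk s sr) _.
  have : `|s| `^ k <= del `^ k by apply: powR_mono => //; exact: ltW.
  rewrite /del -powRrM mulVf ?gt_eqF // powRr1 ?divr_ge0 ?(ltW ep0) ?(ltW M0) //.
  by rewrite ler_pdivlMr // mulrC.
pose e := ep * del / M; have e0 : 0 < e by rewrite divr_gt0 // mulr_gt0.
have low s : pbox r s -> s.2 <= e -> `|b s| <= ep.
  move=> sr se; have [sd|sd] := leP `|s| del; first exact: inner.
  apply: le_trans (hM s sr) _; rewrite mulrA ler_pdivrMr; last exact: lt_trans sd.
  apply: (@le_trans _ _ (M * e)); first by rewrite ler_wpM2l // ltW.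
  rewrite /e mulrC divfK ?gt_eqF // ler_wpM2l ?(ltW ep0) //; exact: ltW.
have hpos s : pbox r s -> 0 < s.2 -> 0 <= h s.
  by move=> sr sp; apply: le_trans (hle s sr sp); rewrite mulr_ge0 ?divr_ge0 // ltW.
have edge s : pbox r s -> 0 < s.2 -> ep < `|b s| - h s -> [/\ del < `|s|, `|s| < r & e < s.2].
  move=> sr sp es; have hs := hpos s sr sp.
  have bs : ep < `|b s| by apply: lt_le_trans es _; rewrite gerBl.
  split; rewrite ltNge; apply/negP => le.
  - by have := lt_le_trans bs (inner s sr le); rewrite ltxx.
  - have sE : `|s| = r by apply/eqP; rewrite eq_le le andbT; have /andP[] := sr.1.
    have := hM s sr; rewrite sE => h1; have h2 := hle s sr sp.
    have h3 : M * (s.2 / r) = M / r * s.2 by ring.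
    by rewrite h3 in h1; have := le_trans h1 h2; rewrite leNgt -subr_gt0 (lt_trans ep0 es).
  - by have := lt_le_trans bs (low s sr le); rewrite ltxx.
have abz : ep < `|b z| - h z by rewrite ltrBrDr.
have oU := hopen_upper oD.
pose T := Ann del r `&` [set s | e <= s.2].
have Tr s : T s -> pbox r s /\ 0 < s.2.
  move=> [[/andP[h1 h2] h3] h4]; split; last exact: lt_le_trans h4.
  by split=> //; rewrite h2 (lt_le_trans del0 h1).
have TU : T `<=` upper D by move=> s /Tr[sr sp]; split => //; exact: rD.
have sh0 : smD (upper D) (fun z : R * R => z.2 `^ (3 / 2)).
  by apply: smD_powR (@smD_snd R (upper D)) _ => s [].
have s1h := smDM (@smD_cst _ _ (upper D) K) (@smD_snd R (upper D)).
have s2h := smDM (@smD_cst _ _ (upper D) (- c)) sh0.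
have sh : smD (upper D) h := smDD s1h s2h.
have sbU := smD_sub (@upper_sub R D) sb.
have ct : {within T, continuous (fun z => `|b z| - h z)}.
  have c1 := smD_norm_continuous oU sbU TU; have c2 := within_continuousD oU sh TU.
  apply/subspace_continuousP => s Ts; apply: cvgB.
    by move/subspace_continuousP: c1; exact.
  by move/subspace_continuousP: c2; exact.
have Tz : T z.
  by have [h1 h2 h3] := edge z zr zp abz; split; [split; [rewrite !ltW|exact: ltW]|exact: ltW].
have T0 : T !=set0 by exists z.
have [zs Tzs maxz] := compact_EVT_max T0 (@Ann_compact R del r e) ct.
rewrite inE in Tzs; have [zsr zsp] := Tr _ Tzs.
have mz : ep < `|b zs| - h zs by apply: lt_le_trans abz _; apply: maxz; rewrite inE.
have [in1 in2 in3] := edge zs zsr zsp mz.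
have bz0 : 0 < `|b zs|.
  by apply: lt_le_trans (lt_trans ep0 mz) _; rewrite gerBl; exact: hpos.
have [i bi] : exists i, `|b zs 0 i| = `|b zs| by apply: mx_norm_attained; rewrite gt_eqF.
pose sg := Num.sg (b zs 0 i).
have sgn : `|sg| <= 1 by rewrite normr_sg; case: (b zs 0 i != 0).
pose F s := sg * b s 0 i + (-1) * h s.
have sbi := smD_coord 0 i sbU.
have f1 := smDM (@smD_cst _ _ (upper D) sg) sbi.
have f2 := smDM (@smD_cst _ _ (upper D) (-1 : R)) sh.
have Uz := TU zs Tzs.
have L : lapl F zs <= 0.
  apply: (max_lapl oU (smDD f1 f2) Uz); last by move=> zs20; move: zsp; rewrite zs20 ltxx.
  have d0 : 0 < Num.min (`|zs| - del) (r - `|zs|) by rewrite lt_min !subr_gt0 in1.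
  apply: (near_norm d0) => s; rewrite lt_min => /andP[d1 d2] [_ sp].
  have sA : del < `|s| < r.
    have l1 : `|s| <= `|s - zs| + `|zs| by rewrite -{1}(subrK zs s) ler_normD.
    have l2 : `|zs| <= `|s - zs| + `|s| by rewrite distrC -{1}(subrK s zs) ler_normD.
    have ar (a1 a2 a3 : R) : a1 < a3 - del -> a1 < r - a3 -> a2 <= a1 + a3 -> a3 <= a1 + a2 ->
      del < a2 < r by move=> ? ? ? ?; apply/andP; split; lra.
    exact: ar d1 d2 l1 l2.
  have /andP[a1 a2] := sA.
  have sr : pbox r s by split; [rewrite (lt_trans del0 a1) ltW|exact: ltW].
  have Fz : F zs = `|b zs| - h zs by rewrite /F mulN1r -bi /sg -normrEsg.
  have Fs : F s <= `|b s| - h s.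
    rewrite /F mulN1r lerD2r; apply: le_trans (ler_norm _) _; rewrite normrM.
    by apply: le_trans (mx_norm_coord (b s) 0 i); rewrite ler_piMl.
  change (F s <= F zs); apply: le_trans Fs _; rewrite Fz.
  have [le|gt] := leP e s.2.
    by apply: maxz; rewrite inE; split => //; split; [rewrite !ltW|exact: ltW].
  apply: le_trans (ltW mz); apply: le_trans (low s sr (ltW gt)); rewrite gerBl; exact: hpos.
have lF : lapl F zs = sg * lapl b zs 0 i + (-1) * lapl h zs.
  by rewrite /F (laplD oU f1 f2 Uz) (laplZ sg oU sbi Uz) (laplZ (-1) oU sh Uz) (lapl_coord 0 i oU sbU Uz).
have lh : lapl h zs = - (C + 1) * zs.2 `^ (3 / 2 - 2).
  rewrite /h (laplD oU s1h s2h Uz) (laplZ K oU (@smD_snd R (upper D)) Uz) (laplZ (- c) oU sh0 Uz).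
  rewrite (lapl_snd oU Uz) (lapl_ypow _ oU Uz) // /c.
  by move: (_ `^ _) => a; field.
have c2 : - `|lapl b zs| <= sg * lapl b zs 0 i.
  rewrite lerNl -mulrN; apply: le_trans (ler_norm _) _; rewrite normrM normrN.
  by apply: le_trans (mx_norm_coord (lapl b zs) 0 i); rewrite ler_piMl.
have c3 := hl zs zsr zsp.
have c4 : 0 < zs.2 `^ (3 / 2 - 2) by exact: powR_gt0.
rewrite lF lh in L; move: (zs.2 `^ (3 / 2 - 2)) (sg * _) L c2 c3 c4 => a s L c2 c3 c4.
move: (`|lapl b zs|) c2 c3 => v c2 c3; lra.
Qed.

End Boundary.

(** * Gradient bound up to the puncture *)

Section Puncture.
Variables (R : realType) (m N : nat) (I : pred 'I_N) (Om : set 'rV[R]_m).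
Variables (E : 'rV[R]_m -> 'M[R]_(N, m)) (A : 'rV[R]_m -> 'M[R]_N).
Local Notation SYS := (sys I Om E A).
Local Notation P := (projI R I).
Variable q : 'rV[R]_m.
Hypothesis Omq : Om q.
Hypothesis oO : open Om.
Hypothesis sE : smooth_on Om E.
Hypothesis sA : smooth_on Om A.
Hypothesis Aq2 : A q *m A q = - 1%:M.
Hypothesis Aqs : forall j i, ~~ I j -> ~~ I i -> A q j i = 0.

Lemma pbox_box (r : R) z s : pbox (r / 2) z -> box z (`|z| / 4) s ->
  pbox r s /\ `|s| <= 2 * `|z|.
Proof.
move=> [/andP[z0 zr] _] [bs s0].
have l1 : `|s| <= `|s - z| + `|z| by rewrite -{1}(subrK z s) ler_normD.
have l2 : `|z| <= `|s - z| + `|s| by rewrite distrC -{1}(subrK s z) ler_normD.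
have ar (a1 a2 a3 : R) : a1 <= a3 / 4 -> 0 < a3 -> a3 <= r / 2 -> a2 <= a1 + a3 -> a3 <= a1 + a2 ->
  [/\ 0 < a2, a2 <= r & a2 <= 2 * a3] by move=> ? ? ? ? ?; split; lra.
have [h1 h2 h3] := ar _ _ _ bs z0 zr l1 l2.
by split => //; split => //; rewrite h1.
Qed.

Lemma pbox_sub (r r' : R) : r <= r' -> pbox r `<=` pbox r'.
Proof. by move=> rr z [/andP[h1 h2] h3]; split => //; rewrite h1 (le_trans h2). Qed.

(** The gradient estimate on squares of size [|z| / 4] is fed with better and better bounds on the
    imaginary part [b]. A constant bound, integrated from the axis, gives [|b| <= M y / |z|]; the
    local supremum gives the hypothesis of [decay_annulus], hence [|b| = O(|z|^(3/4))] as the inner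
    radius tends to 0; then the squared gradient is [O(|z|^(-1/2))] and [linear_barrier] yields
    [|b| = O(y)]. A last application bounds the gradient. *)
Lemma removable_gradient : exists2 d : R, 0 < d & forall D u w (r : R), SYS D u w -> 0 < r ->
  pbox r `<=` D -> (forall z, pbox r z -> `|u z - q| < d /\ `|w z *m P| <= d) ->
  exists K r' : R, [/\ 0 <= K, 0 < r', r' <= r & forall z, pbox r' z -> `|dx w z| <= K].
Proof.
have [d2 [C2 [d20 C20 G2]]] := gradient_bound_im Omq oO sE sA Aq2 Aqs.
have [d3 [C3 [d30 C30 G3]]] := evle_lapl I Omq oO sE sA.
have [d4 [C4 [d40 C40 G4]]] := evle_dyw I E Omq oO sA.
(* [3 / 256 = k (1 - k) / 16] for [k = 3 / 4], the threshold of [decay_annulus]. *)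
pose d := Num.min (Num.min d2 (Num.min d3 d4)) (3 / 256 / (C3 * (4 * C2) ^+ 2 + 1)).
have d0 : 0 < d.
  rewrite !lt_min d20 d30 d40 /=; apply: divr_gt0; first by lra.
  by rewrite ltr_wpDl // mulr_ge0 ?sqr_ge0.
have [dd2 dd3 dd4] : [/\ d <= d2, d <= d3 & d <= d4].
  by split; rewrite /d !ge_min lexx ?orbT.
have deta : C3 * (4 * C2) ^+ 2 * d <= 3 / 256.
  have a0 : 0 <= C3 * (4 * C2) ^+ 2 by rewrite mulr_ge0 ?sqr_ge0.
  have y0 : 0 < 3 / 256 :> R by apply: divr_gt0; rewrite ltr0n.
  by apply: (mul_min_le a0 (ltW d0) y0); rewrite /d ge_min lexx orbT.
exists d => // D u w r S r0 rD nq; have oD := sys_hopen S; have sw := sys_w S.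
pose b z := w z *m P.
have sb : smD D b := smD_proj I sw.
have Gx z beta : pbox (r / 2) z -> (forall s, box z (`|z| / 4) s -> `|b s| <= beta) ->
  `|dx w z| <= 4 * C2 * beta / `|z|.
  move=> zr hb; have [/andP[z0 zr2] z20] := zr.
  have bz : `|b z| <= beta by apply: hb; apply: box_self => //; rewrite divr_ge0.
  have beta0 : 0 <= beta by apply: le_trans bz.
  apply: (@le_trans _ _ (C2 * Num.min beta d / (`|z| / 4))).
    apply: (G2 D u w z _ _ S) => //; first by rewrite divr_gt0.
    - by move=> s /(pbox_box zr)[sr _]; exact: rD.
    - by rewrite ge_min dd2 orbT.
    - move=> s bs; have [sr _] := pbox_box zr bs; have [h1 h2] := nq s sr.
      by split; [exact: lt_le_trans dd2|rewrite le_min h2 (hb s bs)].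
  have -> : C2 * Num.min beta d / (`|z| / 4) = 4 * C2 * Num.min beta d / `|z|.
    by move: (Num.min _ _) => x; field; rewrite gt_eqF.
  rewrite ler_pM2r ?invr_gt0 // ler_wpM2l ?mulr_ge0 //.
  by rewrite ge_min lexx.
have rr : r / 2 <= r by lra.
have Gl z : pbox r z -> `|lapl b z| <= C3 * `|dx w z| ^+ 2.
  move=> zr; rewrite /b (lapl_proj _ oD sw (rD z zr)); apply: le_trans (projI_le _ _) _.
  by apply: (G3 D u w S _ (rD z zr)); have [h _] := nq z zr; apply: lt_le_trans dd3.
pose M := C4 * (4 * C2 * d) + d.
have M0 : 0 < M by rewrite ltr_wpDl // !mulr_ge0 // ltW.
(* Above the diagonals [|z| = y], and the constant bound is enough; below them [|z|] is constant on
   the vertical segment down to the axis, along which [dy b] is integrated. *)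
have hb z : pbox (r / 2) z -> `|b z| <= M * (z.2 / `|z|).
  move=> zr; have [/andP[z0 zr2] z20] := zr.
  have [le|gt] := leP z.2 `|z.1|; last first.
    have -> : `|z| = z.2.
      by rewrite prod_normE /= (ger0_norm z20) max_r // ltW.
    have zp : 0 < z.2 by apply: le_lt_trans gt.
    rewrite divff ?gt_eqF // mulr1; have [_ h] := nq z (pbox_sub rr zr).
    by apply: le_trans h _; rewrite lerDr !mulr_ge0 // ltW.
  have nz s : 0 <= s <= z.2 -> `|(z.1, s)| = `|z|.
    move=> /andP[s0 sz]; rewrite !prod_normE /= (ger0_norm s0) (ger0_norm z20) !max_l //.
    exact: le_trans le.
  have zs s : 0 <= s <= z.2 -> pbox (r / 2) (z.1, s).
    by move=> h; split; [rewrite nz // z0|case/andP: h].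
  have L : `|b (z.1, z.2) - b (z.1, 0)| <= (M / `|z|) * (z.2 - 0).
    apply: (dy_lip oD sb z20) => s hs; have ps := zs s hs; have prs := pbox_sub rr ps.
    split; first exact: rD.
    rewrite /b (dy_proj _ oD sw (rD _ prs)); apply: le_trans (projI_le _ _) _.
    have [h1 h2] := nq _ prs.
    apply: le_trans (G4 D u w S _ (rD _ prs) (lt_le_trans h1 dd4)) _.
    have g := @Gx (z.1, s) d ps (fun t bt => (nq t (pbox_box ps bt).1).2).
    rewrite (nz s hs) in g.
    apply: le_trans (ler_wpM2l C40 g) _; rewrite mulrA ler_pM2r ?invr_gt0 //.
    by rewrite /M lerDl ltW.
  have b0 : b (z.1, 0) = 0.
    have p0 : pbox (r / 2) (z.1, 0) by apply: zs; rewrite lexx z20.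
    apply/matrixP => i j; rewrite /b projIE !mxE (ord1 i); case: ifP => // Ij.
    by apply: (sys_bd S) => //; exact: rD (pbox_sub rr p0).
  by rewrite b0 !subr0 -surjective_pairing in L; rewrite mulrA mulrAC.
pose k : R := 3 / 4; pose r2 := r / 2.
have r20 : 0 < r2 by rewrite divr_gt0.
have k01 : 0 < k < 1 by rewrite /k; apply/andP; split; lra.
have decay z t : 0 < t -> Ann t r2 z -> `|b z| <= 4 * M * ((`|z| / r2) `^ k + (t / `|z|) `^ k).
  move=> t0 Az.
  have Ap s : Ann t r2 s -> pbox (r / 2) s.
    by move=> [/andP[h1 h2] h3]; split => //; rewrite h2 (lt_le_trans t0 h1).
  have AD : Ann t r2 `<=` D by move=> s /Ap sr; apply: rD; exact: (pbox_sub rr).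
  have e0 : 0 <= 3 / 256 :> R by rewrite divr_ge0 ?ler0n.
  have e1 : 3 / 256 <= k * (1 - k) / 16.
    by rewrite /k le_eqVlt; apply/orP; left; apply/eqP; field.
  suff hs : forall s, Ann t r2 s -> 2 * t <= `|s| -> `|s| <= r2 / 2 ->
    forall sigma, (forall x, box s (`|s| / 4) x -> `|b x| <= sigma) ->
    `|lapl b s| <= 3 / 256 / `|s| ^+ 2 * (sigma + 0 * `|s| `^ k).
    have := @decay_annulus R D N b t r2 M 0 (3 / 256) k oD sb t0 r20 AD M0 (lexx 0) k01
      (fun s As => hb s (Ap s As)) e0 e1 hs z Az.
    by rewrite mul0r addr0.
  move=> s As s2t sr2 sigma hs; have ps := Ap s As; have [/andP[s0 _] _] := ps.
  rewrite mul0r addr0.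
  (* One factor of the squared gradient keeps the local supremum [sigma], the other is bounded by
     the small [d]; this makes the quadratic inequality linear. *)
  pose s' := Num.min sigma d.
  have sg0 : 0 <= sigma.
    by apply: le_trans (normr_ge0 (b s)) _; apply: hs; apply: box_self; [rewrite divr_ge0|exact: As.2].
  have g : `|dx w s| <= 4 * C2 * s' / `|s|.
    apply: Gx => // x bx; rewrite le_min hs //=; exact: (nq x (pbox_box ps bx).1).2.
  have s'0 : 0 <= s' by rewrite le_min sg0 ltW.
  apply: le_trans (Gl s (pbox_sub rr ps)) _.
  have g2 : `|dx w s| ^+ 2 <= (4 * C2 * s' / `|s|) ^+ 2.
    by rewrite ler_sqr ?nnegrE // (le_trans _ g).
  apply: le_trans (ler_wpM2l C30 g2) _.
  have -> : C3 * (4 * C2 * s' / `|s|) ^+ 2 = (C3 * (4 * C2) ^+ 2 * s') * s' / `|s| ^+ 2.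
    by field; rewrite gt_eqF.
  have -> : 3 / 256 / `|s| ^+ 2 * sigma = 3 / 256 * sigma / `|s| ^+ 2 by ring.
  rewrite ler_pM2r ?invr_gt0 ?exprn_gt0 //; apply: ler_pM => //.
  - by rewrite !mulr_ge0 ?sqr_ge0.
  - apply: le_trans deta; rewrite ler_wpM2l ?mulr_ge0 ?sqr_ge0 //.
    by rewrite ge_min lexx orbT.
  - by rewrite ge_min lexx.
pose M' := 4 * M / r2 `^ k.
have M'0 : 0 < M' by rewrite divr_gt0 ?mulr_gt0 // powR_gt0.
have hk z : pbox r2 z -> `|b z| <= M' * `|z| `^ k.
  move=> zr; have [/andP[z0 zr2] z20] := zr; have [k0 k1] := andP k01.
  apply/ler_addgt0Pl => ep ep0.
  (* The inner radius is taken to be [x |z|], so small that its contribution [4 M x^k] is at most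
     [ep]. *)
  pose x := Num.min 1 ((ep / (4 * M)) `^ k^-1).
  have M40 : 0 < 4 * M by rewrite mulr_gt0.
  have x0 : 0 < x by rewrite lt_min ltr01 powR_gt0 // divr_gt0.
  have t0 : 0 < x * `|z| by rewrite mulr_gt0.
  have Az : Ann (x * `|z|) r2 z.
    split => //; rewrite zr2 andbT ger_pMl // ge_min lexx //.
  apply: le_trans (decay z _ t0 Az) _.
  rewrite mulfK ?gt_eqF // mulrDr addrC lerD //.
    have : x `^ k <= ep / (4 * M).
      apply: (@le_trans _ _ (((ep / (4 * M)) `^ k^-1) `^ k)).
        by apply: powR_mono; rewrite ?(ltW x0) ?(ltW k0) // ge_min lexx orbT.
      by rewrite -powRrM mulVf ?gt_eqF // powRr1 // divr_ge0 ?(ltW ep0) ?(ltW M40).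
    by rewrite ler_pdivlMr // mulrC.
  rewrite powRM ?invr_ge0 ?(ltW r20) // powRVk // powRN /M'.
  by rewrite le_eqVlt; apply/orP; left; apply/eqP; ring.
have r40 : 0 < r2 / 2 by rewrite divr_gt0.
have r42 : r2 / 2 <= r2 by lra.
have r2r : r2 <= r by rewrite /r2; lra.
have Gx2 z beta : pbox (r2 / 2) z -> 0 < z.2 -> (forall s, box z (`|z| / 4) s -> `|b s| <= beta) ->
  `|dx w z| <= 4 * C2 * beta / `|z|.
  by move=> zr _; apply: Gx; exact: (pbox_sub r42).
pose CC := C3 * (4 * C2 * (2 * M')) ^+ 2.
have hl z : pbox (r2 / 2) z -> 0 < z.2 -> `|lapl b z| <= CC * z.2 `^ (3 / 2 - 2).
  move=> zr zp; have [/andP[z0 zr2] _] := zr; have [k0 k1] := andP k01.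
  have g : `|dx w z| <= 4 * C2 * (2 * M' * `|z| `^ k) / `|z|.
    apply: Gx2 => // s bs; have [sr s2] := pbox_box zr bs.
    apply: le_trans (hk s sr) _; rewrite -mulrA mulrCA; apply: ler_wpM2l; first exact: ltW.
    by apply: powR_dbl => //; apply/andP; split; exact: ltW.
  have zr' : pbox r z by apply: (pbox_sub r2r); exact: (pbox_sub r42).
  apply: le_trans (Gl z zr') _.
  have g2 : `|dx w z| ^+ 2 <= (4 * C2 * (2 * M' * `|z| `^ k) / `|z|) ^+ 2.
    by rewrite ler_sqr ?nnegrE // (le_trans _ g).
  apply: le_trans (ler_wpM2l C30 g2) _.
  have kE : (`|z| `^ k / `|z|) ^+ 2 = `|z| `^ (3 / 2 - 2).
    have -> : `|z| `^ k / `|z| = `|z| `^ (k - 1).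
      by rewrite -(powR_shift k z0) mulfK // gt_eqF.
    by rewrite -powR_mulrn ?powR_ge0 // -powRrM; congr (_ `^ _); rewrite /k; field.
  have -> : C3 * (4 * C2 * (2 * M' * `|z| `^ k) / `|z|) ^+ 2 = CC * (`|z| `^ k / `|z|) ^+ 2.
    by rewrite /CC; field; rewrite gt_eqF.
  rewrite kE; apply: ler_wpM2l; first by rewrite mulr_ge0 ?sqr_ge0.
  have -> : 3 / 2 - 2 = - (2^-1) :> R by field.
  rewrite !powRN lef_pV2 ?posrE ?powR_gt0 //.
  apply: powR_mono; [by rewrite invr_ge0|exact: ltW|].
  by apply: le_trans (snd_le_norm z); rewrite ler_norm.
have [K K0 hK] : exists2 K, 0 <= K & forall z, pbox (r2 / 2) z -> `|b z| <= K * z.2.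
  pose MM := M + M'; have MM0 : 0 < MM by rewrite addr_gt0.
  apply: (@linear_barrier R D N b (r2 / 2) MM CC k) => //.
  - by rewrite mulr_ge0 ?sqr_ge0.
  - by have [] := andP k01.
  - by move=> z zr; apply: rD; apply: (pbox_sub r2r); exact: (pbox_sub r42).
  - move=> z zr; apply: le_trans (hb z (pbox_sub r42 zr)) _.
    by apply: ler_wpM2r; [rewrite divr_ge0 //; exact: zr.2|rewrite lerDl ltW].
  - move=> z zr; apply: le_trans (hk z (pbox_sub r42 zr)) _.
    by apply: ler_wpM2r; [exact: powR_ge0|rewrite lerDr ltW].
exists (4 * C2 * (2 * K)), (r2 / 2 / 2); split.
- by rewrite !mulr_ge0.
- by rewrite !divr_gt0.
- by rewrite /r2; lra.
- move=> z zr; have [/andP[z0 zr2] _] := zr.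
  have le8 : r2 / 2 / 2 <= r / 2 by rewrite /r2; lra.
  have g : `|dx w z| <= 4 * C2 * (K * (2 * `|z|)) / `|z|.
    apply: Gx; first exact: (pbox_sub le8).
    move=> s bs; have [sr s2] := pbox_box zr bs.
    apply: le_trans (hK s sr) _; apply: ler_wpM2l => //; apply: le_trans s2.
    by apply: le_trans (snd_le_norm s); rewrite ler_norm.
  apply: le_trans g _; rewrite le_eqVlt; apply/orP; left; apply/eqP; field.
  by rewrite gt_eqF.
Qed.

End Puncture.

(** * Bounds on all derivatives *)

Fixpoint bddn (R : realType) (W : normedModType R) (n : nat) (S : set (R * R))
    (h : R * R -> W) : Prop :=
  (exists K : R, forall z, S z -> `|h z| <= K) /\
  match n with
  | 0 => True
  | n'.+1 => bddn n' S (dx h) /\ bddn n' S (dy h)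
  end.

Section Bounded.
Variable R : realType.
Implicit Types (D S : set (R * R)) (z : R * R).

Lemma bddn_bound (W : normedModType R) n S (h : R * R -> W) : bddn n S h ->
  exists K : R, forall z, S z -> `|h z| <= K.
Proof. by case: n => [|n] []. Qed.

Lemma bddnW (W : normedModType R) n S (h : R * R -> W) : bddn n.+1 S h -> bddn n S h.
Proof.
elim: n h => [|n IH] h [H1 [H2 H3]]; split=> //; split; exact: IH.
Qed.

Section Domain.
Variables (D S : set (R * R)).
Hypothesis oD : hopen D.
Hypothesis SD : S `<=` D.

Lemma bddn_eqS (W : normedModType R) n (h h' : R * R -> W) :
  smD D h -> (forall z, D z -> h z = h' z) -> bddn n S h -> bddn n S h'.
Proof.
elim: n h h' => [|n IH] h h' sh hh [[K hK] H].
  by split=> //; exists K => z Sz; rewrite -hh; [exact: hK|exact: SD].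
split; first by exists K => z Sz; rewrite -hh; [exact: hK|exact: SD].
case: H => H1 H2; split.
  by apply: IH H1 => [|z Dz]; [exact: smD_dx|exact: (dx_eqD oD sh Dz)].
by apply: IH H2 => [|z Dz]; [exact: smD_dy|exact: (dy_eqD oD sh Dz)].
Qed.

Lemma bddn_cst (W : normedModType R) n (c : W) : bddn n S (fun=> c).
Proof.
elim: n c => [|n IH] c; split => //; try by exists `|c|.
split.
  apply: (@bddn_eqS _ _ (fun=> 0)); [exact: smD_cst|move=> z Dz|exact: IH].
  by rewrite dx_cst.
apply: (@bddn_eqS _ _ (fun=> 0)); [exact: smD_cst|move=> z Dz|exact: IH].
by rewrite (dy_cst _ oD Dz).
Qed.

Lemma bddnD (W : normedModType R) n (f g : R * R -> W) : smD D f -> smD D g ->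
  bddn n S f -> bddn n S g -> bddn n S (fun z => f z + g z).
Proof.
elim: n f g => [|n IH] f g sf sg [[K hK] H] [[L hL] H']; split => //;
  try by exists (K + L) => z Sz; apply: le_trans (ler_normD _ _) _; apply: lerD; [exact: hK|exact: hL].
case: H H' => h1 h2 [h3 h4]; split.
  apply: (@bddn_eqS _ _ (fun z => dx f z + dx g z)).
  - by apply: smDD; exact: smD_dx.
  - by move=> z Dz; rewrite (dxD oD sf sg Dz).
  - by apply: IH => //; exact: smD_dx.
apply: (@bddn_eqS _ _ (fun z => dy f z + dy g z)).
- by apply: smDD; exact: smD_dy.
- by move=> z Dz; rewrite (dyD oD sf sg Dz).
- by apply: IH => //; exact: smD_dy.
Qed.

Lemma bddnM n (f g : R * R -> R) : smD D f -> smD D g ->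
  bddn n S f -> bddn n S g -> bddn n S (fun z => f z * g z).
Proof.
elim: n f g => [|n IH] f g sf sg bf bg.
  have [[K hK] _] := bf; have [[L hL] _] := bg.
  by split=> //; exists (K * L) => z Sz; rewrite normrM; apply: ler_pM => //; [exact: hK|exact: hL].
have [[K hK] [h1 h2]] := bf; have [[L hL] [h3 h4]] := bg.
have bf' := bddnW bf; have bg' := bddnW bg.
have sfx := smD_dx oD sf; have sfy := smD_dy oD sf.
have sgx := smD_dx oD sg; have sgy := smD_dy oD sg.
split.
  by exists (K * L) => z Sz; rewrite normrM; apply: ler_pM => //; [exact: hK|exact: hL].
split.
  apply: (@bddn_eqS _ _ (fun z => dx f z * g z + f z * dx g z)).
  - exact: smDD (smDM sfx sg) (smDM sf sgx).
  - by move=> z Dz; rewrite (dxM oD sf sg Dz).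
  - by apply: bddnD; [exact: smDM|exact: smDM|exact: IH|exact: IH].
apply: (@bddn_eqS _ _ (fun z => dy f z * g z + f z * dy g z)).
- exact: smDD (smDM sfy sg) (smDM sf sgy).
- by move=> z Dz; rewrite (dyM oD sf sg Dz).
- by apply: bddnD; [exact: smDM|exact: smDM|exact: IH|exact: IH].
Qed.

Lemma bddn_sum (W : normedModType R) n (T : Type) (r : seq T) (h : T -> R * R -> W) :
  (forall i, smD D (h i)) -> (forall i, bddn n S (h i)) ->
  bddn n S (fun z => \sum_(i <- r) h i z).
Proof.
move=> sh bh; elim: r => [|i r IH].
  apply: (@bddn_eqS _ _ (fun=> 0)); [exact: smD_cst| |exact: bddn_cst].
  by move=> z _; rewrite big_nil.
apply: (@bddn_eqS _ _ (fun z => h i z + \sum_(i <- r) h i z)).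
- by apply: smDD => //; exact: smD_sum.
- by move=> z _; rewrite big_cons.
- by apply: bddnD => //; exact: smD_sum.
Qed.

Lemma bddn_mx n p p' (h : R * R -> 'M[R]_(p, p')) : smD D h ->
  (forall i j, bddn n S (fun z => h z i j)) -> bddn n S h.
Proof.
have bd (g : R * R -> 'M[R]_(p, p')) k : (forall i j, bddn k S (fun z => g z i j)) ->
    exists K : R, forall z, S z -> `|g z| <= K.
  move=> H; have H' i j := bddn_bound (H i j).
  have {H'}[K hK] := choice (fun ij : 'I_p * 'I_p' => H' ij.1 ij.2).
  exists (\sum_ij `|K ij|) => z Sz; apply: mx_norm_le; first by apply: sumr_ge0.
  move=> i j; apply: le_trans (hK (i, j) z Sz) _; apply: le_trans (ler_norm _) _.
  by rewrite (bigD1 (i, j)) //= lerDl sumr_ge0.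
elim: n h => [|n IH] h sh H; split; try exact: bd H; first by [].
split; apply: IH; [exact: smD_dx| |exact: smD_dy|] => i j; have [_ [h1 h2]] := H i j.
  apply: bddn_eqS h1 => [|z Dz]; first by apply: smD_dx => //; exact: smD_coord.
  exact: (dx_coord i j oD sh Dz).
apply: bddn_eqS h2 => [|z Dz]; first by apply: smD_dy => //; exact: smD_coord.
exact: (dy_coord i j oD sh Dz).
Qed.

Lemma bddn_coord n p p' (h : R * R -> 'M[R]_(p, p')) i j : smD D h ->
  bddn n S h -> bddn n S (fun z => h z i j).
Proof.
elim: n h => [|n IH] h sh [[K hK] H]; split => //;
  try by exists K => z Sz; apply: le_trans (mx_norm_coord _ _ _) _; exact: hK.
case: H => h1 h2; split.
  apply: (@bddn_eqS _ _ (fun z => dx h z i j)).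
  - by apply: smD_coord; exact: smD_dx.
  - by move=> z Dz; rewrite (dx_coord i j oD sh Dz).
  - by apply: IH => //; exact: smD_dx.
apply: (@bddn_eqS _ _ (fun z => dy h z i j)).
- by apply: smD_coord; exact: smD_dy.
- by move=> z Dz; rewrite (dy_coord i j oD sh Dz).
- by apply: IH => //; exact: smD_dy.
Qed.

Lemma bddn_mulmx n p q r (f : R * R -> 'M[R]_(p, q)) (g : R * R -> 'M[R]_(q, r)) :
  smD D f -> smD D g -> bddn n S f -> bddn n S g -> bddn n S (fun z => f z *m g z).
Proof.
move=> sf sg bf bg; apply: bddn_mx => [|i j]; first exact: smD_mulmx.
have s1 k : smD D (fun z => f z i k * g z k j) by apply: smDM; exact: smD_coord.
apply: (@bddn_eqS _ _ (fun z => \sum_k f z i k * g z k j)).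
- by apply: smD_sum => k _.
- by move=> z Dz; rewrite mxE.
- by apply: bddn_sum => // k; apply: bddnM; try exact: smD_coord; exact: bddn_coord.
Qed.

End Domain.

(** The radius depends on [n]: it has to keep the derivatives of [c] up to order [n] bounded near
    [q]. *)
Lemma bddn_comp n m (Om : set 'rV[R]_m) (q : 'rV[R]_m) : open Om -> Om q ->
  forall c : 'rV[R]_m -> R, smooth_on Om c ->
  exists2 d : R, 0 < d & forall D S u, hopen D -> S `<=` D -> smD D u ->
  (forall z, D z -> Om (u z)) -> (forall z, S z -> `|u z - q| < d) ->
  bddn n S u -> bddn n S (fun z => c (u z)).
Proof.
move=> oO Oq; elim: n => [|n IH] c sc.
all: have /(_ q Oq) /cvgrPdist_lt /(_ 1 ltr01) /near_norm_ex[d0 d00 hd0] : Cn_on 0 Om c by exact: sc.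
all: have bd S u : (forall z, S z -> `|u z - q| < d0) ->
    exists K : R, forall z : R * R, S z -> `|c (u z)| <= K.
- 1,3: move=> Su; exists (`|c q| + 1) => z Sz; have h := hd0 _ (Su z Sz).
  1,2: have -> : c (u z) = c q + (c (u z) - c q) by rewrite addrC subrK.
  1,2: apply: le_trans (ler_normD _ _) _; rewrite lerD2l distrC; exact: ltW.
- by exists d0 => // D S u oD SD su uO Su _; split => //; exact: bd.
have H l := IH _ (smooth_on_derive (delta_mx 0 l) sc).
have [d hd] := choice (fun l => let: ex_intro2 d h1 h2 := H l in ex_intro _ d (conj h1 h2)).
pose e := \big[Num.min/d0]_l d l.
exists e; first by apply: lt_bigmin => // l _; exact: (hd l).1.
move=> D S u oD SD su uO Su bu; have [_ [ux uy]] := bu.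
split.
  by apply: bd => z Sz; apply: lt_le_trans (Su z Sz) _; exact: bigmin_le_id.
have bl l : bddn n S (fun z => 'D_(delta_mx 0 l) c (u z)).
  apply: (hd l).2 oD SD su uO _ (bddnW bu) => z Sz.
  by apply: lt_le_trans (Su z Sz) _; apply: bigmin_le.
have sl l : smD D (fun z => 'D_(delta_mx 0 l) c (u z)).
  exact: (smD_comp oO uO (smooth_on_derive (delta_mx 0 l) sc) su).
have sux := smD_dx oD su; have suy := smD_dy oD su.
split.
  apply: (@bddn_eqS D S oD SD _ _ (fun z => \sum_l 'D_(delta_mx 0 l) c (u z) * dx u z 0 l)).
  - by apply: smD_sum => l _; apply: smDM => //; exact: smD_coord.
  - by move=> z Dz; rewrite (dx_comp oD oO uO sc su Dz).
  - apply: (bddn_sum oD SD) => l; first by apply: smDM => //; exact: smD_coord.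
    by apply: (bddnM oD SD) => //; [exact: smD_coord|exact: (bddn_coord oD SD)].
apply: (@bddn_eqS D S oD SD _ _ (fun z => \sum_l 'D_(delta_mx 0 l) c (u z) * dy u z 0 l)).
- by apply: smD_sum => l _; apply: smDM => //; exact: smD_coord.
- by move=> z Dz; rewrite (dy_comp oD oO uO sc su Dz).
- apply: (bddn_sum oD SD) => l; first by apply: smDM => //; exact: smD_coord.
  by apply: (bddnM oD SD) => //; [exact: smD_coord|exact: (bddn_coord oD SD)].
Qed.

Lemma bddn_compmx n m p p' (Om : set 'rV[R]_m) (q : 'rV[R]_m) (F : 'rV[R]_m -> 'M[R]_(p, p')) :
  open Om -> Om q -> smooth_on Om F ->
  exists2 d : R, 0 < d & forall D S u, hopen D -> S `<=` D -> smD D u ->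
  (forall z, D z -> Om (u z)) -> (forall z, S z -> `|u z - q| < d) ->
  bddn n S u -> bddn n S (fun z => F (u z)).
Proof.
move=> oO Oq sF.
have H (ij : 'I_p * 'I_p') := bddn_comp n oO Oq (fun k => Cn_on_coord ij.1 ij.2 oO (sF k)).
have [d hd] := choice (fun l => let: ex_intro2 d h1 h2 := H l in ex_intro _ d (conj h1 h2)).
exists (\big[Num.min/1]_ij d ij); first by apply: lt_bigmin => // l _; exact: (hd l).1.
move=> D S u oD SD su uO Su bu; apply: (bddn_mx oD SD) => [|i j].
  exact: (smD_compmx oO uO sF su).
apply: (hd (i, j)).2 oD SD su uO _ bu => z Sz.
by apply: lt_le_trans (Su z Sz) _; apply: bigmin_le.
Qed.

End Bounded.

Section Regularity.
Variable R : realType.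

Lemma row_mx_norm_le p a b (f : 'M[R]_(p, a)) (g : 'M[R]_(p, b)) (c : R) : 0 <= c ->
  `|f| <= c -> `|g| <= c -> `|row_mx f g| <= c.
Proof.
move=> c0 fc gc; apply: mx_norm_le => // i j; rewrite mxE; case: fintype.split => k.
  by apply: le_trans fc; exact: mx_norm_coord.
by apply: le_trans gc; exact: mx_norm_coord.
Qed.

Lemma row_mx_norm_lt p a b (f : 'M[R]_(p, a)) (g : 'M[R]_(p, b)) (c : R) :
  `|f| < c -> `|g| < c -> `|row_mx f g| < c.
Proof.
move=> fc gc; apply: le_lt_trans (_ : Num.max `|f| `|g| < c); last by rewrite gt_max fc.
by apply: row_mx_norm_le; rewrite le_max ?lexx ?orbT ?normr_ge0.
Qed.

(** Induction on the order over all systems at once: the gradient bound makes the prolonged system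
    satisfy the smallness hypothesis, and bounds of order [n] for its solution contain those for [u]
    and [dx w]. Since [dx u = dx w E(u)] and [dy u = dx w A(u) E(u)], one order is gained for
    [u]. *)
Lemma sys_bounded n : forall m N (I : pred 'I_N) (Om : set 'rV[R]_m)
  (E : 'rV[R]_m -> 'M[R]_(N, m)) (A : 'rV[R]_m -> 'M[R]_N) (q : 'rV[R]_m),
  Om q -> open Om -> smooth_on Om E -> smooth_on Om A ->
  A q *m A q = - 1%:M -> (forall j i, ~~ I j -> ~~ I i -> A q j i = 0) ->
  exists2 d : R, 0 < d & forall D u w (r : R), sys I Om E A D u w -> 0 < r ->
  pbox r `<=` D ->
  (forall z, pbox r z -> `|u z - q| < d /\ `|w z *m projI R I| <= d) ->
  exists2 r' : R, 0 < r' <= r & bddn n (@pbox R r') u.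
Proof.
elim: n => [|n IH] m N I Om E A q Oq oO sE sA Aq Aqs.
  exists 1 => // D u w r S r0 rD nq; exists r; first by rewrite r0 lexx.
  split => //; exists (`|q| + 1) => z zr; have [h _] := nq z zr.
  have -> : u z = q + (u z - q) by rewrite addrC subrK.
  by apply: le_trans (ler_normD _ _) _; rewrite lerD2l ltW.
have [d1 d10 T] := removable_gradient Oq oO sE sA Aq Aqs.
have [Aq' Aqs'] := prol_real E Aq Aqs.
have Oq' : prolOm Om (row_mx q (0 : 'rV[R]_N)) by rewrite /prolOm /= row_mxKl.
have oO' := @open_prolOm R m N Om oO.
have sE' := @smooth_prolE R m N Om E oO sE.
have sA' := @smooth_prolA R m N Om E A oO sE sA.
have [d2 d20 H2] := IH _ _ (prolI I) _ _ _ _ Oq' oO' sE' sA' Aq' Aqs'.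
have [d3 d30 HE] := bddn_compmx n oO Oq sE.
have [d4 d40 HA] := bddn_compmx n oO Oq sA.
pose d := Num.min (Num.min d1 d2) (Num.min d3 d4).
exists d; first by rewrite !lt_min d10 d20 d30 d40.
move=> D u w r S r0 rD nq; have oD := sys_hopen S.
have [dd1 dd2 dd3 dd4] : [/\ d <= d1, d <= d2, d <= d3 & d <= d4].
  by rewrite /d !ge_min !lexx ?orbT.
have [z zr|K [r1 [K0 r10 r1r hK]]] := T D u w r S r0 rD.
  by have [h1 h2] := nq z zr; rewrite (lt_le_trans h1) // (le_trans h2).
have su := sys_u S; have sw := sys_w S; have swx := smD_dx oD sw.
(* The radius [d2] is fixed before the solution and the gradient bound [K] after it; the scale [tau]
   reconciles them. *)
pose tau := d2 / (K + 1).
have tau0 : 0 < tau by rewrite divr_gt0 // ltr_wpDl.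
have S' := prolongation tau S.
have tK z : pbox r1 z -> `|tau *: dx w z| < d2.
  move=> zr; rewrite normrZ (gtr0_norm tau0).
  apply: le_lt_trans (ler_wpM2l (ltW tau0) (hK z zr)) _.
  rewrite /tau -mulrA gtr_pMr // mulrC ltr_pdivrMr ?mul1r ?ltrDl //.
  by rewrite ltr_wpDl.
have r1D : pbox r1 `<=` D by move=> z zr; apply: rD; exact: pbox_sub zr.
have nr1 z : pbox r1 z -> `|u z - q| < d /\ `|w z *m projI R I| <= d.
  by move=> zr; apply: nq; exact: pbox_sub zr.
have [z zr|r2 /andP[r20 r21] b2] := H2 D _ _ r1 S' r10 r1D.
  have [h1 h2] := nr1 z zr; split.
    rewrite /prolu opp_row_mx add_row_mx oppr0 addr0; apply: row_mx_norm_lt; last exact: tK.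
    exact: lt_le_trans dd2.
  apply: mx_norm_le; first exact: ltW.
  move=> i j; rewrite projIE /prolI /prolw mxE; case: (fintype.split j) => l; case: ifP => Il; rewrite ?normr0 ?(ltW d20) //.
    by apply: le_trans dd2; apply: le_trans h2; have := mx_norm_coord (w z *m projI R I) i l; rewrite projIE Il.
  by apply: ltW; apply: le_lt_trans (tK z zr); exact: mx_norm_coord.
exists r2; first by rewrite r20 (le_trans r21).
have r2D : pbox r2 `<=` D by move=> z zr; apply: r1D; exact: pbox_sub zr.
have sp : smD D (prolu tau u w) by exact: sys_u S'.
have bu : bddn n (@pbox R r2) u.
  apply: (bddn_mx oD r2D) => // i j.
  have := bddn_coord oD r2D i (lshift N j) sp b2.
  apply: (bddn_eqS oD r2D) => [|z Dz]; first exact: smD_coord.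
  by rewrite /prolu row_mxEl.
have bwx : bddn n (@pbox R r2) (dx w).
  apply: (bddn_mx oD r2D) => // i j.
  have bt : bddn n (@pbox R r2) (fun z => tau^-1 * prolu tau u w z i (rshift m j)).
    apply: (bddnM oD r2D); [exact: smD_cst|exact: smD_coord|exact: (bddn_cst oD r2D)|].
    exact: (bddn_coord oD r2D).
  apply: (bddn_eqS oD r2D _ _ bt) => [|z Dz].
    by apply: smDM; [exact: smD_cst|exact: smD_coord].
  by rewrite /prolu row_mxEr mxE mulKf // gt_eqF.
have nr2 z : pbox r2 z -> `|u z - q| < d by move=> zr; apply: (nr1 z (pbox_sub r21 zr)).1.
have bE : bddn n (@pbox R r2) (fun z => E (u z)).
  by apply: HE oD r2D su (sys_Om S) _ bu => z zr; apply: lt_le_trans dd3; exact: nr2.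
have bA : bddn n (@pbox R r2) (fun z => A (u z)).
  by apply: HA oD r2D su (sys_Om S) _ bu => z zr; apply: lt_le_trans dd4; exact: nr2.
have smE : smD D (fun z => E (u z)) := smD_compmx oO (sys_Om S) sE su.
have smA : smD D (fun z => A (u z)) := smD_compmx oO (sys_Om S) sA su.
split; first exact: bddn_bound bu.
split.
  apply: (@bddn_eqS _ D _ oD r2D _ _ (fun z => dx w z *m E (u z))).
  - exact: smD_mulmx.
  - by move=> z Dz; rewrite (sys_ux S Dz).
  - exact: (bddn_mulmx oD r2D).
apply: (@bddn_eqS _ D _ oD r2D _ _ (fun z => dx w z *m A (u z) *m E (u z))).
- by apply: smD_mulmx => //; exact: smD_mulmx.
- by move=> z Dz; rewrite (sys_uy S Dz) (sys_eq S Dz).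
- by apply: (bddn_mulmx oD r2D) => //; [exact: smD_mulmx|exact: (bddn_mulmx oD r2D)].
Qed.

End Regularity.

(** * Reflection of functions with bounded derivatives *)

Definition lin2 (R : realType) (a b : R) (h : R * R) : R := h.1 * a + h.2 * b.

Lemma lin2_is_linear (R : realType) (a b : R) : linear (@lin2 R a b).
Proof.
by move=> k x y; rewrite /lin2 /=; rewrite /GRing.scale /=; ring.
Qed.

HB.instance Definition _ (R : realType) (a b : R) :=
  GRing.isLinear.Build R (R * R)%type R _ (@lin2 R a b) (@lin2_is_linear R a b).

Section Extension.
Variable R : realType.
Implicit Types (f : R * R -> R) (z : R * R).

Lemma lin2_continuous (a b : R) : continuous (@lin2 R a b).
Proof.
move=> z; apply: cvgD; apply: cvgM.
- exact: cvg_fst.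
- exact: cvg_cst.
- exact: cvg_snd.
- exact: cvg_cst.
Qed.

Lemma quad_differentiable f z (a b K d : R) : 0 < d ->
  (forall h, `|h| < d -> `|f (h + z) - f z - lin2 a b h| <= K * `|h| ^+ 2) ->
  differentiable f z /\ forall v, 'D_v f z = lin2 a b v.
Proof.
move=> d0 H; have cl := @lin2_continuous a b.
have e1 : f \o shift z = (cst (f z) + lin2 a b) +o_ (0 : R * R) id.
  apply/eqaddoP => e e0.
  have m0 : 0 < Num.min d (e / (`|K| + 1)).
    by rewrite lt_min d0 /= divr_gt0 // ltr_wpDl.
  apply: (near_norm m0) => h; rewrite subr0 lt_min => /andP[h1 h2].
  change (`|f (h + z) - (f z + lin2 a b h)| <= e * `|h|).
  rewrite opprD addrA; apply: le_trans (H h h1) _.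
  rewrite expr2 mulrA ler_wpM2r //.
  apply: (@le_trans _ _ ((`|K| + 1) * `|h|)).
    by rewrite ler_wpM2r // (le_trans (ler_norm K)) // lerDl.
  by rewrite mulrC -ler_pdivlMr ?ltW // ltr_wpDl.
have dE := diff_unique cl e1.
have df : differentiable f z by apply/diff_locallyP; rewrite dE.
by split => // v; rewrite deriveE // dE.
Qed.

Lemma mvt_between (F F' : R -> R) (a b : R) :
  (forall s, (a <= s <= b) || (b <= s <= a) -> is_derive s (1 : R) F (F' s)) ->
  exists2 c, (a <= c <= b) || (b <= c <= a) & F b - F a = F' c * (b - a).
Proof.
move=> H; have [ab|ab] := leP a b.
  have [s hs|c hc e] := @MVT_le R F F' a b ab; first by apply: H; rewrite hs.
  by exists c => //; rewrite hc.
have [s hs|c hc e] := @MVT_le R F F' b a (ltW ab); first by apply: H; rewrite hs orbT.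
by exists c; [rewrite hc orbT|rewrite -opprB e -mulrN opprB].
Qed.

Lemma between_dist (a b c : R) : (a <= c <= b) || (b <= c <= a) -> `|c - a| <= `|b - a|.
Proof.
case/orP => /andP[h1 h2].
  by rewrite !ger0_norm ?subr_ge0 ?lerD2r // (le_trans h1).
by rewrite !ler0_norm ?subr_le0 ?lerN2 ?lerD2r // (le_trans h1).
Qed.

Lemma between_norm (a b c r : R) : (a <= c <= b) || (b <= c <= a) -> `|a| < r -> `|b| < r ->
  `|c| < r.
Proof. by rewrite !ltr_norml => /orP[] /andP[h1 h2] /andP[h3 h4] /andP[h5 h6]; lra. Qed.

Lemma between_pos (a b c : R) : (a <= c <= b) || (b <= c <= a) -> 0 < a -> 0 < b -> 0 < c.
Proof. by move=> /orP[] /andP[h1 h2] h3 h4; lra. Qed.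

Variable rho : R.
Definition strip : set (R * R) := [set z | `|z.1| < rho /\ 0 < z.2].

Lemma hopen_strip : hopen strip.
Proof.
move=> z [z1 z2]; split; first exact: ltW.
have m0 : 0 < Num.min (rho - `|z.1|) z.2 by rewrite lt_min subr_gt0 z1.
apply: (near_norm m0) => w; rewrite lt_min !pair_norm_lt /= => /andP[/andP[h1 _] /andP[_ h2]] _.
split.
  rewrite -(subrK z.1 w.1); apply: le_lt_trans (ler_normD _ _) _; by rewrite -ltrBrDr.
by move: h2; rewrite ltr_norml => /andP[h3 h4]; rewrite -(ltrD2r (- z.2)) sub0r.
Qed.
Let oT := hopen_strip.

Definition nice f := smD strip f /\ forall n, bddn n strip f.

Lemma nice_dx f : nice f -> nice (dx f).
Proof. by move=> [sf bf]; split; [exact: smD_dx|move=> n; have [_ []] := bf n.+1]. Qed.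

Lemma nice_dy f : nice f -> nice (dy f).
Proof. by move=> [sf bf]; split; [exact: smD_dy|move=> n; have [_ []] := bf n.+1]. Qed.

Lemma nice_bound f : nice f -> exists2 K, 0 <= K & forall z, strip z -> `|f z| <= K.
Proof.
move=> [_ /(_ 0)[[K hK] _]]; exists `|K| => // z /hK h.
exact: le_trans (ler_norm K).
Qed.

(* The five estimates below are stable under closure and under the series
   that defines the extension, which is why they replace limits. *)
Definition est (X Y : R -> Prop) (K : R) (F Fx Fy : R -> R -> R) := 0 <= K /\
  forall x x' s s', X x -> X x' -> Y s -> Y s' ->
  [/\ `|F x s| <= K, `|F x' s - F x s| <= K * `|x' - x|,
    `|F x s' - F x s| <= K * `|s' - s|,
    `|F x' s - F x s - (x' - x) * Fx x s| <= K * `|x' - x| ^+ 2 &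
    `|F x s' - F x s - (s' - s) * Fy x s| <= K * `|s' - s| ^+ 2].

Lemma nice_est f : nice f -> exists K, est (fun x => `|x| < rho) (fun s => 0 < s) K
  (fun x s => f (x, s)) (fun x s => dx f (x, s)) (fun x s => dy f (x, s)).
Proof.
move=> nf; have nx := nice_dx nf; have ny := nice_dy nf.
have [K0 K00 b0] := nice_bound nf; have [K1 K10 b1] := nice_bound nx.
have [K2 K20 b2] := nice_bound ny; have [K3 K30 b3] := nice_bound (nice_dx nx).
have [K4 K40 b4] := nice_bound (nice_dy ny).
have lx g s x x' L : nice g -> 0 < s -> `|x| < rho -> `|x'| < rho ->
    (forall z, strip z -> `|dx g z| <= L) -> exists2 c, (x <= c <= x') || (x' <= c <= x) &
    g (x', s) - g (x, s) = dx g (c, s) * (x' - x).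
  move=> [sg _] s0 hx hx' hL.
  apply: (@mvt_between (fun t => g (t, s)) (fun t => dx g (t, s))) => t ht.
  by apply: (is_derive_x oT sg); split => //; exact: between_norm ht hx hx'.
have ly g x s s' L : nice g -> 0 < s -> 0 < s' -> `|x| < rho ->
    (forall z, strip z -> `|dy g z| <= L) -> exists2 c, (s <= c <= s') || (s' <= c <= s) &
    g (x, s') - g (x, s) = dy g (x, c) * (s' - s).
  move=> [sg _] s0 s'0 hx hL.
  apply: (@mvt_between (fun t => g (x, t)) (fun t => dy g (x, t))) => t ht.
  have t0 := between_pos ht s0 s'0; by apply: (is_derive_y oT sg).
pose K := K0 + K1 + K2 + K3 + K4; exists K; split; first by rewrite !addr_ge0.
have [k0 k1 k2 k3 k4] : [/\ K0 <= K, K1 <= K, K2 <= K, K3 <= K & K4 <= K].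
  by move: K00 K10 K20 K30 K40; rewrite /K => ? ? ? ? ?; split; lra.
move=> x x' s s' hx hx' s0 s'0.
have st y t : `|y| < rho -> 0 < t -> strip (y, t) by [].
split.
- by apply: le_trans k0; apply: b0.
- have [c hc ->] := lx f s x x' K1 nf s0 hx hx' b1.
  rewrite normrM ler_wpM2r //; apply: le_trans k1; apply: b1.
  by apply: st => //; exact: between_norm hc hx hx'.
- have [c hc ->] := ly f x s s' K2 nf s0 s'0 hx b2.
  rewrite normrM ler_wpM2r //; apply: le_trans k2; apply: b2.
  by apply: st => //; exact: between_pos hc s0 s'0.
- have [c hc ->] := lx f s x x' K1 nf s0 hx hx' b1.
  have hcr := between_norm hc hx hx'.
  rewrite mulrC -mulrBr normrM expr2 mulrCA ler_wpM2l //.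
  have [c' hc' ->] := lx (dx f) s x c K3 nx s0 hx hcr b3.
  rewrite normrM; apply: ler_pM => //.
    by apply: le_trans k3; apply: b3; apply: st => //; exact: between_norm hc' hx hcr.
  exact: between_dist.
- have [c hc ->] := ly f x s s' K2 nf s0 s'0 hx b2.
  have hcr := between_pos hc s0 s'0.
  rewrite mulrC -mulrBr normrM expr2 mulrCA ler_wpM2l //.
  have [c' hc' ->] := ly (dy f) x s c K4 ny s0 hcr hx b4.
  rewrite normrM; apply: ler_pM => //.
    by apply: le_trans k4; apply: b4; apply: st => //; exact: between_pos hc' s0 hcr.
  exact: between_dist.
Qed.

Definition trace f (x : R) : R := lim ((fun s => f (x, s)) @ 0^'+).

Lemma trace_eq f (x l : R) : (fun s => f (x, s)) @ 0^'+ --> l -> trace f x = l.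
Proof. by move=> h; apply: cvg_lim h. Qed.

(** The limit is realised as a supremum: by the Lipschitz estimate every [f (x, a) - K a] is below
    every [f (x, b) + K b], so a value separating them differs from [f (x, s)] by at most [K s]. *)
Lemma trace_le f : nice f -> exists2 K, 0 <= K & forall x s, `|x| < rho -> 0 < s ->
  `|f (x, s) - trace f x| <= K * s.
Proof.
move=> nf; have [K [K0 H]] := nice_est nf; exists K => // x s hx s0.
have L a b : 0 < a -> 0 < b -> f (x, a) - K * a <= f (x, b) + K * b.
  move=> a0 b0; have [_ _ h _ _] := H x x b a hx hx b0 a0.
  have h1 : `|a - b| <= a + b by apply: le_trans (ler_normB _ _) _; rewrite !gtr0_norm.
  have h2 := le_trans (ler_norm _) (le_trans h (ler_wpM2l K0 h1)).
  by move: h2; rewrite mulrDr; move: (f _) (f _) (K * a) (K * b) => ? ? ? ?; lra.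
pose S := [set y | exists2 a, 0 < a & y = f (x, a) - K * a].
have ubS b : 0 < b -> ubound S (f (x, b) + K * b).
  by move=> b0 _ [a a0 ->]; exact: L.
have S0 : S !=set0 by exists (f (x, s) - K * s); exists s.
have hS : has_sup S by split => //; exists (f (x, s) + K * s); exact: ubS.
have bd t : 0 < t -> `|f (x, t) - sup S| <= K * t.
  move=> t0; have u1 : sup S <= f (x, t) + K * t by apply: ge_sup => //; exact: ubS.
  have u2 : f (x, t) - K * t <= sup S by apply: sup_upper_bound => //; exists t.
  by rewrite ler_norml; apply/andP; split; lra.
rewrite (_ : trace f x = sup S); first exact: bd.
apply: trace_eq; apply/cvgrPdist_lt => e e0.
have d0 : 0 < e / (K + 1) by rewrite divr_gt0 // ltr_wpDl.
near=> t; have t0 : 0 < t by near: t; exact: nbhs_right_gt.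
rewrite distrC; apply: le_lt_trans (bd t t0) _.
have td : t < e / (K + 1) by near: t; exact: nbhs_right_lt.
have K1 : 0 < K + 1 by rewrite ltr_wpDl.
apply: le_lt_trans (_ : t * (K + 1) < e); last by rewrite -ltr_pdivlMr.
by rewrite mulrC ler_wpM2l ?lerDl // ltW.
Unshelve. all: by end_near. Qed.

Definition hat f (x s : R) : R := if 0 < s then f (x, s) else trace f x.

Lemma hat_near f : nice f -> exists2 K, 0 <= K & forall x s e, `|x| < rho -> 0 <= s -> 0 < e ->
  `|hat f x s - f (x, s + e)| <= K * e.
Proof.
move=> nf; have [K [K0 H]] := nice_est nf; have [L L0 hL] := trace_le nf.
exists (K + L); first exact: addr_ge0.
move=> x s e hx s0 e0; rewrite /hat; have [sp|sn] := ltP 0 s.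
  have [_ _ h _ _] := H x x s (s + e) hx hx sp (addr_gt0 sp e0).
  rewrite distrC; apply: le_trans h _; rewrite [s + e]addrC addrK (gtr0_norm e0).
  by rewrite ler_wpM2r ?(ltW e0) // lerDl.
have -> : s = 0 by apply/eqP; rewrite eq_le sn.
rewrite add0r distrC; apply: le_trans (hL x e hx e0) _.
by rewrite ler_wpM2r ?(ltW e0) // lerDr.
Qed.

Lemma le_eps (X Y C : R) : 0 <= C -> (forall e, 0 < e -> X <= Y + C * e) -> X <= Y.
Proof.
move=> C0 H; apply/ler_addgt0Pl => e e0.
have C1 : 0 < C + 1 by rewrite ltr_wpDl.
apply: le_trans (H (e / (C + 1)) (divr_gt0 e0 C1)) _.
rewrite addrC lerD2r mulrA ler_pdivrMr // mulrC ler_wpM2l ?lerDl //; exact: ltW.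
Qed.

(** Each estimate is shifted by [e] into the open strip, at a cost proportional to [e], and [e]
    tends to 0. *)
Lemma hat_est f : nice f -> exists K, est (fun x => `|x| < rho) (fun s => 0 <= s) K
  (hat f) (hat (dx f)) (hat (dy f)).
Proof.
move=> nf; have [K [K0 H]] := nice_est nf; have [L L0 hL] := hat_near nf.
have [L1 L10 hL1] := hat_near (nice_dx nf); have [L2 L20 hL2] := hat_near (nice_dy nf).
exists K; split => // x x' s s' hx hx' s0 s'0.
have tri3 (a b c a' b' c' t u u1 v : R) : `|a - a'| <= u -> `|b - b'| <= u -> `|c - c'| <= u1 ->
    `|a' - b' - t * c'| <= v -> `|a - b - t * c| <= v + (2 * u + `|t| * u1).
  move=> h1 h2 h3 h4.
  have -> : a - b - t * c = (a' - b' - t * c') + ((a - a') - (b - b') - t * (c - c')) by ring.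
  apply: le_trans (ler_normD _ _) _; apply: lerD => //.
  apply: le_trans (ler_normB _ _) _; rewrite normrM; apply: lerD; last exact: ler_wpM2l.
  by apply: le_trans (ler_normB _ _) _; lra.
have tri2 (a b a' b' u v : R) : `|a - a'| <= u -> `|b - b'| <= u ->
    `|a' - b'| <= v -> `|a - b| <= v + 2 * u.
  move=> h1 h2 h4; have := tri3 a b 0 a' b' 0 0 u 0 v h1 h2.
  by rewrite !mul0r !subr0 normr0 lexx mul0r addr0; exact.
have P (t e : R) : 0 <= t -> 0 < e -> 0 < t + e by move=> t0 e0; exact: ltr_wpDl.
have cE (a b c e : R) : (2 * a + b * c) * e = 2 * (a * e) + b * (c * e) by ring.
have shE (a b e : R) : a + e - (b + e) = a - b by rewrite opprD addrACA subrr addr0.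
split.
- apply: (@le_eps _ _ L L0) => e e0; have h := hL x s e hx s0 e0.
  have [hb _ _ _ _] := H x x' _ _ hx hx' (P s e s0 e0) (P s' e s'0 e0).
  rewrite -(subrK (f (x, s + e)) (hat f x s)) addrC.
  by apply: le_trans (ler_normD _ _) _; exact: lerD.
- have c0 : 0 <= 2 * L by rewrite mulr_ge0.
  apply: (@le_eps _ _ (2 * L) c0) => e e0; rewrite -mulrA.
  have [_ h _ _ _] := H x x' _ _ hx hx' (P s e s0 e0) (P s' e s'0 e0).
  exact: tri2 (hL x' s e hx' s0 e0) (hL x s e hx s0 e0) h.
- have c0 : 0 <= 2 * L by rewrite mulr_ge0.
  apply: (@le_eps _ _ (2 * L) c0) => e e0; rewrite -mulrA.
  have [_ _ h _ _] := H x x' _ _ hx hx' (P s e s0 e0) (P s' e s'0 e0).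
  rewrite shE in h.
  exact: tri2 (hL x s' e hx s'0 e0) (hL x s e hx s0 e0) h.
- have c0 : 0 <= 2 * L + `|x' - x| * L1 by rewrite addr_ge0 // mulr_ge0.
  apply: (@le_eps _ _ _ c0) => e e0.
  have [_ _ _ h _] := H x x' _ _ hx hx' (P s e s0 e0) (P s' e s'0 e0).
  rewrite cE; exact: tri3 (hL x' s e hx' s0 e0) (hL x s e hx s0 e0) (hL1 x s e hx s0 e0) h.
- have c0 : 0 <= 2 * L + `|s' - s| * L2 by rewrite addr_ge0 // mulr_ge0.
  apply: (@le_eps _ _ _ c0) => e e0.
  have [_ _ _ _ h] := H x x' _ _ hx hx' (P s e s0 e0) (P s' e s'0 e0).
  rewrite shE in h.
  rewrite cE; exact: tri3 (hL x s' e hx s'0 e0) (hL x s e hx s0 e0) (hL2 x s e hx s0 e0) h.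
Qed.

(** * Seeley reflection across the axis *)

Section Series.
Variables (adm : (R -> R) -> Prop) (Ser : (R -> R) -> R) (B : nat -> R).
Hypothesis B0 : forall j, 0 <= B j.
Hypothesis admP : forall phi K j, (forall b, 0 < b -> `|phi b| <= K * b ^+ j) -> adm phi.
Hypothesis SerD : forall phi psi, adm phi -> adm psi ->
  adm (fun b => phi b + psi b) /\ Ser (fun b => phi b + psi b) = Ser phi + Ser psi.
Hypothesis SerZ : forall c phi, adm phi ->
  adm (fun b => c * phi b) /\ Ser (fun b => c * phi b) = c * Ser phi.
Hypothesis Ser_le : forall phi K j, 0 <= K -> (forall b, 0 < b -> `|phi b| <= K * b ^+ j) ->
  `|Ser phi| <= K * B j.
Hypothesis Ser1 : forall j, Ser (fun b => (- b) ^+ j) = 1.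

(** [Ser] stands for a sum of terms [a_i phi(b_i)] over positive nodes [b_i] whose moments, the sums
    of [a_i (- b_i)^j], all equal 1; [B j] bounds the sum of [|a_i| b_i^j]. Differentiating
    [f (x, - b y)] in [y] brings out [- b], so the [y]-derivative of [refl j f] is
    [refl j.+1 (dy f)], and the moments make all derivatives match those of [f] on the axis. *)
Definition refl (j : nat) f (x y : R) : R := Ser (fun b => (- b) ^+ j * hat f x (b * - y)).

Definition extend (j : nat) f (z : R * R) : R :=
  if 0 <= z.2 then hat f z.1 z.2 else refl j f z.1 z.2.

Lemma adm_pow j : adm (fun b => (- b) ^+ j).
Proof.
by apply: (admP (K := 1) (j := j)) => b b0; rewrite normrX normrN (gtr0_norm b0) mul1r.
Qed.

(** On the axis itself both branches agree, by the moment of order [j]. *)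
Lemma extend_le0 j f x y : y <= 0 -> extend j f (x, y) = refl j f x y.
Proof.
move=> y0; rewrite /extend /=; case: ifP => // y1.
have -> : y = 0 by apply/eqP; rewrite eq_le y0.
rewrite /refl oppr0; have [_ h] := SerZ (hat f x 0) (adm_pow j).
rewrite Ser1 mulr1 in h; rewrite -[LHS]h; congr Ser; apply/funext => b.
by rewrite mulr0 mulrC.
Qed.

Lemma refl_adm f j x y : nice f -> `|x| < rho -> y <= 0 ->
  adm (fun b => (- b) ^+ j * hat f x (b * - y)).
Proof.
move=> nf hx y0; have [K [K0 H]] := hat_est nf.
apply: (admP (K := K) (j := j)) => b b0.
have s0 : 0 <= b * - y by rewrite mulr_ge0 ?oppr_ge0 // ltW.
have [h _ _ _ _] := H x x _ _ hx hx s0 s0.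
by rewrite normrM normrX normrN (gtr0_norm b0) mulrC ler_wpM2r // exprn_ge0 // ltW.
Qed.

(** The estimates of [hat f] hold term by term. A difference in [y] is stretched by the node [b], so
    the first- and second-order bounds in [y] need the sums with [b^(j + 1)] and [b^(j + 2)]. *)
Lemma refl_est j f : nice f -> exists K, est (fun x => `|x| < rho) (fun y => y <= 0) K
  (refl j f) (refl j (dx f)) (refl j.+1 (dy f)).
Proof.
move=> nf; have [K [K0 H]] := hat_est nf.
pose C := K * (B j + B j.+1 + B j.+2).
have [c0 c1 c2] : [/\ K * B j <= C, K * B j.+1 <= C & K * B j.+2 <= C].
  have b0 := B0 j; have b1 := B0 j.+1; have b2 := B0 j.+2.
  by split; rewrite ler_wpM2l // -?addrA ?lerDl ?addr_ge0 // addrCA ?lerDl ?addr_ge0 // addrA lerDr addr_ge0.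
have C0 : 0 <= C by apply: le_trans c0; exact: mulr_ge0.
exists C; split => // x x' y y' hx hx' y0 y'0.
have pos (b t : R) : 0 < b -> t <= 0 -> 0 <= b * - t by move=> b0 t0; rewrite mulr_ge0 ?oppr_ge0 // ltW.
have pw (b : R) n : 0 < b -> `|(- b) ^+ n| = b ^+ n by move=> b0; rewrite normrX normrN (gtr0_norm b0).
have SB phi psi c chi : adm phi -> adm psi -> adm chi ->
    Ser phi - Ser psi - c * Ser chi = Ser (fun b => phi b - psi b - c * chi b).
  move=> ap ac ax; have [a1 e1] := SerZ (-1) ac; have [a2 e2] := SerZ (- c) ax.
  have [a3 e3] := SerD ap a1; have [a4 e4] := SerD a3 a2.
  rewrite -mulN1r -mulNr -e1 -e2 -e3 -e4; congr Ser; apply/funext => b.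
  by rewrite mulN1r mulNr.
have SB2 phi psi : adm phi -> adm psi -> Ser phi - Ser psi = Ser (fun b => phi b - psi b).
  move=> ap ac; have := SB phi psi 0 psi ap ac ac.
  rewrite mul0r subr0 => ->; congr Ser; apply/funext => b; by rewrite mul0r subr0.
have a1 := @refl_adm f j x y nf hx y0; have a2 := @refl_adm f j x' y nf hx' y0.
have a3 := @refl_adm f j x y' nf hx y'0.
have a4 := @refl_adm _ j x y (nice_dx nf) hx y0.
have a5 := @refl_adm _ j.+1 x y (nice_dy nf) hx y0.
split.
- apply: le_trans c0; apply: Ser_le => // b b0.
  have [h _ _ _ _] := H x x _ _ hx hx (pos b y b0 y0) (pos b y b0 y0).
  by rewrite normrM pw // mulrC ler_wpM2r // exprn_ge0 // ltW.
- rewrite /refl SB2 //.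
  apply: (@le_trans _ _ ((K * `|x' - x|) * B j)); last by rewrite mulrAC ler_wpM2r.
  apply: Ser_le => [|b b0]; first exact: mulr_ge0.
  have [_ h _ _ _] := H x x' _ _ hx hx' (pos b y b0 y0) (pos b y b0 y0).
  by rewrite -mulrBr normrM pw // mulrC ler_wpM2r // exprn_ge0 // ltW.
- rewrite /refl SB2 //.
  apply: (@le_trans _ _ ((K * `|y' - y|) * B j.+1)); last by rewrite mulrAC ler_wpM2r.
  apply: Ser_le => [|b b0]; first exact: mulr_ge0.
  have [_ _ h _ _] := H x x' _ _ hx hx' (pos b y b0 y0) (pos b y' b0 y'0).
  have e1 : b * - y' - b * - y = - b * (y' - y) by ring.
  rewrite e1 in h.
  rewrite -mulrBr normrM pw //; apply: le_trans (ler_wpM2l _ h) _; first by rewrite exprn_ge0 // ltW.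
  rewrite normrM normrN (gtr0_norm b0) exprS le_eqVlt; apply/orP; left; apply/eqP.
  by move: (b ^+ j) (`|y' - y|) => ? ?; ring.
- rewrite /refl (SB _ _ (x' - x) _ a2 a1 a4).
  apply: (@le_trans _ _ ((K * `|x' - x| ^+ 2) * B j)); last by rewrite mulrAC ler_wpM2r // exprn_ge0.
  apply: Ser_le => [|b b0]; first by rewrite mulr_ge0 // exprn_ge0.
  have [_ _ _ h _] := H x x' _ _ hx hx' (pos b y b0 y0) (pos b y b0 y0).
  by rewrite [_ * (_ * hat _ _ _)]mulrCA -!mulrBr normrM pw // mulrC ler_wpM2r // exprn_ge0 // ltW.
- rewrite /refl (SB _ _ (y' - y) _ a3 a1 a5).
  apply: (@le_trans _ _ ((K * `|y' - y| ^+ 2) * B j.+2)); last by rewrite mulrAC ler_wpM2r // exprn_ge0.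
  apply: Ser_le => [|b b0]; first by rewrite mulr_ge0 // exprn_ge0.
  have [_ _ _ _ h] := H x x' _ _ hx hx' (pos b y b0 y0) (pos b y' b0 y'0).
  have e1 : b * - y' - b * - y = - b * (y' - y) by ring.
  rewrite e1 in h.
  have e2 p q r : (- b) ^+ j * p - (- b) ^+ j * q - (y' - y) * ((- b) ^+ j.+1 * r) =
    (- b) ^+ j * (p - q - - b * (y' - y) * r).
    by rewrite exprS; move: ((- b) ^+ j) => t; ring.
  rewrite e2 normrM pw //; apply: le_trans (ler_wpM2l _ h) _; first by rewrite exprn_ge0 // ltW.
  rewrite normrM normrN (gtr0_norm b0) !exprS expr0 le_eqVlt; apply/orP; left; apply/eqP.
  by move: (b ^+ j) (`|y' - y|) => ? ?; ring.
Qed.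

(** Two points on different sides are joined through the axis. Their second-order remainders add up,
    and the change of the derivative between [y] and 0 contributes a cross term; the constant at
    most doubles. *)
Lemma extend_est j f : nice f -> exists K, est (fun x => `|x| < rho) (fun y => True) K
  (fun x y => extend j f (x, y)) (fun x y => extend j (dx f) (x, y))
  (fun x y => extend j.+1 (dy f) (x, y)).
Proof.
move=> nf; have [K1 [K10 H1]] := hat_est nf; have [K2 [K20 H2]] := refl_est j nf.
have [K3 [K30 H3]] := hat_est (nice_dy nf); have [K4 [K40 H4]] := refl_est j.+1 (nice_dy nf).
pose K := K1 + K2 + K3 + K4; have K0 : 0 <= K by rewrite !addr_ge0.
have [k1 k2 k3 k4] : [/\ K1 <= K, K2 <= K, K3 <= K & K4 <= K].
  by move: K10 K20 K30 K40; rewrite /K => ? ? ? ?; split; lra.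
have E0 i g x y : 0 <= y -> extend i g (x, y) = hat g x y by rewrite /extend /= => ->.
have Up x x' y y' : `|x| < rho -> `|x'| < rho -> 0 <= y -> 0 <= y' ->
  [/\ `|extend j f (x, y)| <= K, `|extend j f (x', y) - extend j f (x, y)| <= K * `|x' - x|,
    `|extend j f (x, y') - extend j f (x, y)| <= K * `|y' - y|,
    `|extend j f (x', y) - extend j f (x, y) - (x' - x) * extend j (dx f) (x, y)| <= K * `|x' - x| ^+ 2 &
    `|extend j f (x, y') - extend j f (x, y) - (y' - y) * extend j.+1 (dy f) (x, y)| <= K * `|y' - y| ^+ 2].
  move=> hx hx' y0 y'0; rewrite !E0 //; have [h1 h2 h3 h4 h5] := H1 x x' y y' hx hx' y0 y'0.
  split; [exact: le_trans k1|apply: le_trans h2 _|apply: le_trans h3 _|apply: le_trans h4 _|apply: le_trans h5 _];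
    by rewrite ler_wpM2r // exprn_ge0.
have Lo x x' y y' : `|x| < rho -> `|x'| < rho -> y <= 0 -> y' <= 0 ->
  [/\ `|extend j f (x, y)| <= K, `|extend j f (x', y) - extend j f (x, y)| <= K * `|x' - x|,
    `|extend j f (x, y') - extend j f (x, y)| <= K * `|y' - y|,
    `|extend j f (x', y) - extend j f (x, y) - (x' - x) * extend j (dx f) (x, y)| <= K * `|x' - x| ^+ 2 &
    `|extend j f (x, y') - extend j f (x, y) - (y' - y) * extend j.+1 (dy f) (x, y)| <= K * `|y' - y| ^+ 2].
  move=> hx hx' y0 y'0; rewrite !extend_le0 //; have [h1 h2 h3 h4 h5] := H2 x x' y y' hx hx' y0 y'0.
  split; [exact: le_trans k2|apply: le_trans h2 _|apply: le_trans h3 _|apply: le_trans h4 _|apply: le_trans h5 _];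
    by rewrite ler_wpM2r // exprn_ge0.
have Ly x y : `|x| < rho -> `|extend j.+1 (dy f) (x, 0) - extend j.+1 (dy f) (x, y)| <= K * `|y|.
  move=> hx; have [y0|/ltW y0] := leP 0 y.
    rewrite !E0 //; have [_ _ h _ _] := H3 x x y 0 hx hx y0 (lexx 0).
    by apply: le_trans h _; rewrite sub0r normrN ler_wpM2r.
  rewrite !extend_le0 //; have [_ _ h _ _] := H4 x x y 0 hx hx y0 (lexx 0).
  by apply: le_trans h _; rewrite sub0r normrN ler_wpM2r.
have sgn (y y' : R) : (0 <= y /\ 0 <= y') \/ (y <= 0 /\ y' <= 0) \/
    (`|y| + `|y'| = `|y' - y| /\ ((y <= 0 /\ 0 <= y') \/ (0 <= y /\ y' <= 0))).
  have [y0|/ltW y0] := leP 0 y; have [y1|/ltW y1] := leP 0 y'.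
  - by left.
  - right; right; split; last by right.
    by rewrite (ger0_norm y0) (ler0_norm y1) ler0_norm ?opprB // subr_le0 (le_trans y1).
  - right; right; split; last by left.
    by rewrite (ler0_norm y0) (ger0_norm y1) ger0_norm ?subr_ge0 1?addrC // (le_trans y0).
  - by right; left.
exists (2 * K); split; first exact: mulr_ge0.
have KK : K <= 2 * K by lra.
have mono (a b : R) n : `|a| <= K * `|b| ^+ n -> `|a| <= 2 * K * `|b| ^+ n.
  by move=> h; apply: le_trans h _; rewrite ler_wpM2r // exprn_ge0.
move=> x x' y y' hx hx' _ _.
have Same : [/\ `|extend j f (x, y)| <= K, `|extend j f (x', y) - extend j f (x, y)| <= K * `|x' - x| &
    `|extend j f (x', y) - extend j f (x, y) - (x' - x) * extend j (dx f) (x, y)| <= K * `|x' - x| ^+ 2].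
  have [y0|/ltW y0] := leP 0 y.
    by have [] := Up x x' y y hx hx' y0 y0.
  by have [] := Lo x x' y y hx hx' y0 y0.
have [s1 s2 s3] := Same.
suff [l1 l2] : `|extend j f (x, y') - extend j f (x, y)| <= 2 * K * `|y' - y| /\
  `|extend j f (x, y') - extend j f (x, y) - (y' - y) * extend j.+1 (dy f) (x, y)| <= 2 * K * `|y' - y| ^+ 2.
  split => //; [exact: le_trans KK|exact: (mono _ _ 1)|exact: (mono _ _ 2)].
have [[y0 y'0]|[[y0 y'0]|[ab sg]]] := sgn y y'.
- have [_ _ h3 _ h5] := Up x x' y y' hx hx' y0 y'0; split; [exact: (mono _ _ 1)|exact: (mono _ _ 2)].
- have [_ _ h3 _ h5] := Lo x x' y y' hx hx' y0 y'0; split; [exact: (mono _ _ 1)|exact: (mono _ _ 2)].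
have [p1 p2 q1 q2] : [/\ `|extend j f (x, 0) - extend j f (x, y)| <= K * `|y|,
    `|extend j f (x, y') - extend j f (x, 0)| <= K * `|y'|,
    `|extend j f (x, 0) - extend j f (x, y) - (0 - y) * extend j.+1 (dy f) (x, y)| <= K * `|y| ^+ 2 &
    `|extend j f (x, y') - extend j f (x, 0) - (y' - 0) * extend j.+1 (dy f) (x, 0)| <= K * `|y'| ^+ 2].
  have [[y0 y'0]|[y0 y'0]] := sg.
    have [_ _ a1 _ a2] := Lo x x y 0 hx hx y0 (lexx 0).
    have [_ _ b1 _ b2] := Up x x 0 y' hx hx (lexx 0) y'0.
    by rewrite !(sub0r, subr0) !normrN in a1 a2 b1 b2 *.
  have [_ _ a1 _ a2] := Up x x y 0 hx hx y0 (lexx 0).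
  have [_ _ b1 _ b2] := Lo x x 0 y' hx hx (lexx 0) y'0.
  by rewrite !(sub0r, subr0) !normrN in a1 a2 b1 b2 *.
have p3 := Ly x y hx.
have h : `|y' * (extend j.+1 (dy f) (x, 0) - extend j.+1 (dy f) (x, y))| <= `|y'| * (K * `|y|).
  by rewrite normrM ler_wpM2l.
rewrite -ab; move: (`|y|) (`|y'|) (normr_ge0 y) (normr_ge0 y') p1 p2 q1 q2 h => a b a0 b0 p1 p2 q1 q2.
move: p1 p2 q1 q2.
move: (extend j f (x, y)) (extend j f (x, y')) (extend j f (x, 0)) => e1 e2 e3.
move: (extend j.+1 (dy f) (x, y)) (extend j.+1 (dy f) (x, 0)) => d1 d2 p1 p2 q1 q2 h.
split.
  have -> : e2 - e1 = (e3 - e1) + (e2 - e3) by ring.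
  apply: le_trans (ler_normD _ _) _; apply: le_trans (lerD p1 p2) _.
  by rewrite -mulrDr ler_wpM2r // addr_ge0.
have -> : e2 - e1 - (y' - y) * d1 =
  (e3 - e1 - (0 - y) * d1) + (e2 - e3 - (y' - 0) * d2) + y' * (d2 - d1) by ring.
apply: le_trans (ler_normD _ _) _; apply: le_trans (lerD (ler_normD _ _) h) _.
apply: le_trans (lerD (lerD q1 q2) (lexx _)) _.
have : 0 <= K * (a * b) by rewrite !mulr_ge0.
have : 0 <= K * a ^+ 2 by rewrite mulr_ge0 // exprn_ge0.
have : 0 <= K * b ^+ 2 by rewrite mulr_ge0 // exprn_ge0.
by nra.
Qed.

Definition wide : set (R * R) := [set z | `|z.1| < rho].

Lemma open_wide : open wide.
Proof.
rewrite /wide (_ : [set z | _] = (fun z : R * R => `|z.1|) @^-1` [set t | t < rho]) //.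
apply: open_comp; last exact: open_lt.
by move=> z _; apply: (@continuous_comp _ _ _ fst (fun t : R => `|t|)); [exact: cvg_fst|exact: norm_continuous].
Qed.

Lemma extend_derive j f z : nice f -> wide z -> differentiable (extend j f) z /\
  forall v, 'D_v (extend j f) z = v.1 * extend j (dx f) z + v.2 * extend j.+1 (dy f) z.
Proof.
move=> nf wz; have [K [K0 H]] := extend_est j nf.
have [L [L0 HL]] := extend_est j.+1 (nice_dy nf).
have d0 : 0 < rho - `|z.1| by rewrite subr_gt0.
apply: (@quad_differentiable _ z (extend j (dx f) z) (extend j.+1 (dy f) z) (2 * K + L) _ d0) => h.
rewrite pair_norm_lt => /andP[h1 _].
have wz' : `|h.1 + z.1| < rho by apply: le_lt_trans (ler_normD _ _) _; rewrite -ltrBrDr.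
have [_ _ _ e1 _] := H z.1 (h.1 + z.1) z.2 z.2 wz wz' I I.
have [_ _ _ _ e2] := H (h.1 + z.1) z.1 z.2 (h.2 + z.2) wz' wz I I.
have [_ e3 _ _ _] := HL z.1 (h.1 + z.1) z.2 z.2 wz wz' I I.
rewrite !addrK -!surjective_pairing in e1 e2 e3.
have hz : h + z = (h.1 + z.1, h.2 + z.2) by [].
rewrite hz /lin2.
have l1 : `|h.1| <= `|h| by rewrite prod_normE le_max lexx.
have l2 := snd_le_norm h.
move: (extend j f z) (extend j f (h.1 + z.1, z.2)) (extend j f (h.1 + z.1, h.2 + z.2)) e1 e2 => a1 a2 a3.
move: (extend j (dx f) z) (extend j.+1 (dy f) z) (extend j.+1 (dy f) (h.1 + z.1, z.2)) e3 => b1 b2 b3 e3 e1 e2.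
have -> : a3 - a1 - (h.1 * b1 + h.2 * b2) = (a2 - a1 - h.1 * b1) + (a3 - a2 - h.2 * b3) + h.2 * (b3 - b2) by ring.
have s1 : `|h.1| ^+ 2 <= `|h| ^+ 2 by rewrite ler_sqr ?nnegrE.
have s2 : `|h.2| ^+ 2 <= `|h| ^+ 2 by rewrite ler_sqr ?nnegrE.
have e4 : `|h.2 * (b3 - b2)| <= L * `|h| ^+ 2.
  rewrite normrM; apply: le_trans (ler_wpM2l (normr_ge0 _) e3) _.
  by rewrite mulrCA ler_wpM2l // expr2; apply: ler_pM.
apply: le_trans (ler_normD _ _) _; apply: le_trans (lerD (ler_normD _ _) e4) _.
rewrite mulrDl lerD2r -mulrA mulrDl mul1r.
by apply: lerD; [apply: le_trans e1 _|apply: le_trans e2 _]; rewrite ler_wpM2l.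
Qed.

(** The family of all [extend j f] is closed under differentiation, so differentiability alone gives
    smoothness by induction. *)
Lemma extend_smooth j f : nice f -> smooth_on wide (extend j f).
Proof.
move=> nf n; elim: n j f nf => [|n IH] j f nf.
  by move=> z wz; have [/differentiable_continuous] := extend_derive j nf wz.
split=> [z wz|v]; first by have [] := extend_derive j nf wz.
have ow := open_wide.
have c1 := Cn_onM ow (Cn_on_cst n wide v.1) (IH j _ (nice_dx nf)).
have c2 := Cn_onM ow (Cn_on_cst n wide v.2) (IH j.+1 _ (nice_dy nf)).
apply: (Cn_on_eq ow) (Cn_onD ow c1 c2) => z wz.
by have [_ ->] := extend_derive j nf wz.
Qed.

End Series.
End Extension.

(** * Coefficients of the reflection *)

Section Theta.
Variable R : realType.

(** Coefficients of a theta series with [q = 1/8]: over all integers [n], the coefficient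
    [(-1)^n q^(n (n + 1) / 2)] belongs to the node [q^n]. Here [ndm l] is the node of [n = l] and
    [ndp l] that of [n = - l - 1], whose coefficient is [- th l]. The quadratic exponents make every
    power of the nodes summable, and the series applied to [b^j] is 0 because theta has a zero
    there. *)
Definition th (l : nat) : R := (-1) ^+ l / 8 ^+ 'C(l.+1, 2).
Definition ndm (l : nat) : R := (8 ^+ l)^-1.
Definition ndp (l : nat) : R := 8 ^+ l.+1.

Let p8 : 0 < 8 :> R. Proof. by rewrite ltr0n. Qed.
Let u8 : 8 != 0 :> R. Proof. by rewrite gt_eqF. Qed.

Lemma ndm_gt0 l : 0 < ndm l. Proof. by rewrite invr_gt0 exprn_gt0. Qed.
Lemma ndp_gt0 l : 0 < ndp l. Proof. by rewrite exprn_gt0. Qed.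

Lemma th_norm l : `|th l| = (8 ^+ 'C(l.+1, 2))^-1.
Proof. by rewrite normrM normrX normrN1 expr1n mul1r ger0_norm // invr_ge0 exprn_ge0 // ltW. Qed.

Lemma thS l : th l.+1 = - th l * ndm l.+1.
Proof.
rewrite /th /ndm binS bin1 exprD invfM exprS.
by move: ((-1) ^+ l) ((8 ^+ 'C(l.+1, 2))^-1) ((8 ^+ l.+1)^-1) => a b c; ring.
Qed.

Lemma triangle_bound l j : (l.+1 * j.+1 <= j.+1.*2 * j.+1 + 'C(l.+1, 2))%N.
Proof.
have e : ('C(l.+1, 2).*2 = l.+1 * l)%N.
  by elim: l => [//|l IH]; rewrite binS bin1 doubleD IH -!muln2; nia.
by move: ('C(_, _)) e => c e; nia.
Qed.

Definition tb (j l : nat) : R := `|th l| * (1 + ndp l ^+ j).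

Lemma tb_le j l : tb j l <= geometric (2 * 8 ^+ (j.+1.*2 * j.+1)) 8^-1 l.
Proof.
rewrite /geometric /= /tb th_norm.
have h1 : 1 <= ndp l ^+ j by rewrite exprn_ege1 // exprn_ege1 // ler1n.
apply: (@le_trans _ _ ((8 ^+ 'C(l.+1, 2))^-1 * (2 * ndp l ^+ j))).
  by rewrite ler_wpM2l ?invr_ge0 ?exprn_ge0 ?(ltW p8) // mulrDl mul1r lerD2r.
rewrite mulrCA -mulrA ler_wpM2l // mulrC ler_pdivrMr ?exprn_gt0 // exprVn.
rewrite mulrAC ler_pdivlMr ?exprn_gt0 // /ndp -exprM -!exprD ler_eXn2l ?ltr1n //.
have := triangle_bound l j; rewrite mulnS; lia.
Qed.

Lemma tb_ge0 j l : 0 <= tb j l.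
Proof. by rewrite mulr_ge0 // addr_ge0 // exprn_ge0 // ltW // ndp_gt0. Qed.

Lemma tb_cvg j : cvgn (series (tb j)).
Proof.
apply: series_le_cvg (tb_ge0 j) _ (tb_le j) _ => [n|].
  by apply: le_trans (tb_ge0 j n) (tb_le j n).
by apply: is_cvg_geometric_series; rewrite ger0_norm ?invr_ge0 ?(ltW p8) // invf_lt1 // ltr1n.
Qed.

(** Dividing by [1 + b] turns vanishing power sums into alternating ones: [b^j / (1 + b)] and
    [b^(j + 1) / (1 + b)] add up to [b^j], whose sum is 0. Up to a common normalisation these are
    the moments wanted. *)
Definition raw (phi : R -> R) (l : nat) : R :=
  th l * (phi (ndm l) / (1 + ndm l) - phi (ndp l) / (1 + ndp l)).

Lemma raw_le phi K j l : 0 <= K -> (forall b, 0 < b -> `|phi b| <= K * b ^+ j) ->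
  `|raw phi l| <= K * tb j l.
Proof.
move=> K0 H; rewrite normrM mulrCA ler_wpM2l //.
have q b : 0 < b -> `|phi b / (1 + b)| <= K * b ^+ j.
  move=> b0; have b1 : 0 < 1 + b by rewrite addr_gt0.
  rewrite normrM normfV (gtr0_norm b1) ler_pdivrMr //; apply: le_trans (H b b0) _.
  by rewrite ler_peMr ?mulr_ge0 ?exprn_ge0 ?(ltW b0) // lerDl ltW.
apply: le_trans (ler_normB _ _) _; rewrite mulrDr mulr1; apply: lerD; last exact: q (ndp_gt0 l).
apply: le_trans (q _ (ndm_gt0 l)) _; rewrite ler_piMr // exprn_ile1 ?(ltW (ndm_gt0 l)) //.
by rewrite invf_le1 ?exprn_gt0 // exprn_ege1 // ler1n.
Qed.

Lemma raw_ncvg phi K j : 0 <= K -> (forall b, 0 < b -> `|phi b| <= K * b ^+ j) ->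
  cvgn [normed series (raw phi)].
Proof.
move=> K0 H; have c : cvgn (series (fun l => K * tb j l)) := @is_cvg_seriesZ _ (tb j) K (@tb_cvg j).
apply: (@series_le_cvg R (fun l => `|raw phi l|) _ _ _ _ c) => n //.
  by apply: mulr_ge0 => //; exact: tb_ge0.
exact: raw_le.
Qed.

Definition rawS (phi : R -> R) : R := limn (series (raw phi)).

Lemma rawS_le phi K j : 0 <= K -> (forall b, 0 < b -> `|phi b| <= K * b ^+ j) ->
  `|rawS phi| <= K * limn (series (tb j)).
Proof.
move=> K0 H; have c := raw_ncvg K0 H; apply: le_trans (lim_series_norm c) _.
have -> : K * limn (series (tb j)) = limn (series (K *: tb j)).
  by rewrite (lim_seriesZ K (@tb_cvg j)).
by apply: lim_series_le => //; [exact: (@is_cvg_seriesZ _ (tb j) K (@tb_cvg j))|move=> n; exact: raw_le].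
Qed.

Definition diff (j l : nat) : R := th l * (ndm l ^+ j - ndp l ^+ j).

(** The functional equation of theta for partial sums: raising [j] by one shifts the index, and only
    two boundary terms survive, which tend to 0. *)
Lemma diffS j L : series (diff j.+1) L.+1 =
  - 8 ^+ j.+1 * (series (diff j) L + th L * ndm L ^+ j + th L.+1 * ndm L.+1 ^+ j).
Proof.
have mS l : 8 * ndm l.+1 = ndm l by rewrite /ndm exprS invfM mulrA mulfV // mul1r.
have pS l : ndp l.+1 = 8 * ndp l by rewrite /ndp exprS.
have mp l : ndm l.+1 * ndp l = 1 by rewrite /ndm /ndp mulVf // expf_neq0.
elim: L => [|L IH].
  rewrite seriesSr !seriesEnat /= !big_geq // !add0r /diff thS.
  have -> : th 0 = 1 by rewrite /th bin_small // !expr0 divr1.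
  rewrite {1}/ndm expr0 invr1 !expr1n /ndm expr0 invr1 expr1n /ndp expr1 !mul1r.
  rewrite exprS exprVn; have e : 8 ^+ j != 0 :> R by rewrite expf_neq0.
  by move: (8 ^+ j : R) e => t t0; field; rewrite t0.
rewrite seriesSr IH [series (diff j) L.+1]seriesSr /diff.
have e1 : th L.+1 * ndm L.+1 ^+ j.+1 = - 8 ^+ j.+1 * (th L.+2 * ndm L.+2 ^+ j).
  rewrite (thS L.+1) -(mS L.+1) exprMn !exprS.
  by move: (th L.+1) (ndm L.+2) (8 ^+ j) => a b c; move: (b ^+ j) => d; ring.
have e2 : th L.+1 * ndp L.+1 ^+ j.+1 = - 8 ^+ j.+1 * (th L * ndp L ^+ j).
  rewrite (thS L) pS exprMn; have := mp L.
  rewrite [ndp L ^+ j.+1]exprS; move: (th L) (ndm L.+1) (ndp L) (8 ^+ j.+1) => a b c d bc.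
  move: (c ^+ j) => x; transitivity (- d * (a * x) * (b * c)); first by ring.
  by rewrite bc mulr1.
rewrite !mulrBr e1 e2.
move: (series (diff j) L) (th L * ndm L ^+ j) (th L.+1 * ndm L.+1 ^+ j) (th L * ndp L ^+ j)
  (th L.+2 * ndm L.+2 ^+ j) (8 ^+ j.+1) => a b c d e g; ring.
Qed.

Lemma th_ndm_cvg j : (fun l => th l * ndm l ^+ j) @ \oo --> 0.
Proof.
have c : cvgn [normed series (fun l => th l * ndm l ^+ j)].
  apply: (@series_le_cvg R (fun l => `|th l * ndm l ^+ j|) (tb j) _ _ _ (@tb_cvg j)) => n //.
    exact: tb_ge0.
  rewrite /= normrM ler_wpM2l //.
  rewrite ger0_norm ?exprn_ge0 ?(ltW (ndm_gt0 n)) //.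
  apply: (@le_trans _ _ 1).
    by rewrite exprn_ile1 ?(ltW (ndm_gt0 n)) // invf_le1 ?exprn_gt0 // exprn_ege1 // ler1n.
  by rewrite lerDl exprn_ge0 // ltW // ndp_gt0.
exact: cvg_series_cvg_0 (normed_cvg c).
Qed.

Lemma diff_cvg0 j : series (diff j) @ \oo --> 0.
Proof.
elim: j => [|j IH].
  have -> : series (diff 0) = fun=> 0.
    by apply/funext => n; rewrite /series /= big1 // => i _; rewrite /diff !expr0 subrr mulr0.
  exact: cvg_cst.
rewrite -(cvg_shiftS (series (diff j.+1))).
have -> : (fun n => series (diff j.+1) n.+1) = fun n => - 8 ^+ j.+1 *
    (series (diff j) n + th n * ndm n ^+ j + th n.+1 * ndm n.+1 ^+ j).
  by apply/funext => n; exact: diffS.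
have t := @th_ndm_cvg j.
have t' : (fun n => th n.+1 * ndm n.+1 ^+ j) @ \oo --> 0.
  by rewrite (cvg_shiftS (fun l => th l * ndm l ^+ j)).
have c8 : (fun _ : nat => - 8 ^+ j.+1 : R) @ \oo --> (- 8 ^+ j.+1 : R) by exact: cvg_cst.
by have := cvgM c8 (cvgD (cvgD IH t) t'); rewrite !addr0 mulr0; apply.
Qed.

Lemma pow_bound j (b : R) : 0 < b -> `|b ^+ j| <= 1 * b ^+ j.
Proof. by move=> b0; rewrite mul1r ger0_norm // exprn_ge0 // ltW. Qed.

Lemma rawS_pow j : rawS (fun b => b ^+ j) = (-1) ^+ j * rawS (fun=> 1).
Proof.
elim: j => [|j IH].
  by rewrite expr0 mul1r; congr rawS; apply/funext => b; rewrite expr0.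
have c i := normed_cvg (raw_ncvg ler01 (@pow_bound i)).
have e : rawS (fun b => b ^+ j) + rawS (fun b => b ^+ j.+1) = 0.
  rewrite /rawS -(lim_seriesD (c j) (c j.+1)).
  have -> : raw (fun b => b ^+ j) + raw (fun b => b ^+ j.+1) = diff j.
    apply/funext => l; change (raw (fun b => b ^+ j) l + raw (fun b => b ^+ j.+1) l = diff j l).
    have m1 : 1 + ndm l != 0 by rewrite gt_eqF // addr_gt0 // ndm_gt0.
    have m2 : 1 + ndp l != 0 by rewrite gt_eqF // addr_gt0 // ndp_gt0.
    rewrite /raw /diff !exprS; move: (ndm l) (ndp l) m1 m2 => a b m1 m2.
    move: (a ^+ j) (b ^+ j) => x y; field; exact/andP.
  exact: cvg_lim (@diff_cvg0 j).
by rewrite exprS mulN1r mulNr -IH; apply/eqP; rewrite -addr_eq0 addrC e.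
Qed.

(** The term of index 0 is [1/2 - 1/9 = 7/18]; the others are at most [8^(-l)] in size and sum to at
    most [1/7]. *)
Lemma rawS1_gt0 : 0 < rawS (fun=> 1).
Proof.
have c := normed_cvg (raw_ncvg ler01 (@pow_bound 0)).
have e0 : (fun b : R => b ^+ 0) = fun=> 1 by apply/funext => b; rewrite expr0.
rewrite e0 in c.
have d l : raw (fun=> 1) l >= - 8^-1 ^+ l /\ (l = 0%N -> raw (fun=> 1) l = 7 / 18).
  have m0 := ndm_gt0 l; have q0 := ndp_gt0 l.
  have m1 : 0 < 1 + ndm l by rewrite addr_gt0. have q1 : 0 < 1 + ndp l by rewrite addr_gt0.
  split; last first.
    by move=> ->; rewrite /raw /th /ndm /ndp bin_small // !expr0 expr1; field.
  have h1 : `|1 / (1 + ndm l) - 1 / (1 + ndp l)| <= 1.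
    have a1 : 0 <= 1 / (1 + ndm l) <= 1.
      by rewrite divr_ge0 ?(ltW m1) //= ler_pdivrMr // mul1r lerDl ltW.
    have a2 : 0 <= 1 / (1 + ndp l) <= 1.
      by rewrite divr_ge0 ?(ltW q1) //= ler_pdivrMr // mul1r lerDl ltW.
    by move: (1 / _) (1 / _) a1 a2 => x y /andP[? ?] /andP[? ?]; rewrite ler_norml; apply/andP; split; lra.
  have h2 : `|raw (fun=> 1) l| <= 8^-1 ^+ l.
    rewrite /raw normrM; apply: (@le_trans _ _ (`|th l|)); first by rewrite ler_piMr.
    rewrite th_norm exprVn lef_pV2 ?posrE ?exprn_gt0 // ler_eXn2l ?ltr1n //.
    by move: l {m0 q0 m1 q1 h1} => [//|l]; rewrite binS bin1 leq_addl.
  by move: h2; rewrite ler_norml => /andP[].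
have lb n : 7 / 18 - 7^-1 * (1 - 8^-1 ^+ n) <= series (raw (fun=> 1)) n.+1.
  elim: n => [|n IH].
    by rewrite seriesSr seriesEnat /= big_geq // add0r (d 0%N).2 // expr0 subrr mulr0 subr0.
  rewrite seriesSr; apply: le_trans (lerD IH (d n.+1).1).
  by rewrite exprS; move: (8^-1 ^+ n : R) => t; rewrite le_eqVlt; apply/orP; left; apply/eqP; field.
have : 7 / 18 - 7^-1 <= rawS (fun=> 1).
  apply: limr_ge => //; exists 1%N => // -[//|n] _ /=; apply: le_trans (lb n).
  have e1 : 1 - 8^-1 ^+ n <= 1 :> R by rewrite gerBl exprn_ge0 // invr_ge0 ltW.
  have e2 : 0 <= 7^-1 :> R by rewrite invr_ge0.
  by have := ler_wpM2l e2 e1; rewrite mulr1 => e3; rewrite lerD2l lerN2.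
by apply: lt_le_trans; lra.
Qed.

Lemma reflection_series : exists (adm : (R -> R) -> Prop) (Ser : (R -> R) -> R) (B : nat -> R),
  [/\ forall j, 0 <= B j,
   forall phi K j, (forall b, 0 < b -> `|phi b| <= K * b ^+ j) -> adm phi,
   (forall phi psi, adm phi -> adm psi ->
     adm (fun b => phi b + psi b) /\ Ser (fun b => phi b + psi b) = Ser phi + Ser psi) /\
   (forall c phi, adm phi ->
     adm (fun b => c * phi b) /\ Ser (fun b => c * phi b) = c * Ser phi),
   forall phi K j, 0 <= K -> (forall b, 0 < b -> `|phi b| <= K * b ^+ j) ->
     `|Ser phi| <= K * B j &
   forall j, Ser (fun b => (- b) ^+ j) = 1].
Proof.
have s0 := rawS1_gt0; set s := rawS _ in s0.
exists (fun phi => cvgn (series (raw phi))), (fun phi => rawS phi / s),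
  (fun j => limn (series (tb j)) / s); split.
- move=> j; apply: divr_ge0 (ltW s0); apply: limr_ge; first exact: tb_cvg.
  by apply: nearW => n; rewrite seriesEnat /= sumr_ge0 // => i _; exact: tb_ge0.
- move=> phi K j H.
  have K0 : 0 <= K by have := H 1 ltr01; rewrite expr1n mulr1; apply: le_trans.
  exact: normed_cvg (raw_ncvg K0 H).
- split=> [phi psi cp cq|c phi cp].
    have e : raw (fun b => phi b + psi b) = raw phi + raw psi.
      apply/funext => l; change (raw (fun b => phi b + psi b) l = raw phi l + raw psi l).
      by rewrite /raw; ring.
    rewrite /rawS e; split; first exact: is_cvg_seriesD.
    by rewrite lim_seriesD // mulrDl.
  have e : raw (fun b => c * phi b) = c *: raw phi.
    apply/funext => l; change (raw (fun b => c * phi b) l = c * raw phi l).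
    by rewrite /raw; ring.
  rewrite /rawS e; split; first exact: is_cvg_seriesZ.
  by rewrite lim_seriesZ // mulrA.
- move=> phi K j K0 H; rewrite normrM normfV (gtr0_norm s0) mulrA ler_pM2r ?invr_gt0 //.
  exact: rawS_le.
- move=> j; have -> : (fun b : R => (- b) ^+ j) = fun b => (-1) ^+ j * b ^+ j.
    by apply/funext => b; exact: exprNn.
  have e : raw (fun b => (-1) ^+ j * b ^+ j) = (-1) ^+ j *: raw (fun b => b ^+ j).
    apply/funext => l; change (raw (fun b => (-1) ^+ j * b ^+ j) l = (-1) ^+ j * raw (fun b => b ^+ j) l).
    by rewrite /raw; ring.
  have c := normed_cvg (raw_ncvg ler01 (@pow_bound j)).
  rewrite /rawS e lim_seriesZ // -/(rawS _) rawS_pow /GRing.scale /= mulrA -exprMn mulrNN mulr1 expr1n.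
  by rewrite mul1r divff // gt_eqF.
Qed.

End Theta.

(** * Composition with functions on the plane *)

Section PlaneComposition.
Variable R : realType.

Lemma Cn_on_local (V W : normedModType R) n (A : set V) (f : V -> W) :
  (forall x, A x -> exists U, [/\ open U, U x & Cn_on n U f]) -> Cn_on n A f.
Proof.
elim: n f => [|n IH] f H.
  by move=> x /H[U [_ Ux]]; exact.
split=> [x /H[U [_ Ux [h _]]]|v]; first exact: h.
by apply: IH => x /H[U [oU Ux [_ h]]]; exists U; split => //; exact: h.
Qed.

Lemma linear_plane (L : {linear (R * R)%type -> R}) (a b : R) :
  L (a, b) = L (1, 0) * a + L (0, 1) * b.
Proof.
have -> : (a, b) = a *: ((1, 0) : R * R) + b *: ((0, 1) : R * R).
  apply: injective_projections.
    by change (a = a * 1 + b * 0); rewrite mulr1 mulr0 addr0.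
  by change (b = a * 0 + b * 1); rewrite mulr1 mulr0 add0r.
by rewrite linearD !linearZ mulrC [L (0, 1) * b]mulrC.
Qed.

Lemma derive_comp_plane (V : normedModType R) (f : R * R -> R) (g1 g2 : V -> R) x v :
  differentiable g1 x -> differentiable g2 x -> differentiable f (g1 x, g2 x) ->
  differentiable (fun y => f (g1 y, g2 y)) x /\
  'D_v (fun y => f (g1 y, g2 y)) x = 'D_((1, 0) : R * R) f (g1 x, g2 x) * 'D_v g1 x +
    'D_((0, 1) : R * R) f (g1 x, g2 x) * 'D_v g2 x.
Proof.
move=> d1 d2 df; pose G y := (g1 y, g2 y).
have dG : differentiable G x by exact: differentiable_pair.
have dc : differentiable (f \o G) x by exact: differentiable_comp.
split=> //; rewrite [LHS](deriveE (f := f \o G) v dc) diff_comp //= diff_pair //=.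
rewrite (deriveE _ df) (deriveE _ df) (deriveE v d1) (deriveE v d2).
rewrite -[G x]/(g1 x, g2 x); exact: linear_plane.
Qed.

Lemma Cn_on_comp_plane (V : normedModType R) n (A : set V) (B : set (R * R)) (f : R * R -> R)
  (g1 g2 : V -> R) : open A -> (forall x, A x -> B (g1 x, g2 x)) ->
  Cn_on n B f -> Cn_on n A g1 -> Cn_on n A g2 -> Cn_on n A (fun x => f (g1 x, g2 x)).
Proof.
move=> oA AB; elim: n f => [|n IH] f.
  move=> hf h1 h2 x Ax; apply: (@continuous_comp _ _ _ (fun x => (g1 x, g2 x)) f).
    exact: cvg_pair (h1 x Ax) (h2 x Ax).
  exact: hf (AB x Ax).
move=> [f1 f2] h1 h2; have [g11 g12] := h1; have [g21 g22] := h2.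
split=> [x Ax|v].
  by have [] := derive_comp_plane 0 (g11 x Ax) (g21 x Ax) (f1 _ (AB x Ax)).
have c1 := Cn_onM oA (IH _ (f2 (1, 0)) (Cn_onW h1) (Cn_onW h2)) (g12 v).
have c2 := Cn_onM oA (IH _ (f2 (0, 1)) (Cn_onW h1) (Cn_onW h2)) (g22 v).
apply: (Cn_on_eq oA) (Cn_onD oA c1 c2) => x Ax.
by have [_ ->] := derive_comp_plane v (g11 x Ax) (g21 x Ax) (f1 _ (AB x Ax)).
Qed.

Lemma open_upper (D : set (R * R)) : hopen D -> open (upper D).
Proof.
move=> oD; rewrite openE => z [Dz z0]; have [_ nz] := oD z Dz.
have [e e0 H] := near_norm_ex nz.
have m0 : 0 < Num.min e z.2 by rewrite lt_min e0.
apply: (near_norm m0) => w; rewrite lt_min pair_norm_lt pair_norm_lt /= => /andP[h1 /andP[_ h2]].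
have w0 : 0 < w.2.
  by move: h2; rewrite ltr_norml => /andP[h3 _]; rewrite -(ltrD2r (- z.2)) sub0r.
by split => //; apply: H; [rewrite pair_norm_lt|exact: ltW].
Qed.

Lemma smD_upper (W : normedModType R) (D : set (R * R)) (h : R * R -> W) : hopen D -> smD D h ->
  smooth_on (upper D) h.
Proof.
move=> oD sh n; apply: Cn_on_local => z [Dz z0]; have [g [U [oU Uz sg gh]]] := sh z Dz.
exists (U `&` upper D); split; [exact: openI (open_upper oD)|by []|].
apply: (@Cn_on_eq _ _ _ _ _ g); first exact: openI (open_upper oD).
  by move=> w [Uw [Dw _]]; exact: gh.
by apply: Cn_on_sub (sg n) => w [].
Qed.

Lemma dx_open (W : normedModType R) (D U : set (R * R)) (h : R * R -> W) z : hopen D -> D z ->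
  open U -> U z -> smooth_on U h ->
  dx h z = 'D_((1, 0) : R * R) h z /\ dy h z = 'D_((0, 1) : R * R) h z.
Proof.
move=> oD Dz oU Uz sh; have e : ext_at D h z h by exists U.
by split; [exact: (dx_ext oD Dz e)|exact: (dy_ext oD Dz e)].
Qed.

End PlaneComposition.

(** * Extension across the puncture from bounded derivatives *)

Section Removable.
Variable R : realType.
Implicit Types (D S : set (R * R)) (h : R * R -> R).

Lemma bddn_compact D S h n : hopen D -> smD D h -> compact S -> S `<=` D -> bddn n S h.
Proof.
move=> oD sh cS SD; have bd (g : R * R -> R) : smD D g -> exists K : R, forall z, S z -> `|g z| <= K.
  move=> sg; have [->|/set0P S0] := eqVneq S set0; first by exists 0.
  have c : {within S, continuous (fun z => `|g z|)}.
    apply/subspace_continuousP => y Sy; apply/cvgrPdist_lt => e e0.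
    have [r r0 Hr] := smD_cvg oD sg (SD y Sy) e0.
    apply: (near_norm r0) => t ty St; apply: le_lt_trans (ler_dist_dist _ _) _.
    by rewrite distrC; apply: Hr => //; exact: SD.
  have [z _ hz] := compact_EVT_max S0 cS c.
  by exists `|g z| => w Sw; apply: hz; rewrite inE.
elim: n h sh => [|n IH] h sh; split; try exact: bd; first by [].
by split; apply: IH; [exact: smD_dx|exact: smD_dy].
Qed.

Lemma bddn_setU (W : normedModType R) S S' (h : R * R -> W) n :
  bddn n S h -> bddn n S' h -> bddn n (S `|` S') h.
Proof.
have bd (g : R * R -> W) : (exists K : R, forall z, S z -> `|g z| <= K) ->
    (exists K : R, forall z, S' z -> `|g z| <= K) -> exists K : R, forall z, (S `|` S') z -> `|g z| <= K.
  move=> [K hK] [L hL]; exists (Num.max K L) => z [Sz|Sz].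
    by rewrite le_max hK.
  by rewrite le_max hL ?orbT.
elim: n h => [|n IH] h [b1 H1] [b2 H2]; split; try exact: bd; first by [].
by case: H1 => h1 h2; case: H2 => h3 h4; split; exact: IH.
Qed.

Section Half.
Variables (D : set (R * R)) (h0 : R * R -> R) (r : R).
Hypothesis oD : hopen D.
Hypothesis r0 : 0 < r.
Hypothesis rD : pbox r `<=` D.
Local Notation T := (strip r).

Let oT : hopen T. Proof. exact: hopen_strip. Qed.
Let opT : open T.
Proof.
have -> : T = upper T by rewrite predeqE => z; split=> [[h1 h2]|[]].
exact: open_upper.
Qed.

Definition inv1 (z : R * R) : R := (1 + z.2)^-1.
(** The map [y -> r y / (1 + y)] from [(0, oo)] onto [(0, r)]. The reflection evaluates a function
    at arbitrarily large heights, so the half square is stretched to a half strip of infinite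
    height, with all derivatives kept bounded. *)
Definition squeeze (z : R * R) : R := r * (1 - inv1 z).

Lemma inv1_smooth : smooth_on T inv1.
Proof.
move=> n; apply: Cn_onV => //; first by move=> z [_ z0]; rewrite gt_eqF // addr_gt0.
by apply: Cn_onD => //; [exact: Cn_on_cst|exact: smooth_on_snd].
Qed.

Let smI : smD T inv1 := smD_smooth opT (fun z Tz => Tz) inv1_smooth.

Lemma squeeze_smooth : smooth_on T squeeze.
Proof.
have e z : T z -> r + (- r) * inv1 z = squeeze z by move=> _; rewrite /squeeze; ring.
move=> n; apply: (Cn_on_eq opT e); apply: Cn_onD => //; first exact: Cn_on_cst.
by apply: Cn_onM => //; [exact: Cn_on_cst|exact: inv1_smooth].
Qed.

Lemma dxdy_inv1 z : T z -> dx inv1 z = 0 /\ dy inv1 z = - (inv1 z * inv1 z).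
Proof.
move=> Tz; have [_ z0] := Tz; have n0 : 1 + z.2 != 0 by rewrite gt_eqF // addr_gt0.
split.
  by apply: (dx_smooth oT Tz opT Tz inv1_smooth); exact: (is_derive_cst (inv1 z) z.1 (1 : R)).
apply: (dy_smooth oT Tz opT Tz inv1_smooth).
have d1 : is_derive z.2 (1 : R) (fun t : R => 1 + t) (0 + 1).
  exact: (is_deriveD (is_derive_cst (1 : R) z.2 1) (is_derive_id z.2 (1 : R))).
refine (is_derive_eq (is_deriveV n0 d1) _).
by rewrite /inv1 add0r /GRing.scale /= mulr1 -exprVn expr2.
Qed.

Lemma dxdy_squeeze z : T z -> dx squeeze z = 0 /\ dy squeeze z = r * (inv1 z * inv1 z).
Proof.
move=> Tz; have [d1 d2] := dxdy_inv1 Tz.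
have sc := @smD_cst R R T (- r); have sr := @smD_cst R R T r.
have sm := smDM sc smI.
have e w : T w -> r + (- r) * inv1 w = squeeze w by move=> _; rewrite /squeeze; ring.
split.
  rewrite -(dx_eqD oT (smDD sr sm) Tz e) (dxD oT sr sm Tz) dx_cst (dxM oT sc smI Tz) dx_cst d1.
  by ring.
rewrite -(dy_eqD oT (smDD sr sm) Tz e) (dyD oT sr sm Tz) (dy_cst _ oT Tz) (dyM oT sc smI Tz).
by rewrite (dy_cst _ oT Tz) d2; ring.
Qed.

Lemma squeeze_pbox z : T z -> pbox r (z.1, squeeze z) /\ 0 < squeeze z.
Proof.
move=> [z1 z0]; have q0 : 0 < 1 + z.2 by rewrite addr_gt0.
have i0 : 0 < inv1 z by rewrite invr_gt0.
have i1 : inv1 z < 1 by rewrite invf_lt1 // ltrDl.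
have s0 : 0 < squeeze z by rewrite mulr_gt0 // subr_gt0.
split => //; split; last exact: ltW.
rewrite pair_norm_le /= (ltW z1) /= (gtr0_norm s0) normr_gt0; apply/andP; split.
  by apply/eqP => -[_ e]; rewrite e ltxx in s0.
by rewrite ger_pMr // gerBl ltW.
Qed.

Definition squeezed h (z : R * R) : R := h (z.1, squeeze z).

Lemma squeezed_smooth h : smD D h -> [/\ smD T (squeezed h),
  forall z, T z -> dx (squeezed h) z = squeezed (dx h) z &
  forall z, T z -> dy (squeezed h) z = squeezed (dy h) z * (r * (inv1 z * inv1 z))].
Proof.
move=> sh; have su := smD_upper oD sh.
have TU z : T z -> upper D (z.1, squeeze z).
  by move=> Tz; have [p s0] := squeeze_pbox Tz; split => //; exact: rD.
have s : smooth_on T (squeezed h).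
  move=> n; apply: (Cn_on_comp_plane opT TU (su n)); last exact: squeeze_smooth.
  exact: smooth_on_fst.
have df1 (z : R * R) : differentiable (fun z : R * R => z.1) z.
  by apply: (smooth_on_differentiable (smooth_on_fst openT)).
have main z : T z -> dx (squeezed h) z = squeezed (dx h) z /\
    dy (squeezed h) z = squeezed (dy h) z * (r * (inv1 z * inv1 z)).
  move=> Tz; have Uz := TU z Tz.
  have [-> ->] := dx_open oT Tz opT Tz s.
  have dsq := smooth_on_differentiable squeeze_smooth Tz.
  have [sx sy] := dxdy_squeeze Tz.
  have [qx qy] := dx_open oT Tz opT Tz squeeze_smooth.
  have [px py] := dx_open oT Tz openT I (smooth_on_fst openT).
  have dh := smooth_on_differentiable su Uz.
  have [hx hy] := dx_open oD (rD (squeeze_pbox Tz).1) (open_upper oD) Uz su.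
  have [_ e1] := derive_comp_plane ((1, 0) : R * R) (df1 z) dsq dh.
  have [_ e2] := derive_comp_plane ((0, 1) : R * R) (df1 z) dsq dh.
  rewrite /squeezed e1 e2 -hx -hy -qx -qy sx sy -px -py (dx_fst oT Tz) (dy_fst oT Tz).
  by rewrite !mulr0 mulr1 addr0 add0r.
split; first exact: (smD_smooth opT).
  by move=> z /main[].
by move=> z /main[].
Qed.

Lemma bddn_inv1 n : bddn n T inv1.
Proof.
have b : exists K : R, forall z, T z -> `|inv1 z| <= K.
  exists 1 => z [_ z0]; have q0 : 0 < 1 + z.2 by rewrite addr_gt0.
  by rewrite gtr0_norm ?invr_gt0 // invf_le1 // lerDl ltW.
elim: n => [|n IH]; split => //; split.
  apply: (@bddn_eqS _ T T oT _ _ _ (fun=> 0)) => //; first exact: smD_cst.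
    by move=> z /dxdy_inv1[->].
  exact: (bddn_cst oT).
apply: (@bddn_eqS _ T T oT _ _ _ (fun z => (-1) * (inv1 z * inv1 z))) => //.
- by apply: smDM; [exact: smD_cst|exact: smDM].
- by move=> z /dxdy_inv1[_ ->]; rewrite mulN1r.
- apply: (bddnM oT) => //; [exact: smD_cst|exact: smDM|exact: (bddn_cst oT)|exact: (bddnM oT)].
Qed.

Lemma bddn_squeezed n h : smD D h -> bddn n (@pbox R r) h -> bddn n T (squeezed h).
Proof.
elim: n h => [|n IH] h sh [[K hK] H].
  by split => //; exists K => z /squeeze_pbox[p _]; exact: hK.
have [s ex ey] := squeezed_smooth sh; have [Hx Hy] := H.
split; first by exists K => z /squeeze_pbox[p _]; exact: hK.
have [sx _ _] := squeezed_smooth (smD_dx oD sh); have [sy _ _] := squeezed_smooth (smD_dy oD sh).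
split.
  apply: (@bddn_eqS _ T T oT _ _ _ (squeezed (dx h))) => //; first by move=> z /ex.
  by apply: IH => //; exact: smD_dx.
have sI2 := smDM smI smI; have src := smDM (@smD_cst R R T r) sI2.
apply: (@bddn_eqS _ T T oT _ _ _ (fun z => squeezed (dy h) z * (r * (inv1 z * inv1 z)))) => //.
- exact: smDM.
- by move=> z /ey.
- apply: (bddnM oT) => //; first by apply: IH => //; exact: smD_dy.
  apply: (bddnM oT) => //; [exact: smD_cst|exact: (bddn_cst oT)|].
  by apply: (bddnM oT) => //; exact: bddn_inv1.
Qed.

Hypothesis sh0 : smD D h0.
Hypothesis bh0 : forall n, bddn n (@pbox R r) h0.

(** The puncture is just another point of the edge of the open half strip. The reflected function is
    composed with the inverse [y / (r - y)] of the stretching, which makes sense for all [y < r],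
    negative ones included. At the other points of the axis the trace is [h0] by continuity. *)
Lemma half_extension : exists2 g : R * R -> R, smooth_on [set z | `|z| < r] g &
  forall z, `|z| < r -> D z -> z != 0 -> g z = h0 z.
Proof.
have nH : nice r (squeezed h0).
  by split; [have [] := squeezed_smooth sh0|move=> n; exact: bddn_squeezed].
have [adm [Ser [B [B0 aP [SD SZ] Sle S1]]]] := reflection_series R.
pose E := extend Ser 0 (squeezed h0).
have sE : smooth_on (wide r) E := extend_smooth B0 aP SD SZ Sle S1 0 nH.
pose U : set (R * R) := [set z | `|z| < r].
have oU : open U.
  rewrite /U (_ : [set z | _] = (fun z : R * R => `|z|) @^-1` [set t | t < r]) //.
  by apply: open_comp; [move=> z _; exact: norm_continuous|exact: open_lt].
have Uy z : U z -> 0 < r - z.2.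
  move=> Uz; rewrite subr_gt0; apply: le_lt_trans Uz.
  by apply: le_trans (snd_le_norm z); rewrite ler_norm.
pose th (z : R * R) : R := z.2 * (r + (-1) * z.2)^-1.
exists (fun z => E (z.1, th z)).
  move=> n; apply: (Cn_on_comp_plane oU _ (sE n)).
  - by move=> z; rewrite /U /= pair_norm_lt => /andP[].
  - exact: smooth_on_fst.
  - have s2 := @smooth_on_snd R U oU n.
    apply: Cn_onM => //; apply: Cn_onV => //.
      by move=> z /Uy; rewrite mulN1r => h; rewrite gt_eqF.
    by apply: Cn_onD => //; [exact: Cn_on_cst|apply: Cn_onM => //; exact: Cn_on_cst].
move=> z Uz Dz zn; have p := Uy z Uz; have [z0 _] := oD Dz.
have z1 : `|z.1| < r by move: Uz; rewrite pair_norm_lt => /andP[].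
have th0 : 0 <= th z by rewrite /th mulN1r divr_ge0 // ltW.
rewrite /E /extend /= th0 /hat; have [zp|zn0] := ltP 0 (th z).
  rewrite /squeezed /squeeze /inv1 /=; congr h0; apply: injective_projections => //=.
  have e : 1 + th z = r / (r - z.2) by rewrite /th mulN1r; field; rewrite gt_eqF.
  by rewrite e invf_div; field; rewrite gt_eqF.
have zz : z.2 = 0.
  have : th z = 0 by apply/eqP; rewrite eq_le th0 zn0.
  move/eqP; rewrite mulf_eq0 invr_eq0 mulN1r (gt_eqF p) orbF; exact/eqP.
apply: trace_eq; apply/cvgrPdist_lt => e e0.
have [d d0 hd] := smD_cvg oD sh0 Dz e0.
have d1 : 0 < d / r by rewrite divr_gt0.
near=> s; have s0 : 0 < s by near: s; exact: nbhs_right_gt.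
have sd : s < d / r by near: s; exact: nbhs_right_lt.
rewrite /squeezed distrC; have Ts : T (z.1, s) by [].
have [ps q0] := squeeze_pbox Ts.
apply: hd; first exact: rD.
rewrite pair_norm_lt /= subrr normr0 d0 zz subr0 (gtr0_norm q0).
have s1 : 0 < 1 + s by rewrite addr_gt0.
apply: le_lt_trans (_ : r * s < d); last by rewrite mulrC -ltr_pdivlMr.
rewrite /squeeze /inv1 /= ler_pM2l //.
have -> : 1 - (1 + s)^-1 = s / (1 + s) by field; rewrite gt_eqF.
by rewrite ler_pdivrMr // ler_peMr ?lerDl // ltW.
Unshelve. all: by end_near. Qed.

End Half.

Lemma removable_extension N (D : set (R * R)) (u : R * R -> 'rV[R]_N) (r : R) : hopen D ->
  0 < r -> pbox r `<=` D -> smD D u ->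
  (forall n, exists2 r' : R, 0 < r' <= r & bddn n (@pbox R r') u) ->
  exists2 g : R * R -> 'rV[R]_N, smooth_on [set z | `|z| < r] g &
  forall z, `|z| < r -> D z -> z != 0 -> g z = u z.
Proof.
move=> oD r0 rD su bu.
have bi i n : bddn n (@pbox R r) (fun z => u z 0 i).
  have [r' /andP[r'0 r'r] b] := bu n.
  have r'D : pbox r' `<=` D by move=> z [/andP[a b'] c]; apply: rD; split => //; rewrite a (le_trans b').
  (* The radius [r'] of the bound depends on the order [n]; away from the puncture compactness of
     the remaining half-annulus supplies the bound up to [r]. *)
  have -> : @pbox R r = pbox r' `|` (Ann r' r `&` [set z | 0 <= z.2]).
    rewrite predeqE => z; split.
      move=> [/andP[h1 h2] h3]; have [le|gt] := leP `|z| r'.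
        by left; split => //; rewrite h1.
      by right; split => //; split => //; rewrite h2 ltW.
    move=> [[/andP[h1 h2] h3]|[[/andP[h1 h2] h3] _]]; split => //.
      by rewrite h1 (le_trans h2).
    by rewrite h2 (lt_le_trans r'0).
  apply: bddn_setU; first exact: (bddn_coord oD r'D).
  apply: (bddn_compact _ oD); [exact: smD_coord|exact: Ann_compact|].
  by move=> z [[/andP[h1 h2] h3] _]; apply: rD; split => //; rewrite h2 (lt_le_trans r'0).
have H i := half_extension oD r0 rD (smD_coord 0 i su) (bi i).
have [g hg] := choice (fun i => let: ex_intro2 g h1 h2 := H i in ex_intro _ g (conj h1 h2)).
exists (fun z => \row_i g i z) => [n|z zr Dz z0].
  have oU : open [set z : R * R | `|z| < r].
    rewrite (_ : [set z | _] = (fun z : R * R => `|z|) @^-1` [set t | t < r]) //.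
    by apply: open_comp; [move=> z _; exact: norm_continuous|exact: open_lt].
  apply: Cn_on_mx => // i j; apply: (Cn_on_eq oU) ((hg j).1 n) => z _.
  by rewrite mxE.
by apply/rowP => i; rewrite mxE (hg i).2.
Qed.

End Removable.

(** * Straightening charts *)

Section MatrixSmooth.
Variable R : realType.

Lemma Cn_on_det (V : normedModType R) n (U : set V) p (F : V -> 'M[R]_p) : open U ->
  Cn_on n U F -> Cn_on n U (fun x => \det (F x)).
Proof.
move=> oU cF; rewrite /determinant; apply: Cn_on_sum => // s _.
by apply: Cn_onM => //; [exact: Cn_on_cst|apply: Cn_on_prod => // i _; exact: Cn_on_coord].
Qed.

Lemma Cn_on_invmx (V : normedModType R) n (U : set V) p (F : V -> 'M[R]_p) : open U ->
  (forall x, U x -> F x \in unitmx) -> Cn_on n U F -> Cn_on n U (fun x => invmx (F x)).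
Proof.
move=> oU uF cF; apply: (Cn_on_eq oU) (_ : Cn_on n U (fun x => (\det (F x))^-1 *: \adj (F x))).
  by move=> x /uF ux; rewrite /invmx ux.
apply: Cn_on_scale => //.
  apply: Cn_onV => //; last exact: Cn_on_det.
  by move=> x /uF; rewrite unitmxE unitfE.
apply: Cn_on_mx => // i j.
have e x : U x -> (-1) ^+ (j + i) * \det (row' j (col' i (F x))) = (\adj (F x)) i j by rewrite mxE.
apply: (Cn_on_eq oU e); apply: Cn_onM => //; first exact: Cn_on_cst.
apply: Cn_on_det => //; apply: Cn_on_mx => // a b.
apply: (Cn_on_eq oU) (Cn_on_coord (lift j a) (lift i b) oU cF) => x _.
by rewrite !mxE.
Qed.

Lemma Cn_on_submx (V : normedModType R) n (U : set V) p q p' q' (F : V -> 'M[R]_(p, q))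
  (G : V -> 'M[R]_(p', q')) (a : 'I_p' -> 'I_p) (b : 'I_q' -> 'I_q) : open U ->
  (forall x i j, G x i j = F x (a i) (b j)) -> Cn_on n U F -> Cn_on n U G.
Proof.
move=> oU e cF; apply: Cn_on_mx => // i j.
by apply: (Cn_on_eq oU) (Cn_on_coord (a i) (b j) oU cF) => x _; rewrite e.
Qed.

Definition jac m p (phi : 'rV[R]_m -> 'rV[R]_p) (x : 'rV[R]_m) : 'M[R]_(m, p) :=
  \matrix_(l, j) 'D_(delta_mx 0 l) phi x 0 j.

Lemma smooth_jac m p (U : set 'rV[R]_m) (phi : 'rV[R]_m -> 'rV[R]_p) : open U ->
  smooth_on U phi -> smooth_on U (jac phi).
Proof.
move=> oU sp n; apply: Cn_on_mx => // l j.
have := Cn_on_coord 0 j oU (smooth_on_derive (delta_mx 0 l) sp n).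
by apply: (Cn_on_eq oU) => x _; rewrite mxE.
Qed.

Lemma derive_coord m p (phi : 'rV[R]_m -> 'rV[R]_p) x v j : differentiable phi x ->
  'D_v (fun y => phi y 0 j) x = 'D_v phi x 0 j.
Proof. by move=> df; rewrite derive_mx ?mxE //; exact: diff_derivable. Qed.

Lemma dx_jac D m p (u : R * R -> 'rV[R]_m) (Om : set 'rV[R]_m) (phi : 'rV[R]_m -> 'rV[R]_p) z :
  hopen D -> open Om -> (forall z, D z -> Om (u z)) -> smooth_on Om phi -> smD D u -> D z ->
  dx (fun z => phi (u z)) z = dx u z *m jac phi (u z) /\
  dy (fun z => phi (u z)) z = dy u z *m jac phi (u z).
Proof.
move=> oD oO HO sp su Dz; have sw := smD_compmx oO HO sp su.
have dp := smooth_on_differentiable sp (HO z Dz).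
split; apply/matrixP => i j; rewrite (ord1 i) mxE.
  rewrite -(dx_coord 0 j oD sw Dz) (dx_comp oD oO HO (fun n => Cn_on_coord 0 j oO (sp n)) su Dz).
  by apply: eq_bigr => l _; rewrite mxE derive_coord // mulrC.
rewrite -(dy_coord 0 j oD sw Dz) (dy_comp oD oO HO (fun n => Cn_on_coord 0 j oO (sp n)) su Dz).
by apply: eq_bigr => l _; rewrite mxE derive_coord // mulrC.
Qed.

Lemma derive_affine (V W : normedModType R) (phi : V -> W) (x v : V) (l : W) :
  differentiable phi x -> (forall t : R, phi (t *: v + x) = phi x + t *: l) -> 'D_v phi x = l.
Proof.
move=> dp H; have d : differentiable phi (0 *: v + x) by rewrite scale0r add0r.
have h1 := is_derive_line d; rewrite scale0r add0r in h1.
have di (y : W) : differentiable (id : W -> W) y.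
  by apply: (@linear_differentiable _ _ _ (idfun : {linear W -> W})) => w; exact: cvg_id.
have h2 := @is_derive_line R W W id (phi x) l 0 (di _).
have e : (fun t : R => phi (t *: v + x)) = (fun t => id (t *: l + phi x)).
  by apply/funext => t; rewrite H addrC.
have := @derive_val _ _ _ _ _ _ _ h1; rewrite e.
by rewrite (@derive_val _ _ _ _ _ _ _ h2) derive_id.
Qed.

End MatrixSmooth.

(** * The map read in charts *)

Section HalfDisc.
Variable R : realType.
Variables (M : topologicalType) (m : nat) (S : smooth_manifold R M m).
Local Notation PH := (@punctured_half_disc R).

Lemma hopen_punctured : hopen PH.
Proof.
move=> z [[z1 z2] z0]; split => //.
have f1 := @smooth_on_fst R setT openT 0; have f2 := @smooth_on_snd R setT openT 0.
have c := Cn_onD openT (Cn_onM openT f1 f1) (Cn_onM openT f2 f2) z I.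
have n1 : \forall w \near z, w.1 ^+ 2 + w.2 ^+ 2 < 1.
  have : \forall w \near z, w.1 * w.1 + w.2 * w.2 < 1.
    have o : nbhs (z.1 * z.1 + z.2 * z.2) [set t | t < 1].
      by apply: open_nbhs_nbhs; split; [exact: open_lt|rewrite /= -!expr2].
    exact: (c _ o).
  by apply: filterS => w; rewrite !expr2.
have zn : 0 < `|z| by rewrite normr_gt0; apply/eqP.
have n2 : \forall w \near z, `|w - z| < `|z| by apply: (near_norm zn).
apply: filterS2 n1 n2 => w w1 wz w0; split => // e; move: wz.
by rewrite e [X in X - z](_ : _ = 0) // sub0r normrN ltxx.
Qed.

Lemma open_chart_image (c : chart R M m) (V : set M) : open V -> open (c @` (dom c `&` V)).
Proof.
move=> oV.
have -> : c @` (dom c `&` V) = (c @` dom c) `&` param c @^-1` V.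
  rewrite predeqE => x; split.
    by move=> [p [dp Vp] <-]; split; [exists p|rewrite /= coordK].
  by move=> [[p dp <-]] /=; rewrite coordK // => Vp; exists p.
apply: open_comp_in => //; first exact: image_open.
by move=> x; rewrite inE => hx; exact: param_continuous.
Qed.

Lemma open_chart_preimage (c : chart R M m) (B : set 'rV[R]_m) : open B ->
  open (dom c `&` c @^-1` B).
Proof.
move=> oB; apply: open_comp_in => //; first exact: dom_open.
by move=> p; rewrite inE => dp; exact: Defs.coord_continuous.
Qed.

Variable f : R * R -> M.
Hypothesis Hf : smooth_in S PH f.

Lemma map_near z (V : set M) : PH z -> open V -> V (f z) ->
  exists2 r : R, 0 < r & forall w, PH w -> `|w - z| < r -> V (f w).
Proof.
move=> Pz oV Vz; have [g [U [oU Uz [cg _] gf]]] := Hf Pz.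
have n1 : \forall w \near z, U w by apply: open_nbhs_nbhs.
have n2 : \forall w \near z, V (g w).
  by apply: (cg z Uz); apply: open_nbhs_nbhs; rewrite gf.
have [r r0 H] := near_norm_ex (filterI n1 n2).
by exists r => // w Pw wz; have [Uw Vw] := H w wz; rewrite -gf.
Qed.

Lemma hopen_preimage (V : set M) : open V -> hopen [set z | PH z /\ V (f z)].
Proof.
move=> oV z [Pz Vz]; have [z0 nP] := hopen_punctured Pz; split => //.
have [r r0 H] := map_near Pz oV Vz.
have n2 : \forall w \near z, `|w - z| < r by apply: (near_norm r0).
by apply: filterS2 nP n2 => w w1 wz w0; split; [exact: w1|apply: H => //; exact: w1].
Qed.

Section Chart.
Variables (c : chart R M m) (D : set (R * R)).
Hypothesis Sc : charts S c.
Hypothesis oD : hopen D.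
Hypothesis DP : D `<=` PH.
Hypothesis Dc : forall z, D z -> dom c (f z).

Lemma chart_ext z g : D z -> local_extension S PH f z g -> ext_at D (c \o f) z (c \o g).
Proof.
move=> Dz [U [oU Uz [cg sg] gf]]; exists (U `&` g @^-1` dom c); split.
- apply: open_comp_in => //; last exact: dom_open.
  by move=> w; rewrite inE => Uw; exact: cg.
- by split => //=; rewrite gf; [exact: Dc|exact: Uz|exact: DP].
- exact: sg.
- by move=> w [Uw _] Dw /=; rewrite gf //; exact: DP.
Qed.

Lemma chart_smD : smD D (c \o f).
Proof. by move=> z Dz; have [g lg] := Hf (DP Dz); exists (c \o g); exact: chart_ext. Qed.

Lemma tangent_mapE z : D z ->
  tangent_map S PH f c z (1, 0) = dx (c \o f) z /\ tangent_map S PH f c z (0, 1) = dy (c \o f) z.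
Proof.
move=> Dz; rewrite /tangent_map; set g := xget _ _.
have lg : local_extension S PH f z g.
  by have := @xgetPex _ f [set g | local_extension S PH f z g] (Hf (DP Dz)).
have e := chart_ext Dz lg; have dg := ext_differentiable e.
by rewrite (dx_ext oD Dz e) (dy_ext oD Dz e) !deriveE.
Qed.

Lemma chart_J (J : almost_complex S) : J_holomorphic J PH f ->
  forall z, D z -> dy (c \o f) z = dx (c \o f) z *m J c (c (f z)).
Proof.
move=> HJ z Dz; have [<- <-] := tangent_mapE Dz.
have := HJ z c (1, 0) (DP Dz) Sc (Dc Dz); rewrite /mul_i /= oppr0 => ->.
by [].
Qed.

End Chart.

Lemma boundary_punctured z : PH z -> z.2 = 0 -> punctured_half_disc_boundary z.
Proof.
move=> [[z1 _] z0] e; split => //; rewrite e expr0n addr0 in z1.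
have n0 : z.1 != 0.
  by apply/eqP => e1; apply: z0; rewrite (surjective_pairing z) e e1.
rewrite normr_gt0 n0 /=; rewrite -(@ltr_pXn2r _ 2) ?nnegrE // expr1n.
by rewrite real_normK ?num_real.
Qed.

End HalfDisc.

(** A chart at [p] in which the map solves a system of the standard form on every domain that it
    sends into [Om]; [phi] produces the unknown [w]. The second half of [lm_sys] says that
    [phi (c p)] is real as soon as such a domain meets the axis, as [gradient_bound] requires of its
    base value. *)
Record local_model (R : realType) (M : topologicalType) (m : nat) (S : smooth_manifold R M m)
    (W : set M) (f : R * R -> M) (p : M) (c : chart R M m)
    (I : pred 'I_m) (Om : set 'rV[R]_m) (E A : 'rV[R]_m -> 'M[R]_m)
    (phi : 'rV[R]_m -> 'rV[R]_m) : Prop := LocalModel {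
  lm_chart : charts S c;
  lm_dom : dom c p;
  lm_open : open Om;
  lm_p : Om (c p);
  lm_sub : Om `<=` c @` dom c;
  lm_E : smooth_on Om E;
  lm_A : smooth_on Om A;
  lm_phi : smooth_on Om phi;
  lm_sq : A (c p) *m A (c p) = - 1%:M;
  lm_swap : forall j i, ~~ I j -> ~~ I i -> A (c p) j i = 0;
  lm_sys : forall D, hopen D -> D `<=` @punctured_half_disc R ->
    (forall z, D z -> dom c (f z) /\ Om (c (f z))) ->
    sys I Om E A D (c \o f) (fun z => phi (c (f z))) /\
    forall z, D z -> z.2 = 0 -> forall i, I i -> phi (c p) 0 i = 0;
  lm_W : W p -> forall i, I i -> phi (c p) 0 i = 0 }.

Section Interior.
Variables (R : realType) (M : topologicalType) (m : nat) (S : smooth_manifold R M m).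
Variables (J : almost_complex S) (W : set M) (f : R * R -> M).
Local Notation PH := (@punctured_half_disc R).
Hypothesis Hf : smooth_in S PH f.
Hypothesis HJ : J_holomorphic J PH f.
Hypothesis HfW : f @` (@punctured_half_disc_boundary R) `<=` W.
Hypothesis Wc : closed W.

(** Off the closed set [W] the domain [Om] is chosen disjoint from [W], so no admissible domain
    meets the axis and the boundary conditions are void; declaring all components imaginary voids
    the algebraic condition on [A] too. *)
Lemma interior_model p : ~ W p -> exists c I Om E A phi, local_model S W f p c I Om E A phi.
Proof.
move=> nW; have [c Sc dp] := charts_cover S p.
have oV : open (~` W) by rewrite openC.
pose Om := c @` (dom c `&` ~` W).
have oO : open Om := open_chart_image oV.
have OmS : Om `<=` c @` dom c by move=> x [y [dy _] <-]; exists y.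
have OmP y : dom c y -> Om (c y) -> ~ W y.
  move=> dy [y' [dy' nW'] e].
  by rewrite -(coordK dy) -e coordK.
exists c, predT, Om, (fun=> 1%:M), (J c), id.
have sJ : smooth_on Om (J c) := smooth_on_sub OmS (acs_smooth J Sc).
split=> //.
- by exists p.
- by move=> n; exact: Cn_on_cst.
- move=> n; apply: (Cn_on_lin n (f := (idfun : {linear 'rV[R]_m -> 'rV[R]_m}))) => // x; exact: cvg_id.
- exact: acs_square.
- move=> D oD DP DO.
  have nb z : D z -> z.2 <> 0.
    move=> Dz z0; have [dz Oz] := DO z Dz; apply: (OmP _ dz Oz).
    by apply: HfW; exists z => //; apply: boundary_punctured => //; exact: DP.
  have su : smD D (c \o f) by apply: (chart_smD Hf Sc DP) => z /DO[].
  split; last by move=> z Dz /nb.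
  split=> //.
  + by move=> n; exact: Cn_on_cst.
  + by move=> z /DO[].
  + by move=> z Dz; rewrite mulmx1.
  + by move=> z Dz; rewrite mulmx1.
  + by move=> z Dz; apply: (chart_J Hf Sc oD DP _ HJ Dz) => w /DO[].
  + by move=> z /DO[dz _]; exact: acs_square.
  + by move=> z Dz /nb.
Qed.

End Interior.

(** * Straightening at a point of the totally real submanifold *)

Section BoundaryModel.
Variables (R : realType) (M : topologicalType) (k : nat) (S : smooth_manifold R M (k + k)).
Variables (J : almost_complex S) (W : set M) (f : R * R -> M).
Local Notation PH := (@punctured_half_disc R).
Hypothesis Hf : smooth_in S PH f.
Hypothesis HJ : J_holomorphic J PH f.
Hypothesis HfW : f @` (@punctured_half_disc_boundary R) `<=` W.
Hypothesis HWt : forall p c, W p -> charts S c -> dom c p ->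
  [set v *m J c (c p) | v in tangent_sub S k W c p] `&` tangent_sub S k W c p = [set 0].
Variables (s : chart R M (k + k)).
Hypothesis Ss : slice_chart S k W s.

Local Notation T := 'rV[R]_(k + k).
Definition im_index : pred 'I_(k + k) := fun i => (k <= i)%N.

Definition proj0 (x : T) : T := row_mx (lsubmx x) 0.
(** With [J11] and [J12] the upper blocks of [J], a vector [(a, 0)] tangent to [W] is sent to
    [(a J11, a J12)]. The shear [straight] by [J12^-1 J11] turns this image into [(0, a J12)].
    Evaluating [J] at [proj0 x] keeps [slope] independent of the normal coordinates. *)
Definition slope (x : T) : 'M[R]_k :=
  invmx (ursubmx (J s (proj0 x))) *m ulsubmx (J s (proj0 x)).
Definition straight (x : T) : T := row_mx (lsubmx x - rsubmx x *m slope x) (rsubmx x).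

Definition img_ok : set T := [set x | (s @` dom s) (proj0 x) /\
  \det (ursubmx (J s (proj0 x))) != 0] `&` (s @` dom s).
(** Invertibility is asked of the Jacobian of [straight], not of the map: a [sys] keeps the original
    coordinates as arguments of its coefficients. *)
Definition straight_dom : set T := [set x | \det (jac straight x) != 0] `&` img_ok.
Definition modelE (x : T) : 'M[R]_(k + k) := invmx (jac straight x).
Definition modelA (x : T) : 'M[R]_(k + k) := modelE x *m J s x *m jac straight x.

Let Sc : charts S s. Proof. by have [] := Ss. Qed.

Lemma flat_rsubmx (x : T) : @flat R (k + k) k x <-> rsubmx x = 0.
Proof.
split=> [H|H i ki].
  by apply/rowP => i; rewrite !mxE; apply: H => /=; rewrite leq_addr.
case: (fintype.splitP i) => j ij; first by move: ki; rewrite ij leqNgt ltn_ord.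
have := congr1 (fun v : 'rV_k => v 0 j) H; rewrite !mxE => <-.
by congr (x 0 _); apply: val_inj.
Qed.

Lemma slice_flat p : dom s p -> W p -> rsubmx (s p) = 0.
Proof.
move=> dp Wp; apply/flat_rsubmx; have [_ e] := Ss.
have : (s @` (dom s `&` W)) (s p) by exists p.
by rewrite e => -[].
Qed.

Lemma proj0_flat (x : T) : rsubmx x = 0 -> proj0 x = x.
Proof. by move=> e; rewrite /proj0 -{2}(hsubmxK x) e. Qed.

Lemma transition_id p v : dom s p -> tangent_change s s p v = v.
Proof.
move=> dp; have [sm _] := charts_compatible Sc Sc.
have oi := open_chart_image (c := s) (dom_open s).
have ip : (s @` (dom s `&` dom s)) (s p) by exists p.
have dt := smooth_on_differentiable sm ip.
rewrite /tangent_change -(deriveE v dt).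
have di (y : T) : differentiable (id : T -> T) y.
  by apply: (@linear_differentiable _ _ _ (idfun : {linear T -> T})) => w; exact: cvg_id.
have [->|v0] := eqVneq v 0; first by rewrite deriveE // linear0.
have -> : 'D_v (transition s s) (s p) = 'D_v (id : T -> T) (s p).
  apply: near_eq_derive => //; apply: filterS (open_nbhs_nbhs (conj oi ip)).
  by move=> y [p' [dp' _] <-]; rewrite /transition /= coordK.
by rewrite derive_id.
Qed.

(** If [v] times the upper right block is 0, then [(v, 0)] and its image under [J] are both tangent
    to [W]; total reality makes the image 0, and [J] is invertible. *)
Lemma ur_unit p : dom s p -> W p -> \det (ursubmx (J s (s p))) != 0.
Proof.
move=> dp Wp; rewrite -unitfE -unitmxE -row_free_unit; apply: inj_row_free => v v0.
set Jp := J s (s p) in v0 *; pose V : T := row_mx v 0.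
have tan (y : T) : rsubmx y = 0 -> tangent_sub S k W s p y.
  by move=> y0; exists s; split => //; apply/flat_rsubmx; rewrite transition_id.
have VJ : V *m Jp = row_mx (v *m ulsubmx Jp) 0.
  by rewrite -{1}(submxK Jp) mul_row_block !mul0mx !addr0 v0.
have : (V *m Jp) = 0.
  have : ([set v *m Jp | v in tangent_sub S k W s p] `&` tangent_sub S k W s p) (V *m Jp).
    split; first by exists V => //; apply: tan; rewrite row_mxKr.
    by apply: tan; rewrite VJ row_mxKr.
  by rewrite HWt.
move=> e; have : V *m Jp *m Jp = 0 by rewrite e mul0mx.
rewrite -mulmxA acs_square // mulmxN mulmx1 => /eqP; rewrite oppr_eq0 => /eqP V0.
by have := row_mxKl v (0 : 'rV[R]_k); rewrite -/V V0 => <-; apply/rowP => i; rewrite !mxE.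
Qed.

Let oimg : open (s @` dom s). Proof. exact: image_open. Qed.

Lemma proj0_smooth (U : set T) : open U -> smooth_on U proj0.
Proof.
by move=> oU n; apply: Cn_on_row_mx => //; [exact: Cn_on_lsubmx|exact: Cn_on_cst].
Qed.

Lemma open_nz (V : normedModType R) (U : set V) (h : V -> R) : open U -> Cn_on 0 U h ->
  open ([set x | h x != 0] `&` U).
Proof.
move=> oU ch; rewrite setIC (_ : [set x | h x != 0] = h @^-1` (~` [set 0])).
  apply: open_comp_in => //; first by move=> x; rewrite inE => Ux; exact: ch.
  by rewrite openC; exact: closed_eq.
by rewrite predeqE => x; split => /eqP.
Qed.

Let V0 : set T := proj0 @^-1` (s @` dom s).
Let oV0 : open V0.
Proof.
have := open_comp_in openT _ oimg; rewrite /V0 => H.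
rewrite -[X in open X]setTI; apply: H => x _.
exact: (proj0_smooth openT 0).
Qed.

Lemma Jproj_smooth : smooth_on V0 (fun x => J s (proj0 x)).
Proof.
move=> n; apply: (Cn_on_compmx oV0 oimg) (acs_smooth J Sc n) (proj0_smooth oV0 n).
by [].
Qed.

Lemma img_okE : img_ok = ([set x | \det (ursubmx (J s (proj0 x))) != 0] `&` V0) `&` (s @` dom s).
Proof. by rewrite predeqE => x; split=> [[[h1 h2] h3]|[[h1 h2] h3]]. Qed.

Lemma open_img_ok : open img_ok.
Proof.
rewrite img_okE.
have c0 : Cn_on 0 V0 (fun x => ursubmx (J s (proj0 x))).
  by apply: (Cn_on_submx (a := lshift k) (b := @rshift k k) oV0 _ (@Jproj_smooth 0)) => x i j; rewrite !mxE.
exact: (openI (open_nz oV0 (Cn_on_det oV0 c0)) oimg).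
Qed.

Lemma slope_smooth : smooth_on img_ok slope.
Proof.
have o1 := open_img_ok.
have s1 n : Cn_on n img_ok (fun x => J s (proj0 x)).
  by apply: Cn_on_sub (@Jproj_smooth n) => x [[]].
move=> n; apply: Cn_on_mulmx => //.
  apply: Cn_on_invmx => //; first by move=> x [[_ h] _]; rewrite unitmxE unitfE.
  by apply: (Cn_on_submx (a := lshift k) (b := @rshift k k) o1 _ (s1 n)) => x i j; rewrite !mxE.
by apply: (Cn_on_submx (a := lshift k) (b := lshift k) o1 _ (s1 n)) => x i j; rewrite !mxE.
Qed.

Lemma straight_smooth : smooth_on img_ok straight.
Proof.
have o1 := open_img_ok.
move=> n; apply: Cn_on_row_mx => //; last exact: Cn_on_rsubmx.
have e (x : T) : img_ok x -> lsubmx x + (-1) *: (rsubmx x *m slope x) = lsubmx x - rsubmx x *m slope x.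
  by rewrite scaleN1r.
apply: (Cn_on_eq o1 e); apply: Cn_onD => //; first exact: Cn_on_lsubmx.
apply: Cn_on_scale => //; first exact: Cn_on_cst.
by apply: Cn_on_mulmx => //; [exact: Cn_on_rsubmx|exact: slope_smooth].
Qed.

Lemma open_straight_dom : open straight_dom.
Proof.
apply: open_nz; first exact: open_img_ok.
apply: Cn_on_det; first exact: open_img_ok.
exact: (smooth_jac open_img_ok straight_smooth).
Qed.

(** Along tangential and normal lines through a flat point [straight] is affine, so its directional
    derivatives can be read off. *)
Lemma jac_flat (x : T) : img_ok x -> rsubmx x = 0 ->
  jac straight x = block_mx 1%:M 0 (- slope x) 1%:M.
Proof.
move=> okx x0; set B := block_mx _ _ _ _.
have ds := smooth_on_differentiable straight_smooth okx.
have D1 a : 'D_(row_mx a 0 : T) straight x = row_mx a 0.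
  apply: derive_affine => // t; rewrite /straight.
  rewrite !linearD !linearZ /= !row_mxKl !row_mxKr x0 scaler0 addr0 !mul0mx !subr0.
  by rewrite scale_row_mx scaler0 add_row_mx addr0 addrC.
have D2 b : 'D_(row_mx 0 b : T) straight x = row_mx (- (b *m slope x)) b.
  apply: derive_affine => // t.
  have e : proj0 (t *: row_mx 0 b + x) = proj0 x.
    by rewrite /proj0 linearD linearZ /= row_mxKl scaler0 add0r.
  rewrite /straight /slope e -/(slope x) !linearD !linearZ /= !row_mxKl !row_mxKr x0.
  rewrite scaler0 add0r addr0 mul0mx subr0 scale_row_mx add_row_mx add0r.
  by rewrite scalerN -scalemxAl.
have main (v : T) : 'D_v straight x = v *m B.
  rewrite -{1}(hsubmxK v) -[row_mx _ _]addr0.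
  have -> : row_mx (lsubmx v) (rsubmx v) + 0 = row_mx (lsubmx v) 0 + row_mx 0 (rsubmx v) :> T.
    by rewrite addr0 add_row_mx addr0 add0r.
  have -> : v *m B = row_mx (lsubmx v - rsubmx v *m slope x) (rsubmx v).
    by rewrite -{1}(hsubmxK v) /B mul_row_block !mulmx1 mulmx0 add0r mulmxN.
  by rewrite deriveE // linearD /= -!deriveE // D1 D2 add_row_mx add0r.
apply/matrixP => l j; rewrite mxE main -rowE mxE //.
Qed.

Lemma straight_flat (x : T) : rsubmx x = 0 -> straight x = x.
Proof. by move=> e; rewrite /straight e mul0mx subr0 -{2}(hsubmxK x) e. Qed.

Lemma slice_img_ok p : dom s p -> W p -> straight_dom (s p).
Proof.
move=> dp Wp; have x0 := slice_flat dp Wp; have up := ur_unit dp Wp.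
have ok : img_ok (s p) by split; [rewrite /= proj0_flat //; split => //; exists p|exists p].
split => //=; rewrite jac_flat // det_lblock !det1 mulr1; exact: oner_neq0.
Qed.

(** The upper left block of the transformed structure is [J11 - J12 slope], which is 0 by the choice
    of [slope]. *)
Lemma modelA_flat p : dom s p -> W p -> forall j i, ~~ im_index j -> ~~ im_index i ->
  modelA (s p) j i = 0.
Proof.
move=> dp Wp; have [_ ok] := slice_img_ok dp Wp; have x0 := slice_flat dp Wp.
have jE := jac_flat ok x0; have up := ur_unit dp Wp.
set N := slope (s p) in jE; set Jp := J s (s p) in up.
have EE : modelE (s p) = block_mx 1%:M 0 N 1%:M.
  have e1 : block_mx 1%:M 0 N 1%:M *m jac straight (s p) = 1%:M.
    rewrite jE mulmx_block !mulmx1 !mul1mx !mulmx0 !mul0mx !addr0 add0r subrr.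
    by rewrite -scalar_mx_block.
  have [_ u2] := mulmx1_unit e1.
  by rewrite /modelE -[LHS]mul1mx -e1 -mulmxA mulmxV // mulmx1.
have ul : ulsubmx (modelA (s p)) = 0.
  rewrite /modelA EE jE -/Jp -{1}(submxK Jp) !mulmx_block block_mxKul.
  rewrite !mul1mx !mul0mx !addr0 !mulmx1 mulmxN /N /slope (proj0_flat x0) -/Jp.
  by rewrite mulmxA mulmxV ?mul1mx ?subrr // unitmxE unitfE.
move=> j i; rewrite /im_index -!ltnNge => jk ik.
have lsh (a : 'I_(k + k)) : (a < k)%N -> exists b, a = lshift k b.
  by move=> ak; exists (Ordinal ak); apply: val_inj.
have [j' ->] := lsh _ jk; have [i' ->] := lsh _ ik.
by have := congr1 (fun v : 'M[R]_k => v j' i') ul; rewrite !mxE.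
Qed.

Lemma boundary_model p : dom s p -> W p ->
  local_model S W f p s im_index straight_dom modelE modelA straight.
Proof.
move=> dp Wp; have oO := open_straight_dom.
have Ok : straight_dom `<=` img_ok by move=> x [].
have OS : straight_dom `<=` s @` dom s by move=> x [_ []].
have uJ x : straight_dom x -> jac straight x \in unitmx by move=> [h _]; rewrite unitmxE unitfE.
have sj := smooth_on_sub Ok (smooth_jac open_img_ok straight_smooth).
have sE : smooth_on straight_dom modelE by move=> n; exact: Cn_on_invmx.
have sA : smooth_on straight_dom modelA.
  move=> n; apply: Cn_on_mulmx => //; apply: Cn_on_mulmx => //.
  exact: (smooth_on_sub OS (acs_smooth J Sc)).
have sq p' : dom s p' -> straight_dom (s p') -> modelA (s p') *m modelA (s p') = - 1%:M.
  move=> dp' Op'; have u := uJ _ Op'.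
  rewrite /modelA /modelE !mulmxA -[_ *m _ *m invmx _]mulmxA mulmxV // mulmx1.
  rewrite -[invmx _ *m _ *m _]mulmxA acs_square // mulmxN mulmx1 mulNmx mulVmx //.
have Wi p' : dom s p' -> W p' -> forall i, im_index i -> straight (s p') 0 i = 0.
  move=> dp' Wp' i ki; rewrite straight_flat; last exact: slice_flat.
  by have /flat_rsubmx := slice_flat dp' Wp'; apply.
split=> //.
- exact: slice_img_ok.
- exact: smooth_on_sub Ok straight_smooth.
- by apply: sq => //; exact: slice_img_ok.
- exact: modelA_flat.
- move=> D oD DP DO; have D1 z : D z -> dom s (f z) by move=> /DO[].
  have D2 z : D z -> straight_dom ((s \o f) z) by move=> /DO[].
  have bW z : D z -> z.2 = 0 -> W (f z).
    by move=> Dz z0; apply: HfW; exists z => //; apply: boundary_punctured => //; exact: DP.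
  have su := chart_smD Hf Sc DP D1.
  have sp : smooth_on straight_dom straight := smooth_on_sub Ok straight_smooth.
  have jE z : D z -> dx (fun z => straight (s (f z))) z = dx (s \o f) z *m jac straight (s (f z)) /\
      dy (fun z => straight (s (f z))) z = dy (s \o f) z *m jac straight (s (f z)).
    by move=> Dz; exact: (dx_jac oD oO D2 sp su Dz).
  split; last by move=> z Dz z0; exact: Wi.
  split=> //.
  + exact: (smD_compmx oO D2 sp su).
  + by move=> z Dz; rewrite (jE z Dz).1 /modelE mulmxK //; apply: uJ; exact: D2.
  + by move=> z Dz; rewrite (jE z Dz).2 /modelE mulmxK //; apply: uJ; exact: D2.
  + move=> z Dz; rewrite (jE z Dz).1 (jE z Dz).2 /modelA /modelE !mulmxA mulmxK; last by apply: uJ; exact: D2.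
    by rewrite (chart_J Hf Sc oD DP D1 HJ Dz).
  + by move=> z Dz; apply: sq; [exact: D1|exact: D2].
  + by move=> z Dz z0; apply: Wi; [exact: D1|exact: bW].
  + by move=> z Dz z0; apply: modelA_flat; [exact: D1|exact: bW].
- exact: Wi.
Qed.

End BoundaryModel.

(** * Area *)

Section SimpleLowerBound.
Context d (T : measurableType d) (R : realType) (mu : {measure set T -> \bar R}).
Import HBNNSimple.
Local Open Scope ereal_scope.

(** Proved from the definition of the integral as a supremum over simple functions, so that it
    applies to an [h] of unknown measurability such as the area density. *)
Lemma integral_ge_simple (D : set T) (h : T -> R) (n : nat) (Q : nat -> set T) (la : nat -> R) :
  (forall x, D x -> (0 <= h x)%R) -> (forall i, measurable (Q i)) -> (forall i, (0 <= la i)%R) ->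
  (forall i, Q i `<=` D) -> (forall i x, Q i x -> (la i <= h x)%R) ->
  (forall i j x, Q i x -> Q j x -> i = j) ->
  \sum_(i < n) (la i)%:E * mu (Q i) <= \int[mu]_(x in D) (h x)%:E.
Proof.
move=> h0 mQ l0 QD lh disj.
pose g i : {nnsfun T >-> R} := scale_nnsfun (indic_nnsfun R (mQ i)) (l0 i).
pose G := sum_nnsfun g n.
have sG : sintegral mu G = \sum_(i < n) (la i)%:E * mu (Q i).
  have gE i : sintegral mu (g i) = (la i)%:E * mu (Q i).
    by rewrite /g sintegralrM sintegral_indic.
  rewrite /G {G}; elim: n => [|p IH].
    rewrite big_ord0 -(sintegral0 mu); apply: eq_sintegral => x.
    by rewrite sum_nnsfunE big_ord0.
  rewrite big_ord_recr /= -IH -gE -sintegralD; apply: eq_sintegral => x.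
  by rewrite /= !sum_nnsfunE big_ord_recr.
rewrite -sG /integral.
have f0 x : D x -> 0 <= (h x)%:E by move=> Dx; rewrite lee_fin; exact: h0.
rewrite funeneg_restrict funepos_restrict.
have /eq_restrictP-> := ge0_funeposE f0.
have /eq_restrictP-> := ge0_funenegE f0.
rewrite erestrict0.
have n0 : ereal_sup [set sintegral mu h | h in [set h : {nnsfun T >-> R} | forall x, (h x)%:E <= (cst 0 : T -> \bar R) x]] = 0.
  apply/eqP; rewrite eq_le; apply/andP; split; last first.
    by apply/ereal_sup_ubound; exists nnsfun0; [|exact: sintegral0].
  apply/ge_ereal_sup => /= x [f /= f1 <-]; have {}f1 : forall x, f x = 0%R.
    by move=> y; apply/eqP; rewrite eq_le -2!lee_fin f1 //= lee_fin//.
  by rewrite (eq_sintegral (@nnsfun0 _ T R)) ?sintegral0.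
rewrite n0 sube0; apply: ereal_sup_ubound; exists G => // x /=.
rewrite sum_nnsfunE /patch.
have gx i : g i x = (la i * (x \in Q i)%:R)%R by rewrite -indicE.
have [[i Qi]|nQ] := pselect (exists i, Q i x).
  have Dx := QD i x Qi; rewrite mem_set //= lee_fin.
  apply: le_trans (lh i x Qi).
  have e j : g j x = (if (j == i) then la i else 0)%R.
    rewrite gx; have [->|ji] := eqVneq j i; first by rewrite mem_set // mulr1.
    rewrite memNset ?mulr0 // => Qj; move/eqP: ji; apply; exact: disj Qj Qi.
  rewrite (eq_bigr (fun j : 'I_n => if (j == i :> nat) then la i else 0)%R); last by move=> j _; exact: e.
  have [ni|ni] := ltnP i n.
    by rewrite (bigD1 (Ordinal ni)) //= eqxx big1 ?addr0 // => j /negP ji; case: ifP => // /eqP e1; case: ji; apply/eqP/val_inj.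
  by rewrite big1 // => j _; case: ifP => // /eqP e1; move: (ltn_ord j); rewrite e1 ltnNge ni.
rewrite big1 => [|j _]; first by case: ifPn => [/set_mem|//]; exact: f0.
by rewrite gx memNset ?mulr0 // => Qj; apply: nQ; exists (j : nat).
Qed.

End SimpleLowerBound.

(** * Area density and gradient *)

Section Density.
Variables (R : realType) (M : topologicalType) (m : nat) (S : smooth_manifold R M m).
Variables (J : almost_complex S) (g : riemannian_metric S) (f : R * R -> M).
Local Notation PH := (@punctured_half_disc R).
Hypothesis Hf : smooth_in S PH f.
Hypothesis HJ : J_holomorphic J PH f.
Local Notation e := (area_density g PH f).

Definition quad (P : 'M[R]_m) (v : 'rV[R]_m) : R := (v *m P *m v^T) 0 0.

Lemma trmx_norm p q (P : 'M[R]_(p, q)) : `|P^T| <= `|P|.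
Proof. by apply: mx_norm_le => // i j; rewrite mxE mx_norm_coord. Qed.

Lemma quad_le P v : `|quad P v| <= m%:R ^+ 2 * `|P| * `|v| ^+ 2.
Proof.
apply: le_trans (mx_norm_coord _ 0 0) _; apply: le_trans (mulmx_norm _ _) _.
have h1 := mulmx_norm v P; have h2 := trmx_norm v.
have -> : m%:R ^+ 2 * `|P| * `|v| ^+ 2 = m%:R * (m%:R * (`|v| * `|P|) * `|v|) :> R by ring.
by rewrite ler_wpM2l // ler_pM.
Qed.

Lemma quadB P Q v : quad P v - quad Q v = quad (P - Q) v.
Proof. by rewrite /quad mulmxBr mulmxBl !mxE. Qed.

Lemma quadZ P t v : quad P (t *: v) = t ^+ 2 * quad P v.
Proof. by rewrite /quad linearZ /= -!scalemxAl -!scalemxAr !mxE expr2 mulrA. Qed.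

Definition gram (P Q K : 'M[R]_m) (v : 'rV[R]_m) : R := quad P v * quad Q v - quad K v ^+ 2.

Lemma gram_close P Q K P' Q' K' v (B ep : R) : 0 <= ep ->
  `|P| <= B -> `|Q| <= B -> `|K| <= B -> `|P'| <= B -> `|Q'| <= B -> `|K'| <= B ->
  `|P - P'| <= ep -> `|Q - Q'| <= ep -> `|K - K'| <= ep ->
  `|gram P Q K v - gram P' Q' K' v| <= 4 * m%:R ^+ 4 * B * ep * `|v| ^+ 4.
Proof.
move=> ep0 hP hQ hK hP' hQ' hK' dP dQ dK; have B0 : 0 <= B by apply: le_trans hP.
pose c := m%:R ^+ 2 * B * `|v| ^+ 2; pose c' := m%:R ^+ 2 * ep * `|v| ^+ 2.
have q0 : 0 <= m%:R ^+ 2 :> R by rewrite exprn_ge0.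
have v0 : 0 <= `|v| ^+ 2 by rewrite exprn_ge0.
have bd X : `|X| <= B -> `|quad X v| <= c.
  by move=> h; apply: le_trans (quad_le X v) _; rewrite ler_wpM2r // ler_wpM2l.
have cl X Y : `|X - Y| <= ep -> `|quad X v - quad Y v| <= c'.
  by move=> h; rewrite quadB; apply: le_trans (quad_le _ v) _; rewrite ler_wpM2r // ler_wpM2l.
have [p1 p2 p3] := And3 (bd P hP) (bd Q hQ) (bd K hK).
have [p4 p5 p6] := And3 (bd P' hP') (bd Q' hQ') (bd K' hK').
have [p7 p8 p9] := And3 (cl P P' dP) (cl Q Q' dQ) (cl K K' dK).
have -> : 4 * m%:R ^+ 4 * B * ep * `|v| ^+ 4 = 4 * (c * c') by rewrite /c /c'; ring.
rewrite /gram; move: (quad P v) (quad Q v) (quad K v) (quad P' v) (quad Q' v) (quad K' v) p1 p2 p3 p4 p5 p6 p7 p8 p9.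
move=> a b k a' b' k' p1 p2 p3 p4 p5 p6 p7 p8 p9.
have -> : a * b - k ^+ 2 - (a' * b' - k' ^+ 2) = (a - a') * b + a' * (b - b') - ((k - k') * k + k' * (k - k')) by ring.
have c0 : 0 <= c by apply: le_trans p1. have c'0 : 0 <= c' by apply: le_trans p7.
have t1 : `|(a - a') * b| <= c * c' by rewrite normrM mulrC ler_pM.
have t2 : `|a' * (b - b')| <= c * c' by rewrite normrM ler_pM.
have t3 : `|(k - k') * k| <= c * c' by rewrite normrM mulrC ler_pM.
have t4 : `|k' * (k - k')| <= c * c' by rewrite normrM ler_pM.
apply: le_trans (ler_normB _ _) _; apply: le_trans (lerD (ler_normD _ _) (ler_normD _ _)) _.
by move: t1 t2 t3 t4; move: (c * c') => x; lra.
Qed.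

(** A continuous function, homogeneous of degree four and positive off 0, has a positive minimum on
    the unit sphere; the sphere is empty when [m = 0]. *)
Lemma gram_lower P Q K : (forall v, v != 0 -> 0 < gram P Q K v) ->
  exists2 c, 0 < c & forall v, c * `|v| ^+ 4 <= gram P Q K v.
Proof.
move=> pos; pose Sp := [set v : 'rV[R]_m | `|v| = 1].
have gc : continuous (fun v => (-1) * gram P Q K v).
  have qs X : Cn_on 0 [set: 'rV[R]_m] (quad X).
    have cid0 : Cn_on 0 [set: 'rV[R]_m] (fun v : 'rV[R]_m => v) by move=> x _; exact: cvg_id.
    apply: (Cn_on_coord 0 0 openT); apply: Cn_on_mulmx; first exact: openT.
      by apply: Cn_on_mulmx; [exact: openT|exact: cid0|exact: Cn_on_cst].
    by apply: (Cn_on_mx openT) => i j; apply: (Cn_on_eq openT) (Cn_on_coord j i openT cid0) => x _; rewrite mxE.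
  have c0 : Cn_on 0 [set: 'rV[R]_m] (gram P Q K).
    have e1 v : setT v -> quad P v * quad Q v + (-1) * (quad K v * quad K v) = gram P Q K v.
      by move=> _; rewrite /gram; ring.
    apply: (Cn_on_eq openT e1); apply: (Cn_onD openT); first exact: (Cn_onM openT).
    by apply: (Cn_onM openT); [exact: Cn_on_cst|exact: (Cn_onM openT)].
  by move=> x; exact: (Cn_onM openT (Cn_on_cst 0 _ (-1 : R)) c0).
have hom t v : gram P Q K (t *: v) = t ^+ 4 * gram P Q K v by rewrite /gram !quadZ; ring.
have cS : compact Sp.
  apply: bounded_closed_compact.
    by exists 1; split; [exact: num_real|move=> x x1 v /= ->; exact: ltW].
  have c1 : closed [set x : R | x = 1] := @closed_eq _ _.
  have cn : continuous (fun v : 'rV[R]_m => `|v|) by move=> v; exact: norm_continuous.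
  have -> : Sp = (fun v : 'rV[R]_m => `|v|) @^-1` [set x : R | x = 1] by [].
  by apply: preimage_closed; do [exact: c1|move=> x _; exact: cn].
have unit v : v != 0 -> Sp (`|v|^-1 *: v).
  by move=> v0; rewrite /Sp /= normrZ normfV normr_id mulVf // normr_eq0.
have [Se|/set0P S0] := eqVneq Sp set0.
  exists 1 => // v; have [->|v0] := eqVneq v 0.
    by rewrite normr0 expr0n mulr0 -(scale0r (0 : 'rV[R]_m)) hom expr0n mul0r.
  by have := unit v v0; rewrite Se.
have cg : {within Sp, continuous (fun v => (-1) * gram P Q K v)} by exact: continuous_subspaceT.
have [w Sw hw] := compact_EVT_max S0 cS cg; rewrite inE /Sp /= in Sw.
have w0 : w != 0 by rewrite -normr_eq0 Sw oner_neq0.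
exists (gram P Q K w); first exact: pos.
move=> v; have [->|v0] := eqVneq v 0.
  by rewrite normr0 expr0n mulr0 -(scale0r (0 : 'rV[R]_m)) hom expr0n mul0r.
have := hw (`|v|^-1 *: v); rewrite inE => /(_ (unit v v0)); rewrite !mulN1r lerN2 hom exprVn.
have p4 : 0 < `|v| ^+ 4 by rewrite exprn_gt0 // normr_gt0.
by rewrite mulrC ler_pdivlMr.
Qed.

(** The Gram determinant of [v] and [v J]: for a [J]-holomorphic map the [y]-derivative is the
    [x]-derivative times [J]. The metric is not assumed [J]-invariant, hence a determinant rather
    than a squared length. *)
Definition chart_gram (c : chart R M m) (x : 'rV[R]_m) (v : 'rV[R]_m) : R :=
  gram (g c x) (J c x *m g c x *m (J c x)^T) (g c x *m (J c x)^T) v.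

Lemma jac_mul p (phi : 'rV[R]_m -> 'rV[R]_p) x v : differentiable phi x ->
  'd phi x v = v *m jac phi x.
Proof.
move=> df; rewrite {1}(matrix_sum_delta v) big_ord1 linear_sum /=.
apply/matrixP => i j; rewrite (ord1 i) summxE mxE; apply: eq_bigr => l _.
by rewrite linearZ /= !mxE deriveE.
Qed.

(** [area_density] is computed in the chart picked by [chart_at], which varies with the point in no
    controlled way; naturality of the metric moves the computation to a fixed chart. *)
Lemma density_chart c z : charts S c -> PH z -> dom c (f z) ->
  e z = Num.sqrt (chart_gram c (c (f z)) (dx (c \o f) z)).
Proof.
move=> Sc Pz dz; rewrite /area_density; set c' := chart_at S (f z).
have [Sc' dz'] : charts S c' /\ dom c' (f z).
  by rewrite /c' /chart_at; case: cid2.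
pose D := [set w | PH w /\ (dom c `&` dom c') (f w)].
have oD : hopen D by apply: (hopen_preimage Hf); apply: openI; exact: dom_open.
have DP : D `<=` PH by move=> w [].
have D1 w : D w -> dom c (f w) by move=> [_ []].
have D2 w : D w -> dom c' (f w) by move=> [_ []].
have Dz : D z by [].
have [-> ->] := tangent_mapE Hf Sc' oD DP D2 Dz.
have su := chart_smD Hf Sc DP D1.
have [sm _] := charts_compatible Sc Sc'.
have oO := open_chart_image (c := c) (dom_open c').
have DO w : D w -> (c @` (dom c `&` dom c')) ((c \o f) w) by move=> [_ hw]; exists (f w).
have eqf w : D w -> transition c c' ((c \o f) w) = (c' \o f) w.
  by move=> Dw; rewrite /transition /= coordK //; exact: D1.
have st := smD_compmx oO DO sm su.
have dt := smooth_on_differentiable sm (DO z Dz).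
have [jx jy] := dx_jac oD oO DO sm su Dz.
have tx : dx (c' \o f) z = tangent_change c c' (f z) (dx (c \o f) z).
  by rewrite -(dx_eqD oD st Dz eqf) jx /tangent_change jac_mul.
have ty : dy (c' \o f) z = tangent_change c c' (f z) (dy (c \o f) z).
  by rewrite -(dy_eqD oD st Dz eqf) jy /tangent_change jac_mul.
rewrite tx ty !metric_natural // (chart_J Hf Sc oD DP D1 HJ Dz).
move: (dx (c \o f) z) => v; congr (Num.sqrt _).
by rewrite /chart_gram /gram /quad /bilin !trmx_mul !mulmxA.
Qed.

Lemma bilin_sym (G : 'M[R]_m) v w : G^T = G -> bilin G w v = bilin G v w.
Proof.
move=> Gs; have e1 : (w *m G *m v^T)^T = v *m G *m w^T by rewrite !trmx_mul trmxK Gs mulmxA.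
by rewrite /bilin -e1 [RHS]mxE.
Qed.

(** The Gram determinant is [a] times the squared length of the part of [v J] orthogonal to [v].
    That part is not 0, since [v J = t v] would give [t^2 = -1]. *)
Lemma chart_gram_gt0 c p v : charts S c -> dom c p -> v != 0 -> 0 < chart_gram c (c p) v.
Proof.
move=> Sc dp v0; set G := g c (c p); set Jp := J c (c p); pose w := v *m Jp.
pose a := bilin G v v; pose b := bilin G w w; pose k := bilin G v w.
have -> : chart_gram c (c p) v = a * b - k ^+ 2.
  by rewrite /chart_gram /gram /quad /a /b /k /bilin /w !trmx_mul !mulmxA.
have a0 : 0 < a by exact: metric_pos.
pose t := k / a; pose y := w - t *: v.
have y0 : y != 0.
  apply/eqP => /eqP; rewrite subr_eq0 => /eqP wt.
  have : w *m Jp = - v by rewrite /w -mulmxA acs_square // mulmxN mulmx1.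
  rewrite wt -scalemxAl -/w wt scalerA => /eqP; rewrite -subr_eq0 opprK -{2}(scale1r v) -scalerDl.
  rewrite scaler_eq0 (negPf v0) orbF => /eqP e1.
  have e2 : 0 < t * t + 1 by rewrite ltr_wpDl // -expr2 sqr_ge0.
  by rewrite e1 ltxx in e2.
have ky : bilin G w v = k.
  exact: bilin_sym (Defs.metric_sym g Sc dp).
have yb : bilin G y y = b - k ^+ 2 / a.
  have e1 : bilin G y y = b - t * bilin G w v - t * bilin G v w + t * t * a.
    have tE : (w - t *: v)^T = w^T - t *: v^T by apply/matrixP => i j; rewrite !mxE.
    rewrite /a /b /bilin /y tE !mulmxBl !mulmxBr -!scalemxAl -!scalemxAr -?scalemxAl.
    move: (w *m G *m w^T) (w *m G *m v^T) (v *m G *m w^T) (v *m G *m v^T) => X1 X2 X3 X4.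
    by rewrite !mxE; ring.
  by rewrite e1 ky -/k /t; field; rewrite gt_eqF.
have : 0 < bilin G y y by exact: metric_pos.
rewrite yb => h; have : 0 < a * (b - k ^+ 2 / a) by rewrite mulr_gt0.
by congr (0 < _); field; rewrite gt_eqF.
Qed.

Lemma density_bounds c p : charts S c -> dom c p ->
  exists d C, [/\ 0 < d, 0 < C & forall z, PH z -> dom c (f z) -> `|c (f z) - c p| < d ->
    `|dx (c \o f) z| ^+ 2 <= C * e z /\ e z <= C * `|dx (c \o f) z| ^+ 2].
Proof.
move=> Sc dp; set q := c p; have iq : (c @` dom c) q by exists p.
have oi : open (c @` dom c) by exact: image_open.
have sJ := acs_smooth J Sc; have sG := metric_smooth g Sc.
pose P := g c; pose Q x := J c x *m g c x *m (J c x)^T; pose K x := g c x *m (J c x)^T.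
have sT n : Cn_on n (c @` dom c) (fun x => (J c x)^T).
  by apply: (Cn_on_mx oi) => i j; apply: (Cn_on_eq oi) (Cn_on_coord j i oi (sJ n)) => x _; rewrite mxE.
have cP : Cn_on 0 (c @` dom c) P := sG 0.
have cK : Cn_on 0 (c @` dom c) K := Cn_on_mulmx oi (sG 0) (sT 0).
have cQ : Cn_on 0 (c @` dom c) Q := Cn_on_mulmx oi (Cn_on_mulmx oi (sJ 0) (sG 0)) (sT 0).
have [c0 c00 low] := @gram_lower (P q) (Q q) (K q) (fun v v0 => chart_gram_gt0 Sc dp v0).
pose B := `|P q| + `|Q q| + `|K q| + 1.
pose ep := Num.min 1 (c0 / 2 / (4 * m%:R ^+ 4 * B + 1)).
have B0 : 0 <= B by rewrite !addr_ge0.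
have den : 0 < 4 * m%:R ^+ 4 * B + 1 by rewrite ltr_wpDl // !mulr_ge0 // exprn_ge0.
have ep0 : 0 < ep by rewrite lt_min ltr01 !divr_gt0.
have nr p1 p2 (F : 'rV[R]_m -> 'M[R]_(p1, p2)) : Cn_on 0 (c @` dom c) F -> \forall x \near q, `|F x - F q| < ep.
  by move=> /(_ q iq) /cvgrPdist_lt /(_ ep ep0); apply: filterS => x; rewrite distrC.
have [d d0 H] := near_norm_ex (filterI (nr _ _ P cP) (filterI (nr _ _ Q cQ) (nr _ _ K cK))).
pose C1 := m%:R ^+ 4 * (2 * B ^+ 2).
pose C := Num.sqrt (2 / c0) + Num.sqrt C1.
have s0 : 0 < Num.sqrt (2 / c0) by rewrite sqrtr_gt0 divr_gt0.
exists d, C; split => //; first by rewrite ltr_pwDl // sqrtr_ge0.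
move=> z Pz dz zd; rewrite (density_chart Sc Pz dz); move: (dx (c \o f) z) => v.
set x := c (f z) in zd *; have [h1 [h2 h3]] := H x zd.
have nB p1 p2 (X Y : 'M[R]_(p1, p2)) : `|X - Y| < ep -> `|Y| + 1 <= B -> `|X| <= B.
  move=> xy yB; rewrite -(subrK Y X); apply: le_trans (ler_normD _ _) _.
  by apply: le_trans yB; rewrite addrC lerD2l; apply: le_trans (ltW xy) _; rewrite ge_min lexx.
have [b1 b2 b3] : [/\ `|P q| + 1 <= B, `|Q q| + 1 <= B & `|K q| + 1 <= B].
  by rewrite /B; move: (normr_ge0 (P q)) (normr_ge0 (Q q)) (normr_ge0 (K q)) => ? ? ?; split; lra.
have lB (a : R) : a + 1 <= B -> a <= B by move=> ?; lra.
have [x1 x2 x3] := And3 (nB _ _ _ _ h1 b1) (nB _ _ _ _ h2 b2) (nB _ _ _ _ h3 b3).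
have cl := gram_close v (ltW ep0) x1 x2 x3 (lB _ b1) (lB _ b2) (lB _ b3) (ltW h1) (ltW h2) (ltW h3).
have v4 : 0 <= `|v| ^+ 4 by rewrite exprn_ge0.
have small : 4 * m%:R ^+ 4 * B * ep <= c0 / 2.
  apply: (@le_trans _ _ ((4 * m%:R ^+ 4 * B + 1) * ep)); first by rewrite ler_wpM2r ?lerDl // ltW.
  by rewrite mulrC -ler_pdivlMr // ge_min lexx orbT.
have lo : c0 / 2 * `|v| ^+ 4 <= chart_gram c x v.
  have := low v; have := ler_wpM2r v4 small; have := le_trans (ler_norm _) cl.
  have := le_trans (ler_norm (- _)) (eq_ind_r (fun t => t <= _) cl (normrN _)).
  rewrite -[gram (P x) (Q x) (K x) v]/(chart_gram c x v).
  move: (gram (P q) _ _ v) (chart_gram c x v) (`|v| ^+ 4) => y1 y2 y3; rewrite -mulrA; lra.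
have up : chart_gram c x v <= C1 * `|v| ^+ 4.
  have bq X : `|X| <= B -> `|quad X v| <= m%:R ^+ 2 * B * `|v| ^+ 2.
    move=> h; apply: le_trans (quad_le X v) _; rewrite ler_wpM2r ?exprn_ge0 // ler_wpM2l // exprn_ge0 //.
  have t1 : quad (P x) v * quad (Q x) v <= (m%:R ^+ 2 * B * `|v| ^+ 2) ^+ 2.
    apply: le_trans (ler_norm _) _; rewrite normrM expr2; apply: ler_pM => //; exact: bq.
  have t2 : 0 <= quad (K x) v ^+ 2 by exact: sqr_ge0.
  have t3 : (m%:R ^+ 2 * B * `|v| ^+ 2) ^+ 2 <= C1 * `|v| ^+ 4.
    rewrite /C1 (_ : _ ^+ 2 = m%:R ^+ 4 * B ^+ 2 * `|v| ^+ 4); last by ring.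
    rewrite ler_wpM2r // ler_wpM2l ?exprn_ge0 // mulr_natl mulr2n lerDl exprn_ge0 //.
  rewrite /chart_gram /gram -/(P x) -/(Q x) -/(K x); lra.
have sv : Num.sqrt (`|v| ^+ 4) = `|v| ^+ 2.
  by rewrite (_ : `|v| ^+ 4 = (`|v| ^+ 2) ^+ 2) ?sqrtr_sqr ?ger0_norm ?exprn_ge0 // -exprM.
split.
  apply: (@le_trans _ _ (Num.sqrt (2 / c0) * Num.sqrt (chart_gram c x v))); last first.
    by rewrite ler_wpM2r ?sqrtr_ge0 // lerDl sqrtr_ge0.
  rewrite -sqrtrM ?divr_ge0 ?(ltW c00) // -sv; apply: ler_wsqrtr.
  have := ler_wpM2l (_ : 0 <= 2 / c0) lo; rewrite divr_ge0 ?(ltW c00) // => /(_ isT).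
  by rewrite mulrA (_ : 2 / c0 * (c0 / 2) = 1) ?mul1r //; field; rewrite gt_eqF.
apply: (@le_trans _ _ (Num.sqrt C1 * `|v| ^+ 2)); last first.
  by rewrite ler_wpM2r ?exprn_ge0 // lerDr sqrtr_ge0.
rewrite -sv -sqrtrM; first exact: ler_wsqrtr.
by rewrite mulr_ge0 ?exprn_ge0 // mulr_ge0 // exprn_ge0.
Qed.

Lemma density_ge0 z : 0 <= e z.
Proof. exact: sqrtr_ge0. Qed.

Lemma density_near z : PH z -> exists r K, 0 < r /\ forall w, PH w -> `|w - z| < r -> e w <= K.
Proof.
move=> Pz; have [c Sc dz] := charts_cover S (f z).
have [d [C [d0 C0 H]]] := density_bounds Sc dz.
pose D := [set w | PH w /\ dom c (f w)].
have oD : hopen D by apply: (hopen_preimage Hf); exact: dom_open.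
have DP : D `<=` PH by move=> w [].
have D1 w : D w -> dom c (f w) by move=> [].
have Dz : D z by [].
have su := chart_smD Hf Sc DP D1.
have [r1 r10 h1] := smD_cvg oD su Dz d0.
have [r2 r20 h2] := smD_cvg oD (smD_dx oD su) Dz ltr01.
have [r3 r30 h3] := map_near Hf Pz (dom_open c) dz.
exists (Num.min r1 (Num.min r2 r3)), (C * (`|dx (c \o f) z| + 1) ^+ 2); split.
  by rewrite !lt_min r10 r20 r30.
move=> w Pw; rewrite !lt_min => /andP[w1 /andP[w2 w3]].
have Dw : D w by split => //; exact: h3.
have [_ up] := H w Pw (h3 w Pw w3) (h1 w Dw w1).
apply: le_trans up _; rewrite ler_pM2l // ler_sqr ?nnegrE ?addr_ge0 //.
rewrite -(subrK (dx (c \o f) z) (dx (c \o f) w)); apply: le_trans (ler_normD _ _) _.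
by rewrite addrC lerD2l ltW // h2.
Qed.

End Density.

(** Phrased with local bounds, because it is such bounds, and not continuity, that are established
    for the area density. *)
Lemma compact_bounded_near (R : realType) (T : topologicalType) (A : set T) (h : T -> R) :
  compact A -> (forall z, A z -> exists K : R, \forall w \near z, A w -> h w <= K) ->
  exists K : R, forall z, A z -> h z <= K.
Proof.
move=> cA H; apply: contrapT => nb.
pose B (K : R) := [set z | A z /\ K < h z].
have BF : ProperFilter (filter_from [set: R] B).
  apply: filter_from_proper.
    apply: filter_from_filter; first by exists 0.
    move=> i j _ _; exists (Num.max i j) => // z [Az]; rewrite gt_max => /andP[h1 h2].
    by split.
  move=> K _; apply: contrapT => h0; apply: nb; exists K => z Az; rewrite leNgt; apply/negP => hz.
  by apply: h0; exists z.
have [z [Az cz]] := cA _ BF (ex_intro2 _ _ 0 I (fun z => @proj1 _ _)).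
have [K nK] := H z Az.
have fB : filter_from [set: R] B (B K) by exists K.
by have [w [[Aw hw] /(_ Aw)]] := cz _ _ fB nK; rewrite leNgt hw.
Qed.

Lemma dist_continuous (R : realType) (V : normedModType R) (q : V) : continuous (fun x : V => `|x - q|).
Proof.
move=> x; apply/cvgrPdist_lt => e e0; apply: (near_norm e0) => y yx.
by apply: le_lt_trans (ler_dist_dist _ _) _; rewrite opprB addrA subrK distrC.
Qed.

(** * Continuity argument along paths *)

Section PathTrap.
Variables (R : realType) (M : topologicalType) (m : nat).
Variables (c : chart R M m) (q : 'rV[R]_m) (s d : R) (h : R -> M).

Lemma closed_chart_ball : hausdorff_space M -> (forall x, `|x - q| <= s -> (c @` dom c) x) ->
  closed (param c @` [set x | `|x - q| <= s]).
Proof.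
move=> hM sub; apply: compact_closed => //; apply: continuous_compact.
  by apply: continuous_in_subspaceT => x; rewrite inE => xs; apply: param_continuous; exact: sub.
apply: bounded_closed_compact.
  exists (`|q| + s); split; [exact: num_real|move=> y ys x /= xs].
  rewrite -(subrK q x); apply: le_trans (ler_normD _ _) _; apply: le_trans (ltW ys).
  by rewrite addrC lerD2l.
have cn : continuous (fun x : 'rV[R]_m => `|x - q|).
  exact: dist_continuous.
have -> : [set x : 'rV[R]_m | `|x - q| <= s] = (fun x => `|x - q|) @^-1` [set t | t <= s] by [].
by apply: preimage_closed; do [exact: closed_le|move=> x _; exact: cn].
Qed.

(** Open-closed argument for the last time [T] up to which the path stays in the open ball of radius
    [d]. The a priori bound [s < d] puts earlier points in a closed ball of the chart, which is
    compact, hence closed in the Hausdorff space [M]; so [h T] has not left the chart, and openness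
    carries on past [T]. *)
Lemma path_trap : hausdorff_space M -> s < d -> (forall x, `|x - q| <= s -> (c @` dom c) x) ->
  (forall t, 0 <= t <= 1 -> forall V : set M, open V -> V (h t) ->
    exists2 r : R, 0 < r & forall x, 0 <= x <= 1 -> `|x - t| < r -> V (h x)) ->
  dom c (h 0) /\ `|c (h 0) - q| < d ->
  (forall t, 0 <= t <= 1 -> (forall x, 0 <= x <= t -> dom c (h x) /\ `|c (h x) - q| < d) ->
    `|c (h t) - q| <= s) ->
  forall t, 0 <= t <= 1 -> dom c (h t) /\ `|c (h t) - q| <= s.
Proof.
move=> hM sd sub hc h0 H2.
pose V : set M := dom c `&` c @^-1` [set x | `|x - q| < d].
have oV : open V.
  apply: open_chart_preimage.
  have cn : continuous (fun x : 'rV[R]_m => `|x - q|).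
    exact: dist_continuous.
  rewrite (_ : [set x : 'rV[R]_m | `|x - q| < d] = (fun x => `|x - q|) @^-1` [set t | t < d]) //.
  by apply: open_comp; [move=> x _; exact: cn|exact: open_lt].
pose S := [set t | 0 <= t <= 1 /\ forall x, 0 <= x <= t -> V (h x)].
have S0 : S 0.
  split; first by rewrite lexx ler01.
  by move=> x; rewrite -eq_le => /eqP <-.
have S1 : ubound S 1 by move=> t [/andP[]].
have hS : has_sup S by split; [exists 0|exists 1].
pose T := sup S.
have T01 : 0 <= T <= 1.
  by rewrite (sup_upper_bound hS S0) ge_sup //; exists 0.
have adh r : 0 < r -> exists2 t, S t & T - r < t <= T.
  move=> r0; have [t St tr] := sup_adherent r0 hS.
  by exists t => //; rewrite tr sup_upper_bound.
have VT : V (h T).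
  pose K := param c @` [set x | `|x - q| <= s].
  have cK : closed K := closed_chart_ball hM sub.
  have KT : K (h T).
    apply: contrapT => nK; have oK : open (~` K) by rewrite openC.
    have [r r0 hr] := hc T T01 _ oK nK.
    have [t [t01 Vt] /andP[t1 t2]] := adh r r0.
    have : (~` K) (h t).
      by apply: hr => //; rewrite ler0_norm ?subr_le0 // opprB ltrBlDl -ltrBlDr.
    have tt : 0 <= t <= t by case/andP: t01 => -> _; rewrite lexx.
    have [dt _] := Vt t tt.
    by apply; exists (c (h t)); [exact: H2|exact: coordK].
  case: KT => x xs <-; have [p dp px] := sub x xs.
  rewrite -px coordK //; split => //=; rewrite px; exact: le_lt_trans xs sd.
have [r r0 hr] := hc T T01 V oV VT.
have Sbig t : 0 <= t <= 1 -> t < T + r -> S t.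
  move=> t01 tT; split => // x /andP[x0 xt].
  have x1 : 0 <= x <= 1 by rewrite x0 (le_trans xt) //; case/andP: t01.
  have [xT|Tx] := ltP x T.
    have Tx : 0 < T - x by rewrite subr_gt0.
    have [t' [t'01 Vt'] /andP[h1 h2]] := adh _ Tx.
    by apply: Vt'; rewrite x0 ltW //; move: h1; rewrite opprB addrC subrK.
  apply: hr => //; rewrite ger0_norm ?subr_ge0 // ltrBlDl.
  exact: le_lt_trans xt tT.
have all1 : S 1.
  apply: (Sbig 1); first by rewrite ler01 lexx.
  rewrite ltNge; apply/negP => Tr.
  have : S (T + r / 2).
    by case/andP: T01 => T0 _; apply: (Sbig (T + r / 2)); [apply/andP; split; lra|lra].
  by move=> /(sup_upper_bound hS); rewrite -/T; lra.
move=> t t01; have [_ V1] := all1; have /andP[t0 t1] := t01.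
have Vx x : 0 <= x <= t -> V (h x) by move=> /andP[x0 xt]; apply: V1; rewrite x0 (le_trans xt).
by split; [have [] := V1 t t01|exact: H2].
Qed.

End PathTrap.

(** * Estimates for the map in a local model *)

Section Model.
Variables (R : realType) (M : topologicalType) (m : nat) (S : smooth_manifold R M m).
Variables (J : almost_complex S) (g : riemannian_metric S) (W : set M) (f : R * R -> M).
Local Notation PH := (@punctured_half_disc R).
Hypothesis Hf : smooth_in S PH f.
Hypothesis HJ : J_holomorphic J PH f.
Local Notation e := (area_density g PH f).
Local Notation se := (fun z => Num.sqrt (area_density g PH f z)).

Variables (p : M) (c : chart R M m) (I : pred 'I_m) (Om : set 'rV[R]_m).
Variables (E A : 'rV[R]_m -> 'M[R]_m) (phi : 'rV[R]_m -> 'rV[R]_m).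
Hypothesis LM : local_model S W f p c I Om E A phi.
Local Notation q := (c p).
Local Notation u := (c \o f).
Local Notation w := (fun z => phi (c (f z))).

Definition inball (d : R) (z : R * R) : Prop := dom c (f z) /\ `|c (f z) - q| < d.
Definition dball (d : R) : set (R * R) := [set z | PH z /\ inball d z].

Lemma hopen_dball d : hopen (dball d).
Proof.
apply: (hopen_preimage Hf (V := dom c `&` c @^-1` [set x | `|x - q| < d])).
apply: open_chart_preimage.
have cn : continuous (fun x : 'rV[R]_m => `|x - q|).
  exact: dist_continuous.
rewrite (_ : [set x : 'rV[R]_m | `|x - q| < d] = (fun x => `|x - q|) @^-1` [set t | t < d]) //.
by apply: open_comp; [move=> x _; exact: cn|exact: open_lt].
Qed.

Lemma near_bound1 p1 p2 (F : 'rV[R]_m -> 'M[R]_(p1, p2)) : smooth_on Om F ->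
  exists d K, [/\ 0 < d, 0 <= K & forall x, `|x - q| < d -> `|F x| <= K].
Proof.
move=> sF; have /(_ q (lm_p LM)) /cvgrPdist_lt /(_ 1 ltr01) /near_norm_ex[d d0 H] : Cn_on 0 Om F by exact: sF.
exists d, (`|F q| + 1); split => //.
move=> x /H xd; rewrite -(subrK (F q) (F x)) addrC; apply: le_trans (ler_normD _ _) _.
by rewrite lerD2l distrC ltW.
Qed.

(** [se], the square root of the area density, plays the part of [|df|]. It refers to no particular
    chart, so bounds on it can be carried from one local model to another. *)
Record mbounds (C : R) (z : R * R) : Prop := MBounds {
  mb_ux : `|dx u z| <= C * se z;
  mb_uy : `|dy u z| <= C * se z;
  mb_wx : `|dx w z| <= C * se z;
  mb_wy : `|dy w z| <= C * se z;
  mb_e : se z <= C * `|dx w z|;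
  mb_uyx : `|dy u z| <= C * `|dx w z|;
  mb_lapl : `|lapl w z| <= C * `|dx w z| ^+ 2;
  mb_mix : `|dx (dy w) z| <= C * (`|dx w z| ^+ 2 + `|dx (dx w) z|) }.

Lemma model_bounds : exists d C, [/\ 0 < d, 1 <= C,
  (forall x, `|x - q| < d -> Om x) & forall d', d' <= d ->
  sys I Om E A (dball d') u w /\ forall z, dball d' z -> mbounds C z].
Proof.
have [Sc dp oO Op OmS sE sA sphi Aq Aqs Hsys HW] := LM.
have [d0 d00 h0] : exists2 d, 0 < d & forall x, `|x - q| < d -> Om x.
  by apply: near_norm_ex; apply: open_nbhs_nbhs.
have [d1 [C1 [d10 C10 H1]]] := density_bounds g Hf HJ Sc dp.
have [d2 [C2 [d20 C20 H2]]] := evle_lapl I Op oO sE sA.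
have [d3 [C3 [d30 C30 H3]]] := evle_dyw I E Op oO sA.
have [d4 [C4 [d40 C40 H4]]] := evle_ux I A Op oO sE.
have [d5 [C5 [d50 C50 H5]]] := evle_uy I Op oO sE sA.
have [d6 [C6 [d60 C60 H6]]] := evle_dxdyw I Op oO sE sA.
have [d7 [C7 [d70 C70 H7]]] := near_bound1 (smooth_jac oO sphi).
have [d8 [C8 [d80 C80 H8]]] := near_bound1 (smooth_on_sub OmS (acs_smooth J Sc)).
pose d := Num.min (Num.min (Num.min d0 d1) (Num.min d2 d3)) (Num.min (Num.min d4 d5) (Num.min d6 (Num.min d7 d8))).
pose r1 := Num.sqrt C1; have r10 : 0 < r1 by rewrite sqrtr_gt0.
have [K7 K7E] : exists K7, K7 = m%:R * C7 by exists (m%:R * C7).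
have [K8 K8E] : exists K8, K8 = m%:R * C8 by exists (m%:R * C8).
have [K70 K80] : 0 <= K7 /\ 0 <= K8 by rewrite K7E K8E !mulr_ge0.
pose C := 1 + r1 + r1 * K8 + r1 * K7 + C3 * (r1 * K7) + r1 * C4 + C5 + C2 + C6.
have nn : [/\ 0 <= r1 * K8, 0 <= r1 * K7, 0 <= C3 * (r1 * K7) & 0 <= r1 * C4].
  by have r1w := ltW r10; rewrite !mulr_ge0.
have [n1 n2 n3 n4] := nn.
have [b1 b2 b3 b4] : [/\ 1 <= C, r1 <= C, r1 * K8 <= C & r1 * K7 <= C].
  by rewrite /C; clear -n1 n2 n3 n4 r10 C50 C20 C60; move: (r1 * K8) (r1 * K7) (C3 * _) (r1 * C4) n1 n2 n3 n4 => *; split; lra.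
have [b5 b6 b7 b8 b9] : [/\ C3 * (r1 * K7) <= C, r1 * C4 <= C, C5 <= C, C2 <= C & C6 <= C].
  by rewrite /C; clear -n1 n2 n3 n4 r10 C50 C20 C60; move: (r1 * K8) (r1 * K7) (C3 * _) (r1 * C4) n1 n2 n3 n4 => *; split; lra.
have dle : [/\ d <= d0, d <= d1, d <= d2 & d <= d3] /\ [/\ d <= d4, d <= d5, d <= d6, d <= d7 & d <= d8].
  by rewrite /d !ge_min !lexx ?orbT.
have [[e0 e1 e2 e3] [e4 e5 e6 e7 e8]] := dle.
exists d, C; split => //.
- by rewrite !lt_min d00 d10 d20 d30 d40 d50 d60 d70 d80.
- by move=> x xd; apply: h0; exact: lt_le_trans xd e0.
move=> d' dd'; have oD := hopen_dball (d := d').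
have DP : dball d' `<=` PH by move=> z [].
have D1 z : dball d' z -> dom c (f z) by move=> [_ []].
have lt z : dball d' z -> `|c (f z) - q| < d by move=> [_ [_ h]]; exact: lt_le_trans h dd'.
have DO z : dball d' z -> dom c (f z) /\ Om (c (f z)).
  by move=> Dz; split; [exact: D1|apply: h0; exact: lt_le_trans (lt z Dz) e0].
have [Sy _] := Hsys _ oD DP DO; split => // z Dz.
have [Pz [dz _]] := Dz; have zd := lt z Dz.
have [lo up] := H1 z Pz dz (lt_le_trans zd e1).
have e_ge0 : 0 <= e z := density_ge0 _ _ _.
have sq2e : se z ^+ 2 = e z by rewrite sqr_sqrtr.
have s0 : 0 <= se z := sqrtr_ge0 _.
have ux1 : `|dx u z| <= r1 * se z.
  rewrite -(@ler_sqr _ `|dx u z|) ?nnegrE ?mulr_ge0 ?(ltW r10) // exprMn sqr_sqrtr ?(ltW C10) //.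
  by rewrite sq2e.
have eu : se z <= r1 * `|dx u z|.
  rewrite -(@ler_sqr _ (se z)) ?nnegrE ?mulr_ge0 ?(ltW r10) // exprMn sq2e.
  by rewrite sqr_sqrtr ?(ltW C10).
have [jx _] := dx_jac oD oO (sys_Om Sy) sphi (sys_u Sy) Dz.
have wx1 : `|dx w z| <= K7 * `|dx u z|.
  rewrite jx; apply: le_trans (mulmx_norm _ _) _; rewrite K7E -mulrA ler_wpM2l // mulrC.
  by rewrite ler_wpM2r //; apply: H7; exact: lt_le_trans zd e7.
have wxe : `|dx w z| <= r1 * K7 * se z.
  by apply: le_trans wx1 _; rewrite [r1 * K7]mulrC -mulrA ler_wpM2l.
have uy1 : `|dy u z| <= K8 * `|dx u z|.
  rewrite (chart_J Hf Sc oD DP D1 HJ Dz); apply: le_trans (mulmx_norm _ _) _.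
  rewrite K8E -mulrA ler_wpM2l // mulrC ler_wpM2r //; apply: H8; exact: lt_le_trans zd e8.
have wy := H3 _ _ _ Sy _ Dz (lt_le_trans zd e3).
have uxw := H4 _ _ _ Sy _ Dz (lt_le_trans zd e4).
have uyw := H5 _ _ _ Sy _ Dz (lt_le_trans zd e5).
split.
- by apply: le_trans ux1 _; rewrite ler_wpM2r.
- apply: le_trans uy1 _; apply: (@le_trans _ _ (r1 * K8 * se z)); last by rewrite ler_wpM2r.
  by rewrite [r1 * K8]mulrC -mulrA ler_wpM2l.
- by apply: le_trans wxe _; rewrite ler_wpM2r.
- apply: le_trans wy _; apply: (@le_trans _ _ (C3 * (r1 * K7) * se z)); last by rewrite ler_wpM2r.
  by rewrite -mulrA ler_wpM2l.
- apply: le_trans eu _; apply: (@le_trans _ _ (r1 * C4 * `|dx w z|)); last by rewrite ler_wpM2r.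
  by rewrite -mulrA ler_wpM2l // ltW.
- by apply: le_trans uyw _; rewrite ler_wpM2r.
- apply: le_trans (H2 _ _ _ Sy _ Dz (lt_le_trans zd e2)) _; by rewrite ler_wpM2r // exprn_ge0.
- apply: le_trans (H6 _ _ _ Sy _ Dz (lt_le_trans zd e6)) _; by rewrite ler_wpM2r // addr_ge0 // exprn_ge0.
Qed.

Section Moves.
Variables (d C La : R).
Hypothesis hM : hausdorff_space M.
Hypothesis C0 : 0 <= C.
Hypothesis La0 : 0 <= La.
Hypothesis dOm : forall x, `|x - q| < d -> Om x.
Hypothesis dB : forall z, dball d z -> mbounds C z.

Let hcont (ga : R -> R * R) (K : R) : 0 <= K -> (forall t, 0 <= t <= 1 -> PH (ga t)) ->
  (forall s t, `|ga s - ga t| <= K * `|s - t|) ->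
  forall t, 0 <= t <= 1 -> forall V : set M, open V -> V (f (ga t)) ->
    exists2 r : R, 0 < r & forall x, 0 <= x <= 1 -> `|x - t| < r -> V (f (ga x)).
Proof.
move=> K0 gP gl t t01 V oV Vt; have [r r0 H] := map_near Hf (gP t t01) oV Vt.
have K1 : 0 < K + 1 by rewrite ltr_wpDl.
exists (r / (K + 1)); first by rewrite divr_gt0.
move=> x x01 xt; apply: H; first exact: gP.
apply: le_lt_trans (gl x t) _; apply: le_lt_trans (_ : `|x - t| * (K + 1) < r).
  by rewrite mulrC ler_wpM2l // lerDl.
by rewrite -ltr_pdivlMr.
Qed.

Let cbS s : s < d -> forall x, `|x - q| <= s -> (c @` dom c) x.
Proof. by move=> sd x xs; apply: (lm_sub LM); apply: dOm; exact: le_lt_trans xs sd. Qed.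

(** Only the starting point is assumed to lie in the chart; the bound on [se] limits the length of
    the image path, and [path_trap] keeps it in the ball. *)
Lemma move_x x0 x1 y :
  (forall x, (x0 <= x <= x1) || (x1 <= x <= x0) -> PH (x, y) /\ se (x, y) <= La) ->
  dom c (f (x0, y)) -> `|c (f (x0, y)) - q| + C * La * `|x1 - x0| < d ->
  inball d (x1, y) /\ `|c (f (x1, y)) - c (f (x0, y))| <= C * La * `|x1 - x0|.
Proof.
move=> H d0 lt; set L := C * La * `|x1 - x0| in lt *.
have L0 : 0 <= L by rewrite !mulr_ge0.
pose ga (t : R) := (x0 + t * (x1 - x0), y).
have btw t : 0 <= t <= 1 -> (x0 <= x0 + t * (x1 - x0) <= x1) || (x1 <= x0 + t * (x1 - x0) <= x0).
  by move=> /andP[t0 t1]; have [h|h] := leP x0 x1; apply/orP; [left|right]; apply/andP; split; nra.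
have gP t : 0 <= t <= 1 -> PH (ga t) by move=> /btw/H[].
have gl s t : `|ga s - ga t| <= `|x1 - x0| * `|s - t|.
  rewrite pair_norm_le /= subrr normr0 mulr_ge0 // andbT.
  by rewrite (_ : _ - _ = (x1 - x0) * (s - t)) ?normrM //; ring.
have lip t : 0 <= t <= 1 -> (forall x, 0 <= x <= t -> inball d (ga x)) ->
    `|c (f (ga t)) - c (f (x0, y))| <= L.
  move=> t01 Ht; have /andP[t0 t1] := t01.
  have seg x : (x0 <= x <= (ga t).1) || ((ga t).1 <= x <= x0) -> dball d (x, y) /\ `|dx u (x, y)| <= C * La.
    move=> hx; have [s st xs] : exists2 s, 0 <= s <= t & x = x0 + s * (x1 - x0).
      have [e1|n1] := eqVneq x1 x0.
        exists 0; first by rewrite lexx.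
        rewrite mul0r addr0; move: hx; rewrite /ga /= e1 subrr mulr0 addr0 orbb -eq_le => /eqP ->.
        by [].
      exists ((x - x0) / (x1 - x0)); last by rewrite divfK ?subr_eq0 // addrC subrK.
      move: hx; rewrite /ga /=; have [h|h] := ltP x0 x1.
        have p0 : 0 < x1 - x0 by rewrite subr_gt0.
        rewrite ler_pdivlMr // ler_pdivrMr // mul0r => /orP[] /andP[h1 h2]; apply/andP; split; nra.
      have p0 : x1 - x0 < 0 by rewrite subr_lt0 lt_neqAle n1.
      rewrite ler_ndivlMr // ler_ndivrMr // mul0r => /orP[] /andP[h1 h2]; apply/andP; split; nra.
    have s01 : 0 <= s <= 1 by case/andP: st => -> /le_trans; apply.
    have Db : dball d (x, y) by split; rewrite xs; [exact: gP|exact: Ht].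
    split=> //; apply: le_trans (mb_ux (dB Db)) _; rewrite ler_wpM2l //.
    by have [] := H x; rewrite xs; first exact: btw.
  have Sc := lm_chart LM.
  have su : smD (dball d) u by apply: (chart_smD Hf Sc) => [z []|z [_ []]].
  have fin (v : 'rV[R]_m) : `|v| <= C * La * `|(ga t).1 - x0| -> `|v| <= L.
    move=> h; apply: le_trans h _; rewrite /L ler_wpM2l ?mulr_ge0 //= addrAC subrr add0r normrM.
    by rewrite ger0_norm // ler_piMl.
  have [h|h] := leP x0 (ga t).1.
    have := dx_lip (hopen_dball (d := d)) su h (C := C * La) (y := y).
    rewrite -{1}(ger0_norm (_ : 0 <= (ga t).1 - x0)) ?subr_ge0 // => D.
    by apply: fin; apply: D => s hs; apply: seg; rewrite hs.
  have := dx_lip (hopen_dball (d := d)) su (ltW h) (C := C * La) (y := y).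
  rewrite -{1}(ger0_norm (_ : 0 <= x0 - (ga t).1)) ?subr_ge0 ?(ltW h) // => D.
  apply: fin; rewrite distrC [`|_ - x0|]distrC.
  by apply: D => s hs; apply: seg; rewrite hs orbT.
have g0 : ga 0 = (x0, y) by rewrite /ga mul0r addr0.
have g1 : ga 1 = (x1, y) by rewrite /ga mul1r addrC subrK.
have := path_trap (h := f \o ga) hM lt (cbS lt) (hcont (normr_ge0 _) gP gl).
rewrite /= g0 => PT.
have in0 : dom c (f (x0, y)) /\ `|c (f (x0, y)) - q| < d.
  by split => //; apply: le_lt_trans lt; rewrite lerDl.
have all t : 0 <= t <= 1 -> dom c (f (ga t)) /\ `|c (f (ga t)) - q| <= `|c (f (x0, y)) - q| + L.
  apply: (PT in0) => t' t'01 Ht'; rewrite -(subrK (c (f (x0, y))) (c (f (ga t')))) -addrA addrC.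
  apply: le_trans (ler_normD _ _) _; rewrite lerD2l; exact: lip.
have allb t : 0 <= t <= 1 -> inball d (ga t).
  by move=> /all[h1 h2]; split => //; exact: le_lt_trans h2 lt.
have i1 : (0 : R) <= (1 : R) <= (1 : R) by apply/andP; split; [exact: ler01|exact: lexx].
rewrite -g1; split; first exact: allb.
by apply: (lip 1 i1) => x /andP[h1 h2]; apply: allb; rewrite h1.
Qed.

Lemma move_y x0 x1 y :
  (forall x, (x0 <= x <= x1) || (x1 <= x <= x0) -> PH (y, x) /\ se (y, x) <= La) ->
  dom c (f (y, x0)) -> `|c (f (y, x0)) - q| + C * La * `|x1 - x0| < d ->
  inball d (y, x1) /\ `|c (f (y, x1)) - c (f (y, x0))| <= C * La * `|x1 - x0|.
Proof.
move=> H d0 lt; set L := C * La * `|x1 - x0| in lt *.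
have L0 : 0 <= L by rewrite !mulr_ge0.
pose ga (t : R) := (y, x0 + t * (x1 - x0)).
have btw t : 0 <= t <= 1 -> (x0 <= x0 + t * (x1 - x0) <= x1) || (x1 <= x0 + t * (x1 - x0) <= x0).
  by move=> /andP[t0 t1]; have [h|h] := leP x0 x1; apply/orP; [left|right]; apply/andP; split; nra.
have gP t : 0 <= t <= 1 -> PH (ga t) by move=> /btw/H[].
have gl s t : `|ga s - ga t| <= `|x1 - x0| * `|s - t|.
  rewrite pair_norm_le /= subrr normr0 mulr_ge0 //=.
  by rewrite (_ : _ - _ = (x1 - x0) * (s - t)) ?normrM //; ring.
have lip t : 0 <= t <= 1 -> (forall x, 0 <= x <= t -> inball d (ga x)) ->
    `|c (f (ga t)) - c (f (y, x0))| <= L.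
  move=> t01 Ht; have /andP[t0 t1] := t01.
  have seg x : (x0 <= x <= (ga t).2) || ((ga t).2 <= x <= x0) -> dball d (y, x) /\ `|dy u (y, x)| <= C * La.
    move=> hx; have [s st xs] : exists2 s, 0 <= s <= t & x = x0 + s * (x1 - x0).
      have [e1|n1] := eqVneq x1 x0.
        exists 0; first by rewrite lexx.
        rewrite mul0r addr0; move: hx; rewrite /ga /= e1 subrr mulr0 addr0 orbb -eq_le => /eqP ->.
        by [].
      exists ((x - x0) / (x1 - x0)); last by rewrite divfK ?subr_eq0 // addrC subrK.
      move: hx; rewrite /ga /=; have [h|h] := ltP x0 x1.
        have p0 : 0 < x1 - x0 by rewrite subr_gt0.
        rewrite ler_pdivlMr // ler_pdivrMr // mul0r => /orP[] /andP[h1 h2]; apply/andP; split; nra.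
      have p0 : x1 - x0 < 0 by rewrite subr_lt0 lt_neqAle n1.
      rewrite ler_ndivlMr // ler_ndivrMr // mul0r => /orP[] /andP[h1 h2]; apply/andP; split; nra.
    have s01 : 0 <= s <= 1 by case/andP: st => -> /le_trans; apply.
    have Db : dball d (y, x) by split; rewrite xs; [exact: gP|exact: Ht].
    split=> //; apply: le_trans (mb_uy (dB Db)) _; rewrite ler_wpM2l //.
    by have [] := H x; rewrite xs; first exact: btw.
  have Sc := lm_chart LM.
  have su : smD (dball d) u by apply: (chart_smD Hf Sc) => [z []|z [_ []]].
  have fin (v : 'rV[R]_m) : `|v| <= C * La * `|(ga t).2 - x0| -> `|v| <= L.
    move=> h; apply: le_trans h _; rewrite /L ler_wpM2l ?mulr_ge0 //= addrAC subrr add0r normrM.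
    by rewrite ger0_norm // ler_piMl.
  have [h|h] := leP x0 (ga t).2.
    have := dy_lip (hopen_dball (d := d)) su h (C := C * La) (x := y).
    rewrite -{1}(ger0_norm (_ : 0 <= (ga t).2 - x0)) ?subr_ge0 // => D.
    by apply: fin; apply: D => s hs; apply: seg; rewrite hs.
  have := dy_lip (hopen_dball (d := d)) su (ltW h) (C := C * La) (x := y).
  rewrite -{1}(ger0_norm (_ : 0 <= x0 - (ga t).2)) ?subr_ge0 ?(ltW h) // => D.
  apply: fin; rewrite distrC [`|_ - x0|]distrC.
  by apply: D => s hs; apply: seg; rewrite hs orbT.
have g0 : ga 0 = (y, x0) by rewrite /ga mul0r addr0.
have g1 : ga 1 = (y, x1) by rewrite /ga mul1r addrC subrK.
have := path_trap (h := f \o ga) hM lt (cbS lt) (hcont (normr_ge0 _) gP gl).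
rewrite /= g0 => PT.
have in0 : dom c (f (y, x0)) /\ `|c (f (y, x0)) - q| < d.
  by split => //; apply: le_lt_trans lt; rewrite lerDl.
have all t : 0 <= t <= 1 -> dom c (f (ga t)) /\ `|c (f (ga t)) - q| <= `|c (f (y, x0)) - q| + L.
  apply: (PT in0) => t' t'01 Ht'; rewrite -(subrK (c (f (y, x0))) (c (f (ga t')))) -addrA addrC.
  apply: le_trans (ler_normD _ _) _; rewrite lerD2l; exact: lip.
have allb t : 0 <= t <= 1 -> inball d (ga t).
  by move=> /all[h1 h2]; split => //; exact: le_lt_trans h2 lt.
have i1 : (0 : R) <= (1 : R) <= (1 : R) by apply/andP; split; [exact: ler01|exact: lexx].
rewrite -g1; split; first exact: allb.
by apply: (lip 1 i1) => x /andP[h1 h2]; apply: allb; rewrite h1.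
Qed.

End Moves.
End Model.

(** * Point picking *)

Section PickArith.
Variable R : realType.
Implicit Types a b c d l r : R.

Lemma pick_arith1 d a b c : d / 2 < c -> c <= a -> a / 2 < b -> d / 8 <= b / 2.
Proof. by move=> ? ? ?; lra. Qed.
Lemma pick_arith2 a b l : a <= (l - b) / 2 -> 0 < l - b -> a + b <= l.
Proof. by move=> ? ?; lra. Qed.
Lemma pick_arith3 a r : a <= r / 2 -> 0 < r -> 3 / 2 * a <= r.
Proof. by move=> ? ?; lra. Qed.
Lemma pick_arith4 a b c l : a <= (l - b) / 2 -> c <= a + b -> (l - b) / 2 <= l - c.
Proof. by move=> ? ?; lra. Qed.
Lemma pick_arith5 a b : a / 2 < b -> a <= 2 * b.
Proof. by move=> ?; lra. Qed.
Lemma pick_arith6 a b : a - a / 2 < b -> a / 2 < b.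
Proof. by move=> ?; lra. Qed.
Lemma pick_arith7 a b : a / 2 * (4 * b) = 2 * (a * b).
Proof. by field. Qed.

End PickArith.

Section Bubbling.
Variables (R : realType) (M : topologicalType) (m : nat) (S : smooth_manifold R M m).
Variables (J : almost_complex S) (g : riemannian_metric S) (W : set M) (f : R * R -> M).
Local Notation PH := (@punctured_half_disc R).
Hypothesis Hf : smooth_in S PH f.
Hypothesis HJ : J_holomorphic J PH f.
Local Notation e := (area_density g PH f).
Local Notation se := (fun z => Num.sqrt (area_density g PH f z)).

Lemma se_sqr z : se z ^+ 2 = e z. Proof. by rewrite sqr_sqrtr //; exact: density_ge0. Qed.

(* Near a point where the density dominates its neighbours, the gradient bound for
   the prolonged system controls second derivatives, so the density stays large on a
   square of comparable size. *)
Lemma square_energy p c I Om E A phi (de : R) : local_model S W f p c I Om E A phi -> 0 < de ->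
  exists ep rad : R, [/\ 0 < ep, 0 < rad & forall z (N rho : R), 0 < N -> 0 < rho -> PH z ->
  se z = N -> inball f p c rad z -> (forall s, box z rho s -> PH s /\ se s <= 4 * N) ->
  de <= rho * N -> exists s la : R, [/\ 0 < s, s <= rho, 0 <= la, ep <= la * s ^+ 2 &
  forall t, z.1 <= t.1 <= z.1 + s -> z.2 <= t.2 <= z.2 + s -> la <= e t]].
Proof.
move=> LM de0; have [d [C [d0 C1 dOm mb]]] := model_bounds g Hf HJ LM.
have [Sc dp oO Op OmS sE sA sphi Aq Aqs Hsys HW] := LM.
have C0 : 0 < C by apply: lt_le_trans C1.
set q := c p in dOm mb Op Aq Aqs.
have Oq' : prolOm Om (row_mx q (0 : 'rV[R]_m)) by rewrite /prolOm /= row_mxKl.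
have oO' := @open_prolOm R m m Om oO.
have sE' := @smooth_prolE R m m Om E oO sE.
have sA' := @smooth_prolA R m m Om E A oO sE sA.
have [d2 [C2 [d20 C20 G1]]] := gradient_bound (prolI I) Oq' oO' sE' sA'.
have [d3 d30 h3] : exists2 d3, 0 < d3 & forall x, `|x - q| < d3 -> `|phi x - phi q| <= d2.
  have cphi : Cn_on 0 Om phi by exact: sphi.
  have /cvgrPdist_lt /(_ d2 d20) /near_norm_ex[d3 d30 H] := cphi q Op.
  by exists d3 => // x /H xd; rewrite distrC ltW.
pose dm := Num.min d (Num.min d2 d3).
have dm0 : 0 < dm by rewrite !lt_min d0 d20 d30.
have [m1 m2 m3] : [/\ dm <= d, dm <= d2 & dm <= d3] by rewrite /dm !ge_min !lexx ?orbT.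
have [Sy mbd] := mb dm m1.
(* In a square of size [ka / N] each of the two legs of a path moves the image by at most
   [4 C ka <= dm / 8], so from within [dm / 2] it stays in the ball of radius [dm]. *)
pose ka := Num.min de (dm / (32 * C)).
have ka0 : 0 < ka by rewrite lt_min de0 divr_gt0 // mulr_gt0.
have kd : ka <= de by rewrite ge_min lexx.
have kC : 8 * C * ka <= dm / 4.
  have : ka <= dm / (32 * C) by rewrite ge_min lexx orbT.
  rewrite ler_pdivlMr ?mulr_gt0 // => h; have -> : 8 * C * ka = ka * (32 * C) / 4 by field.
  by rewrite ler_pM2r // invr_gt0.
(* Bounds of [dx (dx w)] and [dy (dx w)] in units of [N ^+ 2]. *)
pose K1 := 16 * C * C2 / (ka * d2); pose K2 := C * (16 * C ^+ 2 + K1).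
have K10 : 0 <= K1 by rewrite divr_ge0 ?mulr_ge0 ?(ltW C0) ?(ltW ka0) ?(ltW d20).
have K20 : 0 <= K2.
  apply: mulr_ge0 (ltW C0) _; apply: addr_ge0 => //; apply: mulr_ge0 (ler0n _ 16) _.
  by apply: exprn_ge0; exact: ltW.
(* Over a square of side [ka1 / N] the derivative [dx w], of size at least [N / C] at the corner,
   loses at most [N / (4 C)]. *)
pose ka1 := Num.min (ka / 2) (1 / (4 * C * (K1 + K2 + 1))).
have Kp : 0 < K1 + K2 + 1 by apply: ltr_wpDl ltr01; exact: addr_ge0.
have den : 0 < 4 * C * (K1 + K2 + 1) by rewrite !mulr_gt0.
have ka10 : 0 < ka1 by rewrite lt_min; apply/andP; split; exact: divr_gt0.
have ka1h : ka1 <= ka / 2 by rewrite ge_min lexx.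
have ka1C : (K1 + K2) * ka1 <= 1 / (4 * C).
  have : ka1 <= 1 / (4 * C * (K1 + K2 + 1)) by rewrite ge_min lexx orbT.
  rewrite ler_pdivlMr // ler_pdivlMr ?mulr_gt0 // => h; apply: le_trans h.
  have -> : (K1 + K2) * ka1 * (4 * C) = ka1 * (4 * C) * (K1 + K2) by ring.
  have -> : ka1 * (4 * C * (K1 + K2 + 1)) = ka1 * (4 * C) * (K1 + K2) + ka1 * (4 * C) by ring.
  by rewrite lerDl !mulr_ge0 ?(ltW C0) ?(ltW ka10).
exists (ka1 ^+ 2 / (4 * C ^+ 4)), (dm / 2); split; first by rewrite divr_gt0 ?mulr_gt0 ?exprn_gt0.
  by rewrite divr_gt0.
move=> z N rho N0 rho0 Pz zN [dz zq] Hb dN.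
pose r0 := ka / N; have r00 : 0 < r0 by rewrite divr_gt0.
have r0r : r0 <= rho by rewrite ler_pdivrMr // (le_trans kd).
have r0N : r0 * N = ka by rewrite divfK // gt_eqF.
have z20 : 0 <= z.2 by have [[]] := Pz.
have La0 : 0 <= 4 * N by rewrite mulr_ge0 // ltW.
have bx t : box z r0 t -> PH t /\ se t <= 4 * N by move=> [tz t0]; apply: Hb; split => //; exact: le_trans r0r.
have dOm' x : `|x - q| < dm -> Om x by move=> h; apply: dOm; exact: lt_le_trans m1.
have hM := manifold_hausdorff S.
have step (a b : R) : `|b - a| <= r0 -> C * (4 * N) * `|b - a| <= 4 * C * ka.
  move=> h; have := ler_wpM2l (mulr_ge0 (ltW C0) La0) h; move: (`|b - a|) => x.
  by rewrite (_ : C * (4 * N) * r0 = 4 * C * ka) //; rewrite -r0N; ring.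
have inb t : box z r0 t -> dball f p c dm t.
  move=> Bt; have [tz t0] := Bt; have [Pt _] := bx t Bt.
  move: tz; rewrite pair_norm_le /= => /andP[t1 t2].
  have b1 := step z.1 t.1 t1; have b2 := step z.2 t.2 t2.
  have [[i1 i1q] j1] : inball f p c dm (t.1, z.2) /\ `|c (f (t.1, z.2)) - c (f (z.1, z.2))| <= C * (4 * N) * `|t.1 - z.1|.
    apply: (move_x Hf LM hM (ltW C0) La0 dOm' mbd); rewrite -?surjective_pairing //.
      move=> x hx; apply: bx; split => //; rewrite pair_norm_le /= subrr normr0 (ltW r00) andbT.
      by apply: le_trans t1; exact: between_dist.
    rewrite -/q; move: zq kC b1; rewrite -/q; move: (`|c (f z) - q|) (C * (4 * N) * _) => x y; lra.
  have i2 : `|c (f (t.1, z.2)) - q| <= `|c (f z) - q| + 4 * C * ka.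
    rewrite -(subrK (c (f z)) (c (f (t.1, z.2)))) -addrA addrC; apply: le_trans (ler_normD _ _) _.
    by rewrite lerD2l -surjective_pairing in j1 *; exact: le_trans j1 b1.
  have [i3 _] : inball f p c dm (t.1, t.2) /\ `|c (f (t.1, t.2)) - c (f (t.1, z.2))| <= C * (4 * N) * `|t.2 - z.2|.
    apply: (move_y Hf LM hM (ltW C0) La0 dOm' mbd) => //.
      move=> y hy; apply: bx; split => /=; last by case/orP: hy => /andP[h _]; [exact: le_trans z20 h|exact: le_trans t0 h].
      rewrite pair_norm_le /= t1 /=; apply: le_trans t2; exact: between_dist.
    rewrite -/q; move: zq kC b2 i2; rewrite -/q; move: (`|c (f z) - q|) (C * (4 * N) * _) (`|c (f (t.1, z.2)) - q|) => x y x'; lra.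
  by rewrite -surjective_pairing in i3; split.
have oD := sys_hopen Sy; have sw := sys_w Sy; have swx := smD_dx oD sw.
set u := c \o f in Sy; set w := fun z => phi (c (f z)) in Sy sw swx mbd.
have wxN t : box z r0 t -> `|dx w t| <= 4 * C * N.
  move=> Bt; apply: le_trans (mb_wx (mbd t (inb t Bt))) _.
  by have [_ h] := bx t Bt; rewrite [4 * C]mulrC -mulrA ler_wpM2l // ltW.
(* Scales [dx w], of size at most [4 C N], down to [d2 / 2]; the gradient bound for the prolonged
   system then bounds [dx (dx w)]. *)
pose tau := d2 / (8 * C * N).
have tau0 : 0 < tau by rewrite divr_gt0 // !mulr_gt0.
have sw' := smDZ tau swx.
have tw t : box z r0 t -> `|tau *: dx w t| <= d2 / 2.
  move=> Bt; rewrite normrZ (gtr0_norm tau0); apply: le_trans (ler_wpM2l (ltW tau0) (wxN t Bt)) _.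
  by rewrite /tau le_eqVlt; apply/orP; left; apply/eqP; field; rewrite !gt_eqF.
have d2h : d2 / 2 < d2 by lra.
have wxx t : box z (r0 / 2) t -> `|dx (dx w) t| <= K1 * N ^+ 2.
  move=> [tz t0]; have h0 : 0 < r0 / 2 by rewrite divr_gt0.
  have sub s : box t (r0 / 2) s -> box z r0 s.
    move=> [st s0]; split => //; rewrite -(subrK t s) -addrA; apply: le_trans (ler_normD _ _) _; lra.
  have self : box z r0 t by split => //; lra.
  have G := G1 _ _ _ (row_mx (phi q) 0) t (r0 / 2) (prolongation tau Sy) h0 t0.
  have : `|dx (prolw tau w) t| <= C2 / (r0 / 2).
    apply: G => [s /sub/inb //|s /sub Bs|s /sub Bs s0 i].
      have [_ [_ uq]] := inb s Bs; split.
        rewrite /prolu opp_row_mx add_row_mx oppr0 addr0; apply: row_mx_norm_lt.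
          exact: lt_le_trans uq m2.
        exact: le_lt_trans (tw s Bs) d2h.
      rewrite /prolw opp_row_mx add_row_mx oppr0 addr0; apply: row_mx_norm_le; first exact: ltW.
        by apply: h3; exact: lt_le_trans uq m3.
      exact: le_trans (tw s Bs) (ltW d2h).
    have DO y : dball f p c dm y -> dom c (f y) /\ Om (c (f y)).
      by move=> [_ [dy yq]]; split => //; exact: dOm'.
    have [_ bdz] := Hsys _ oD (fun y => @proj1 _ _) DO.
    rewrite /prolI mxE; case: (fintype.split i) => j Ij; last by rewrite mxE.
    exact: (bdz s (inb s Bs) s0 j Ij).
  have -> : dx (prolw tau w) t = row_mx (dx w t) (tau *: dx (dx w) t).
    by rewrite /prolw (dx_row_mx oD sw sw' (inb t self)) (dxZ _ oD swx (inb t self)).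
  move=> h; have h2 : tau * `|dx (dx w) t| <= C2 / (r0 / 2).
    rewrite -(gtr0_norm tau0) -normrZ; apply: le_trans h; apply: mx_norm_le => // i j.
    by apply: le_trans (mx_norm_coord _ i (rshift m j)); rewrite row_mxEr.
  rewrite mulrC -ler_pdivlMr // in h2; apply: le_trans h2 _.
  by rewrite /tau /K1 /r0 le_eqVlt; apply/orP; left; apply/eqP; field; rewrite !gt_eqF.
have wxy t : box z (r0 / 2) t -> `|dy (dx w) t| <= K2 * N ^+ 2.
  move=> Bt; have [tz t0] := Bt; have self : box z r0 t by split => //; lra.
  rewrite -(dxdy_mx oD sw (inb t self)); apply: le_trans (mb_mix (mbd t (inb t self))) _.
  rewrite /K2 -mulrA ler_wpM2l ?(ltW C0) // mulrDl; apply: lerD; last exact: wxx.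
  rewrite (_ : 16 * C ^+ 2 * N ^+ 2 = (4 * C * N) ^+ 2); last by ring.
  by rewrite ler_sqr ?nnegrE ?mulr_ge0 ?(ltW C0) ?(ltW N0) //; exact: wxN.
pose s := ka1 / N; have s0 : 0 < s by rewrite divr_gt0.
have sN : s * N = ka1 by rewrite divfK // gt_eqF.
have sr0 : s <= r0 / 2 by rewrite ler_pdivrMr // mulrAC r0N.
exists s, (N ^+ 2 / (4 * C ^+ 4)); split => //.
- by apply: le_trans sr0 _; lra.
- by rewrite divr_ge0 ?mulr_ge0 ?exprn_ge0 ?(ltW C0) ?(ltW N0).
- by rewrite -sN exprMn le_eqVlt; apply/orP; left; apply/eqP; field; rewrite gt_eqF.
move=> t /andP[a1 a2] /andP[b1 b2].
have bxs (x y : R) : z.1 <= x <= t.1 -> z.2 <= y <= t.2 -> box z (r0 / 2) (x, y).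
  move=> /andP[x1 x2] /andP[y1 y2]; split; last exact: le_trans y1.
  by rewrite pair_norm_le /= !ger0_norm ?subr_ge0 //; apply/andP; split; lra.
have xx : z.2 <= z.2 <= t.2 by rewrite lexx b1.
have bhalf y : box z (r0 / 2) y -> box z r0 y by move=> [h1 h2]; split => //; lra.
have l1 : `|dx w (t.1, z.2) - dx w (z.1, z.2)| <= K1 * N ^+ 2 * (t.1 - z.1).
  apply: (dx_lip oD swx a1) => x hx; have B := bxs x z.2 hx xx.
  by split; [exact: inb (bhalf _ B)|exact: wxx].
have tt : z.1 <= t.1 <= t.1 by rewrite a1 lexx.
have l2 : `|dx w (t.1, t.2) - dx w (t.1, z.2)| <= K2 * N ^+ 2 * (t.2 - z.2).
  apply: (dy_lip oD swx b1) => y hy; have B := bxs t.1 y tt hy.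
  by split; [exact: inb (bhalf _ B)|exact: wxy].
have Bt : box z r0 t by rewrite (surjective_pairing t); apply/bhalf/bxs; rewrite ?lexx ?a1 ?b1.
have Bz : box z r0 z by apply: box_self => //; exact: ltW.
rewrite -!surjective_pairing in l1 l2.
have N2 : 0 <= K1 * N ^+ 2 /\ 0 <= K2 * N ^+ 2.
  by split; apply: mulr_ge0 => //; apply: exprn_ge0; exact: ltW.
have l3 : `|dx w z| <= `|dx w t| + (K1 + K2) * N ^+ 2 * s.
  have -> : dx w z = dx w t - ((dx w t - dx w (t.1, z.2)) + (dx w (t.1, z.2) - dx w z)).
    by rewrite addrA subrK subKr.
  apply: le_trans (ler_normB _ _) _; rewrite lerD2l; apply: le_trans (ler_normD _ _) _.
  apply: le_trans (lerD l2 l1) _; have [n1 n2] := N2.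
  have : K1 * N ^+ 2 * (t.1 - z.1) <= K1 * N ^+ 2 * s by rewrite ler_wpM2l //; lra.
  have : K2 * N ^+ 2 * (t.2 - z.2) <= K2 * N ^+ 2 * s by rewrite ler_wpM2l //; lra.
  by rewrite [(K1 + K2) * _]mulrDl mulrDl; move: (_ * (t.1 - _)) (_ * (t.2 - _)) (K1 * _ * s) (K2 * _ * s) => ? ? ? ?; lra.
have l4 : (K1 + K2) * N ^+ 2 * s <= N / (4 * C).
  have -> : (K1 + K2) * N ^+ 2 * s = (K1 + K2) * ka1 * N by rewrite -sN; ring.
  have -> : N / (4 * C) = 1 / (4 * C) * N by ring.
  by rewrite ler_wpM2r // ltW.
have l5 : N / C <= `|dx w z|.
  rewrite ler_pdivrMr // mulrC -zN; exact: mb_e (mbd z (inb z Bz)).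
have l6 : N / (2 * C) <= `|dx w t|.
  have e1 : N / C = N / (2 * C) + N / (4 * C) + N / (4 * C) by field; rewrite gt_eqF.
  have : 0 <= N / (4 * C) by rewrite divr_ge0 ?mulr_ge0 ?(ltW C0) ?(ltW N0).
  move: l3 l4 l5; rewrite e1; move: (N / (2 * C)) (N / (4 * C)) (_ * s) (`|dx w z|) (`|dx w t|) => ? ? ? ? ?; lra.
have l7 : N / (2 * C) <= C * se t := le_trans l6 (mb_wx (mbd t (inb t Bt))).
rewrite -se_sqr (_ : N ^+ 2 / (4 * C ^+ 4) = (N / (2 * C) / C) ^+ 2); last by field; rewrite gt_eqF.
have q0 : 0 <= N / (2 * C) / C by rewrite !divr_ge0 ?mulr_ge0 ?(ltW C0) ?(ltW N0).
by rewrite ler_sqr ?nnegrE ?sqrtr_ge0 // ler_pdivrMr // (mulrC (Num.sqrt _)).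
Qed.

Lemma small_box_PH (z0 z : R * R) : PH z0 -> `|z0| <= 1 / 4 -> box z0 (`|z0| / 2) z ->
  [/\ PH z, `|z0| / 2 <= `|z| & `|z| <= 3 / 2 * `|z0| ].
Proof.
move=> P0 z04 [zz z2].
have n0 : 0 < `|z0|.
  by rewrite normr_gt0; apply/eqP => e0; have [_ +] := P0; apply; rewrite e0.
have l1 : `|z| <= `|z - z0| + `|z0| by rewrite -{1}(subrK z0 z) ler_normD.
have l2 : `|z0| <= `|z - z0| + `|z| by rewrite distrC -{1}(subrK z z0) ler_normD.
have ar (a b c : R) : a <= b + c -> c <= b + a -> b <= c / 2 -> c / 2 <= a /\ a <= 3 / 2 * c.
  by move=> ? ? ?; split; lra.
have [h1 h2] := ar _ _ _ l1 l2 zz; split => //.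
split; last by move=> e0; move: h1; rewrite e0 (_ : `|(0, 0) : R * R| = 0) ?normr0 //; lra.
split => //; have [_] := andP (sq2_norm z); rewrite /sq2 -!expr2 => h; apply: le_lt_trans h _.
have zb : `|z| <= 3 / 8 by move: h2 z04; move: (`|z|) (`|z0|) => a b; lra.
have : `|z| ^+ 2 <= (3 / 8) ^+ 2 by rewrite ler_sqr ?nnegrE ?normr_ge0 //; lra.
by move: (`|z| ^+ 2) => y; lra.
Qed.

(** Hofer's lemma without iteration: [(l - |s - z0|) se s] is maximised over the square up to a
    factor 2. Around the chosen point half the remaining distance is a radius on which [se] is at
    most [4 N], and its product with [N] is at least [de / 8]. The bound [t <= |s|] serves to place
    the next square strictly closer to 0. *)
Lemma point_picking (de : R) : 0 < de ->
  (forall r, 0 < r -> exists2 z, PH z & `|z| <= r /\ de < `|z| * se z) ->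
  forall r, 0 < r -> exists (z : R * R) (N rho t : R), [/\ 0 < N, se z = N, PH z, 0 < rho & 0 < t] /\
  de / 8 <= rho * N /\ forall s, box z rho s -> [/\ PH s, se s <= 4 * N, t <= `|s| & `|s| <= r].
Proof.
move=> de0 H r r0.
(* Points of the square around [z0] have norm at most [3/2 |z0|]: the bound [1 / 4] keeps them in
   the half disc, and [r / 2] keeps them within [r]. *)
have m0 : 0 < Num.min (r / 2) (1 / 4) by rewrite lt_min; apply/andP; split; apply: divr_gt0.
have [z0 P0 [z0r dz]] := H _ m0; move: z0r; rewrite le_min => /andP[z0r z04].
set l := `|z0| / 2; have [z020] : 0 <= z0.2 /\ True by have [[]] := P0.
have n0 : 0 < `|z0|.
  by rewrite normr_gt0; apply/eqP => e0; have [_ +] := P0; apply; rewrite e0.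
have l0 : 0 < l by rewrite divr_gt0.
pose F s := (l - `|s - z0|) * se s.
have [K hK] : exists K : R, forall s, box z0 l s -> F s <= K.
  apply: compact_bounded_near; first exact: box_compact.
  move=> s Bs; have [Ps _ _] := small_box_PH P0 z04 Bs.
  have [r1 [K [r10 hK]]] := density_near g Hf HJ Ps.
  exists (l * Num.sqrt K); apply: (near_norm r10) => w ws Bw; have [Pw _ _] := small_box_PH P0 z04 Bw.
  apply: ler_pM; rewrite ?sqrtr_ge0 ?subr_ge0 //; [exact: Bw.1|by rewrite gerBl|].
  by apply: ler_wsqrtr; exact: hK.
pose X := [set F s | s in box z0 l].
have Bz0 : box z0 l z0 by apply: box_self => //; exact: ltW.
have X0 : X (F z0) by exists z0.
have hX : has_sup X by split; [exists (F z0)|exists K => _ [s Bs <-]; exact: hK].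
have Fz0 : de / 2 < F z0.
  by rewrite /F subrr normr0 subr0 /l mulrAC ltr_pM2r // invr_gt0.
have S1 : F z0 <= sup X by exact: sup_upper_bound.
have S0 : 0 < sup X / 2 by apply: divr_gt0 => //; apply: lt_le_trans S1; apply: lt_trans Fz0; exact: divr_gt0.
have [_ [zs Bs <-] hs] := sup_adherent S0 hX.
have hs2 : sup X / 2 < F zs by exact: pick_arith6 hs.
have [Ps _ _] := small_box_PH P0 z04 Bs.
have Fp : 0 < F zs by exact: lt_trans hs2.
have a0 : 0 <= l - `|zs - z0| by rewrite subr_ge0; exact: Bs.1.
have ap : 0 < l - `|zs - z0|.
  by rewrite lt_neqAle a0 andbT; apply/eqP => e0; move: Fp; rewrite /F -e0 mul0r ltxx.
have Np : 0 < se zs by move: Fp; rewrite /F pmulr_rgt0.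
exists zs, (se zs), ((l - `|zs - z0|) / 2), l; split; first by split => //; exact: divr_gt0.
split.
  have -> : (l - `|zs - z0|) / 2 * se zs = F zs / 2 by rewrite /F mulrAC.
  exact: pick_arith1 Fz0 S1 hs2.
move=> s [ss s0]; have Bz : box z0 l s.
  split => //; rewrite -(subrK zs s) -addrA; apply: le_trans (ler_normD _ _) _.
  exact: pick_arith2 ss ap.
have [PS h1 h2] := small_box_PH P0 z04 Bz.
have h4 := le_trans h2 (pick_arith3 z0r r0).
have Xs : X (F s) by exists s.
have Fs : F s <= sup X := sup_upper_bound hX Xs.
have d1 : `|s - z0| <= `|s - zs| + `|zs - z0| by rewrite -{1}(subrK zs s) -addrA ler_normD.
have low : (l - `|zs - z0|) / 2 * se s <= F s.
  rewrite /F ler_wpM2r ?sqrtr_ge0 //.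
  exact: pick_arith4 ss d1.
have h3 : (l - `|zs - z0|) / 2 * se s <= (l - `|zs - z0|) / 2 * (4 * se zs).
  apply: le_trans low _; apply: le_trans Fs _.
  rewrite pick_arith7 -/(F zs); exact: pick_arith5 hs2.
have c0 : 0 < (l - `|zs - z0|) / 2 by exact: divr_gt0.
rewrite (ler_pM2l c0) in h3.
by split; [exact: PS|exact: h3|exact: h1|exact: h4].
Qed.

End Bubbling.

Section NoBubbling.
Variables (R : realType) (M : topologicalType) (m : nat) (S : smooth_manifold R M m).
Variables (J : almost_complex S) (g : riemannian_metric S) (W : set M) (f : R * R -> M).
Local Notation PH := (@punctured_half_disc R).
Hypothesis Hf : smooth_in S PH f.
Hypothesis HJ : J_holomorphic J PH f.
Local Notation e := (area_density g PH f).
Local Notation se := (fun z => Num.sqrt (area_density g PH f z)).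

Hypothesis models : forall p, exists c I Om E A phi, local_model S W f p c I Om E A phi.
Hypothesis Hc : relatively_compact (f @` PH).
Hypothesis Ha : (area g PH f < +oo)%E.

(** Relative compactness provides one cluster point [p] of the images, hence one chart and one
    energy quantum [ep] for picked points arbitrarily close to 0. Radii are then chosen so that the
    squares lie in disjoint ranges of [|z|]; each carries area at least [ep], against finite
    area. *)
Lemma no_bubbling (de : R) : 0 < de -> exists2 r, 0 < r & forall z, PH z -> `|z| <= r -> `|z| * se z <= de.
Proof.
move=> de0; apply: contrapT => nE.
have H r : 0 < r -> exists2 z, PH z & `|z| <= r /\ de < `|z| * se z.
  move=> r0; apply: contrapT => nz; apply: nE; exists r => // z Pz zr.
  by rewrite leNgt; apply/negP => lt; apply: nz; exists z.
have in0 n : 0 < n.+1%:R^-1 :> R by rewrite invr_gt0.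
have pp n := point_picking Hf HJ de0 H (in0 n).
have [zs hz] := choice pp.
pose x n := f (zs n).
have xP n : PH (zs n) by have [N [rho [t [[_ _ P _ _] _]]]] := hz n.
have FF : ProperFilter (x @ \oo) by exact: fmap_proper_filter.
have xC : (x @ \oo) (closure (f @` PH)).
  by exists 0%N => // n _ /=; apply: subset_closure; exists (zs n).
have [p [_ cp]] := Hc FF xC.
have [c [I [Om [E [A [phi LM]]]]]] := models p.
have d80 : 0 < de / 8 by exact: divr_gt0.
have [ep [rad [ep0 rad0 SE]]] := square_energy g Hf HJ LM d80.
have nV : nbhs p (dom c `&` c @^-1` [set y | `|y - c p| < rad]).
  apply: open_nbhs_nbhs; split; last by split; [exact: (lm_dom LM)|rewrite /= subrr normr0].
  apply: open_chart_preimage.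
  rewrite (_ : [set y | `|y - c p| < rad] = (fun y => `|y - c p|) @^-1` [set t | t < rad]) //.
  by apply: open_comp; [move=> y _; exact: dist_continuous|exact: open_lt].
(* [X] packs a lower bound of [|y|], the lower left corner, the side, and a lower bound of the
   density. *)
pose sq (X : R * (R * R) * R * R) := [set y : R * R | X.1.1.2.1 <= y.1 <= X.1.1.2.1 + X.1.2 /\
  X.1.1.2.2 <= y.2 <= X.1.1.2.2 + X.1.2].
pose good (r : R) (X : R * (R * R) * R * R) := [/\ 0 < X.1.1.1, 0 < X.1.2, 0 <= X.2,
  ep <= X.2 * X.1.2 ^+ 2 & forall y, sq X y -> [/\ PH y, X.2 <= e y, X.1.1.1 <= `|y| & `|y| <= r]].
have step r : exists X, 0 < r -> good r X.
  have [r0|r0] := ltP 0 r; last first.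
    by exists ((0, (0, 0), 0, 0) : R * (R * R) * R * R).
  have nr : (x @ \oo) [set y | exists2 n : nat, n.+1%:R^-1 <= r & y = x n].
    have [n0 _ Hn] := near_infty_natSinv_lt (PosNum r0).
    by exists n0 => // n /Hn /= lt; exists n => //; exact: ltW.
  have [_ [[n nr1 ->] [dx1 dx2]]] := cp _ _ nr nV.
  have [N [rho [t [[N0 eN Pz rho0 t0] [dN Hb]]]]] := hz n.
  have [|s [la [s0 sr la0 els Hs]]] := SE (zs n) N rho N0 rho0 Pz eN (conj dx1 dx2) _ dN.
    by move=> s /Hb[].
  have z2 : 0 <= (zs n).2 by have [[]] := Pz.
  exists (t, zs n, s, la) => _; split => //= y [/= y1 y2].
  have By : box (zs n) rho y.
    have /andP[a1 a2] := y1; have /andP[b1 b2] := y2.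
    split; last exact: le_trans b1.
    by rewrite pair_norm_le /= !ger0_norm ?subr_ge0 //; apply/andP; split; apply: le_trans sr; rewrite lerBlDl.
  by have [h1 h2 h3 h4] := Hb y By; split => //; [exact: Hs|exact: le_trans nr1].
have [G hG] := choice step.
(* Each new square is sought below half the inner radius of the previous one, which makes the
   squares disjoint. *)
pose rr := fix rr n := if n is n'.+1 then (G (rr n')).1.1.1 / 2 else (1 : R).
have rr0 n : 0 < rr n by elim: n => [//|n IH] /=; apply: divr_gt0 => //; have [] := hG _ IH.
have rrS n : rr n.+1 = (G (rr n)).1.1.1 / 2 by [].
have gd n := hG _ (rr0 n).
have tr n : (G (rr n)).1.1.1 <= rr n.
  have [_ s0 _ _ /(_ (G (rr n)).1.1.2)[]] := gd n; last by move=> _ _; exact: le_trans.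
  by split; rewrite lexx lerDl ltW.
have rrm i j : (i <= j)%N -> rr j <= rr i.
  elim: j => [|j IH]; first by rewrite leqn0 => /eqP ->.
  rewrite leq_eqVlt => /orP[/eqP -> //|]; rewrite ltnS => /IH; apply: le_trans.
  by rewrite rrS; have := tr j; have := rr0 j; move: (rr j) (_.1.1.1) => a b; lra.
have disj i j y : sq (G (rr i)) y -> sq (G (rr j)) y -> i = j.
  have asym a b : (a < b)%N -> sq (G (rr a)) y -> sq (G (rr b)) y -> False.
    move=> ab sa sb; have [t0 _ _ _ /(_ y sa)[_ _ h1 _]] := gd a.
    have [_ _ _ _ /(_ y sb)[_ _ _ h2]] := gd b.
    have := rrm _ _ ab; rewrite rrS; move: h1 h2 t0; move: (`|y|) (rr b) (_.1.1.1) => ? ? ?; lra.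
  by move=> si sj; case: (ltngtP i j) => // lt; exfalso; [exact: asym lt si sj|exact: asym lt sj si].
have sqE X : sq X = `[X.1.1.2.1, X.1.1.2.1 + X.1.2]%classic `*` `[X.1.1.2.2, X.1.1.2.2 + X.1.2]%classic.
  by rewrite predeqE => y; rewrite /sq /= !in_itv.
have msq X : measurable (sq X) by rewrite sqE; apply: measurableX; exact: measurable_itv.
have meas X : 0 < X.1.2 -> (lebesgue_measure \x lebesgue_measure)%E (sq X) = (X.1.2 ^+ 2)%:E.
  move=> s0; rewrite sqE.
  have L (a s : R) : 0 < s -> lebesgue_measure (`[a, a + s]%classic : set R) = s%:E.
    by move=> sp; rewrite lebesgue_measure_itv /= lte_fin ltrDl sp -EFinB addrAC subrr add0r.
  pose IA : set R := `[X.1.1.2.1, X.1.1.2.1 + X.1.2]%classic.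
  pose IB : set R := `[X.1.1.2.2, X.1.1.2.2 + X.1.2]%classic.
  transitivity (lebesgue_measure IA * lebesgue_measure IB)%E.
    by apply: product_measure1E; exact: measurable_itv.
  by rewrite !L // -EFinM expr2.
have lowb n : ((n%:R * ep)%:E <= area g PH f)%E.
  apply: le_trans (@integral_ge_simple _ _ R (lebesgue_measure \x lebesgue_measure)%E PH (fun z => e z)
    n (fun i => sq (G (rr i))) (fun i => (G (rr i)).2) _ _ _ _ _ disj).
  - elim: n => [|n IH]; first by rewrite big_ord0 mul0r.
    rewrite big_ord_recr /= -natr1 mulrDl mul1r EFinD; apply: leeD => //.
    by have [_ s0 _ h _] := gd n; rewrite meas // -EFinM lee_fin.
  - by move=> z _; exact: density_ge0.
  - by move=> i; exact: msq.
  - by move=> i; have [] := gd i.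
  - by move=> i y sy; have [_ _ _ _ /(_ y sy)[]] := gd i.
  - by move=> i y sy; have [_ _ _ _ /(_ y sy)[]] := gd i.
have := Ha; have := lowb 0%N; rewrite mul0r; case: (area g PH f) lowb => // a lowb _ _.
have [n hn] : exists n : nat, a / ep < n%:R by exists (Num.truncn (a / ep)).+1; exact: truncnS_gt.
have := lowb n; rewrite lee_fin leNgt; move: hn; rewrite ltr_pdivrMr // => ->.
by [].
Qed.

End NoBubbling.

(** * Trapping the map near a boundary point *)

Section TrapArith.
Variable R : realType.
Implicit Types a b c x y s t r : R.

Lemma trap_arith3 a b x : a < x / 4 -> b <= x / 8 -> 0 < x -> a + b < x / 2.
Proof. by move=> ? ? ?; lra. Qed.
Lemma trap_arith4 a b c : a <= c / 4 -> b <= a + c -> c <= a + b -> 0 < c -> 3 / 4 * c <= b /\ b <= 5 / 4 * c.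
Proof. by move=> ? ? ? ?; split; lra. Qed.
Lemma trap_arith5 s t b : 2 * t <= s -> 3 / 4 * s <= b -> 0 < s -> t <= b.
Proof. by move=> ? ? ?; lra. Qed.
Lemma trap_arith6 s r b : s <= r / 2 -> b <= 5 / 4 * s -> 0 < s -> b <= r.
Proof. by move=> ? ? ?; lra. Qed.
Lemma trap_arith7 s b : b <= 5 / 4 * s -> 0 < s -> b <= 2 * s.
Proof. by move=> ? ?; lra. Qed.
Lemma trap_arith8 s b : 3 / 4 * s <= b -> 0 < s -> s <= 2 * b.
Proof. by move=> ? ?; lra. Qed.

Lemma between_abs (x a b s : R) : `|a| <= s -> `|b| <= s -> (a <= x <= b) || (b <= x <= a) -> `|x| <= s.
Proof. by rewrite !ler_norml => /andP[? ?] /andP[? ?] /orP[] /andP[? ?]; apply/andP; split; lra. Qed.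
Lemma trap_arith9 a b x : a < x / 2 -> b <= x / 32 -> 0 < x -> a + b < x.
Proof. by move=> ? ? ?; lra. Qed.
Lemma trap_arith10 a b c e x : c <= b + a -> a < x / 2 -> b <= x / 32 -> e <= x / 32 -> 0 < x -> c + e < x.
Proof. by move=> ? ? ? ? ?; lra. Qed.
Lemma trap_arith11 a b x : a < x / 8 -> b <= x / 32 -> 0 < x -> a + b < x.
Proof. by move=> ? ? ?; lra. Qed.
Lemma trap_arith12 a b c e x : c <= a + b -> a < x / 8 -> b <= x / 32 -> e <= x / 32 -> 0 < x -> c + e < x.
Proof. by move=> ? ? ? ? ?; lra. Qed.
Lemma trap_arith13 a b c y e x : y <= c + e -> c <= a + b -> a < x / 8 -> b <= x / 32 -> e <= x / 32 -> 0 < x -> y < x / 4.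
Proof. by move=> ? ? ? ? ? ?; lra. Qed.

(** A primitive of the decay rate divided by [s]; its increment between the two radii of an annulus
    is bounded independently of their ratio. *)
Lemma is_derive_ratio (r t B k s : R) : 0 < s -> 0 < k ->
  is_derive s (1 : R) (fun s => B / k * (r * s `^ k + (- t) * s `^ (- k)))
    (B * (r * s `^ (k - 1) + t * s `^ (- k - 1))).
Proof.
move=> s0 k0; pose H := [set z : R * R | 0 <= z.2].
have oH : hopen H by move=> z z0; split; [exact: z0|apply: filterE => w w0; exact: w0].
have oU := hopen_upper oH.
have sn := @smD_snd R (upper H).
have pos (z : R * R) : upper H z -> 0 < z.2 by case.
have s1 := smD_powR k sn pos; have s2 := smD_powR (- k) sn pos.
have c1 := smDM (@smD_cst _ _ (upper H) r) s1.
have c2 := smDM (@smD_cst _ _ (upper H) (- t)) s2.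
have c3 := smDM (@smD_cst _ _ (upper H) (B / k)) (smDD c1 c2).
have Us : upper H (0, s) by split => //=; rewrite /H /= ltW.
have := is_derive_y oU c3 Us s0 => D; apply: (is_derive_eq D).
rewrite (dyM oU (@smD_cst _ _ _ _) (smDD c1 c2) Us) (dyD oU c1 c2 Us).
rewrite (dyM oU (@smD_cst _ _ _ _) s1 Us) (dyM oU (@smD_cst _ _ _ _) s2 Us).
rewrite !(dy_cst _ oU Us) (dy_powR k oU sn pos Us) (dy_powR (- k) oU sn pos Us) (dy_snd oU Us) /=.
by move: (s `^ (k - 1)) (s `^ (- k - 1)) => x y; field; rewrite gt_eqF.
Qed.

End TrapArith.

Section Trap.
Variables (R : realType) (M : topologicalType) (m : nat) (S : smooth_manifold R M m).
Variables (J : almost_complex S) (g : riemannian_metric S) (W : set M) (f : R * R -> M).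
Local Notation PH := (@punctured_half_disc R).
Hypothesis Hf : smooth_in S PH f.
Hypothesis HJ : J_holomorphic J PH f.
Hypothesis HfW : f @` (@punctured_half_disc_boundary R) `<=` W.
Hypothesis Wc : closed W.
Hypothesis Hc : relatively_compact (f @` PH).
Local Notation e := (area_density g PH f).
Local Notation se := (fun z => Num.sqrt (area_density g PH f z)).
Hypothesis nb : forall de : R, 0 < de -> exists2 r, 0 < r & forall z, PH z -> `|z| <= r -> `|z| * se z <= de.

Lemma pbox_PH (r : R) z : r <= 1 / 4 -> pbox r z -> PH z.
Proof.
move=> r4 [/andP[z0 zr] z2]; split; last by move=> e0; move: z0; rewrite e0 normr0 ltxx.
split => //; have [_] := andP (sq2_norm z); rewrite /sq2 -!expr2 => h; apply: le_lt_trans h _.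
have zb : `|z| <= 1 / 4 by exact: le_trans r4.
have : `|z| ^+ 2 <= (1 / 4) ^+ 2 by rewrite ler_sqr ?nnegrE ?normr_ge0 //; lra.
by move: (`|z| ^+ 2) => y; lra.
Qed.

Lemma norm_xaxis (s : R) : 0 < s -> `|(s, 0) : R * R| = s.
Proof. by move=> s0; rewrite prod_normE /= normr0 gtr0_norm // max_l // ltW. Qed.

(** Compactness yields only a cluster point along the axis, in [W] since [W] is closed; that the
    whole map converges to it is the content of [trap]. *)
Lemma boundary_limit_point : exists2 p, W p &
  forall V, nbhs p V -> forall r : R, 0 < r -> exists2 s, 0 < s <= r & V (f (s, 0)).
Proof.
pose a (n : nat) : R := n.+4%:R^-1.
have a0 n : 0 < a n by rewrite invr_gt0.
have a4 n : a n <= 1 / 4 by rewrite mul1r lef_pV2 ?posrE // ler_nat.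
have pa n : PH (a n, 0).
  by apply: (pbox_PH (r := a n)) => //; split => //=; rewrite norm_xaxis // a0 lexx.
pose x n := f (a n, 0).
have FF : ProperFilter (x @ \oo) by exact: fmap_proper_filter.
have xC : (x @ \oo) (closure (f @` PH)).
  by exists 0%N => // n _ /=; apply: subset_closure; exists (a n, 0).
have [p [_ cp]] := Hc FF xC.
have Wx n : W (x n) by apply: HfW; exists (a n, 0) => //; exact: boundary_punctured.
exists p.
  apply: Wc => V nV; have xW : (x @ \oo) W by exists 0%N => // n _; exact: Wx.
  by have [y [h1 h2]] := cp _ _ xW nV; exists y.
move=> V nV r r0.
have nr : (x @ \oo) [set y | exists2 n : nat, a n <= r & y = x n].
  have [n0 _ Hn] := near_infty_natSinv_lt (PosNum r0).
  exists n0 => // n /Hn /= lt; exists n => //; apply: ltW; apply: le_lt_trans lt.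
  rewrite /a lef_pV2 ?posrE ?ltr0n // ler_nat; exact: (leq_addl 3 n.+1).
have [_ [[n nr1 ->] Vn]] := cp _ _ nr nV.
by exists (a n) => //; rewrite a0.
Qed.

Variables (p : M) (c : chart R M m) (I : pred 'I_m) (Om : set 'rV[R]_m).
Variables (E A : 'rV[R]_m -> 'M[R]_m) (phi : 'rV[R]_m -> 'rV[R]_m).
Hypothesis LM : local_model S W f p c I Om E A phi.
Hypothesis Wp : W p.
Hypothesis plim : forall V, nbhs p V -> forall r : R, 0 < r -> exists2 s, 0 < s <= r & V (f (s, 0)).
Local Notation q := (c p).
Local Notation w := (fun z => phi (c (f z))).
Local Notation P := (projI R I).

(* On an annulus mapped into the chart, the imaginary part decays towards both ends,
   so the variation along a ray is bounded by the supremum of |z||df|, whatever the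
   modulus of the annulus. *)
Lemma annulus_variation : exists d C : R, [/\ 0 < d, 0 < C & forall eta r0 t dm : R,
  0 < eta -> eta <= d -> 0 < t -> t <= r0 -> dm <= d ->
  (forall z, Ann t r0 z -> dball f p c dm z /\ `|z| * se z <= eta) ->
  `|c (f (0, r0)) - c (f (0, t))| <= C * eta].
Proof.
have [d [C [d0 C1 dOm mb]]] := model_bounds g Hf HJ LM.
have [Sc dp oO Op OmS sE sA sphi Aq Aqs Hsys HW] := LM.
have C0 : 0 < C by apply: lt_le_trans C1.
have [dG [CG [dG0 CG0 G2]]] := gradient_bound_im Op oO sE sA Aq Aqs.
have [d3 d30 h3] : exists2 d3, 0 < d3 & forall x, `|x - q| < d3 -> `|phi x - phi q| <= dG.
  have cphi : Cn_on 0 Om phi by exact: sphi.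
  have /cvgrPdist_lt /(_ dG dG0) /near_norm_ex[d3 d30 H] := cphi q Op.
  by exists d3 => // x /H xd; rewrite distrC ltW.
pose k : R := 3 / 4.
have k0 : 0 < k by rewrite divr_gt0.
have k1 : k < 1 by rewrite /k ltr_pdivrMr // mul1r ltr_nat.
have kk : 0 <= k <= 1 by rewrite !ltW.
(* For [eta] below [3 / 256 / den] the coefficient in the linear inequality for [lapl b] is at most
   [3 / 256], the threshold of [decay_annulus] for [k = 3 / 4]. *)
pose den := 4 * C * CG * C + 1.
have den0 : 0 < den by rewrite ltr_wpDl // !mulr_ge0 // ltW.
have e2560 : 0 < 3 / 256 :> R by rewrite divr_gt0 ?ltr0n.
pose dd := Num.min (Num.min d dG) (Num.min d3 (3 / 256 / den)).
have dd0 : 0 < dd by rewrite !lt_min d0 dG0 d30 /=; exact: divr_gt0.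
have [dd1 dd2 dd3 dd4] : [/\ dd <= d, dd <= dG, dd <= d3 & dd <= 3 / 256 / den].
  by rewrite /dd !ge_min !lexx ?orbT.
(* [128 = 4 * 4 * 4 * 2] collects the gradient estimate on squares of size [|z| / 4], the decay
   constant, [Mb], and the comparison on the square; [2 C] covers the collars, where only the rough
   bound is available. *)
pose B0 := C * (128 * C * CG + 2 * C).
have B00 : 0 < B0.
  by rewrite mulr_gt0 // ltr_wpDl ?mulr_gt0 // !mulr_ge0 ?ler0n // ltW.
exists dd, (B0 / k * 2); split => //; first by apply: mulr_gt0 => //; apply: divr_gt0.
move=> eta r0 t dm eta0 etad t0 tr dmd HA; have dmd1 := le_trans dmd dd1.
have [Sy mbd] := mb dm dmd1; have r00 : 0 < r0 by exact: lt_le_trans tr.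
have oD := sys_hopen Sy; have sw := sys_w Sy.
have AD : Ann t r0 `<=` dball f p c dm by move=> z /HA[].
have An0 z : Ann t r0 z -> 0 < `|z| by move=> [/andP[h _] _]; exact: lt_le_trans h.
have sez z : Ann t r0 z -> se z <= eta / `|z|.
  by move=> Az; have [_ h] := HA z Az; rewrite ler_pdivlMr ?An0 // mulrC.
pose b z := w z *m P; have sb : smD (dball f p c dm) b := smD_proj I sw.
have bG z : dball f p c dm z -> `|b z| <= dG.
  move=> [_ [_ zq]]; have -> : b z = (w z - phi q) *m P.
    apply/matrixP => i j; rewrite /b !projIE !mxE (ord1 i); case: ifP => // Ij.
    by rewrite (HW Wp j Ij) subr0.
  apply: le_trans (projI_le _ _) _; apply: h3.
  exact: lt_le_trans zq (le_trans dmd dd3).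
have wx z : Ann t r0 z -> `|dx w z| <= C * eta / `|z|.
  move=> Az; apply: le_trans (mb_wx (mbd z (AD z Az))) _; rewrite -mulrA ler_wpM2l ?(ltW C0) //.
  exact: sez.
have wy z : Ann t r0 z -> `|dy w z| <= C * eta / `|z|.
  move=> Az; apply: le_trans (mb_wy (mbd z (AD z Az))) _; rewrite -mulrA ler_wpM2l ?(ltW C0) //.
  exact: sez.
have near2 z s : Ann t r0 z -> 2 * t <= `|z| -> `|z| <= r0 / 2 -> box z (`|z| / 4) s ->
    [/\ Ann t r0 s, `|s| <= 2 * `|z| & `|z| <= 2 * `|s|].
  move=> Az z2 zr [sz s0]; have n0 := An0 z Az.
  have l1 : `|s| <= `|s - z| + `|z| by rewrite -{1}(subrK z s) ler_normD.
  have l2 : `|z| <= `|s - z| + `|s| by rewrite distrC -{1}(subrK s z) ler_normD.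
  have [h1 h2] := trap_arith4 sz l1 l2 n0.
  split; [|exact: trap_arith7 h2 n0|exact: trap_arith8 h1 n0].
  by split => //; rewrite (trap_arith5 z2 h1 n0) (trap_arith6 zr h2 n0).
have GB z (beta : R) : Ann t r0 z -> 2 * t <= `|z| -> `|z| <= r0 / 2 ->
    (forall s, box z (`|z| / 4) s -> `|b s| <= beta) -> `|dx w z| <= 4 * CG * beta / `|z|.
  move=> Az z2 zr hbt; have n0 := An0 z Az.
  apply: (@le_trans _ _ (CG * Num.min beta dG / (`|z| / 4))).
    apply: (G2 _ _ _ z _ _ Sy) => //; [by rewrite divr_gt0|exact: Az.2| | |].
    - by move=> s /(near2 z s Az z2 zr)[As _ _]; exact: AD.
    - by rewrite ge_min lexx orbT.
    - move=> s Bs; have [As _ _] := near2 z s Az z2 zr Bs; have [_ [_ sq]] := AD s As.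
      split; first exact: lt_le_trans sq (le_trans dmd dd2).
      by rewrite le_min hbt //=; apply: bG; exact: AD.
  have -> : CG * Num.min beta dG / (`|z| / 4) = 4 * CG * Num.min beta dG / `|z|.
    by move: (Num.min _ _) => x; field; rewrite gt_eqF.
  rewrite ler_pM2r ?invr_gt0 // ler_wpM2l ?mulr_ge0 //.
  by rewrite ge_min lexx.
pose Mb := 4 * (C * eta).
have Ce0 : 0 < C * eta by rewrite mulr_gt0.
have hb1 z : Ann t r0 z -> z.2 <= `|z.1| -> `|b z| <= C * eta * (z.2 / `|z|).
  move=> Az le; have z20 := Az.2.
  have nz s : 0 <= s <= z.2 -> `|(z.1, s)| = `|z|.
    move=> /andP[s0 sz]; rewrite !prod_normE /= (ger0_norm s0) (ger0_norm z20) !max_l //.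
    exact: le_trans le.
  have As s : 0 <= s <= z.2 -> Ann t r0 (z.1, s).
    by move=> h; split; [rewrite nz //; exact: Az.1|case/andP: h].
  have L : `|b (z.1, z.2) - b (z.1, 0)| <= (C * eta / `|z|) * (z.2 - 0).
    apply: (dy_lip oD sb z20) => s hs; have Dz := AD _ (As s hs); split => //.
    rewrite /b (dy_proj _ oD sw Dz); apply: le_trans (projI_le _ _) _.
    by have := wy _ (As s hs); rewrite nz.
  have b0 : b (z.1, 0) = 0.
    have A0 := As 0 (_ : 0 <= 0 <= z.2); rewrite lexx z20 in A0.
    apply/matrixP => i j; rewrite /b projIE !mxE (ord1 i); case: ifP => // Ij.
    by apply: (sys_bd Sy) => //; exact: AD (A0 isT).
  by rewrite b0 !subr0 -surjective_pairing in L; rewrite mulrA mulrAC.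
have hb z : Ann t r0 z -> `|b z| <= Mb * (z.2 / `|z|).
  move=> Az; have z20 := Az.2; have n0 := An0 z Az.
  have [le|gt] := leP z.2 `|z.1|.
    apply: le_trans (hb1 z Az le) _; rewrite ler_wpM2r ?divr_ge0 // /Mb ler_peMl ?(ltW Ce0) //.
    by rewrite ler1n.
  have zE : `|z| = z.2 by rewrite prod_normE /= (ger0_norm z20) max_r // ltW.
  have z1 : z.1 <= z.2 by apply: le_trans (ler_norm _) (ltW gt).
  have z1' : - z.2 <= z.1 by have := ltW gt; rewrite ler_norml => /andP[].
  have nx x : z.1 <= x <= z.2 -> `|(x, z.2)| = z.2.
    move=> /andP[a1 a2]; rewrite prod_normE /= (ger0_norm z20) max_r // ler_norml a2.
    by rewrite (le_trans z1').
  have Ax x : z.1 <= x <= z.2 -> Ann t r0 (x, z.2).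
    by move=> h; split => //; rewrite nx // -zE; exact: Az.1.
  (* Above the diagonals a point is joined horizontally, at constant norm, to the diagonal, where
     the previous bound holds. *)
  have L : `|b (z.2, z.2) - b (z.1, z.2)| <= (C * eta / z.2) * (z.2 - z.1).
    apply: (dx_lip oD sb z1) => s hs; have Dz := AD _ (Ax s hs); split => //.
    rewrite /b (dx_proj _ oD sw Dz); apply: le_trans (projI_le _ _) _.
    by have := wx _ (Ax s hs); rewrite nx.
  have c2 : z.1 <= z.2 <= z.2 by rewrite z1 lexx.
  have z2p : 0 < z.2 by rewrite -zE.
  have L2 : `|b (z.2, z.2)| <= C * eta * (z.2 / z.2).
    by have := hb1 _ (Ax _ c2); rewrite (nx _ c2) /=; apply; exact: ler_norm.
  rewrite zE divff ?gt_eqF // mulr1 in L2 *; rewrite mulr1.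
  have L3 : (C * eta / z.2) * (z.2 - z.1) <= C * eta * 2.
    rewrite -mulrA ler_wpM2l ?(ltW Ce0) // mulrC ler_pdivrMr // mulr_natl mulr2n lerD2l.
    by rewrite lerNl.
  have -> : b z = b (z.2, z.2) - (b (z.2, z.2) - b (z.1, z.2)) by rewrite subKr -surjective_pairing.
  apply: le_trans (ler_normB _ _) _; apply: le_trans (lerD L2 (le_trans L L3)) _.
  by rewrite /Mb (_ : C * eta + C * eta * 2 = 3 * (C * eta)) ?ler_pM2r ?ler_nat //; ring.
have decay z : Ann t r0 z -> `|b z| <= 4 * Mb * ((`|z| / r0) `^ k + (t / `|z|) `^ k).
  have Mb0 : 0 < Mb by rewrite mulr_gt0.
  have e0 : 0 <= 3 / 256 :> R by exact: ltW.
  have e1 : 3 / 256 <= k * (1 - k) / 16.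
    by rewrite /k le_eqVlt; apply/orP; left; apply/eqP; field.
  move=> Az.
  suff hs : forall s, Ann t r0 s -> 2 * t <= `|s| -> `|s| <= r0 / 2 ->
    forall sigma, (forall x, box s (`|s| / 4) x -> `|b x| <= sigma) ->
    `|lapl b s| <= 3 / 256 / `|s| ^+ 2 * (sigma + 0 * `|s| `^ k).
    have k01 : 0 < k < 1 by rewrite k0.
    have := @decay_annulus R _ m b t r0 Mb 0 (3 / 256) k oD sb t0 r00 AD Mb0 (lexx 0) k01 hb e0 e1 hs z Az.
    by rewrite mul0r addr0.
  move=> s As s2 sr sigma hsg; have n0 := An0 s As; rewrite mul0r addr0.
  have g1 := GB s sigma As s2 sr hsg; have g2 := wx s As.
  have sg0 : 0 <= sigma.
    by apply: le_trans (normr_ge0 (b s)) _; apply: hsg; apply: box_self; [rewrite divr_ge0|exact: As.2].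
  rewrite /b (lapl_proj _ oD sw (AD s As)); apply: le_trans (projI_le _ _) _.
  apply: le_trans (mb_lapl (mbd s (AD s As))) _.
  (* One gradient factor is bounded through the local supremum of [b], the other through [eta]: a
     linear inequality with a small coefficient. *)
  have g3 : `|dx w s| ^+ 2 <= (4 * CG * sigma / `|s|) * (C * eta / `|s|) by rewrite expr2; apply: ler_pM.
  apply: le_trans (ler_wpM2l (ltW C0) g3) _.
  have -> : C * (4 * CG * sigma / `|s| * (C * eta / `|s|)) = (4 * C * CG * C * eta) * (sigma / `|s| ^+ 2).
    by field; rewrite gt_eqF.
  have -> : 3 / 256 / `|s| ^+ 2 * sigma = 3 / 256 * (sigma / `|s| ^+ 2) by ring.
  rewrite ler_wpM2r ?divr_ge0 ?exprn_ge0 //.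
  apply: (mul_min_le _ (ltW eta0) e2560); first by rewrite !mulr_ge0 ?(ltW C0).
  exact: le_trans etad dd4.
pose th (s : R) := (s / r0) `^ k + (t / s) `^ k.
have grad s : t <= s <= r0 -> `|dx w (0, s)| <= (128 * C * CG + 2 * C) * eta * th s / s.
  move=> /andP[ts sr]; have s0 : 0 < s by exact: lt_le_trans ts.
  have nE : `|(0, s) : R * R| = s by rewrite prod_normE /= normr0 (gtr0_norm s0) max_r // ltW.
  have As : Ann t r0 (0, s) by split; [rewrite nE ts|exact: ltW].
  have th0 : 0 <= th s by rewrite addr_ge0 ?powR_ge0.
  have [CGn Cn] : 0 <= 128 * C * CG /\ 0 <= 2 * C by rewrite !mulr_ge0 ?ler0n ?(ltW C0).
  have rough : 1 <= 2 * th s -> `|dx w (0, s)| <= (128 * C * CG + 2 * C) * eta * th s / s.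
    move=> h; apply: le_trans (wx _ As) _; rewrite nE ler_pM2r ?invr_gt0 //.
    apply: (@le_trans _ _ (C * eta * (2 * th s))); first by rewrite ler_peMr // ltW.
    have -> : C * eta * (2 * th s) = 2 * C * (eta * th s) by ring.
    by rewrite -[leRHS]mulrA ler_wpM2r ?mulr_ge0 ?(ltW eta0) // lerDr.
  have one (x : R) : 0 <= x -> 1 <= 2 * x -> 1 <= 2 * x `^ k.
    by move=> x0 x1; have := powR_dbl kk ler01 x1 x0; rewrite powR1.
  have [s2|s2] := leP (2 * t) s; last first.
    apply: rough; have ts0 : 0 <= t / s by rewrite divr_ge0 // ltW.
    apply: le_trans (one _ ts0 _) _; first by rewrite mulrA ler_pdivlMr // mul1r ltW.
    by rewrite ler_pM2l // /th lerDr powR_ge0.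
  have [sr2|sr2] := leP s (r0 / 2); last first.
    apply: rough; have rs0 : 0 <= s / r0 by rewrite divr_ge0 // ltW.
    apply: le_trans (one _ rs0 _) _.
      by rewrite mulrA ler_pdivlMr // mul1r mulrC -ler_pdivrMr // ltW.
    by rewrite ler_pM2l // /th lerDl powR_ge0.
  have g1 : `|dx w (0, s)| <= 4 * CG * (4 * Mb * (2 * th s)) / `|(0, s) : R * R|.
    apply: GB => //; rewrite ?nE // => y By.
    have [Ay y1 y2] : [/\ Ann t r0 y, `|y| <= 2 * s & s <= 2 * `|y|].
      by have := near2 (0, s) y As; rewrite nE; apply.
    have y0 := An0 y Ay.
    have Mb0 : 0 <= 4 * Mb by apply: mulr_ge0 => //; apply: mulr_ge0 => //; exact: ltW.
    apply: le_trans (decay y Ay) _; apply: (ler_wpM2l Mb0); rewrite /th mulrDr.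
    have p0 (x z : R) : 0 <= x -> 0 < z -> 0 <= x / z by move=> x0 zp; apply: divr_ge0 => //; exact: ltW.
    have q1 : `|y| / r0 <= 2 * (s / r0) by rewrite mulrA ler_pM2r ?invr_gt0.
    have q2 : t / `|y| <= 2 * (t / s).
      rewrite ler_pdivrMr // (_ : 2 * (t / s) * `|y| = t * (2 * `|y| / s)); last by field; rewrite gt_eqF.
      by rewrite ler_peMr ?(ltW t0) // ler_pdivlMr // mul1r.
    exact: (lerD (powR_dbl kk (p0 _ _ (normr_ge0 y) r00) q1 (p0 _ _ (ltW s0) r00))
      (powR_dbl kk (p0 _ _ (ltW t0) y0) q2 (p0 _ _ (ltW t0) s0))).
  rewrite nE in g1; apply: le_trans g1 _; rewrite ler_pM2r ?invr_gt0 //.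
  have -> : 4 * CG * (4 * Mb * (2 * th s)) = 128 * C * CG * (eta * th s) by rewrite /Mb; ring.
  by rewrite -[leRHS]mulrA ler_wpM2r ?mulr_ge0 ?(ltW eta0) // lerDl.
have su := sys_u Sy.
have D0 s : t <= s <= r0 -> dball f p c dm (0, s).
  move=> /andP[h1 h2]; have s0 : 0 < s by exact: lt_le_trans h1.
  by apply: AD; split; [rewrite prod_normE /= normr0 (gtr0_norm s0) max_r ?(ltW s0) ?h1|exact: ltW].
pose gg (s : R) : R := B0 * eta / k * ((r0 `^ (- k)) * s `^ k + (- (t `^ k)) * s `^ (- k)).
pose gg' (s : R) : R := B0 * eta * ((r0 `^ (- k)) * s `^ (k - 1) + (t `^ k) * s `^ (- k - 1)).
have dgg (s : R) : 0 < s -> is_derive s (1 : R) gg (gg' s) by move=> s0; exact: is_derive_ratio.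
have ggE (s : R) : 0 < s -> gg' s = B0 * eta * (th s / s).
  move=> s0; have e1 := powR_shift k s0; have e2 := powR_shift (- k) s0.
  rewrite /gg' /th powRM ?invr_ge0 ?(ltW s0) ?(ltW r00) // powRM ?invr_ge0 ?(ltW s0) ?(ltW t0) //.
  rewrite !powRVk // -e1 -e2; move: (s `^ (k - 1)) (s `^ (- k - 1)) (r0 `^ (- k)) (t `^ k) => x y a a'.
  by congr (_ * _); field; rewrite gt_eqF.
apply: mx_norm_le.
  apply: mulr_ge0; last exact: ltW.
  by apply: mulr_ge0 => //; apply: ltW; apply: divr_gt0.
move=> i j; rewrite !mxE (ord1 i); pose ui (z : R * R) := c (f z) 0 j.
have sui : smD (dball f p c dm) ui := smD_coord 0 j su.
have fin : `|ui (0, r0) - ui (0, t)| <= gg r0 - gg t.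
  apply: (@path_le R (fun s => ui (0, s)) gg (fun s => dy ui (0, s)) gg' t r0 tr).
  - move=> s /andP[h1 h2]; have s0 : 0 < s by exact: lt_trans h1.
    have hs : t <= s <= r0 by rewrite !ltW.
    split; [exact: (is_derive_y oD sui (D0 s hs) s0)|exact: dgg|].
    rewrite (dy_coord 0 j oD su (D0 s hs)) ggE //; apply: le_trans (mx_norm_coord _ _ _) _.
    apply: le_trans (mb_uyx (mbd _ (D0 s hs))) _.
    apply: le_trans (ler_wpM2l (ltW C0) (grad s hs)) _.
    by rewrite le_eqVlt; apply/orP; left; apply/eqP; rewrite /B0; move: (th s) => x; ring.
  - by apply: (cont_within_y oD sui) => s hs; exact: D0.
  - apply: derivable_within_continuous => s; rewrite in_itv /= => /andP[h1 _].
    by have [] := dgg s (lt_le_trans t0 h1).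
apply: le_trans fin _; rewrite /gg -mulrBr.
have -> : B0 / k * 2 * eta = B0 * eta / k * 2 by ring.
have Bk : 0 <= B0 * eta / k by apply: divr_ge0; [apply: mulr_ge0; exact: ltW|exact: ltW].
apply: (ler_wpM2l Bk).
(* Up to its constant factor the increment of [gg] is [2 - 2 (t / r0)^k], hence at most 2 for every
   [t]. *)
have r1 : r0 `^ (- k) * r0 `^ k = 1 by rewrite powRN mulVf // gt_eqF // powR_gt0.
have t1 : t `^ k * t `^ (- k) = 1 by rewrite powRN mulfV // gt_eqF // powR_gt0.
have n1 : 0 <= t `^ k * r0 `^ (- k) by rewrite mulr_ge0 ?powR_ge0.
have n2 : 0 <= r0 `^ (- k) * t `^ k by rewrite mulr_ge0 ?powR_ge0.
rewrite !mulNr r1 t1; move: (t `^ k * _) (r0 `^ (- k) * _) n1 n2 => x y x0 y0; lra.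
Qed.

(** * Trapping scale by scale *)

Section Sphere.
Variables (dm C eta r0 : R).
Hypothesis hM : hausdorff_space M.
Hypothesis C0 : 0 <= C.
Hypothesis eta0 : 0 <= eta.
Hypothesis dm0 : 0 < dm.
Hypothesis Ce : C * eta <= dm / 32.
Hypothesis dOm : forall x, `|x - q| < dm -> Om x.
Hypothesis dB : forall z, dball f p c dm z -> mbounds g f c phi C z.
Hypothesis HB : forall z, pbox r0 z -> PH z /\ `|z| * se z <= eta.

Lemma short_x sig x0 x1 y : 0 < sig <= r0 -> 0 <= y ->
  (forall x, (x0 <= x <= x1) || (x1 <= x <= x0) -> `|(x, y) : R * R| = sig) ->
  `|x1 - x0| <= sig -> dom c (f (x0, y)) -> `|c (f (x0, y)) - q| + C * eta < dm ->
  inball f p c dm (x1, y) /\ `|c (f (x1, y)) - c (f (x0, y))| <= C * eta.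
Proof.
move=> /andP[s0 sr] y0 nx xs dx lt.
have La0 : 0 <= eta / sig by apply: divr_ge0 => //; exact: ltW.
have L : C * (eta / sig) * `|x1 - x0| <= C * eta.
  by rewrite -mulrA ler_wpM2l // mulrAC ler_pdivrMr // ler_wpM2l.
have H x : (x0 <= x <= x1) || (x1 <= x <= x0) -> PH (x, y) /\ se (x, y) <= eta / sig.
  move=> /nx nE; have pb : pbox r0 (x, y) by split; [rewrite nE s0 sr|exact: y0].
  have [P1 P2] := HB pb; split; first exact: P1.
  by rewrite ler_pdivlMr // mulrC; move: P2; rewrite nE.
have lt' : `|c (f (x0, y)) - q| + C * (eta / sig) * `|x1 - x0| < dm.
  by apply: le_lt_trans lt; rewrite lerD2l.
have [h1 h2] := move_x Hf LM hM C0 La0 dOm dB H dx lt'.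
by split; [exact: h1|exact: le_trans h2 L].
Qed.

Lemma short_y sig x0 x1 y : 0 < sig <= r0 ->
  (forall x, (x0 <= x <= x1) || (x1 <= x <= x0) -> 0 <= x /\ `|(y, x) : R * R| = sig) ->
  `|x1 - x0| <= sig -> dom c (f (y, x0)) -> `|c (f (y, x0)) - q| + C * eta < dm ->
  inball f p c dm (y, x1) /\ `|c (f (y, x1)) - c (f (y, x0))| <= C * eta.
Proof.
move=> /andP[s0 sr] nx xs dx lt.
have La0 : 0 <= eta / sig by apply: divr_ge0 => //; exact: ltW.
have L : C * (eta / sig) * `|x1 - x0| <= C * eta.
  by rewrite -mulrA ler_wpM2l // mulrAC ler_pdivrMr // ler_wpM2l.
have H x : (x0 <= x <= x1) || (x1 <= x <= x0) -> PH (y, x) /\ se (y, x) <= eta / sig.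
  move=> /nx[x00 nE]; have pb : pbox r0 (y, x) by split; [rewrite nE s0 sr|exact: x00].
  have [P1 P2] := HB pb; split; first exact: P1.
  by rewrite ler_pdivlMr // mulrC; move: P2; rewrite nE.
have lt' : `|c (f (y, x0)) - q| + C * (eta / sig) * `|x1 - x0| < dm.
  by apply: le_lt_trans lt; rewrite lerD2l.
have [h1 h2] := move_y Hf LM hM C0 La0 dOm dB H dx lt'.
by split; [exact: h1|exact: le_trans h2 L].
Qed.

(** In the maximum norm the set [|z| = sig] in the half plane is made of three segments; each point
    is reached from [(0, sig)] by a horizontal and a vertical piece of length at most [sig], on
    which [se <= eta / sig]. So each piece moves the image by at most [C eta], whatever the
    scale. *)
Lemma sphere_trap sig z : 0 < sig <= r0 -> `|z| = sig -> 0 <= z.2 ->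
  dom c (f (0, sig)) -> `|c (f (0, sig)) - q| < dm / 2 -> dball f p c dm z.
Proof.
move=> sr nz z2 d0 lt; have /andP[s0 sr0] := sr.
have zE := nz; rewrite prod_normE /= (ger0_norm z2) in zE.
have z1s : `|z.1| <= sig by rewrite -zE le_max lexx.
have z2s : z.2 <= sig by rewrite -zE le_max lexx orbT.
have s0' := ltW s0.
have Pz : PH z by have [] := HB (z := z) (conj (_ : 0 < `|z| <= r0) z2); rewrite nz.
have nx x : (0 <= x <= z.1) || (z.1 <= x <= 0) -> `|(x, sig) : R * R| = sig.
  move=> hx; have xs : `|x| <= sig by apply: (between_abs _ z1s hx); rewrite normr0.
  by rewrite prod_normE /= (ger0_norm s0') max_r.
have m1 : `|z.1 - 0| <= sig by rewrite subr0.
have lt1 : `|c (f (0, sig)) - q| + C * eta < dm by exact: trap_arith9 lt Ce dm0.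
have [[d1 _] v1] := short_x sr s0' nx m1 d0 lt1.
have lt2 : `|c (f (z.1, sig)) - q| + C * eta < dm.
  apply: (trap_arith10 (a := `|c (f (0, sig)) - q|) (b := `|c (f (z.1, sig)) - c (f (0, sig))|) _ lt (le_trans v1 Ce) Ce dm0).
  by rewrite -{1}(subrK (c (f (0, sig))) (c (f (z.1, sig)))) -addrA; apply: ler_normD.
have ny x : (sig <= x <= z.2) || (z.2 <= x <= sig) -> 0 <= x /\ `|(z.1, x) : R * R| = sig.
  move=> hx; have /andP[x1 x2] : z.2 <= x <= sig.
    case/orP: hx => // /andP[h1 h2]; have e1 : z.2 = sig by apply/le_anti; rewrite z2s (le_trans h1).
    by rewrite e1 in h2 *; rewrite h1 h2.
  have x0 := le_trans z2 x1; split => //; rewrite prod_normE /= (ger0_norm x0).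
  apply/le_anti; rewrite ge_max z1s x2 /= -zE ge_max le_max lexx /= le_max x1 orbT //.
have m2 : `|z.2 - sig| <= sig by rewrite distrC ger0_norm ?subr_ge0 // gerBl.
have [i _] := short_y sr ny m2 d1 lt2.
by split; [exact: Pz|rewrite [z]surjective_pairing].
Qed.

Variable K : R.
Hypothesis K0 : 0 <= K.
Hypothesis Ke : K * eta <= dm / 8.
Hypothesis r00 : 0 < r0.
Hypothesis AV : forall t, 0 < t -> t <= r0 ->
  (forall z, Ann t r0 z -> dball f p c dm z /\ `|z| * se z <= eta) ->
  `|c (f (0, r0)) - c (f (0, t))| <= K * eta.
Hypothesis start : dom c (f (r0, 0)) /\ `|c (f (r0, 0)) - q| < dm / 8.

(** The path climbs from [(r0, 0)] to the corner [(r0, r0)] and follows the top side to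
    [(0, r0)]. *)
Lemma corner_trap : dom c (f (0, r0)) /\ `|c (f (0, r0)) - q| < dm / 4.
Proof.
have [d0 lt0] := start.
have rr : 0 < r0 <= r0 by rewrite r00 lexx.
have r0w := ltW r00.
have ny x : (0 <= x <= r0) || (r0 <= x <= 0) -> 0 <= x /\ `|(r0, x) : R * R| = r0.
  move=> hx; have /andP[x0 x1] : 0 <= x <= r0 by case/orP: hx => // /andP[h1 h2]; lra.
  by split => //; rewrite prod_normE /= !ger0_norm // max_l.
have m1 : `|r0 - 0| <= r0 by rewrite subr0 ger0_norm.
have lt1 : `|c (f (r0, 0)) - q| + C * eta < dm by exact: trap_arith11 lt0 Ce dm0.
have [[d1 _] v1] := short_y rr ny m1 d0 lt1.
have tri (x y : 'rV[R]_m) : `|x - q| <= `|y - q| + `|x - y|.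
  by rewrite -{1}(subrK y x) -addrA addrC; apply: ler_normD.
have lt2 : `|c (f (r0, r0)) - q| + C * eta < dm.
  exact: (trap_arith12 (tri _ _) lt0 (le_trans v1 Ce) Ce dm0).
have nx x : (r0 <= x <= 0) || (0 <= x <= r0) -> `|(x, r0) : R * R| = r0.
  move=> hx; have /andP[x0 x1] : 0 <= x <= r0 by case/orP: hx => // /andP[h1 h2]; lra.
  by rewrite prod_normE /= !ger0_norm // max_r.
have m2 : `|0 - r0| <= r0 by rewrite sub0r normrN ger0_norm.
have [[d2 _] v2] := short_x rr r0w nx m2 d1 lt2.
by split => //; exact: (trap_arith13 (tri _ _) (tri _ _) lt0 (le_trans v1 Ce) (le_trans v2 Ce) dm0).
Qed.

(** Continuity argument down the imaginary axis. As long as the axis from height [r0] down is mapped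
    into the ball of radius [dm / 2], [sphere_trap] puts the whole half-annulus into the ball of
    radius [dm], and the variation estimate on the annulus returns a bound strictly below
    [dm / 2]. *)
Lemma axis_trap sig : 0 < sig <= r0 -> dom c (f (0, sig)) /\ `|c (f (0, sig)) - q| < dm / 2.
Proof.
(* The path runs on to [sig / 2], so that its length [l] is positive even for [sig = r0]. *)
move=> /andP[s0 sr]; pose t1 := sig / 2; pose l := r0 - t1.
have t10 : 0 < t1 by rewrite divr_gt0.
have l0 : 0 < l by rewrite /l /t1; lra.
have [dc lc] := corner_trap.
pose ga (t : R) : R * R := (0, r0 - t * l).
have gb t : 0 <= t <= 1 -> 0 < (ga t).2 <= r0.
  by move=> /andP[h0 h1]; rewrite /ga /=; apply/andP; split; rewrite /l in l0 *; nra.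
have nE (s : R) : 0 < s -> `|(0, s) : R * R| = s.
  by move=> sp; rewrite prod_normE /= normr0 gtr0_norm // max_r // ltW.
have gP t : 0 <= t <= 1 -> PH (ga t).
  move=> /gb /andP[h0 h1]; have pb : pbox r0 (ga t) by split; [rewrite nE // h0|exact: ltW].
  by have [] := HB pb.
have gl s t : `|ga s - ga t| <= l * `|s - t|.
  rewrite pair_norm_le /= subrr normr0 mulr_ge0 ?(ltW l0) //=.
  by rewrite (_ : _ - _ = l * (t - s)) ?normrM ?(ger0_norm (ltW l0)) ?[`|t - s|]distrC //; ring.
pose s := `|c (f (0, r0)) - q| + K * eta.
have sd : s < dm / 2 by exact: trap_arith3 lc Ke dm0.
have sub x : `|x - q| <= s -> (c @` dom c) x.
  move=> xs; apply: (lm_sub LM); apply: dOm; apply: le_lt_trans xs _; apply: lt_trans sd _.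
  by rewrite ltr_pdivrMr // ltr_pMr // ltr1n.
have hc t : 0 <= t <= 1 -> forall V : set M, open V -> V (f (ga t)) ->
    exists2 r : R, 0 < r & forall x, 0 <= x <= 1 -> `|x - t| < r -> V (f (ga x)).
  move=> t01 V oV Vt; have [r r_0 H] := map_near Hf (gP t t01) oV Vt.
  exists (r / l); first by rewrite divr_gt0.
  move=> x x01 xt; apply: H; first exact: gP.
  by apply: le_lt_trans (gl x t) _; rewrite mulrC -ltr_pdivlMr.
have g0 : ga 0 = (0, r0) by rewrite /ga mul0r subr0.
have in0 : dom c (f (ga 0)) /\ `|c (f (ga 0)) - q| < dm / 2.
  by rewrite g0; split => //; apply: lt_trans lc _; rewrite ltr_pM2l // ltf_pV2 ?posrE // ltr_nat.
have H2 t : 0 <= t <= 1 -> (forall x, 0 <= x <= t -> dom c (f (ga x)) /\ `|c (f (ga x)) - q| < dm / 2) ->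
    `|c (f (ga t)) - q| <= s.
  move=> t01 Ht; have /andP[g1 g2] := gb t t01; have /andP[t0 t1'] := t01.
  have HA z : Ann (ga t).2 r0 z -> dball f p c dm z /\ `|z| * se z <= eta.
    move=> [/andP[z1 z2] z20]; have z0 : 0 < `|z| by exact: lt_le_trans z1.
    have [P1 P2] := HB (conj (introT andP (conj z0 z2)) z20); split; last exact: P2.
    pose x := (r0 - `|z|) / l.
    have xE : ga x = (0, `|z|) by rewrite /ga /x divfK ?gt_eqF // subKr.
    have xt : 0 <= x <= t.
      apply/andP; split; first by apply: (divr_ge0 _ (ltW l0)); rewrite subr_ge0.
      by rewrite ler_pdivrMr //; move: z1; rewrite /ga /= lerBlDl lerBlDr.
    have [dx lx] := Ht x xt; rewrite xE in dx lx.
    by apply: (sphere_trap (sig := `|z|)) => //; rewrite z0.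
  have := AV g1 g2 HA; rewrite -/(ga t) => v.
  have -> : c (f (ga t)) - q = (c (f (0, r0)) - q) - (c (f (0, r0)) - c (f (ga t))).
    by apply/matrixP => i j; rewrite !mxE; ring.
  by apply: le_trans (ler_normB _ _) _; rewrite /s lerD2l.
have PT := path_trap (h := f \o ga) hM sd sub hc in0 H2.
pose x := (r0 - sig) / l.
have xE : ga x = (0, sig) by rewrite /ga /x divfK ?gt_eqF // subKr.
have x01 : 0 <= x <= 1.
  apply/andP; split; first by apply: (divr_ge0 _ (ltW l0)); rewrite subr_ge0.
  by rewrite ler_pdivrMr // mul1r /l /t1; lra.
have := PT x x01; rewrite /= xE => -[h1 h2].
by split => //; exact: le_lt_trans h2 sd.
Qed.

End Sphere.

Lemma trap (d' : R) : hausdorff_space M -> 0 < d' ->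
  exists2 r : R, 0 < r <= 1 / 4 & forall z, pbox r z -> PH z /\ inball f p c d' z.
Proof.
move=> hM d'0.
have [d1 [C1 [d10 C11 dOm mb]]] := model_bounds g Hf HJ LM.
have [d2 [K [d20 K0 AV]]] := annulus_variation.
have C0 : 0 < C1 by exact: lt_le_trans C11.
pose dm := Num.min d' (Num.min d1 d2).
have dm0 : 0 < dm by rewrite !lt_min d'0 d10.
have [e1 e2 e3] : [/\ dm <= d', dm <= d1 & dm <= d2] by rewrite /dm !ge_min !lexx ?orbT.
pose eta := Num.min d2 (Num.min (dm / 32 / C1) (dm / 8 / K)).
have eta0 : 0 < eta by rewrite !lt_min d20 /= !divr_gt0.
have [f1 f2 f3] : [/\ eta <= d2, C1 * eta <= dm / 32 & K * eta <= dm / 8].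
  split; first by rewrite /eta ge_min lexx.
    by rewrite mulrC -ler_pdivlMr // /eta !ge_min lexx ?orbT.
  by rewrite mulrC -ler_pdivlMr // /eta !ge_min lexx ?orbT.
have [r1 r10 H1] := nb eta0.
have nV : nbhs p (dom c `&` c @^-1` [set y | `|y - c p| < dm / 8]).
  apply: open_nbhs_nbhs; split; last by split; [exact: (lm_dom LM)|rewrite /= subrr normr0 divr_gt0].
  apply: open_chart_preimage.
  rewrite (_ : [set y | `|y - c p| < dm / 8] = (fun y => `|y - c p|) @^-1` [set t | t < dm / 8]) //.
  by apply: open_comp; [move=> y _; exact: dist_continuous|exact: open_lt].
have ra0 : 0 < Num.min r1 (1 / 4) by rewrite lt_min r10 divr_gt0.
(* The cluster point property provides a start [(r0, 0)] whose image is close to [p], at a scale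
   where [|z| se z <= eta] already holds. *)
have [r0 /andP[r00 r0a] start] := plim nV ra0.
have [r01 r04] : r0 <= r1 /\ r0 <= 1 / 4 by move: r0a; rewrite le_min => /andP[].
have HB z : pbox r0 z -> PH z /\ `|z| * se z <= eta.
  move=> pz; have Pz := pbox_PH r04 pz; split; first exact: Pz.
  by apply: (H1 z Pz); have [/andP[_ h] _] := pz; exact: le_trans h r01.
have dOm' x : `|x - q| < dm -> Om x by move=> h; apply: dOm; exact: lt_le_trans h e2.
have [_ dB] := mb dm e2.
have AV' t : 0 < t -> t <= r0 -> (forall z, Ann t r0 z -> dball f p c dm z /\ `|z| * se z <= eta) ->
    `|c (f (0, r0)) - c (f (0, t))| <= K * eta.
  by move=> h1 h2 h3; exact: (AV eta r0 t dm eta0 f1 h1 h2 e3 h3).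
have AT := axis_trap hM (ltW C0) (ltW eta0) dm0 f2 dOm' dB HB f3 r00 AV' start.
exists r0; first by rewrite r00.
move=> z pz; have [/andP[z0 zr] z2] := pz.
have zs : 0 < `|z| <= r0 by rewrite z0.
have [h1 h2] := AT _ zs.
have [Pz [dz lz]] := sphere_trap hM (ltW C0) (ltW eta0) dm0 f2 dOm' dB HB zs erefl z2 h1 h2.
by split; [exact: Pz|split; [exact: dz|exact: lt_le_trans lz e1]].
Qed.

End Trap.

(** * Extension over the puncture *)

Section Assembly.
Variables (R : realType) (M : topologicalType) (m : nat) (S : smooth_manifold R M m).
Variables (J : almost_complex S) (g : riemannian_metric S) (W : set M) (f : R * R -> M).
Local Notation PH := (@punctured_half_disc R).
Hypothesis Hf : smooth_in S PH f.
Hypothesis HJ : J_holomorphic J PH f.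
Variable p : M.

Definition fill (z : R * R) : M := if z == 0 then p else f z.

Lemma fill_punctured z : PH z -> fill z = f z.
Proof. by move=> [_ z0]; rewrite /fill; case: eqP => // e; case: z0; rewrite e. Qed.

Lemma fill_extension z : PH z -> exists h, local_extension S (@half_disc R) fill z h.
Proof.
move=> Pz; have [h [U [oU Uz [ch sh] hf]]] := Hf Pz; have [_ z0] := Pz.
have nz (w : R * R) : 0 < `|w - 0| -> w != 0 by rewrite subr0 normr_gt0.
exists h, (U `&` [set w : R * R | 0 < `|w - 0|]); split.
- apply: openI => //.
  rewrite (_ : [set w : R * R | 0 < `|w - 0|] = (fun w => `|w - 0|) @^-1` [set t | 0 < t]) //.
  by apply: open_comp; [move=> y _; exact: dist_continuous|exact: open_gt].
- by split => //=; rewrite subr0 normr_gt0; apply/eqP.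
- split; first by move=> w [Uw _]; exact: ch.
  by move=> c Sc; apply: smooth_on_sub (sh c Sc) => w [[Uw _] dw].
- move=> w [Uw /= /nz w0] Hw; rewrite fill_punctured; last by split => // e; move: w0; rewrite e eqxx.
  by apply: hf => //; split => // e; move: w0; rewrite e eqxx.
Qed.

Variable s : chart R M m.
Hypothesis Ss : charts S s.
Hypothesis ds : dom s p.

Lemma fill_extension0 (r : R) (h : R * R -> 'rV[R]_m) : 0 < r ->
  smooth_on [set z | `|z| < r] h -> h 0 = s p ->
  (forall z, PH z -> `|z| < r -> dom s (f z) /\ h z = s (f z)) ->
  exists h', local_extension S (@half_disc R) fill 0 h'.
Proof.
move=> r0 sh h0 hf.
have oB : open [set z : R * R | `|z| < r].
  rewrite (_ : [set z : R * R | `|z| < r] = (fun w => `|w - 0|) @^-1` [set t | t < r]).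
    by apply: open_comp; [move=> y _; exact: dist_continuous|exact: open_lt].
  by rewrite predeqE => z /=; rewrite subr0.
have hc z : `|z| < r -> {for z, continuous h} by move=> zr; have := sh 0%N; apply.
pose U := [set z : R * R | `|z| < r] `&` h @^-1` (s @` dom s).
have oU : open U.
  apply: open_comp_in => //; last exact: image_open.
  by move=> x; rewrite inE => hx; exact: hc.
have pc z : U z -> {for z, continuous (param s \o h)}.
  move=> [zr im]; apply: continuous_comp; first exact: hc.
  exact: param_continuous.
exists (param s \o h), U; split => //.
- by split; [rewrite /= normr0|rewrite /= h0; exists p].
- split => // c Sc n.
  have oV : open (U `&` (param s \o h) @^-1` dom c).
    apply: open_comp_in => //; last exact: dom_open.
    by move=> x; rewrite inE => hx; exact: pc.
  have UB z : (U `&` (param s \o h) @^-1` dom c) z -> (s @` (dom s `&` dom c)) (h z).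
    by move=> [[_ [y dy yE]] /=]; rewrite -yE coordK // => dc; exists y.
  have sh' : Cn_on n (U `&` (param s \o h) @^-1` dom c) h by apply: Cn_on_sub (sh n) => z [[]].
  have oI : open (s @` (dom s `&` dom c)) := open_chart_image (dom_open c).
  have st := (charts_compatible Ss Sc).1 n.
  exact: (Cn_on_compmx (F := transition s c) oV oI UB st sh').
- move=> w [wr _] Hw; rewrite /= /fill; case: eqP => [->|w0]; first by rewrite h0 coordK.
  have Pw : PH w by split => // e; apply: w0; rewrite e.
  by have [d1 ->] := hf w Pw wr; rewrite coordK.
Qed.

Variables (I : pred 'I_m) (Om : set 'rV[R]_m).
Variables (E A : 'rV[R]_m -> 'M[R]_m) (phi : 'rV[R]_m -> 'rV[R]_m).
Hypothesis LM : local_model S W f p s I Om E A phi.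
Hypothesis Wp : W p.
Hypothesis tp : forall d : R, 0 < d ->
  exists2 r : R, 0 < r <= 1 / 4 & forall z, pbox r z -> PH z /\ inball f p s d z.

Lemma chart_extension : exists r h, [/\ 0 < r, smooth_on [set z : R * R | `|z| < r] h, h 0 = s p &
  forall z, PH z -> `|z| < r -> dom s (f z) /\ h z = s (f z)].
Proof.
have [d1 [C1 [d10 C11 dOm mb]]] := model_bounds g Hf HJ LM.
have [Sc dp oO Op OmS sE sA sphi Aq Aqs Hsys HW] := LM.
have [r0 /andP[r00 r04] T0] := tp d10.
have [Sy0 _] := mb d1 (lexx d1).
have sub0 : pbox r0 `<=` dball f p s d1 by move=> z /T0[h1 h2].
(* Higher orders ask for smaller balls around [p]; the trap supplies a radius for each. *)
have bd n : exists2 r' : R, 0 < r' <= r0 & bddn n (@pbox R r') (s \o f).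
  have [dn dn0 H] := sys_bounded n Op oO sE sA Aq Aqs.
  have [d3 d30 h3] : exists2 d3, 0 < d3 & forall x, `|x - s p| < d3 -> `|phi x - phi (s p)| <= dn.
    have cphi : Cn_on 0 Om phi by exact: sphi.
    have /cvgrPdist_lt /(_ dn dn0) /near_norm_ex[d3 d30 H3] := cphi (s p) Op.
    by exists d3 => // x /H3 xd; rewrite distrC ltW.
  pose d' := Num.min d1 (Num.min dn d3).
  have d'0 : 0 < d' by rewrite !lt_min d10 dn0.
  have [e1 e2 e3] : [/\ d' <= d1, d' <= dn & d' <= d3] by rewrite /d' !ge_min !lexx ?orbT.
  have [r /andP[r_0 _] T] := tp d'0.
  pose rm := Num.min r r0.
  have rm0 : 0 < rm by rewrite lt_min r_0.
  have sub z : pbox rm z -> PH z /\ inball f p s d' z.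
    by move=> [/andP[z0 zr] z2]; apply: T; split => //; rewrite z0 (le_trans zr) // ge_min lexx.
  have [Sy _] := mb d' e1.
  have sub1 : pbox rm `<=` dball f p s d' by move=> z /sub[h1 h2].
  have small z : pbox rm z -> `|s (f z) - s p| < dn /\ `|phi (s (f z)) *m projI R I| <= dn.
    move=> /sub[_ [_ zq]]; split; first exact: lt_le_trans zq e2.
    have -> : phi (s (f z)) *m projI R I = (phi (s (f z)) - phi (s p)) *m projI R I.
      apply/matrixP => i j; rewrite !projIE !mxE (ord1 i); case: ifP => // Ij.
      by rewrite (HW Wp j Ij) subr0.
    apply: le_trans (projI_le _ _) _; apply: h3; exact: lt_le_trans zq e3.
  have [r' /andP[r'0 r'm] B] := H _ _ _ rm Sy rm0 sub1 small.
  by exists r' => //; rewrite r'0 (le_trans r'm) // ge_min lexx orbT.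
have oD := sys_hopen Sy0.
have [h sh hE] := removable_extension oD r00 sub0 (sys_u Sy0) bd.
have hf z : PH z -> `|z| < r0 -> dom s (f z) /\ h z = s (f z).
  move=> Pz zr; have [[_ z2] z0] := Pz; have zn : z != 0 by apply/eqP.
  have Dz : dball f p s d1 z by apply: sub0; split => //; rewrite normr_gt0 zn ltW.
  by split; [have [_ []] := Dz|exact: hE].
exists r0, h; split => //.
have hc : {for 0, continuous h} by have := sh 0%N; apply; rewrite /= normr0.
(* The value at 0 is identified by approaching along the axis: there [h] is close both to [h 0], by
   continuity, and to [s p], by the trap. *)
apply: contrapT => ne; pose ep := `|h 0 - s p| / 2.
have ep0 : 0 < ep by rewrite divr_gt0 // normr_gt0 subr_eq0; apply/eqP.
have /cvgrPdist_lt /(_ ep ep0) /near_norm_ex[rho rho0 Hr] := hc.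
have [r /andP[r_0 _] T] := tp ep0.
pose t := Num.min (Num.min (rho / 2) (r0 / 2)) r.
have t0 : 0 < t by rewrite !lt_min !divr_gt0.
have [t1 t2 t3] : [/\ t <= rho / 2, t <= r0 / 2 & t <= r] by rewrite /t !ge_min !lexx ?orbT.
have nt : `|(t, 0) : R * R| = t by rewrite prod_normE /= normr0 gtr0_norm // max_l // ltW.
have pt : pbox r (t, 0) by split; [rewrite nt t0 t3|exact: lexx].
have half (x : R) : 0 < x -> x / 2 < x by move=> x0; rewrite ltr_pdivrMr // ltr_pMr // ltr1n.
have [Pt [dt lt]] := T _ pt.
have tr0 : `|(t, 0) : R * R| < r0 by rewrite nt; apply: le_lt_trans t2 (half _ r00).
have trh : `|(t, 0) - 0 : R * R| < rho by rewrite subr0 nt; apply: le_lt_trans t1 (half _ rho0).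
have [_ e1] := hf _ Pt tr0; have := Hr _ trh; rewrite e1 => l2.
have : `|h 0 - s p| < ep + ep.
  rewrite -(subrK (s (f (t, 0))) (h 0)) -addrA; apply: le_lt_trans (ler_normD _ _) _.
  exact: ltrD.
by rewrite -splitr ltxx.
Qed.

End Assembly.

Theorem theoremA (R : realType) (M : topologicalType) (m k : nat)
    (S : smooth_manifold R M m) (J : almost_complex S)
    (W : set M) (HW : embedded_submanifold S k W)
    (HWtr : totally_real J k W) (HWclosed : closed W)
    (f : R * R -> M)
    (Hfsmooth : smooth_in S (@punctured_half_disc R) f)
    (HfJ : J_holomorphic J (@punctured_half_disc R) f)
    (HfW : f @` (@punctured_half_disc_boundary R) `<=` W)
    (Hfcompact : relatively_compact (f @` (@punctured_half_disc R)))
    (Hfarea : exists g : riemannian_metric S,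
        (area g (@punctured_half_disc R) f < +oo)%E) :
  exists F : R * R -> M, smooth_in S (@half_disc R) F /\
    (forall z, punctured_half_disc z -> F z = f z).
Proof.
have [mE tr] := HWtr; have [km slices] := HW; have [g Ha] := Hfarea.
(* Total reality forces [m = k + k], the form that the block decomposition of slice charts uses. *)
rewrite -addnn in mE; subst m.
have hM := manifold_hausdorff S.
(* Models are needed at every point of [M], since the limit points in the bubbling argument may lie
   off [W]. *)
have models q : exists c I Om E A phi, local_model S W f q c I Om E A phi.
  have [Wq|nW] := pselect (W q); last exact: (interior_model Hfsmooth HfJ HfW HWclosed nW).
  have [s Ss ds] := slices q Wq.
  by do 6 eexists; exact: (boundary_model Hfsmooth HfJ HfW tr Ss ds Wq).
have nb := no_bubbling Hfsmooth HfJ models Hfcompact Ha.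
have [p Wp plim] := boundary_limit_point HfW HWclosed Hfcompact.
have [s [I [Om [E [A [phi LM]]]]]] := models p.
have tp d := trap Hfsmooth HfJ nb LM Wp plim hM (d' := d).
have [r [h [r0 sh h0 hf]]] := chart_extension g Hfsmooth HfJ LM Wp tp.
exists (fill f p); split; last by move=> z Pz; exact: fill_punctured.
move=> z Hz; have [->|z0] := eqVneq z 0.
  exact: (fill_extension0 (lm_chart LM) (lm_dom LM) r0 sh h0 hf).
by apply: (fill_extension Hfsmooth); split => // e; move: z0; rewrite e eqxx.
Qed.
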